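(* Let $d\ge1$ be an integer and let $r,\tilde r\in[2,\infty]$. Suppose one of the following conditions holds: - $d=1$ and $r,\tilde r\in(2,\infty]$; - $d=2$ and $r,\tilde r\in(2,\infty)$; - $d\ge3$ and $$\frac{d-2}{r}\le\frac{d}{\tilde r},\qquad \frac{d-2}{\tilde r}\le\frac{d}{r}.$$ Then for all exponents $q$ and $\tilde q$ satisfying $$d\Big(\frac12-\frac1r\Big)=\frac1q<\frac1{\tilde q'}=1-\frac d2\Big(\frac1r-\frac1{\tilde r}\Big),\qquad \frac1{\tilde r}\le\frac1r,$$ the estimate $$\bigg\|\int_{s<t}e^{i(t-s)\Delta}F(s,\cdot)\,\mathrm{d}s\bigg\|_{L^{q,\infty}_tL^r_x}\lesssim\|F\|_{L^{\tilde q'}_tL^{\tilde r'}_x}$$ holds, with implicit constant independent of $F$.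
   Context: Functions are on $\mathbb{R}\times\mathbb{R}^d$, with time variable $t\in\mathbb{R}$ and space variable $x\in\mathbb{R}^d$. $e^{it\Delta}$ is the Schrödinger propagator, i.e. the Fourier multiplier operator in $x$ with symbol $e^{-it|\xi|^2}$. $A\lesssim B$ means $A\le CB$ for some constant $C>0$. Exponents $q,\tilde q$ lie in $[1,\infty]$, and primes denote conjugate exponents ($\frac1p+\frac1{p'}=1$). $\|G\|_{L^p_tL^r_x}$ is the $L^p(\mathbb{R})$ norm of $t\mapsto\|G(t,\cdot)\|_{L^r(\mathbb{R}^d)}$, and $\|G\|_{L^{q,\infty}_tL^r_x}=\sup_{\lambda>0}\lambda\,|\{t\in\mathbb{R}:\|G(t,\cdot)\|_{L^r(\mathbb{R}^d)}>\lambda\}|^{1/q}$ for $q<\infty$, with $L^{\infty,\infty}=L^\infty$. The estimate is understood as an a priori inequality for sufficiently nice $F$ (for instance Schwartz functions). *)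

(* Defs.v *)
From HB Require Import structures.
From mathcomp Require Import all_boot all_order all_algebra.
From mathcomp Require Import complex.
From mathcomp Require Import all_classical all_reals all_analysis.

Set Implicit Arguments.
Unset Strict Implicit.
Unset Printing Implicit Defensive.

Import Order.TTheory GRing.Theory Num.Theory.
Import numFieldNormedType.Exports.

Local Open Scope classical_set_scope.
Local Open Scope ring_scope.

Definition measure_rV_display : measure_display -> measure_display.
Proof. exact. Qed.

Section measurable_rV.
Context {d} {T : sigmaRingType d}.
Variable n : nat.

Let coors : 'I_n -> 'rV[T]_n -> T := fun i v => v ord0 i.

Let rV_set0 : g_sigma_preimage coors set0.
Proof. exact: sigma_algebra0. Qed.

Let rV_setC A : g_sigma_preimage coors A -> g_sigma_preimage coors (~` A).
Proof. exact: sigma_algebraC. Qed.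

Let rV_bigcup (F : _^nat) : (forall i, g_sigma_preimage coors (F i)) ->
  g_sigma_preimage coors (\bigcup_i (F i)).
Proof. exact: sigma_algebra_bigcup. Qed.

HB.instance Definition _ := @isMeasurable.Build (measure_rV_display d)
  ('rV[T]_n) (g_sigma_preimage coors) rV_set0 rV_setC rV_bigcup.

Lemma measurable_rV_coord (i : 'I_n) :
  measurable_fun [set: 'rV[T]_n] (fun v : 'rV[T]_n => v ord0 i).
Proof.
move=> _ Y mY; rewrite setTI; apply: sub_sigma_algebra => /=.
rewrite -bigcup_seq/=; exists i => /=; first by rewrite mem_index_enum.
by exists Y => //; rewrite setTI.
Qed.

End measurable_rV.

Lemma measurable_fun_rVP d1 d2 (T1 : measurableType d1) (T2 : measurableType d2)
    n (f : T1 -> 'rV[T2]_n) :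
  (forall i, measurable_fun [set: T1] (fun x => f x ord0 i)) ->
  measurable_fun [set: T1] f.
Proof.
move=> mf.
suff fS : g_sigma_preimage (fun i => (fun v : 'rV[T2]_n => v ord0 i) \o f)
    `<=` measurable.
  by rewrite g_sigma_preimage_comp in fS => _ A mA; apply: fS; exists A.
apply: smallest_sub; first exact: sigma_algebra_measurable.
case: n => [|n] in f mf *; first by rewrite big_ord0.
rewrite -bigcup_mkord_ord; apply: bigcup_sub => i Ii.
by move=> A [B mB <-]; exact: mf.
Qed.

Section lebesgue_rV.
Context {R : realType}.

Definition consrV n (z : measurableTypeR R * 'rV[R]_n) : 'rV[R]_n.+1 :=
  row_mx (const_mx z.1 : 'rV[R]_1) z.2.

Definition unconsrV n (v : 'rV[R]_n.+1) : measurableTypeR R * 'rV[R]_n :=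
  (v ord0 ord0, \row_j v ord0 (lift ord0 j)).

Lemma consrV0 n (z : measurableTypeR R * 'rV[R]_n) : consrV z ord0 ord0 = z.1.
Proof.
rewrite /consrV mxE; case: splitP => [j _|j] /=; last by [].
by rewrite mxE.
Qed.

Lemma consrV_lift n (z : measurableTypeR R * 'rV[R]_n) (j : 'I_n) :
  consrV z ord0 (lift ord0 j) = z.2 ord0 j.
Proof.
rewrite /consrV mxE; case: splitP => [k|k] /=.
  by rewrite ord1 /bump.
by rewrite /bump /= => /eqP; rewrite eqn_add2l => /eqP/val_inj ->.
Qed.

Lemma consrVK n : cancel (@consrV n) (@unconsrV n).
Proof.
case=> a v; rewrite /unconsrV consrV0; congr pair.
by apply/rowP => j; rewrite mxE consrV_lift.
Qed.

Lemma measurable_consrV n : measurable_fun setT (@consrV n).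
Proof.
apply: measurable_fun_rVP => i; have [j ->|->] := unliftP ord0 i.
  under eq_fun do rewrite consrV_lift.
  exact: (measurableT_comp (@measurable_rV_coord _ _ n j) measurable_snd).
by under eq_fun do rewrite consrV0; exact: measurable_fst.
Qed.

Lemma measurable_unconsrV n : measurable_fun setT (@unconsrV n).
Proof.
apply: measurable_fun_pair; first exact: (@measurable_rV_coord _ R n.+1 ord0).
apply: measurable_fun_rVP => i /=.
by under eq_fun do rewrite mxE; exact: measurable_rV_coord.
Qed.

Section consrV_measure.
Local Open Scope ereal_scope.
Variables (n : nat) (m : {sigma_finite_measure set 'rV[R]_n -> \bar R}).

Definition consrV_measure : set 'rV[R]_n.+1 -> \bar R :=
  pushforward (@lebesgue_measure R \x m) (@consrV n).

Let push : {measure set 'rV[R]_n.+1 -> \bar R} :=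
  measure_function_pushforward__canonical__measure_function_Measure
    (lebesgue_measure \x m) (@measurable_consrV n).

Let consrV_measure0 : consrV_measure set0 = 0.
Proof. exact: (measure0 push). Qed.

Let consrV_measure_ge0 A : 0 <= consrV_measure A.
Proof. exact: (measure_ge0 push). Qed.

Let consrV_measure_sigma_additive : semi_sigma_additive consrV_measure.
Proof. exact: (@measure_semi_sigma_additive _ _ _ push). Qed.

HB.instance Definition _ := isMeasure.Build _ _ _ consrV_measure
  consrV_measure0 consrV_measure_ge0 consrV_measure_sigma_additive.

Let consrV_measure_sigma_finite : sigma_finite setT consrV_measure.
Proof.
have /sigma_finiteP[F [TF ndF Foo]] := sigma_finiteT (@lebesgue_measure R).
have /sigma_finiteP[G [TG ndG Goo]] := sigma_finiteT m.
exists (fun k => @unconsrV n @^-1` (F k `*` G k)).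
  rewrite -preimage_bigcup (_ : \bigcup_k _ = setT) ?preimage_setT//.
  apply/seteqP; split=> // -[x y] _.
  have [i _ Fix] : (\bigcup_k F k) x by rewrite -TF.
  have [j _ Gjy] : (\bigcup_k G k) y by rewrite -TG.
  exists (maxn i j) => //; split => /=.
  - by move: x Fix; exact/subsetPset/ndF/leq_maxl.
  - by move: y Gjy; exact/subsetPset/ndG/leq_maxr.
move=> k; have [mF Fk] := Foo k; have [mG Gk] := Goo k; split.
  rewrite -[X in measurable X]setTI; apply: measurable_unconsrV => //.
  exact: measurableX.
rewrite /consrV_measure /pushforward -comp_preimage.
rewrite (_ : _ \o _ = id); last by apply/funext => z; exact: consrVK.
by rewrite preimage_id product_measure1E// lte_mul_pinfty// ge0_fin_numE.
Qed.

HB.instance Definition _ := Measure_isSigmaFinite.Build _ _ _ consrV_measure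
  consrV_measure_sigma_finite.

End consrV_measure.

Fixpoint lebesgue_rV n : {sigma_finite_measure set 'rV[R]_n -> \bar R} :=
  match n with
  | 0 => [the {sigma_finite_measure set 'rV[R]_0 -> \bar R} of \d_(0 : 'rV[R]_0)]
  | k.+1 => [the {sigma_finite_measure set 'rV[R]_k.+1 -> \bar R}
              of consrV_measure (lebesgue_rV k)]
  end.

(* Uniquely determines [lebesgue_rV n] on the Borel sets. *)
Lemma lebesgue_rV_box n (A : 'I_n -> set R) : (forall i, measurable (A i)) ->
  lebesgue_rV n [set v | forall i, A i (v ord0 i)] =
    (\prod_(i < n) lebesgue_measure (A i))%E.
Proof.
elim: n A => [|n IH] A mA.
  by rewrite big_ord0 /= diracE mem_set// => -[].
pose B := [set v : 'rV[R]_n | forall i, A (lift ord0 i) (v ord0 i)].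
have consB : @consrV n @^-1` [set v | forall i, A i (v ord0 i)] = A ord0 `*` B.
  apply/seteqP; split=> [z /= Az|z [/= A0 AS] i].
    split=> [|i] /=; first by have := Az ord0; rewrite consrV0.
    by have := Az (lift ord0 i); rewrite consrV_lift.
  by have [j ->|->] := unliftP ord0 i; rewrite ?consrV_lift ?consrV0.
have mB : measurable B.
  rewrite (_ : B = \bigcap_(i in [set: 'I_n])
      [set v : 'rV[R]_n | A (lift ord0 i) (v ord0 i)]); last first.
    by apply/seteqP; split=> v Bv i; [move=> _; exact: Bv|exact: (Bv i I)].
  apply: fin_bigcap_measurable => // i _; rewrite -[X in measurable X]setTI.
  exact: measurable_rV_coord.
rewrite big_ord_recl -IH; last by move=> i; exact: mA.
rewrite -[LHS]/((lebesgue_measure \x lebesgue_rV n)%E (_ @^-1` _)) consB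
  product_measure1E//; exact: mA.
Qed.

End lebesgue_rV.

Section schroedinger.
Context {R : realType}.
Local Open Scope complex_scope.

Definition cis (a : R) : R[i] := cos a +i* sin a.

Definition cmod (z : R[i]) : R := ComplexField.Normc.normc z.

Definition cintegral d (T : measurableType d) (mu : {measure set T -> \bar R})
    (D : set T) (f : T -> R[i]) : R[i] :=
  (\int[mu]_(x in D) complex.Re (f x)) +i* (\int[mu]_(x in D) complex.Im (f x)).

Definition dotrV n (x y : 'rV[R]_n) : R := \sum_(i < n) x ord0 i * y ord0 i.

(* The convention for which the Laplacian has symbol - |xi|^2. *)
Definition fourier n (u : 'rV[R]_n -> R[i]) (xi : 'rV[R]_n) : R[i] :=
  cintegral (lebesgue_rV n) setT (fun x => cis (- dotrV x xi) * u x).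

Definition inv_fourier n (v : 'rV[R]_n -> R[i]) (x : 'rV[R]_n) : R[i] :=
  ((2 * pi) ^- n)%:C *
  cintegral (lebesgue_rV n) setT (fun xi => cis (dotrV x xi) * v xi).

Definition fourier_multiplier n (m : 'rV[R]_n -> R[i]) (u : 'rV[R]_n -> R[i]) :
    'rV[R]_n -> R[i] :=
  inv_fourier (fun xi => m xi * fourier u xi).

(* |xi|^2 is the Euclidean [dotrV xi xi]: the library norm on row vectors is
   the sup norm. *)
Definition schroedinger n (t : R) : ('rV[R]_n -> R[i]) -> ('rV[R]_n -> R[i]) :=
  fourier_multiplier (fun xi => cis (- t * dotrV xi xi)).

Definition duhamel n (F : R -> 'rV[R]_n -> R[i]) (t : R) (x : 'rV[R]_n) : R[i] :=
  cintegral lebesgue_measure [set s | s < t]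
    (fun s => schroedinger (t - s) (F s) x).

End schroedinger.

Section schwartz.
Context {R : realType}.

Definition iter_derive (V : normedModType R) (vs : seq V) (f : V -> R) : V -> R :=
  foldr (fun v g => 'D_v g) f vs.

(* On a finite-dimensional V this is the usual Schwartz space: coordinate
   derivatives and arbitrary directional derivatives control each other, and
   all norms are equivalent. *)
Definition schwartz (V : normedModType R) (f : V -> R) : Prop :=
  forall vs : seq V,
    (forall x, differentiable (iter_derive vs f) x) /\
    (forall k : nat, exists M : R,
      forall x, `|x| ^+ k * `|iter_derive vs f x| <= M).

Definition cschwartz (V : normedModType R) (f : V -> R[i]) : Prop :=
  schwartz (fun z => complex.Re (f z)) /\ schwartz (fun z => complex.Im (f z)).

End schwartz.

Section norms.
Context {R : realType}.
Local Open Scope ereal_scope.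

(* 1/p for an exponent p in [1, +oo], with 1/(+oo) = 0. *)
Definition recip (p : \bar R) : R := fine p^-1.

Definition space_norm n (r : \bar R) (u : 'rV[R]_n -> R[i]) : \bar R :=
  Lnorm (lebesgue_rV n) r (fun x => (cmod (u x))%:E).

Definition mixed_norm n (p r : \bar R) (G : R -> 'rV[R]_n -> R[i]) : \bar R :=
  Lnorm lebesgue_measure p (fun t => space_norm r (G t)).

Definition weak_norm (q : \bar R) (g : R -> \bar R) : \bar R :=
  if q == +oo then Lnorm lebesgue_measure +oo g
  else ereal_sup [set l%:E * lebesgue_measure [set t | l%:E < g t] `^ recip q
                 | l in [set l : R | (0 < l)%R]].

Definition weak_mixed_norm n (q r : \bar R) (G : R -> 'rV[R]_n -> R[i]) :
    \bar R :=
  weak_norm q (fun t => space_norm r (G t)).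

End norms.

(* Main.v *)
(**
Write u(t) for the Duhamel integral, e = 1 - r/rt and D = d/2. The point is the
pointwise-in-time bound
    ‖u(t)‖_r^p <= C ∫_{s<t} ‖F(s)‖_{rt'}^p (t - s)^{-kappa} ds,
with p = qt' and kappa = p/q < 1; the weak-type estimate follows from it by
integrating (t - s)^{-kappa} over a superlevel set of the right-hand side.

For r = 2 the pointwise bound is the dual homogeneous Strichartz estimate, and
for r = oo (which forces d = 1) it is the dispersive estimate. For 2 < r < oo
it is proved on each level set {l <= |u(t)| < 2 l}. There F is split according
to the size of |F|^{P-1}, suitably weighted by ‖F(s)‖_P and t - s: the large
part contributes at most l/2 by the dispersive estimate, and the small part is
bounded by Strichartz's inequality, applied with a power of the weight so that
summing over the dyadic levels l is a geometric series.

The Strichartz inequality is Keel and Tao's: F is cut into dyadic levels, and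
each pair of levels is estimated by the dispersive bound at times further apart
than a threshold and by Cauchy-Schwarz below it. Optimizing the threshold gains
a power of the ratio of the levels, which also covers the double endpoint.

Everything is done for real-valued F and the real kernels
∫ w(xi) cos((s - t)|xi|^2 - (x - y).xi - b) dxi with a frequency cut-off w, a
phase shift b playing the part of the imaginary unit. *)

From HB Require Import structures.
Require Import Defs.
From mathcomp Require Import all_boot all_order all_algebra.
From mathcomp Require Import complex.
From mathcomp Require Import all_classical all_reals all_analysis.
From mathcomp Require Import measurable_realfun ess_sup_inf.
From mathcomp Require Import ring lra.

Set Implicit Arguments.
Unset Strict Implicit.
Unset Printing Implicit Defensive.

Import Order.TTheory GRing.Theory Num.Theory.
Import numFieldNormedType.Exports.

Local Open Scope classical_set_scope.
Local Open Scope ring_scope.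

(** * Lebesgue integrals and product measures *)

(** The power [qt'] makes the right-hand side of the fixed-time bound linear in an [L^1] function of
    time, and convolving [L^1] with [(t - s)^{-kappa}] gives weak [L^{1/kappa}]; this is the origin
    of the weak norm, and [1/q < 1/qt'] is exactly [kappa < 1]. For finite [r] the scaling relations
    leave [e] and [r] as parameters, with [1/qt' = 1 - D e / r]. The condition [(d-2)/r <= d/rt]
    reads [D e <= 1], with equality at the double endpoint, and [e = 1], that is [rt = oo], survives
    only for [d = 1], where [D < 1]. The fixed-time bound is a real interpolation carried out by
    hand: the dispersive estimate controls large values, Strichartz's inequality small ones, and the
    dividing height depends on the slice norm and on [t - s] so that all their powers cancel in both
    halves. This fixes every exponent. Operators are never interpolated: a number with two bounds is
    below their geometric means. Profiles in time are kept strictly positive, so that real powers of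
    either sign can be combined; profiles that may vanish are raised by a small decaying term. *)

Section real_integral.
Context d (T : measurableType d) (R : realType) (m : {measure set T -> \bar R}).
Implicit Types (f g : T -> R) (D : set T).

Lemma le_integrable_real D f g : measurable D -> measurable_fun D f ->
  (forall x, D x -> `|f x| <= g x) -> m.-integrable D (EFin \o g) ->
  m.-integrable D (EFin \o f).
Proof.
move=> mD mf fg; apply: le_integrable => //; first exact/measurable_EFinP.
by move=> x Dx /=; rewrite lee_fin (le_trans (fg x Dx))// ler_norm.
Qed.

Lemma normr_Rintegral_le D f : measurable D -> measurable_fun D f ->
  (`|\int[m]_(x in D) f x|%:E <= \int[m]_(x in D) `|f x|%:E)%E.
Proof.
move=> mD mf; rewrite /Rintegral.
apply: (@le_trans _ _ (`|\int[m]_(x in D) (f x)%:E|)%E).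
  by case: (\int[m]_(x in D) _)%E => [a||]; rewrite /= ?lexx ?leey.
by apply: le_abse_integral => //; exact/measurable_EFinP.
Qed.

Lemma Rintegral_EFin D f : m.-integrable D (EFin \o f) -> measurable D ->
  ((\int[m]_(x in D) f x)%:E = \int[m]_(x in D) (f x)%:E)%E.
Proof. by move=> fi mD; rewrite fineK//; exact: integrable_fin_num. Qed.

Lemma ge0_integrable D f : measurable D -> measurable_fun D f ->
  (forall x, D x -> 0 <= f x) ->
  (\int[m]_(x in D) (f x)%:E < +oo)%E -> m.-integrable D (EFin \o f).
Proof.
move=> mD mf f0 foo; apply/integrableP; split; first exact/measurable_EFinP.
rewrite (eq_integral (EFin \o f))// => x; rewrite inE => Dx /=.
by rewrite ger0_norm// f0.
Qed.

End real_integral.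

Section product_sigma_finite.
Context d1 d2 (T1 : measurableType d1) (T2 : measurableType d2) (R : realType).
Context (m1 : {sigma_finite_measure set T1 -> \bar R}).
Context (m2 : {sigma_finite_measure set T2 -> \bar R}).
Local Open Scope ereal_scope.

(* The product measure as a sigma-finite measure, so that it can itself be a
   factor of a product. *)
Definition prodm : set (T1 * T2)%type -> \bar R := m1 \x m2.

Let P : {measure set (T1 * T2)%type -> \bar R} :=
  lebesgue_integral_fubini_product_measure1__canonical__measure_function_Measure
    m1 m2.

HB.instance Definition _ := isMeasure.Build _ _ _ prodm
  (measure0 P) (measure_ge0 P) (@measure_semi_sigma_additive _ _ _ P).

Let prodm_sigma_finite : sigma_finite setT prodm.
Proof.
have /sigma_finiteP[F [TF ndF Ffin]] := sigma_finiteT m1.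
have /sigma_finiteP[G [TG ndG Gfin]] := sigma_finiteT m2.
exists (fun n => F n `*` G n) => [|n].
  apply/seteqP; split => // -[x y] _.
  have [i _ Fx] : (\bigcup_k F k) x by rewrite -TF.
  have [j _ Gy] : (\bigcup_k G k) y by rewrite -TG.
  exists (i + j)%N => //; split.
    by move/subsetPset: (ndF _ _ (leq_addr j i)); apply.
  by move/subsetPset: (ndG _ _ (leq_addl i j)); apply.
have [mF Fn] := Ffin n; have [mG Gn] := Gfin n.
split; first exact: measurableX.
rewrite /prodm product_measure1E// lte_mul_pinfty//.
by rewrite ge0_fin_numE.
Qed.

HB.instance Definition _ :=
  Measure_isSigmaFinite.Build _ _ _ prodm prodm_sigma_finite.

End product_sigma_finite.

Section fubini_real.
Context d1 d2 (T1 : measurableType d1) (T2 : measurableType d2) (R : realType).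
Context (m1 : {sigma_finite_measure set T1 -> \bar R}).
Context (m2 : {sigma_finite_measure set T2 -> \bar R}).
Implicit Types (f : T1 * T2 -> R).

Lemma measurable_Rintegral_param f : measurable_fun setT f ->
  measurable_fun setT (fun x => \int[m2]_y f (x, y)).
Proof.
move=> mf; rewrite /Rintegral; apply: measurableT_comp; first exact: fine_measurable.
under eq_fun => x do rewrite integralE.
have mfE : measurable_fun setT (EFin \o f) by exact/measurable_EFinP.
apply: emeasurable_funB.
  have h : measurable_fun setT (fubini_F m2 (EFin \o f)^\+%E).
    by apply: measurable_fun_fubini_tonelli_F => //; exact: measurable_funepos.
  apply: eq_measurable_fun h => x _; apply: eq_integral => y _.
  by rewrite !funeposE.
have h : measurable_fun setT (fubini_F m2 (EFin \o f)^\-%E).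
  by apply: measurable_fun_fubini_tonelli_F => //; exact: measurable_funeneg.
apply: eq_measurable_fun h => x _; apply: eq_integral => y _.
by rewrite !funenegE.
Qed.

Lemma measurable_fun_slice f x : measurable_fun setT f ->
  measurable_fun setT (fun y => f (x, y)).
Proof. by move=> mf; exact: (measurableT_comp mf (pair1_measurable x)). Qed.

Lemma measurable_fun_slicer f y : measurable_fun setT f ->
  measurable_fun setT (fun x => f (x, y)).
Proof. by move=> mf; exact: (measurableT_comp mf (pair2_measurable y)). Qed.

Lemma Rintegral_prod12 f : (m1 \x m2)%E.-integrable setT (EFin \o f) ->
  \int[m1]_x \int[m2]_y f (x, y) = \int[(m1 \x m2)%E]_z f z.
Proof.
move=> fi; rewrite [in RHS]/Rintegral -(integral12_prod_meas1 fi) [LHS]/Rintegral.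
congr fine; have Fi := integrable_fubini_F fi.
have /integrableP[mF _] := Fi.
apply: ae_eq_integral => //.
  apply/measurable_EFinP; apply: measurable_Rintegral_param.
  by case/integrableP : fi => /measurable_EFinP.
have := integrable_ae measurableT Fi; apply: filterS => x /= /(_ I) Fx _.
by rewrite /Rintegral fineK.
Qed.

Lemma Rintegral_prod21 f : (m1 \x m2)%E.-integrable setT (EFin \o f) ->
  \int[m2]_y \int[m1]_x f (x, y) = \int[(m1 \x m2)%E]_z f z.
Proof.
move=> fi; rewrite [in RHS]/Rintegral -(integral21_prod_meas1 fi) [LHS]/Rintegral.
congr fine.
have fi' : (m2 \x m1)%E.-integrable setT (EFin \o (fun z => f (z.2, z.1))).
  have /integrableP[mf foo] := fi; apply/integrable21ltyP => //=.
    apply: (measurableT_comp mf); apply: measurable_fun_pair;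
      [exact: measurable_snd|exact: measurable_fst].
  by have /integrable12ltyP := fi; apply.
have Fi := integrable_fubini_F fi'.
have /integrableP[mF _] := Fi.
apply: ae_eq_integral => //.
  apply/measurable_EFinP; rewrite /Rintegral.
  apply: (eq_measurable_fun (fine \o fubini_F m1 (EFin \o (fun z => f (z.2, z.1))))) => //.
  exact: measurableT_comp.
have := integrable_ae measurableT Fi; apply: filterS => x /= /(_ I) Fx _.
by rewrite /Rintegral fineK.
Qed.

Lemma Rintegral_swap f : (m1 \x m2)%E.-integrable setT (EFin \o f) ->
  \int[m1]_x \int[m2]_y f (x, y) = \int[m2]_y \int[m1]_x f (x, y).
Proof. by move=> fi; rewrite Rintegral_prod12// Rintegral_prod21. Qed.

Lemma integrable_Rintegral_param f : (m1 \x m2)%E.-integrable setT (EFin \o f) ->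
  m1.-integrable setT (EFin \o (fun x => \int[m2]_y f (x, y))).
Proof.
move=> fi; have Fi := integrable_fubini_F fi; apply: le_integrable Fi => //.
  apply/measurable_EFinP; apply: measurable_Rintegral_param.
  by case/integrableP : fi => /measurable_EFinP.
move=> x _ /=; rewrite /Rintegral /fubini_F /=.
by case: (\int[m2]_y _)%E => [a||]; rewrite /= ?lexx ?leey.
Qed.

Lemma measurable_tensor (f : T1 -> R) (g : T2 -> R) :
  measurable_fun setT f -> measurable_fun setT g ->
  measurable_fun setT (fun z : T1 * T2 => f z.1 * g z.2).
Proof.
by move=> mf mg; apply: measurable_funM;
  [exact: measurableT_comp measurable_fst|exact: measurableT_comp measurable_snd].
Qed.

Lemma ge0_integral_tensor (f : T1 -> R) (g : T2 -> R) :
  measurable_fun setT f -> measurable_fun setT g ->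
  (forall x, 0 <= f x) -> (forall x, 0 <= g x) ->
  (\int[m1 \x m2]_z (f z.1 * g z.2)%:E =
   (\int[m1]_x (f x)%:E) * (\int[m2]_y (g y)%:E))%E.
Proof.
move=> mf mg f0 g0; rewrite fubini_tonelli1//; last 2 first.
- by apply/measurable_EFinP; exact: measurable_tensor.
- by move=> z; rewrite lee_fin mulr_ge0.
have G0 : (0 <= \int[m2]_y (g y)%:E)%E by apply: integral_ge0 => y _; rewrite lee_fin.
rewrite -ge0_integralZr//; last 2 first.
- exact/measurable_EFinP.
- by move=> x _; rewrite lee_fin.
apply: eq_integral => x _; rewrite /fubini_F /=.
under eq_integral do rewrite EFinM.
rewrite ge0_integralZl_EFin//; last exact/measurable_EFinP.
by move=> y _; rewrite lee_fin.
Qed.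

Lemma integrable_tensor (f : T1 -> R) (g : T2 -> R) :
  m1.-integrable setT (EFin \o f) -> m2.-integrable setT (EFin \o g) ->
  (m1 \x m2)%E.-integrable setT (EFin \o (fun z : T1 * T2 => f z.1 * g z.2)).
Proof.
move=> /integrableP[mf fi] /integrableP[mg gi]; apply/integrableP; split.
  by apply/measurable_EFinP; apply: measurable_tensor; exact/measurable_EFinP.
have mf' : measurable_fun setT f by exact/measurable_EFinP.
have mg' : measurable_fun setT g by exact/measurable_EFinP.
rewrite [X in (X < _)%E](_ : _ =
  (\int[m1 \x m2]_z ((Num.norm \o f) z.1 * (Num.norm \o g) z.2)%:E)%E).
  rewrite ge0_integral_tensor//; last 4 first.
  - exact: measurableT_comp.
  - exact: measurableT_comp.
  - by move=> x /=.
  - by move=> x /=.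
  rewrite lte_mul_pinfty//; first by apply: integral_ge0 => x _; rewrite lee_fin/=.
  rewrite ge0_fin_numE//; apply: integral_ge0 => x _; by rewrite lee_fin/=.
by apply: eq_integral => z _ /=; rewrite normrM.
Qed.

Lemma Rintegral_tensor (f : T1 -> R) (g : T2 -> R) :
  m1.-integrable setT (EFin \o f) -> m2.-integrable setT (EFin \o g) ->
  \int[(m1 \x m2)%E]_z (f z.1 * g z.2) = (\int[m1]_x f x) * \int[m2]_y g y.
Proof.
move=> fi gi; rewrite -(Rintegral_prod12 (f := fun z => f z.1 * g z.2))/=; last first.
  exact: integrable_tensor.
rewrite -RintegralZr//; apply: eq_Rintegral => x _ /=.
by rewrite RintegralZl.
Qed.

End fubini_real.

(** * One-dimensional oscillatory integrals *)

Section calculus.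
Context {R : realType}.
Notation mu := (@lebesgue_measure R).

Lemma Rintegral_FTC (f F : R -> R) (a b : R) : a < b ->
  (forall x, a <= x <= b -> {for x, continuous f}) ->
  (forall x, a <= x <= b -> is_derive x 1 F (f x)) ->
  \int[mu]_(x in `[a, b]) f x = F b - F a.
Proof.
move=> ab cf dF; rewrite /Rintegral (@continuous_FTC2 _ f F)//.
- apply: continuous_in_subspaceT => x; rewrite inE/= in_itv/=; exact: cf.
- have cF x : a <= x <= b -> {for x, continuous F}.
    move=> /dF [dFx _]; apply/differentiable_continuous.
    exact/derivable1_diffP.
  split.
  + move=> x; rewrite in_itv/= => /andP[ax xb].
    by have [] // := dF x; rewrite ?(ltW ax) ?(ltW xb).
  + by apply: cvg_at_right_filter; apply: cF; rewrite lexx ltW.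
  + by apply: cvg_at_left_filter; apply: cF; rewrite lexx ltW.
- move=> x; rewrite in_itv/= => /andP[ax xb].
  have axb : a <= x <= b by rewrite (ltW ax) (ltW xb).
  have [_ <-] := dF x axb.
  by rewrite derive1E.
Qed.

Lemma continuous_itv_integrable (f : R -> R) (a b : R) :
  (forall x, a <= x <= b -> {for x, continuous f}) ->
  mu.-integrable `[a, b] (EFin \o f).
Proof.
move=> cf; apply: continuous_compact_integrable; first exact: segment_compact.
by apply: continuous_in_subspaceT => x; rewrite inE/= in_itv/=; exact: cf.
Qed.

Lemma is_derive_continuous (F : R -> R) (x l : R) :
  is_derive x 1 F l -> {for x, continuous F}.
Proof.
by case=> dFx _; apply/differentiable_continuous; exact/derivable1_diffP.
Qed.

Lemma is_derive_inv (f : R -> R) (x df : R) : f x != 0 ->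
  is_derive x 1 f df -> is_derive x 1 (fun y => (f y)^-1) (- df / (f x) ^+ 2).
Proof.
move=> fx0 [d1 d2]; split; first exact: derivableV.
by rewrite deriveV// d2 /GRing.scale/= mulNr mulrC mulNr.
Qed.

Lemma is_derive_quad (a b c x : R) :
  is_derive x 1 (fun y => a * y ^+ 2 + b * y + c) (2 * a * x + b).
Proof.
apply: is_derive_eq.
rewrite /GRing.scale/=; ring.
Qed.

(* Since [(1 / theta')' <= 0] and [sin theta - 1 <= 0], the derivative of
   [(sin theta - 1) / theta'] dominates [cos theta]. *)
Lemma Rintegral_cos_quad_nonstat (a b c m x y : R) : 0 <= a -> 0 < m -> x <= y ->
  (forall z, x <= z <= y -> m <= `|2 * a * z + b|) ->
  \int[mu]_(z in `[x, y]) cos (a * z ^+ 2 + b * z + c) <= 2 / m.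
Proof.
move=> a0 m0; rewrite le_eqVlt => /predU1P[<- _|xy hm].
  by rewrite set_itv1 Rintegral_set1 divr_ge0// ltW.
pose th z := a * z ^+ 2 + b * z + c.
pose th' z := 2 * a * z + b.
have dth (z : R) : is_derive z 1 th (th' z) by exact: is_derive_quad.
have dth' (z : R) : is_derive z 1 th' (2 * a).
  by apply: is_derive_eq; rewrite /GRing.scale/=; ring.
have th'0 (z : R) : x <= z <= y -> th' z != 0.
  by move=> /hm mz; rewrite -normr_gt0 (lt_le_trans m0).
pose G z := (sin (th z) - 1) * (th' z)^-1.
pose g z := cos (th z) + (1 - sin (th z)) * (2 * a) / (th' z) ^+ 2.
have dG (z : R) : x <= z <= y -> is_derive z 1 G (g z).
  move=> zxy.
  have ds : is_derive z 1 (fun z => sin (th z)) (cos (th z) * th' z).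
    have -> : (fun z => sin (th z)) = sin \o th by [].
    by apply: is_derive1_comp.
  have di := is_derive_inv (th'0 z zxy) (dth' z).
  apply: is_derive_eq.
  rewrite /g /GRing.scale/=; field; exact: th'0.
have cth (z : R) : {for z, continuous th} by exact: is_derive_continuous (dth z).
have cth' (z : R) : {for z, continuous th'} by exact: is_derive_continuous (dth' z).
have ccos (z : R) : {for z, continuous (fun z => cos (th z))}.
  by apply: continuous_comp; [exact: cth|exact: continuous_cos].
have cg (z : R) : x <= z <= y -> {for z, continuous g}.
  move=> zxy; apply: continuousD; first exact: ccos.
  apply: continuousM; last first.
    apply: continuousV; first by rewrite expf_neq0// th'0.
    exact: (continuous_comp (cth' z) (@exprn_continuous R 2 (th' z))).
  apply: continuousM; last exact: cst_continuous.
  apply: continuousB; first exact: cst_continuous.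
  apply: continuous_comp; [exact: cth|exact: continuous_sin].
apply: (@le_trans _ _ (\int[mu]_(z in `[x, y]) g z)).
  apply: le_Rintegral => //.
  - exact: continuous_itv_integrable.
  - exact: continuous_itv_integrable.
  - move=> z _; rewrite /g lerDl divr_ge0// ?sqr_ge0//.
    by rewrite mulr_ge0// ?subr_ge0 ?sin_le1// mulr_ge0.
rewrite (Rintegral_FTC xy cg dG) /G.
have bnd (z : R) : x <= z <= y ->
    - (2 / m) <= (sin (th z) - 1) * (th' z)^-1 <= 2 / m.
  move=> /hm mz; rewrite -ler_norml normrM ler_pM//.
    by apply: (le_trans (ler_normB _ _)); rewrite normr1 -[leRHS]/(1 + 1) lerD2r sin_max.
  by rewrite normfV lef_pV2// posrE// (lt_le_trans m0).
(* [th'] is nondecreasing, so [G y - G x] never collects two positive boundary terms: if [th'] has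
   the same sign at both ends, one of the terms has the good sign. Hence [2 / m] and not [4 / m]. *)
have th'mono : th' x <= th' y.
  by rewrite lerD2r ler_wpM2l ?mulr_ge0// ltW.
have sx := sin_le1 (th x); have sy := sin_le1 (th y).
have xx : x <= x <= y by rewrite lexx ltW.
have yy : x <= y <= y by rewrite lexx ltW.
have /andP[bx1 bx2] := bnd x xx.
have /andP[by1 by2] := bnd y yy.
have [tx|tx] := leP 0 (th' x).
  have : (sin (th y) - 1) / th' y <= 0.
    by rewrite mulr_le0_ge0 ?invr_ge0 ?(le_trans tx)// subr_le0.
  by move: bx1; lra.
have [ty|ty] := leP (th' y) 0.
  have : 0 <= (sin (th x) - 1) / th' x.
    by rewrite mulr_le0// ?invr_le0 ?ltW// ltrBlDr ?subr_lt0; lra.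
  lra.
have : (sin (th y) - 1) / th' y <= 0.
  by rewrite mulr_le0_ge0 ?invr_ge0 ?(ltW ty)// subr_le0.
have : 0 <= (sin (th x) - 1) / th' x.
  by rewrite mulr_le0// ?invr_le0 ?(ltW tx)// subr_le0.
lra.
Qed.


Lemma continuous_cos_quad (a b c z : R) :
  {for z, continuous (fun z : R => cos (a * z ^+ 2 + b * z + c))}.
Proof.
apply: (continuous_comp (is_derive_continuous (is_derive_quad a b c z))).
exact: continuous_cos.
Qed.

(** Adding [pi] to the phase negates the cosine, so the one-sided bound applied twice controls the
    absolute value. *)
Lemma Rintegral_cos_quad_nonstat_norm (a b c m x y : R) : 0 <= a -> 0 < m -> x <= y ->
  (forall z, x <= z <= y -> m <= `|2 * a * z + b|) ->
  `|\int[mu]_(z in `[x, y]) cos (a * z ^+ 2 + b * z + c)| <= 2 / m.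
Proof.
move=> a0 m0 xy hm; rewrite ler_norml Rintegral_cos_quad_nonstat// andbT.
have := Rintegral_cos_quad_nonstat (c + pi) a0 m0 xy hm.
rewrite (_ : (fun z => cos _) = fun z => -1 * cos (a * z ^+ 2 + b * z + c)).
  rewrite RintegralZl//; first lra.
  by apply: continuous_itv_integrable => z _; exact: continuous_cos_quad.
by apply/funext => z; rewrite addrA cosDpi mulN1r.
Qed.

Lemma Rintegral_itv_split (f : R -> R) (a b c : R) :
  a <= b -> b <= c -> mu.-integrable `[a, c] (EFin \o f) ->
  \int[mu]_(x in `[a, c]) f x =
  \int[mu]_(x in `[a, b]) f x + \int[mu]_(x in `[b, c]) f x.
Proof.
move=> ab bc fi.
have := @Rintegral_itvB R f (BLeft a) (BRight c) b fi.
rewrite !bnd_simp => /(_ ab bc) h.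
apply/eqP; rewrite addrC -subr_eq h; apply/eqP.
rewrite Rintegral_itv_obnd_cbnd//.
apply: (integrableS _ _ _ fi) => //.
by apply: subset_itvr; rewrite bnd_simp.
Qed.

(** Van der Corput's argument. Outside the interval of radius [h = 1 / sqrt a] around the stationary
    point [s] the phase has slope at least [2 sqrt a], which costs [1 / sqrt a] on each side; the
    interval itself costs at most its length [2 / sqrt a]. *)
Lemma Rintegral_cos_quad_pos (a b c x y : R) : 0 < a -> x <= y ->
  `|\int[mu]_(z in `[x, y]) cos (a * z ^+ 2 + b * z + c)| <= 4 / Num.sqrt a.
Proof.
move=> a0 xy; set f := fun z => cos _.
have sa0 : 0 < Num.sqrt a by rewrite sqrtr_gt0.
have saE : a = Num.sqrt a ^+ 2 by rewrite sqr_sqrtr// ltW.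
set k := Num.sqrt a in sa0 saE *.
pose s := - b / (2 * a); pose h := k^-1.
have h0 : 0 < h by rewrite invr_gt0.
(* The ends of that interval clamped to [[x, y]], so that [x <= p <= q <= y] wherever [s] lies. *)
pose p := Num.max x (Num.min (s - h) y); pose q := Num.min y (Num.max (s + h) x).
have fi u v : mu.-integrable `[u, v] (EFin \o f).
  by apply: continuous_itv_integrable => z _; exact: continuous_cos_quad.
have phase (z : R) : h <= `|z - s| -> 2 * k <= `|2 * a * z + b|.
  move=> hz; have -> : 2 * a * z + b = 2 * a * (z - s).
    by rewrite /s; field; rewrite gt_eqF.
  rewrite normrM gtr0_norm ?mulr_gt0// -mulrA ler_pM2l//.
  rewrite saE -[leLHS]mulr1 expr2 -mulrA ler_pM2l// -(mulfV (lt0r_neq0 sa0)).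
  by rewrite ler_pM2l.
have k20 : 0 < 2 * k by rewrite mulr_gt0.
have nonstat u v : x <= u -> u <= v -> v <= y ->
    (forall z, u <= z <= v -> h <= `|z - s|) ->
    `|\int[mu]_(z in `[u, v]) f z| <= k^-1.
  move=> xu uv vy hz.
  have -> : k^-1 = 2 / (2 * k) by field; rewrite gt_eqF.
  by apply: Rintegral_cos_quad_nonstat_norm => // [|z /hz /phase//]; exact: ltW.
have stat u v : u <= v -> v - u <= 2 * h -> `|\int[mu]_(z in `[u, v]) f z| <= 2 / k.
  move=> uv vu; apply: le_trans (_ : v - u <= _) => //.
  apply: (le_trans (le_normr_Rintegral _ _)) => //.
  apply: (@le_trans _ _ (\int[mu]_(z in `[u, v]) cst 1 z)).
    apply: le_Rintegral => //.
    - exact: (integrable_norm (fi u v)).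
    - by apply: continuous_itv_integrable => z _; exact: cst_continuous.
    - by move=> z _; exact: cos_max.
  rewrite Rintegral_cst//= mul1r lebesgue_measure_itv/= lte_fin.
  by case: ifPn => //=; rewrite subr_ge0.
have x_p : x <= p by rewrite /p le_max lexx.
have p_y : p <= y by rewrite /p ge_max xy ge_min lexx orbT.
have x_q : x <= q by rewrite /q le_min xy le_max lexx orbT.
have q_y : q <= y by rewrite /q ge_min lexx.
have p_q : p <= q.
  rewrite /p /q ge_max le_min xy le_max lexx orbT/= le_min ge_min lexx orbT/=.
  by rewrite le_max ge_min; apply/orP; left; apply/orP; left; lra.
rewrite (Rintegral_itv_split x_p p_y)// (Rintegral_itv_split p_q q_y)//.
have -> : 4 / k = k^-1 + (2 / k + k^-1) by field; rewrite gt_eqF.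
apply: (le_trans (ler_normD _ _)); apply: lerD; last first.
  apply: (le_trans (ler_normD _ _)); apply: lerD; last first.
    have [qy|qy] := ltP q y.
      apply: nonstat => // z /andP[qz _].
      have : s + h <= q.
        rewrite /q le_min le_max lexx andbT leNgt; apply/negP => ysh.
        by move: qy; rewrite ltNge /q le_min lexx le_max (ltW ysh).
      by move=> sq; rewrite ler_normr; apply/orP; left; lra.
    have -> : q = y by apply/eqP; rewrite eq_le q_y qy.
    by rewrite set_itv1 Rintegral_set1 normr0 ltW.
  apply: stat => //.
  have /orP qsh : (q <= s + h) || (q <= x) by rewrite -le_max ge_min lexx orbT.
  have /orP psh : (s - h <= p) || (y <= p) by rewrite -ge_min le_max lexx orbT.
  by case: qsh; case: psh => *; lra.
have [xp|px] := ltP x p.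
  apply: nonstat => // z /andP[_ zp].
  have : p <= s - h.
    rewrite /p ge_max ge_min lexx andbT leNgt; apply/negP => ysh.
    by move: xp; rewrite ltNge /p ge_max lexx ge_min (ltW ysh).
  by move=> sq; rewrite ler_normr; apply/orP; right; lra.
have -> : p = x by apply/eqP; rewrite eq_le x_p px.
by rewrite set_itv1 Rintegral_set1 normr0 ltW.
Qed.

Lemma Rintegral_cos_quad (a b c x y : R) : a != 0 -> x <= y ->
  `|\int[mu]_(z in `[x, y]) cos (a * z ^+ 2 + b * z + c)| <= 4 / Num.sqrt `|a|.
Proof.
move=> a0 xy; have [{}a0|a0'|/eqP] := ltgtP a 0; last by rewrite (negbTE a0).
  rewrite [X in Num.sqrt X]ltr0_norm// (_ : (fun z => cos _) =
      fun z => cos ((- a) * z ^+ 2 + (- b) * z + (- c))); last first.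
    by apply/funext => z; rewrite -cosN; congr cos; ring.
  by apply: Rintegral_cos_quad_pos => //; rewrite oppr_gt0.
by rewrite [X in Num.sqrt X]gtr0_norm//; exact: Rintegral_cos_quad_pos.
Qed.


Lemma measurable_fun_cos : measurable_fun setT (@cos R).
Proof. by apply: continuous_measurable_fun; exact: continuous_cos. Qed.

(** * The Fejer weight and its kernel *)

Definition fejer_weight (N x : R) : R := Num.max 0 (1 - `|x| / N).

Lemma fejer_weight_ge0 N x : 0 <= fejer_weight N x.
Proof. by rewrite /fejer_weight le_max lexx. Qed.

Lemma fejer_weight_le1 N x : 0 < N -> fejer_weight N x <= 1.
Proof.
by move=> N0; rewrite /fejer_weight ge_max ler01/= gerBl divr_ge0// ltW.
Qed.

(** The reason for doubling the width: on [[-N, N]] the wider triangle stays above [1 / 2], so it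
    dominates the indicator of the interval up to a factor 2. *)
Lemma fejer_weight_half N x : 0 < N -> `|x| <= N -> 1 / 2 <= fejer_weight (2 * N) x.
Proof.
move=> N0 xN; rewrite /fejer_weight le_max; apply/orP; right.
suff : `|x| / (2 * N) <= 1 / 2 by lra.
by rewrite ler_pdivrMr ?mulr_gt0//; lra.
Qed.

Lemma measurable_fejer_weight N : measurable_fun setT (fejer_weight N).
Proof.
apply: measurable_maxr => //; apply: measurable_funB => //.
by apply: measurable_funM => //; exact: measurable_normr.
Qed.

(** Unlike the transform of the indicator of an interval, this transform is nonnegative and
    integrable, with an integral bounded independently of [N]. *)
Definition fejer_kernel (N z : R) : R :=
  \int[mu]_x (fejer_weight N x * cos (z * x)).

Lemma fejer_weight_restrict N (g : R -> R) : 0 < N ->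
  \int[mu]_x (fejer_weight N x * g x) =
  \int[mu]_(x in `[(- N), N]) ((1 - `|x| / N) * g x).
Proof.
move=> N0; rewrite [RHS]Rintegral_mkcond; apply: eq_Rintegral => x _.
rewrite patchE; case: ifPn => [|/negP xN].
  rewrite inE/= in_itv/= -ler_norml => xN; congr *%R.
  by rewrite /fejer_weight max_r// subr_ge0 ler_pdivrMr// mul1r.
rewrite /fejer_weight max_l ?mul0r// subr_le0 ler_pdivlMr// mul1r.
by rewrite ltW// ltNge; apply: contra_notN xN; rewrite inE/= in_itv/= ler_norml.
Qed.

Lemma Rintegral_fejer_cos (N z c : R) : 0 < N -> z != 0 ->
  \int[mu]_x (fejer_weight N x * cos (z * x + c)) =
  cos c * (2 * (1 - cos (N * z)) / (N * z ^+ 2)).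
Proof.
move=> N0 z0; rewrite fejer_weight_restrict//.
(* An antiderivative found by one integration by parts, valid on each half of the triangle: [s = 1]
   for negative [x] and [s = -1] for positive [x]. *)
have dp (s x : R) : is_derive x 1 (fun x => (1 + s * x / N) * sin (z * x + c) / z
     + s * cos (z * x + c) / (N * z ^+ 2)) ((1 + s * x / N) * cos (z * x + c)).
  have dl (y : R) : is_derive y 1 (fun x : R => z * x + c) z.
    by apply: is_derive_eq; rewrite /GRing.scale/=; ring.
  have ds : is_derive x 1 (sin \o (fun x : R => z * x + c)) (cos (z * x + c) * z).
    exact: is_derive1_comp.
  have dc : is_derive x 1 (cos \o (fun x : R => z * x + c)) (- sin (z * x + c) * z).
    exact: is_derive1_comp.
  rewrite (_ : (fun x => _ + _) = fun x => (1 + s / N * x) *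
    ((sin \o (fun x : R => z * x + c)) x) * z^-1 +
    (s / (N * z ^+ 2)) * ((cos \o (fun x : R => z * x + c)) x)); last first.
    by apply/funext => y /=; field; rewrite z0 gt_eqF.
  apply: is_derive_eq; rewrite /GRing.scale/=; field; by rewrite z0 gt_eqF.
have cp (s x : R) : {for x, continuous (fun x : R => (1 + s * x / N) * cos (z * x + c))}.
  have dl (y : R) : is_derive y 1 (fun x : R => z * x + c) z.
    by apply: is_derive_eq; rewrite /GRing.scale/=; ring.
  have dc : is_derive x 1 (cos \o (fun x : R => z * x + c)) (- sin (z * x + c) * z).
    exact: is_derive1_comp.
  rewrite (_ : (fun x => _ * _) = fun x => (1 + s / N * x) *
    ((cos \o (fun x : R => z * x + c)) x)); last first.
    by apply/funext => y /=; field; rewrite gt_eqF.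
  by apply: is_derive_continuous; apply: is_derive_eq.
have N0' : 0 <= N by exact: ltW.
have NN : - N <= 0 by rewrite oppr_le0.
have ci : mu.-integrable `[(- N), N] (EFin \o (fun x => (1 - `|x| / N) * cos (z * x + c))).
  apply: continuous_itv_integrable => x _.
  apply: continuousM.
    apply: continuousB; first exact: cst_continuous.
    apply: continuousM; [exact: norm_continuous|exact: cst_continuous].
  have dl : is_derive x 1 (fun x : R => z * x + c) z.
    by apply: is_derive_eq; rewrite /GRing.scale/=; ring.
  exact: (continuous_comp (is_derive_continuous dl) (@continuous_cos R _)).
rewrite (Rintegral_itv_split NN N0')//.
rewrite (@eq_Rintegral _ _ _ mu `[(- N), 0]%classic
    (fun x => (1 + 1 * x / N) * cos (z * x + c))); last first.
  by move=> x; rewrite inE/= in_itv/= => /andP[_ x0]; rewrite ler0_norm//; congr *%R; lra.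
rewrite (@eq_Rintegral _ _ _ mu `[0, N]%classic
    (fun x => (1 + (- 1) * x / N) * cos (z * x + c))); last first.
  by move=> x; rewrite inE/= in_itv/= => /andP[x0 _]; rewrite ger0_norm//; congr *%R; lra.
rewrite (Rintegral_FTC _ (fun x _ => cp 1 x) (fun x _ => dp 1 x)) ?oppr_lt0//.
rewrite (Rintegral_FTC _ (fun x _ => cp (-1) x) (fun x _ => dp (-1) x))//.
rewrite !mulr0 !add0r !mulrN !cosD !sinD cosN sinN (mulrC N z).
by field; rewrite z0 gt_eqF.
Qed.

Lemma integrable_fejer_weight (N : R) : 0 < N ->
  mu.-integrable setT (EFin \o fejer_weight N).
Proof.
move=> N0.
have h : mu.-integrable setT (EFin \o \1_`[(- N), N]).
  exact: integrable_indic_itv.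
apply: le_integrable h => //.
  by apply/measurable_EFinP; exact: measurable_fejer_weight.
move=> x _ /=; rewrite lee_fin ger0_norm ?fejer_weight_ge0// indicE.
case: (boolP (x \in _)) => [_|/negP xN].
  by rewrite normr1 fejer_weight_le1.
rewrite normr0 /fejer_weight ge_max lexx/= subr_le0 ler_pdivlMr// mul1r.
by rewrite ltW// ltNge; apply: contra_notN xN; rewrite inE/= in_itv/= ler_norml.
Qed.

Lemma integrable_fejer_weight_cos (N z c : R) : 0 < N ->
  mu.-integrable setT (EFin \o (fun x => fejer_weight N x * cos (z * x + c))).
Proof.
move=> N0; apply: le_integrable (integrable_fejer_weight N0) => //.
  apply/measurable_EFinP; apply: measurable_funM.
    exact: measurable_fejer_weight.
  apply: measurableT_comp; first exact: measurable_fun_cos.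
  by apply: measurable_funD => //; apply: measurable_funM.
by move=> x _ /=; rewrite lee_fin normrM ler_piMr// cos_max.
Qed.

(** The weight is even, so the sine part of the expanded cosine integrates to zero and the phase
    factors out. *)
Lemma Rintegral_fejer_phase (N z c : R) : 0 < N ->
  \int[mu]_x (fejer_weight N x * cos (z * x + c)) = cos c * fejer_kernel N z.
Proof.
move=> N0; rewrite /fejer_kernel; have [->|z0] := eqVneq z 0.
  under eq_Rintegral do rewrite mul0r add0r mulrC.
  under [in RHS]eq_Rintegral do rewrite mul0r cos0 mulr1.
  by rewrite RintegralZl//; exact: integrable_fejer_weight.
rewrite Rintegral_fejer_cos//; congr *%R.
under eq_Rintegral do rewrite -[z * _]addr0.
by rewrite Rintegral_fejer_cos// cos0 mul1r.
Qed.

Lemma fejer_kernelE (N z : R) : 0 < N -> z != 0 ->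
  fejer_kernel N z = 2 * (1 - cos (N * z)) / (N * z ^+ 2).
Proof.
move=> N0 z0; rewrite /fejer_kernel.
under eq_Rintegral do rewrite -[z * _]addr0.
by rewrite Rintegral_fejer_cos// cos0 mul1r.
Qed.

Lemma Rintegral_fejer_weight_le (N : R) : 0 < N ->
  \int[mu]_x fejer_weight N x <= 2 * N.
Proof.
move=> N0; apply: (@le_trans _ _ (\int[mu]_x \1_`[(- N), N] x)).
  apply: le_Rintegral => //; first exact: integrable_fejer_weight.
    exact: integrable_indic_itv.
  move=> x _; rewrite indicE; case: (boolP (x \in _)) => [_|/negP xN].
    exact: fejer_weight_le1.
  rewrite /fejer_weight ge_max lexx/= subr_le0 ler_pdivlMr// mul1r.
  by rewrite ltW// ltNge; apply: contra_notN xN; rewrite inE/= in_itv/= ler_norml.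
rewrite /Rintegral integral_indic// setIT/= lebesgue_measure_itv/= lte_fin.
by case: ifPn => _ /=; lra.
Qed.

Lemma fejer_kernel_ge0 (N z : R) : 0 < N -> 0 <= fejer_kernel N z.
Proof.
move=> N0; have [->|z0] := eqVneq z 0.
  apply: Rintegral_ge0 => x _; rewrite mul0r cos0 mulr1.
  exact: fejer_weight_ge0.
have h1 : 0 <= 1 - cos (N * z) by rewrite subr_ge0 cos_le1.
by rewrite fejer_kernelE// divr_ge0// mulr_ge0 ?sqr_ge0// ltW.
Qed.

(** The integral of the weight bounds the kernel by [2 N], the closed form bounds it by
    [4 / (N z ^ 2)]. The constant 10 is what the first bound needs at [(N z) ^ 2 = 4], where the
    cases are separated. *)
Lemma fejer_kernel_le (N z : R) : 0 < N ->
  fejer_kernel N z <= 10 * (N / (1 + (N * z) ^+ 2)).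
Proof.
move=> N0; set v2 := (N * z) ^+ 2.
have v20 : 0 <= v2 by exact: sqr_ge0.
have [v4|v4] := leP v2 4.
  apply: (@le_trans _ _ (2 * N)).
    apply: le_trans (Rintegral_fejer_weight_le N0).
    apply: le_Rintegral => //; last 2 first.
    - exact: integrable_fejer_weight.
    - by move=> x _; rewrite ler_piMr ?fejer_weight_ge0// cos_le1.
    have := integrable_fejer_weight_cos z 0 N0.
    by apply: eq_integrable => // x _ /=; rewrite addr0.
  rewrite mulrCA (mulrC 2) ler_pM2l// ler_pdivlMr; lra.
have z0 : z != 0.
  by apply: contraTneq v4 => z0; rewrite /v2 z0 mulr0 expr0n/= -leNgt.
have -> : fejer_kernel N z = N * (2 * (1 - cos (N * z)) / v2).
  by rewrite fejer_kernelE// /v2; field; rewrite z0 gt_eqF.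
rewrite [leRHS]mulrCA ler_pM2l//.
have cN := cos_geN1 (N * z).
rewrite ler_pdivrMr ?(lt_trans _ v4)//.
apply: (@le_trans _ _ 4); first lra.
have p1 : 0 < 1 + v2 by lra.
rewrite mulrAC -(ler_pM2r p1) mulrVK ?unitfE ?gt_eqF//; lra.
Qed.

Lemma integral_oneDsqrV :
  (\int[mu]_x ((oneDsqr x)^-1)%:E = (pi : R)%:E)%E.
Proof.
rewrite (@ge0_symfun_integralT _ (fun x => (oneDsqr x)^-1)).
- by rewrite -set_itvcy integral0y_oneDsqr -EFinM; congr EFin; field.
- by move=> x; rewrite invr_ge0 (le_trans ler01)// oneDsqr_ge1.
- exact: continuous_oneDsqrV.
- by move=> x /=; rewrite /oneDsqr sqrrN.
Qed.

Lemma measurable_fejer_kernel (N x : R) :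
  measurable_fun setT (fun y : R => fejer_kernel N (x - y)).
Proof.
apply: (@measurable_Rintegral_param _ _ _ _ R mu
  (fun z : R * R => fejer_weight N z.2 * cos ((x - z.1) * z.2))).
apply: measurable_funM.
  exact: (measurableT_comp (measurable_fejer_weight N) measurable_snd).
apply: (measurableT_comp measurable_fun_cos).
apply: measurable_funM; last exact: measurable_snd.
by apply: measurable_funB => //; exact: measurable_fst.
Qed.

(** The substitution [u = N (y - x)] removes both parameters from the majorant and leaves the
    integral of [1 / (1 + u ^ 2)]. *)
Lemma integral_fejer_kernel_le (N x : R) : 0 < N ->
  (\int[mu]_y (fejer_kernel N (x - y))%:E <= (10 * pi)%:E)%E.
Proof.
move=> N0.
have subst : (\int[mu]_y (N / (1 + (N * (x - y)) ^+ 2))%:E = (pi : R)%:E)%E.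
  rewrite -integral_oneDsqrV.
  pose F (y : R) := N * y + - (N * x).
  have dF (y : R) : is_derive y 1 F N.
    by apply: is_derive_eq; rewrite /GRing.scale/=; ring.
  have dFE : F^`()%classic = cst N by apply/funext => y; rewrite derive1E; exact: derive_val.
  rewrite (@increasing_ge0_integration_by_substitutionT _ F (fun x => (oneDsqr x)^-1)).
  - apply: eq_integral => y _; rewrite dFE /F /oneDsqr mulrC; congr EFin.
    rewrite -[RHS]/((1 + (N * y - N * x) ^+ 2)^-1 * N).
    by congr ((1 + _)^-1 * _); ring.
  - by move=> y z yz; rewrite /F ltrD2r ltr_pM2l.
  - by rewrite dFE => y; exact: cst_continuous.
  - by rewrite dFE; exact: is_cvg_cst.
  - by rewrite dFE; exact: is_cvg_cst.
  - by move=> y; exact: ex_derive.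
  - apply/cvgrNyPle => A; exists ((A + N * x) / N); split; first exact: num_real.
    by move=> y; rewrite ltr_pdivlMr// mulrC /F => ?; lra.
  - apply/cvgryPge => A; exists ((A + N * x) / N); split; first exact: num_real.
    by move=> y; rewrite ltr_pdivrMr// mulrC /F => ?; lra.
  - exact: continuous_oneDsqrV.
  - by move=> y; rewrite invr_ge0 (le_trans ler01)// oneDsqr_ge1.
have mq : measurable_fun setT (fun y : R => N / (1 + (N * (x - y)) ^+ 2)).
  apply: continuous_measurable_fun => y.
  suff : {for y, continuous (fun y : R => N / (1 + (N * (x - y)) ^+ 2))} by [].
  apply: continuousM; first exact: cst_continuous.
  apply: continuousV.
    by rewrite gt_eqF// ltr_pwDl ?sqr_ge0.
  apply: (@is_derive_continuous _ _ (- 2 * N * (N * (x - y)))).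
  by apply: is_derive_eq; rewrite /GRing.scale/=; ring.
rewrite EFinM -subst -ge0_integralZl_EFin//; last 2 first.
- by move=> y _; rewrite lee_fin divr_ge0 ?ltW// ltr_pwDl ?sqr_ge0.
- exact/measurable_EFinP.
apply: ge0_le_integral => //.
- by move=> y _; rewrite lee_fin fejer_kernel_ge0.
- apply/measurable_EFinP; exact: measurable_fejer_kernel.
- by apply: measurable_funeM; exact/measurable_EFinP.
- by move=> y _; rewrite -EFinM lee_fin; exact: fejer_kernel_le.
Qed.

End calculus.

(** * Integrals of powers *)

Section power_integrals.
Context {R : realType}.
Notation mu := (@lebesgue_measure R).

(** Monotone convergence over an exhaustion: a bound uniform in the pieces passes to the union. *)
Lemma ge0_integral_bigcup_le d (T : measurableType d) (m : {measure set T -> \bar R})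
    (F : (set T)^nat) (f : T -> \bar R) (B : \bar R) :
  nondecreasing_seq F -> (forall n, measurable (F n)) ->
  measurable_fun setT f -> (forall n x, F n x -> 0 <= f x)%E ->
  (forall n, \int[m]_(x in F n) f x <= B)%E ->
  (\int[m]_(x in \bigcup_n F n) f x <= B)%E.
Proof.
move=> ndF mF mf f0 FB.
have h := @ge0_nondecreasing_set_cvg_integral _ _ _ F f m ndF mF (fun i => measurable_funTS mf) f0.
rewrite -(cvg_lim _ h)//; apply: lime_le; first by apply/cvg_ex; exists (\int[m]_(x in \bigcup_n F n) f x)%E.
by apply: nearW.
Qed.

Lemma is_derive_powR_affine (t e s y : R) : s != 1 -> 0 < e * (y - t) ->
  is_derive y 1 (fun y => (e * (y - t)) `^ (1 - s) / (1 - s)) (e * (e * (y - t)) `^ (- s)).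
Proof.
move=> s1 y0.
have dl : is_derive y 1 (fun y : R => e * (y - t)) e.
  by apply: is_derive_eq; rewrite /GRing.scale/=; ring.
have dp := @is_derive1_powR R (1 - s) _ y0.
have dc := @is_derive1_comp R (@powR R ^~ (1 - s)) (fun y : R => e * (y - t)) y _ _ dp dl.
have -> : (fun y => (e * (y - t)) `^ (1 - s) / (1 - s)) =
    (1 - s)^-1 *: ((@powR R ^~ (1 - s)) \o (fun y : R => e * (y - t))).
  by apply/funext => z /=; rewrite mulrC.
apply: is_derive_eq; rewrite /GRing.scale/=.
have -> : 1 - s - 1 = - s by ring.
by field; rewrite subr_eq0 eq_sym.
Qed.

Lemma continuous_powR_affine (t e s y : R) : 0 < e * (y - t) ->
  {for y, continuous (fun y => (e * (y - t)) `^ (- s))}.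
Proof.
move=> y0.
have dl : is_derive y 1 (fun y : R => e * (y - t)) e.
  by apply: is_derive_eq; rewrite /GRing.scale/=; ring.
have dp := @is_derive1_powR R (- s) _ y0.
exact: (is_derive_continuous (@is_derive1_comp R (@powR R ^~ (- s)) (fun y : R => e * (y - t)) y _ _ dp dl)).
Qed.

Lemma measurable_powR_dist (t s : R) :
  measurable_fun setT (fun y : R => `|t - y| `^ s).
Proof.
apply: (@measurableT_comp _ _ _ _ _ _ (@powR R ^~ s)).
  exact: measurable_powR.
by apply: measurableT_comp => //; exact: measurable_funB.
Qed.

(** The sign [e] selects the side of [t], so that one computation serves both halves of a shell. *)
Lemma integral_powR_side (t e a b s : R) : e ^+ 2 = 1 -> s != 1 -> 0 < a -> a < b ->
  (\int[mu]_(y in [set y | (a <= e * (y - t) <= b)%R]) ((e * (y - t)) `^ (- s))%:E =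
   ((b `^ (1 - s) - a `^ (1 - s)) / (1 - s))%:E)%E.
Proof.
move=> /eqP; rewrite sqrf_eq1 => /orP e1 s1 a0 ab.
have s1' : 1 - s != 0 by rewrite subr_eq0 eq_sym.
have ci u v : (forall y, u <= y <= v -> 0 < e * (y - t)) ->
    mu.-integrable `[u, v] (EFin \o (fun y => (e * (y - t)) `^ (- s))).
  move=> uv0; apply: continuous_itv_integrable => y /uv0.
  exact: continuous_powR_affine.
case: e1 => /eqP eE.
  rewrite (_ : [set y | _] = `[a + t, b + t]%classic); last first.
    by apply/seteqP; split => y /=; rewrite in_itv/= eE mul1r lerBrDr lerBlDr.
  have pos y : a + t <= y <= b + t -> 0 < e * (y - t).
    by move=> /andP[ya _]; rewrite eE; lra.
  rewrite -Rintegral_EFin//; last exact: ci.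
  rewrite (@eq_Rintegral _ _ _ mu `[a + t, b + t]%classic
    (fun y => e * (e * (y - t)) `^ (- s))); last first.
    by move=> y _; rewrite eE !mul1r.
  rewrite (Rintegral_FTC _ _ (fun y hy => is_derive_powR_affine s1 (pos y hy))).
  - by rewrite eE !mul1r !addrK mulrBl.
  - by rewrite ltrD2r.
  - move=> y /pos y0; apply: continuousM; first exact: cst_continuous.
    exact: continuous_powR_affine.
rewrite (_ : [set y | _] = `[t - b, t - a]%classic); last first.
  apply/seteqP; split => y /=; rewrite in_itv/= eE => /andP[? ?]; apply/andP; split; lra.
have pos y : t - b <= y <= t - a -> 0 < e * (y - t).
  by move=> /andP[_ ya]; rewrite eE; lra.
rewrite -Rintegral_EFin//; last exact: ci.
rewrite (@eq_Rintegral _ _ _ mu `[t - b, t - a]%classic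
  (fun y => (-1) * (e * (e * (y - t)) `^ (- s)))); last first.
  by move=> y _; rewrite eE mulrA mulrNN !mul1r.
have cy y : t - b <= y <= t - a -> {for y, continuous (fun y => e * (e * (y - t)) `^ (- s))}.
  move=> /pos y0; apply: continuousM; first exact: cst_continuous.
  exact: continuous_powR_affine.
rewrite RintegralZl//; last exact: continuous_itv_integrable.
rewrite (Rintegral_FTC _ cy (fun y hy => is_derive_powR_affine s1 (pos y hy))); last lra.
rewrite eE; congr EFin.
have -> : -1 * (t - a - t) = a by ring.
have -> : -1 * (t - b - t) = b by ring.
by field.
Qed.

Lemma integral_powR_shell (t a b s : R) : s != 1 -> 0 < a -> a < b ->
  (\int[mu]_(y in [set y | (a <= `|t - y| <= b)%R]) (`|t - y| `^ (- s))%:E <=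
   (2 * ((b `^ (1 - s) - a `^ (1 - s)) / (1 - s)))%:E)%E.
Proof.
move=> s1 a0 ab.
pose A e := [set y : R | a <= e * (y - t) <= b].
have mA e : e ^+ 2 = 1 -> measurable (A e).
  move=> /eqP; rewrite sqrf_eq1 => /orP[] /eqP eE.
    rewrite (_ : A e = `[a + t, b + t]%classic)//.
    by apply/seteqP; split => y /=; rewrite /A/= in_itv/= eE mul1r lerBrDr lerBlDr.
  rewrite (_ : A e = `[t - b, t - a]%classic)//.
  by apply/seteqP; split => y /=; rewrite /A/= in_itv/= eE => /andP[? ?]; apply/andP; split; lra.
have e1 : (1 : R) ^+ 2 = 1 by rewrite expr1n.
have e2 : (-1 : R) ^+ 2 = 1 by rewrite sqrrN expr1n.
have -> : [set y | a <= `|t - y| <= b] = A 1 `|` A (-1).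
  apply/seteqP; split => [y /=|y [|]]; rewrite /A/=.
    have [ty|ty] := ler0P (t - y) => /andP[? ?]; [left|right];
    apply/andP; split; lra.
  - move=> /andP[? ?]; rewrite distrC ger0_norm; last lra.
    apply/andP; split; lra.
  - move=> /andP[? ?]; rewrite ger0_norm; last lra.
    apply/andP; split; lra.
rewrite ge0_integral_setU//; last 4 first.
- exact: mA.
- exact: mA.
- apply: measurable_funTS; apply/measurable_EFinP; exact: measurable_powR_dist.
- rewrite disj_set2E; apply/eqP; rewrite -subset0 => y [/=]; rewrite /A/=.
  by move=> /andP[? ?] /andP[? ?]; lra.
rewrite [in X in (X + _)%E](@eq_integral _ _ _ mu _ (fun y => ((1 * (y - t)) `^ (- s))%:E)); last first.
  move=> y; rewrite inE /A/= => /andP[? ?]; rewrite distrC ger0_norm ?mul1r//; lra.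
rewrite [in X in (_ + X)%E](@eq_integral _ _ _ mu _ (fun y => ((-1 * (y - t)) `^ (- s))%:E)); last first.
  move=> y; rewrite inE /A/= => /andP[? ?]; rewrite ger0_norm ?mulN1r ?opprB//; lra.
rewrite !integral_powR_side//.
by rewrite -EFinD lee_fin; lra.
Qed.

Lemma measurable_dist_itv (t a b : R) : measurable [set y : R | a <= `|t - y| <= b].
Proof.
have h : measurable_fun setT (fun y : R => `|t - y|).
  by apply: measurableT_comp => //; exact: measurable_funB.
rewrite (_ : [set y | _] = (fun y : R => `|t - y|) @^-1` `[a, b]%classic).
  by rewrite -[X in measurable X]setTI; exact: h.
by apply/seteqP; split => y /=; rewrite in_itv.
Qed.

Lemma measurable_dist_le (t h : R) : measurable [set y : R | `|t - y| <= h].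
Proof.
rewrite (_ : [set y | _] = `[t - h, t + h]%classic)//.
by apply/seteqP; split => y /=; rewrite in_itv/= distrC ler_distl.
Qed.

Lemma integral_powR_near (t h k : R) : 0 <= k -> k < 1 -> 0 < h ->
  (\int[mu]_(y in [set y | (`|t - y| <= h)%R]) (`|t - y| `^ (- k))%:E <=
   (2 / (1 - k) * h `^ (1 - k))%:E)%E.
Proof.
move=> k0 k1 h0.
(* The singular point is removed: it is negligible and belongs to none of the shells that exhaust
   the rest. *)
rewrite -(@integral_setD1 _ _ t); last 2 first.
- by apply: measurableD => //; exact: measurable_dist_le.
- apply: measurable_funTS; apply/measurable_EFinP; exact: measurable_powR_dist.
(* [n.+2], not [n.+1], keeps the inner radius strictly below [h], as the formula for a shell
   requires. *)
pose F n := [set y : R | h / n.+2%:R <= `|t - y| <= h].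
rewrite (_ : _ `\ t = \bigcup_n F n); last first.
  apply/seteqP; split => [y /= [yh /eqP yt]|y [n _]]; last first.
    rewrite /F/= => /andP[H ?]; split => // yt.
    have : h / n.+2%:R <= 0 by rewrite (le_trans H)// yt subrr normr0.
    by apply/negP; rewrite -ltNge divr_gt0.
  have ty : 0 < `|t - y| by rewrite normr_gt0 subr_eq0 eq_sym; apply/eqP => /eqP; rewrite (negbTE yt).
  pose n := Num.bound (h / `|t - y|).
  have hn : h / `|t - y| < n%:R.
    by apply: archi_boundP; rewrite divr_ge0 ?(ltW h0)// ltW.
  exists n => //; rewrite /F/= yh andbT ler_pdivrMr//.
  move: hn; rewrite ltr_pdivrMr// => hn; rewrite mulrC (le_trans (ltW hn))//.
  by rewrite ler_wpM2r ?(ltW ty)// ler_nat -addn2 leq_addr.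
have k1' : 0 < 1 - k by rewrite subr_gt0.
apply: ge0_integral_bigcup_le.
- apply/nondecreasing_seqP => n; apply/subsetPset => y; rewrite /F/= => /andP[y1 ->].
  rewrite andbT (le_trans _ y1)// ler_pM2l// lef_pV2// ?posrE//.
  by rewrite ler_nat.
- move=> n; exact: measurable_dist_itv.
- apply/measurable_EFinP; exact: measurable_powR_dist.
- by move=> n y _; rewrite lee_fin powR_ge0.
- move=> n; rewrite /F.
  have hn0 : 0 < h / n.+2%:R by rewrite divr_gt0.
  have hnh : h / n.+2%:R < h by rewrite ltr_pdivrMr// ltr_pMr// ltr1n.
  apply: le_trans (integral_powR_shell _ _ hn0 hnh) _; first by rewrite lt_eqF.
  rewrite lee_fin -mulrA ler_pM2l// [leRHS]mulrC ler_pM2r ?invr_gt0//.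
  by rewrite gerBl powR_ge0.
Qed.

Lemma integral_powR_far (t h k : R) : 1 < k -> 0 < h ->
  (\int[mu]_(y in [set y | (h <= `|t - y|)%R]) (`|t - y| `^ (- k))%:E <=
   (2 / (k - 1) * h `^ (1 - k))%:E)%E.
Proof.
move=> k1 h0.
pose F n := [set y : R | h <= `|t - y| <= h + n.+1%:R].
rewrite (_ : [set y | _] = \bigcup_n F n); last first.
  apply/seteqP; split => [y /= yh|y [n _]]; last by rewrite /F/= => /andP[].
  exists (Num.bound `|t - y|) => //; rewrite /F/= yh/=.
  have := archi_boundP (normr_ge0 (t - y)); set n := Num.bound _ => hn.
  by rewrite (le_trans (ltW hn))// -natr1; lra.
apply: ge0_integral_bigcup_le.
- apply/nondecreasing_seqP => n; apply/subsetPset => y; rewrite /F/= => /andP[-> y1]/=.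
  by rewrite (le_trans y1)// lerD2l ler_nat.
- move=> n; exact: measurable_dist_itv.
- apply/measurable_EFinP; exact: measurable_powR_dist.
- by move=> n y _; rewrite lee_fin powR_ge0.
- move=> n; rewrite /F.
  have hnh : h < h + n.+1%:R by rewrite ltrDl.
  apply: le_trans (integral_powR_shell _ _ h0 hnh) _; first by rewrite gt_eqF.
  rewrite lee_fin -mulrA ler_pM2l//.
  have -> : (1 - k)^-1 = - (k - 1)^-1 by rewrite -[1 - k]opprB invrN.
  rewrite mulrN -mulNr opprB mulrC ler_pM2l ?invr_gt0 ?subr_gt0//.
  by rewrite gerBl powR_ge0.
Qed.

(** A rearrangement argument: with [h] the measure of [E], the points of [E] within [h] of [t]
    contribute at most the integral over that whole interval, and beyond it the kernel is at most
    [h ^ (- k)] on a set of measure at most [h]. *)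
Lemma integral_powR_set (t k : R) (E : set R) : 0 <= k -> k < 1 -> measurable E ->
  (mu E < +oo)%E ->
  (\int[mu]_(y in E) (`|t - y| `^ (- k))%:E <=
   ((2 / (1 - k) + 1) * fine (mu E) `^ (1 - k))%:E)%E.
Proof.
move=> k0 k1 mE Efin.
have mf : measurable_fun setT (fun y : R => (`|t - y| `^ (- k))%:E).
  by apply/measurable_EFinP; exact: measurable_powR_dist.
have [E0|E0] := eqVneq (mu E) 0%E.
  rewrite null_set_integral//.
    by rewrite lee_fin mulr_ge0 ?powR_ge0// addr_ge0// divr_ge0// subr_ge0 ltW.
  exact: measurable_funTS.
set h := fine (mu E).
have hE : mu E = h%:E by rewrite fineK// ge0_fin_numE.
have h0 : 0 < h by rewrite -lte_fin -hE lt0e E0/=.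
pose N := [set y : R | (`|t - y| <= h)%R].
have mN : measurable N by exact: measurable_dist_le.
apply: (@le_trans _ _ (\int[mu]_(y in N) (`|t - y| `^ (- k))%:E +
    \int[mu]_(y in E `\` N) (`|t - y| `^ (- k))%:E)%E).
  rewrite -ge0_integral_setU//; last 3 first.
  - exact: measurableD.
  - exact: measurable_funTS.
  - by rewrite disj_set2E setDE setICA setICr setI0.
  apply: ge0_subset_integral => //.
  - by apply: measurableU => //; exact: measurableD.
  - exact: measurable_funTS.
  - by move=> y Ey; rewrite /=; have [|] := pselect (N y); [left|right].
rewrite mulrDl mul1r EFinD; apply: leeD; first exact: integral_powR_near.
apply: (@le_trans _ _ (\int[mu]_(y in E `\` N) (h `^ (- k))%:E)%E).
  apply: ge0_le_integral => //.
  - exact: measurableD.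
  - exact: measurable_funTS.
  - move=> y [_ /= /negP]; rewrite -ltNge => hy; rewrite lee_fin !powRN.
    rewrite lef_pV2 ?posrE ?powR_gt0// ?(lt_trans h0)//.
    by apply: ge0_ler_powR; rewrite ?nnegrE ?(ltW h0) ?(ltW hy).
rewrite integral_cst; last exact: measurableD.
apply: (@le_trans _ _ ((h `^ (- k))%:E * mu E)%E).
  by rewrite lee_wpmul2l ?lee_fin ?powR_ge0// le_measure ?inE//; exact: measurableD.
by rewrite hE -EFinM lee_fin powRD ?(gt_eqF h0) ?implybT// powRr1 ?(ltW h0)// mulrC.
Qed.

End power_integrals.

(** * Integration on row vectors *)

Section integral_rV.
Context {R : realType}.
Notation mu := (@lebesgue_measure R).
Notation L := (@lebesgue_rV R).

Lemma ge0_integral_rV n (f : 'rV[R]_n.+1 -> \bar R) :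
  measurable_fun setT f -> (forall v, 0 <= f v)%E ->
  (\int[L n.+1]_v f v = \int[mu \x L n]_z f (consrV z))%E.
Proof.
move=> mf f0.
by rewrite (ge0_integral_pushforward (@measurable_consrV R n)).
Qed.

Lemma integrable_rV n (f : 'rV[R]_n.+1 -> R) : measurable_fun setT f ->
  (mu \x L n)%E.-integrable setT (EFin \o (fun z => f (consrV z))) ->
  (L n.+1).-integrable setT (EFin \o f).
Proof.
move=> mf /integrableP[_ fi]; apply/integrableP; split; first exact/measurable_EFinP.
rewrite (ge0_integral_rV (f := fun v => `|(f v)%:E|%E))//.
by apply: measurableT_comp => //; exact/measurable_EFinP.
Qed.

Lemma integrable_rV_cons n (f : 'rV[R]_n.+1 -> R) :
  (L n.+1).-integrable setT (EFin \o f) ->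
  (mu \x L n)%E.-integrable setT (EFin \o (fun z => f (consrV z))).
Proof.
move=> /integrableP[/measurable_EFinP mf fi]; apply/integrableP; split.
  by apply/measurable_EFinP; exact: (measurableT_comp mf (@measurable_consrV R n)).
rewrite (ge0_integral_rV (f := fun v => `|(f v)%:E|%E)) in fi => //.
by apply: measurableT_comp => //; exact/measurable_EFinP.
Qed.

Lemma Rintegral_rV n (f : 'rV[R]_n.+1 -> R) :
  (L n.+1).-integrable setT (EFin \o f) ->
  \int[L n.+1]_v f v = \int[mu]_x \int[L n]_v f (consrV (x, v)).
Proof.
move=> fi; have fc := integrable_rV_cons fi.
rewrite (Rintegral_prod12 (f := fun z => f (consrV z)))//.
rewrite /Rintegral; congr fine.
have /integrableP[mf _] := fi.
by rewrite (integral_pushforward (@measurable_consrV R n) mf).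
Qed.

Lemma Rintegral_rV0 (f : 'rV[R]_0 -> R) : \int[L 0]_v f v = f 0.
Proof.
rewrite /Rintegral integral_dirac//.
  by rewrite diracE mem_set// mul1e.
apply/measurable_EFinP => _ Y mY; rewrite setTI.
have [h|h] := pselect (Y (f 0)).
  rewrite (_ : _ @^-1` _ = setT); first exact: measurableT.
  by apply/seteqP; split => // v _ /=; rewrite (_ : v = 0)//; apply/rowP => -[].
rewrite (_ : _ @^-1` _ = set0); first exact: measurable0.
by apply/seteqP; split => // v /=; rewrite (_ : v = 0)//; apply/rowP => -[].
Qed.

Lemma measurable_fun_rV0 d (T : measurableType d) (f : 'rV[R]_0 -> T) :
  measurable_fun setT f.
Proof.
move=> _ Y mY; rewrite setTI.
have [h|h] := pselect (Y (f 0)).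
  rewrite (_ : _ @^-1` _ = setT); first exact: measurableT.
  by apply/seteqP; split => // v _ /=; rewrite (_ : v = 0)//; apply/rowP => -[].
rewrite (_ : _ @^-1` _ = set0); first exact: measurable0.
by apply/seteqP; split => // v /=; rewrite (_ : v = 0)//; apply/rowP => -[].
Qed.

Definition tensorRV n (w : 'I_n -> R -> R) (v : 'rV[R]_n) : R :=
  \prod_(i < n) w i (v ord0 i).

Lemma measurable_tensorRV n (w : 'I_n -> R -> R) :
  (forall i, measurable_fun setT (w i)) -> measurable_fun setT (tensorRV w).
Proof.
move=> mw; rewrite /tensorRV; apply: measurable_prod => i _.
exact: (measurableT_comp (mw i) (measurable_rV_coord i)).
Qed.

Lemma tensorRV_cons n (w : 'I_n.+1 -> R -> R) z :
  tensorRV w (consrV z) = w ord0 z.1 * tensorRV (fun i => w (lift ord0 i)) z.2.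
Proof.
rewrite /tensorRV big_ord_recl consrV0; congr *%R.
by apply: eq_bigr => i _; rewrite consrV_lift.
Qed.

Lemma tensorRV_ge0 n (w : 'I_n -> R -> R) v :
  (forall i x, 0 <= w i x) -> 0 <= tensorRV w v.
Proof. by move=> w0; apply: prodr_ge0. Qed.

Lemma ge0_integral_tensorRV n (w : 'I_n -> R -> R) :
  (forall i, measurable_fun setT (w i)) -> (forall i x, 0 <= w i x) ->
  (\int[L n]_v (tensorRV w v)%:E = \prod_(i < n) \int[mu]_x (w i x)%:E)%E.
Proof.
elim: n w => [|n IH] w mw w0.
  rewrite big_ord0 -Rintegral_EFin//.
    by rewrite Rintegral_rV0 /tensorRV big_ord0.
  apply/integrableP; split; first exact: measurable_fun_rV0.
  rewrite [X in (X < _)%E](_ : _ = \int[L 0]_v (cst 1 v))%E.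
    rewrite integral_cst// mul1e.
    by rewrite /= diracE mem_set// ltry.
  by apply: eq_integral => v _ /=; rewrite /tensorRV big_ord0 normr1.
rewrite ge0_integral_rV; last 2 first.
- by apply/measurable_EFinP; exact: measurable_tensorRV.
- by move=> v; rewrite lee_fin; exact: tensorRV_ge0.
under eq_integral do rewrite tensorRV_cons.
rewrite (@ge0_integral_tensor _ _ _ _ R mu (L n) (w ord0)
  (tensorRV (fun i => w (lift ord0 i))))//; last 3 first.
- exact: mw.
- exact: measurable_tensorRV.
- by move=> v; exact: tensorRV_ge0.
by rewrite big_ord_recl IH.
Qed.

Lemma integrable_tensorRV n (w : 'I_n -> R -> R) :
  (forall i, mu.-integrable setT (EFin \o w i)) ->
  (L n).-integrable setT (EFin \o tensorRV w).
Proof.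
elim: n w => [|n IH] w wi.
  apply/integrableP; split; first exact: measurable_fun_rV0.
  rewrite [X in (X < _)%E](_ : _ = \int[L 0]_v (cst 1 v))%E.
    by rewrite integral_cst// mul1e /= diracE mem_set// ltry.
  by apply: eq_integral => v _ /=; rewrite /tensorRV big_ord0 normr1.
apply: integrable_rV.
  by apply: measurable_tensorRV => i; have /integrableP[/measurable_EFinP] := wi i.
rewrite (_ : (fun z => _) = fun z => w ord0 z.1 * tensorRV (fun i => w (lift ord0 i)) z.2).
  by apply: integrable_tensor => //; exact: IH.
by apply/funext => z; rewrite tensorRV_cons.
Qed.

Definition tailrV n (v : 'rV[R]_n.+1) : 'rV[R]_n := \row_j v ord0 (lift ord0 j).

Lemma dotrV_cons n z (b : 'rV[R]_n.+1) :
  dotrV (consrV z) b = z.1 * b ord0 ord0 + dotrV z.2 (tailrV b).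
Proof.
rewrite /dotrV big_ord_recl consrV0; congr +%R.
by apply: eq_bigr => i _; rewrite consrV_lift mxE.
Qed.

Lemma dotrV_cons_self n (z : _ * 'rV[R]_n) :
  dotrV (consrV z) (consrV z) = z.1 ^+ 2 + dotrV z.2 z.2.
Proof.
rewrite /dotrV big_ord_recl consrV0 expr2; congr +%R.
by apply: eq_bigr => i _; rewrite consrV_lift.
Qed.

Lemma measurable_dotrV n d (T : measurableType d) (f g : T -> 'rV[R]_n) :
  measurable_fun setT f -> measurable_fun setT g ->
  measurable_fun setT (fun x => dotrV (f x) (g x)).
Proof.
move=> mf mg; rewrite /dotrV; apply: measurable_sum => i.
apply: measurable_funM.
  exact: (measurableT_comp (measurable_rV_coord i) mf).
exact: (measurableT_comp (measurable_rV_coord i) mg).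
Qed.

(* The doubling of the constant in each dimension comes from expanding the
   cosine of a sum instead of factoring a complex exponential. *)
Lemma Rintegral_tensorRV_cos n (w : R -> R) (a K : R) (b : 'rV[R]_n) (c : R) :
  mu.-integrable setT (EFin \o w) -> 0 <= K ->
  (forall b c, `|\int[mu]_x (w x * cos (a * x ^+ 2 + b * x + c))| <= K) ->
  `|\int[L n]_v (tensorRV (fun=> w) v * cos (a * dotrV v v + dotrV v b + c))|
    <= (2 * K) ^+ n.
Proof.
move=> wi K0 wK; elim: n b c => [|n IH] b c.
  by rewrite Rintegral_rV0 /tensorRV big_ord0 mul1r expr0 cos_max.
have Wi k := @integrable_tensorRV k (fun=> w) (fun=> wi).
have mcos k (b' : 'rV[R]_k) c' :
    measurable_fun setT (fun v => cos (a * dotrV v v + dotrV v b' + c')).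
  apply: (measurableT_comp measurable_fun_cos).
  apply: measurable_funD => //; apply: measurable_funD.
    by apply: measurable_funM => //; exact: measurable_dotrV.
  exact: measurable_dotrV.
have Wci k (b' : 'rV[R]_k) c' : (L k).-integrable setT (EFin \o
    (fun v => tensorRV (fun=> w) v * cos (a * dotrV v v + dotrV v b' + c'))).
  apply: le_integrable (Wi k) => //.
    apply/measurable_EFinP; apply: measurable_funM; last exact: mcos.
    by have /integrableP[/measurable_EFinP] := Wi k.
  by move=> v _ /=; rewrite lee_fin normrM ler_piMr// cos_max.
have wci (b' c' : R) : mu.-integrable setT (EFin \o
    (fun x => w x * cos (a * x ^+ 2 + b' * x + c'))).
  apply: le_integrable (wi) => //.
    apply/measurable_EFinP; apply: measurable_funM => //.
      by have /integrableP[/measurable_EFinP] := wi.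
    apply: continuous_measurable_fun => x; exact: continuous_cos_quad.
  by move=> v _ /=; rewrite lee_fin normrM ler_piMr// cos_max.
rewrite Rintegral_rV//.
pose wc c := \int[mu]_x (w x * cos (a * x ^+ 2 + b ord0 ord0 * x + c)).
pose Wc c := \int[L n]_v (tensorRV (fun=> w) v * cos (a * dotrV v v + dotrV v (tailrV b) + c)).
(* The cosine of a sum, with both sines written as cosines shifted by [pi / 2], so that one factor
   falls under the hypothesis and the other under the induction. *)
rewrite (_ : \int[mu]_x _ = wc c * Wc 0 - wc (c - pi / 2) * Wc (- (pi / 2))).
  apply: (le_trans (ler_normB _ _)); rewrite !normrM exprS -mulrA [leRHS]mulrC.
  have -> : K * (2 * K) ^+ n * 2 = K * (2 * K) ^+ n + K * (2 * K) ^+ n by ring.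
  by apply: lerD; apply: ler_pM => //; [exact: wK|exact: IH|exact: wK|exact: IH].
rewrite /wc -!RintegralZr// -RintegralB//; last 2 first.
- have := integrableZr measurableT (Wc 0) (wci (b ord0 ord0) c).
  by apply: eq_integrable => // x _ /=; rewrite EFinM.
- have := integrableZr measurableT (Wc (- (pi / 2))) (wci (b ord0 ord0) (c - pi / 2)).
  by apply: eq_integrable => // x _ /=; rewrite EFinM.
apply: eq_Rintegral => x _; rewrite /Wc -!RintegralZl// -RintegralB//; last 2 first.
- have := integrableZl measurableT (w x * cos (a * x ^+ 2 + b ord0 ord0 * x + c)) (Wci n (tailrV b) 0).
  by apply: eq_integrable => // v _ /=; rewrite EFinM.
- have := integrableZl measurableT (w x * cos (a * x ^+ 2 + b ord0 ord0 * x + (c - pi / 2))) (Wci n (tailrV b) (- (pi / 2))).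
  by apply: eq_integrable => // v _ /=; rewrite EFinM.
apply: eq_Rintegral => v _; rewrite tensorRV_cons dotrV_cons_self dotrV_cons/=.
set A := a * x ^+ 2 + b ord0 ord0 * x + c; set B := a * dotrV v v + dotrV v (tailrV b).
rewrite addr0 [in RHS]addrA !cosBpihalf.
have -> : a * (x ^+ 2 + dotrV v v) + (x * b ord0 ord0 + dotrV v (tailrV b)) + c = A + B.
  by rewrite /A /B; ring.
by rewrite cosD; ring.
Qed.

(** No constant is lost here: the weight is even in each coordinate, so the phase left over from the
    other coordinates passes through each integral as a factor. *)
Lemma Rintegral_fejer_rV n (N : R) (z : 'rV[R]_n) (c : R) : 0 < N ->
  \int[L n]_v (tensorRV (fun=> fejer_weight N) v * cos (dotrV v z + c)) =
  cos c * \prod_(i < n) fejer_kernel N (z ord0 i).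
Proof.
move=> N0; have wi := @integrable_fejer_weight R N N0.
elim: n z c => [|n IH] z c.
  by rewrite Rintegral_rV0 /tensorRV /dotrV !big_ord0 mul1r mulr1 add0r.
have Wi k := @integrable_tensorRV k (fun=> fejer_weight N) (fun=> wi).
rewrite Rintegral_rV//; last first.
  apply: le_integrable (Wi n.+1) => //.
    apply/measurable_EFinP; apply: measurable_funM => //.
      by have /integrableP[/measurable_EFinP] := Wi n.+1.
    apply: (measurableT_comp measurable_fun_cos).
    by apply: measurable_funD => //; exact: measurable_dotrV.
  by move=> v _ /=; rewrite lee_fin normrM ler_piMr// cos_max.
rewrite big_ord_recl mulrA -Rintegral_fejer_phase// -RintegralZr//; last first.
  exact: integrable_fejer_weight_cos.
apply: eq_Rintegral => x _.
under eq_Rintegral => v _.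
  rewrite tensorRV_cons dotrV_cons/= -mulrA.
  rewrite (_ : _ + _ + c = dotrV v (tailrV z) + (z ord0 ord0 * x + c)); last ring.
  over.
rewrite RintegralZl//; last first.
  apply: le_integrable (Wi n) => //.
    apply/measurable_EFinP; apply: measurable_funM => //.
      by have /integrableP[/measurable_EFinP] := Wi n.
    apply: (measurableT_comp measurable_fun_cos).
    by apply: measurable_funD => //; exact: measurable_dotrV.
  by move=> v _ /=; rewrite lee_fin normrM ler_piMr// cos_max.
rewrite IH mulrA; congr *%R.
by apply: eq_bigr => i _; rewrite mxE.
Qed.

End integral_rV.

(** * Bilinear oscillatory forms *)

Section oscillatory_form.
Context {R : realType} (n : nat).
Notation mu := (@lebesgue_measure R).
Notation X := 'rV[R]_n.
Notation L := (@lebesgue_rV R n).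
Notation Z := (measurableTypeR R * X)%type.

(** For [z = (t, x)], minus the phase of the plane wave [exp (i (x . xi - t |xi| ^ 2))], a solution
    of the free equation. *)
Definition phase (z : Z) (xi : X) : R := z.1 * dotrV xi xi - dotrV z.2 xi.

(** The real counterpart of the kernel of the propagator between two times: [b = 0] gives its cosine
    part and [b = pi / 2] its sine part. An integrable weight [w] makes the integral absolutely
    convergent. *)
Definition kern (w : X -> R) (b : R) (z z' : Z) : R :=
  \int[L]_xi (w xi * cos (phase z xi - phase z' xi - b)).

Lemma measurable_phase : measurable_fun setT (fun p : Z * X => phase p.1 p.2).
Proof.
apply: measurable_funB.
  apply: measurable_funM.
    exact: (measurableT_comp measurable_fst measurable_fst).
  by apply: measurable_dotrV; exact: measurable_snd.
apply: measurable_dotrV; last exact: measurable_snd.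
exact: (measurableT_comp measurable_snd measurable_fst).
Qed.

Lemma measurable_phase_comp d (T : measurableType d) (f : T -> Z) (g : T -> X) :
  measurable_fun setT f -> measurable_fun setT g ->
  measurable_fun setT (fun x => phase (f x) (g x)).
Proof.
move=> mf mg; apply: (measurableT_comp measurable_phase (g := fun x => (f x, g x))).
exact: measurable_fun_pair.
Qed.

Lemma measurable_kern (w : X -> R) (b : R) : measurable_fun setT w ->
  measurable_fun setT (fun p : Z * Z => kern w b p.1 p.2).
Proof.
move=> mw; apply: (@measurable_Rintegral_param _ _ _ _ R L
  (fun q : (Z * Z) * X => w q.2 * cos (phase q.1.1 q.2 - phase q.1.2 q.2 - b))).
apply: measurable_funM; first exact: (measurableT_comp mw measurable_snd).
apply: (measurableT_comp measurable_fun_cos); apply: measurable_funB => //.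
apply: measurable_funB; apply: measurable_phase_comp; try exact: measurable_snd.
  exact: (measurableT_comp measurable_fst measurable_fst).
exact: (measurableT_comp measurable_snd measurable_fst).
Qed.

Lemma normr_kern_le (w : X -> R) (b : R) (z z' : Z) : L.-integrable setT (EFin \o w) ->
  `|kern w b z z'| <= \int[L]_xi `|w xi|.
Proof.
move=> wi; have /integrableP[/measurable_EFinP mw _] := wi.
have mc : measurable_fun setT (fun xi => cos (phase z xi - phase z' xi - b)).
  apply: (measurableT_comp measurable_fun_cos); apply: measurable_funB => //.
  by apply: measurable_funB; apply: measurable_phase_comp.
have wci : L.-integrable setT (EFin \o (fun xi => w xi * cos (phase z xi - phase z' xi - b))).
  apply: le_integrable wi => //.
    by apply/measurable_EFinP; apply: measurable_funM.
  by move=> v _ /=; rewrite lee_fin normrM ler_piMr// cos_max.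
apply: le_trans (le_normr_Rintegral measurableT wci) _.
apply: le_Rintegral => //.
- exact: integrable_norm.
- exact: (integrable_norm wi).
- by move=> v _; rewrite normrM ler_piMr// cos_max.
Qed.

Section form.
Context d1 (T1 : measurableType d1) (m1 : {sigma_finite_measure set T1 -> \bar R}).
Context d2 (T2 : measurableType d2) (m2 : {sigma_finite_measure set T2 -> \bar R}).
Variables (z1 : T1 -> Z) (z2 : T2 -> Z).

(** The arguments live on arbitrary measure spaces mapped into spacetime: [idZ] gives functions on
    spacetime and [at_time t] functions on one time slice, so that one Cauchy-Schwarz inequality
    covers every combination. *)
Definition oform (w : X -> R) (b : R) (h1 : T1 -> R) (h2 : T2 -> R) : R :=
  \int[(m1 \x m2)%E]_p (h1 p.1 * h2 p.2 * kern w b (z1 p.1) (z2 p.2)).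

Hypothesis mz1 : measurable_fun setT z1.
Hypothesis mz2 : measurable_fun setT z2.
Variables (w : X -> R) (h1 : T1 -> R) (h2 : T2 -> R) (b : R).
Hypothesis wi : L.-integrable setT (EFin \o w).
Hypothesis hi1 : m1.-integrable setT (EFin \o h1).
Hypothesis hi2 : m2.-integrable setT (EFin \o h2).

Lemma measurable_kern_comp :
  measurable_fun setT (fun p : T1 * T2 => kern w b (z1 p.1) (z2 p.2)).
Proof.
have /integrableP[/measurable_EFinP mw _] := wi.
apply: (measurableT_comp (measurable_kern b mw) (g := fun p => (z1 p.1, z2 p.2))).
apply: measurable_fun_pair.
  exact: (measurableT_comp mz1 measurable_fst).
exact: (measurableT_comp mz2 measurable_snd).
Qed.

Lemma integrable_oform : (m1 \x m2)%E.-integrable setT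
  (EFin \o (fun p => h1 p.1 * h2 p.2 * kern w b (z1 p.1) (z2 p.2))).
Proof.
have ti := integrable_tensor hi1 hi2.
have /integrableP[/measurable_EFinP mt _] := ti.
pose M := \int[L]_xi `|w xi|.
apply: (@le_integrable_real _ _ _ _ _ _ (fun p => M * `|h1 p.1 * h2 p.2|)) => //.
- by apply: measurable_funM => //; exact: measurable_kern_comp.
- by move=> p _; rewrite normrM mulrC ler_wpM2r// normr_kern_le.
- have := integrableZl measurableT M (integrable_norm ti).
  by apply: eq_integrable => // p _ /=; rewrite EFinM.
Qed.

Lemma oform_iter12 : oform w b h1 h2 =
  \int[m1]_x \int[m2]_y (h1 x * h2 y * kern w b (z1 x) (z2 y)).
Proof.
by rewrite (Rintegral_prod12 (f := fun p => h1 p.1 * h2 p.2 * kern w b (z1 p.1) (z2 p.2)))//; exact: integrable_oform.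
Qed.

Lemma oform_iter21 : oform w b h1 h2 =
  \int[m2]_y \int[m1]_x (h1 x * h2 y * kern w b (z1 x) (z2 y)).
Proof.
by rewrite (Rintegral_prod21 (f := fun p => h1 p.1 * h2 p.2 * kern w b (z1 p.1) (z2 p.2)))//; exact: integrable_oform.
Qed.

Lemma normr_oform_le : (`|oform w b h1 h2|%:E <=
  \int[m1]_x \int[m2]_y (`|h1 x| * `|h2 y| * `|kern w b (z1 x) (z2 y)|)%:E)%E.
Proof.
have /integrableP[/measurable_EFinP mi _] := integrable_oform.
apply: le_trans (normr_Rintegral_le _ measurableT mi) _.
rewrite fubini_tonelli1//; last first.
  by apply/measurable_EFinP; exact: measurableT_comp.
rewrite le_eqVlt; apply/orP; left; apply/eqP.
apply: eq_integral => x _; apply: eq_integral => y _ /=.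
by rewrite !normrM.
Qed.

End form.

(** For [a = 0] and [a = - pi / 2] these are the real and imaginary parts of the spacetime Fourier
    transform of [h] on the paraboloid. *)
Definition otransform d (T : measurableType d) (m : {sigma_finite_measure set T -> \bar R})
    (z : T -> Z) (h : T -> R) (a : R) (xi : X) : R :=
  \int[m]_x (h x * cos (phase (z x) xi + a)).

Section otransform.
Context d (T : measurableType d) (m : {sigma_finite_measure set T -> \bar R}).
Variables (z : T -> Z) (h : T -> R).
Hypothesis mz : measurable_fun setT z.
Hypothesis hi : m.-integrable setT (EFin \o h).

Lemma integrable_otransform a xi :
  m.-integrable setT (EFin \o (fun x => h x * cos (phase (z x) xi + a))).
Proof.
have /integrableP[/measurable_EFinP mh _] := hi.
apply: le_integrable (hi) => //.
  apply/measurable_EFinP; apply: measurable_funM => //.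
  apply: (measurableT_comp measurable_fun_cos); apply: measurable_funD => //.
  by apply: measurable_phase_comp.
by move=> v _ /=; rewrite lee_fin normrM ler_piMr// cos_max.
Qed.

Lemma measurable_otransform a : measurable_fun setT (otransform m z h a).
Proof.
have /integrableP[/measurable_EFinP mh _] := hi.
apply: (@measurable_Rintegral_param _ _ _ _ R m
  (fun q : X * T => h q.2 * cos (phase (z q.2) q.1 + a))).
apply: measurable_funM; first exact: (measurableT_comp mh measurable_snd).
apply: (measurableT_comp measurable_fun_cos); apply: measurable_funD => //.
apply: measurable_phase_comp; last exact: measurable_fst.
exact: (measurableT_comp mz measurable_snd).
Qed.

Lemma normr_otransform_le a xi : `|otransform m z h a xi| <= \int[m]_x `|h x|.
Proof.
apply: le_trans (le_normr_Rintegral measurableT (integrable_otransform a xi)) _.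
apply: le_Rintegral => //.
- exact: integrable_norm (integrable_otransform a xi).
- exact: (integrable_norm hi).
- by move=> v _; rewrite normrM ler_piMr// cos_max.
Qed.

Lemma otransformD a c xi : otransform m z h (a + c) xi =
  cos c * otransform m z h a xi - sin c * otransform m z h (a - pi / 2) xi.
Proof.
rewrite /otransform -!RintegralZl ?integrable_otransform// -RintegralB//; last 2 first.
- have := integrableZl measurableT (cos c) (integrable_otransform a xi).
  by apply: eq_integrable => // v _ /=; rewrite EFinM.
- have := integrableZl measurableT (sin c) (integrable_otransform (a - pi / 2) xi).
  by apply: eq_integrable => // v _ /=; rewrite EFinM.
apply: eq_Rintegral => x _; set A := phase (z x) xi.
have -> : A + (a + c) = A + a + c by ring.
have -> : A + (a - pi / 2) = A + a - pi / 2 by ring.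
rewrite cosBpihalf (cosD (A + a)); ring.
Qed.

(** The two transforms are the coordinates of a point of the plane, and the shift [b] rotates it. *)
Lemma otransform_shift_sq b xi :
  otransform m z h b xi ^+ 2 + otransform m z h (b - pi / 2) xi ^+ 2 =
  otransform m z h 0 xi ^+ 2 + otransform m z h (- (pi / 2)) xi ^+ 2.
Proof.
have E1 := otransformD 0 b xi; have E2 := otransformD (- (pi / 2)) b xi.
have E3 := otransformD 0 (- pi) xi.
have e1 : - (pi / 2) + b = b - pi / 2 by rewrite addrC.
have e2 : - (pi / 2) - pi / 2 = - pi :> R by field.
rewrite !add0r in E1 E3; rewrite e1 e2 in E2.
rewrite cosN sinN cospi sinpi in E3.
rewrite E1 E2 E3; transitivity ((cos b ^+ 2 + sin b ^+ 2) *
  (otransform m z h 0 xi ^+ 2 + otransform m z h (- (pi / 2)) xi ^+ 2)); first ring.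
by rewrite cos2Dsin2 mul1r.
Qed.

End otransform.

Section form_freq.
Context d1 (T1 : measurableType d1) (m1 : {sigma_finite_measure set T1 -> \bar R}).
Context d2 (T2 : measurableType d2) (m2 : {sigma_finite_measure set T2 -> \bar R}).
Variables (z1 : T1 -> Z) (z2 : T2 -> Z).
Hypothesis mz1 : measurable_fun setT z1.
Hypothesis mz2 : measurable_fun setT z2.
Variables (w : X -> R) (h1 : T1 -> R) (h2 : T2 -> R) (b : R).
Hypothesis wi : L.-integrable setT (EFin \o w).
Hypothesis hi1 : m1.-integrable setT (EFin \o h1).
Hypothesis hi2 : m2.-integrable setT (EFin \o h2).

(** The cosine of a difference splits into products and Fubini's theorem separates the arguments.
    This exhibits the form as a scalar product of two Fourier transforms weighted by [w]. *)
Lemma oform_freq : oform m1 m2 z1 z2 w b h1 h2 = \int[L]_xi (w xi *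
  (otransform m1 z1 h1 0 xi * otransform m2 z2 h2 b xi +
   otransform m1 z1 h1 (- (pi / 2)) xi * otransform m2 z2 h2 (b - pi / 2) xi)).
Proof.
pose f (q : (T1 * T2) * X) := h1 q.1.1 * h2 q.1.2 *
  (w q.2 * cos (phase (z1 q.1.1) q.2 - phase (z2 q.1.2) q.2 - b)).
have /integrableP[/measurable_EFinP mw _] := wi.
pose m12 : {sigma_finite_measure set (T1 * T2)%type -> \bar R} := prodm m1 m2.
have ti := integrable_tensor (m1 := m12) (integrable_tensor hi1 hi2) wi.
have /integrableP[/measurable_EFinP mt _] := ti.
have fi : (m12 \x L)%E.-integrable setT (EFin \o f).
  apply: le_integrable ti => //.
    apply/measurable_EFinP; rewrite /f; under eq_fun do rewrite mulrA.
    apply: measurable_funM => //.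
    apply: (measurableT_comp measurable_fun_cos); apply: measurable_funB => //.
    apply: measurable_funB; apply: measurable_phase_comp; try exact: measurable_snd.
      exact: (measurableT_comp mz1 (measurableT_comp measurable_fst measurable_fst)).
    exact: (measurableT_comp mz2 (measurableT_comp measurable_snd measurable_fst)).
  by move=> q _ /=; rewrite lee_fin /f mulrA normrM ler_piMr// cos_max.
have ci1 a xi := integrable_otransform mz1 hi1 a xi.
have ci2 a xi := integrable_otransform mz2 hi2 a xi.
transitivity (\int[m12]_p \int[L]_xi f (p, xi)).
  apply: eq_Rintegral => p _; rewrite /kern -RintegralZl//.
  apply: le_integrable wi => //.
    apply/measurable_EFinP; apply: measurable_funM => //.
    apply: (measurableT_comp measurable_fun_cos); apply: measurable_funB => //.
    by apply: measurable_funB; apply: measurable_phase_comp.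
  by move=> v _ /=; rewrite lee_fin normrM ler_piMr// cos_max.
rewrite Rintegral_swap//; apply: eq_Rintegral => xi _.
transitivity (\int[(m1 \x m2)%E]_p f (p, xi)); first by [].
rewrite -!Rintegral_tensor// -RintegralD//; last 2 first.
- exact: (integrable_tensor (ci1 _ _) (ci2 _ _)).
- exact: (integrable_tensor (ci1 _ _) (ci2 _ _)).
rewrite -RintegralZl//; last first.
  have := integrableD measurableT (integrable_tensor (ci1 0 xi) (ci2 b xi))
    (integrable_tensor (ci1 (- (pi / 2)) xi) (ci2 (b - pi / 2) xi)).
  by apply: eq_integrable.
apply: eq_Rintegral => p _; rewrite /f/=.
rewrite addr0 addrA !cosBpihalf.
have -> : phase (z1 p.1) xi - phase (z2 p.2) xi - b =
  phase (z1 p.1) xi - (phase (z2 p.2) xi + b) by ring.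
by rewrite cosB; ring.
Qed.

End form_freq.

Lemma discriminant_le (P Q S : R) : (forall l, 0 <= P + 2 * l * Q + l ^+ 2 * S) ->
  0 <= S -> Q ^+ 2 <= P * S.
Proof.
move=> h; rewrite le_eqVlt => /predU1P[S0|S0].
  have P0 : 0 <= P by have := h 0; rewrite mulr0 mul0r expr0n/= mul0r !addr0.
  have [->|Q0] := eqVneq Q 0; first by rewrite expr0n/= -S0 mulr0.
  (* With [S = 0] the polynomial is affine in [l] and takes the value [-1] here. *)
  have := h (- (P + 1) / (2 * Q)); rewrite -S0 mulr0 addr0.
  have -> : 2 * (- (P + 1) / (2 * Q)) * Q = - (P + 1) by field.
  by lra.
have := h (- Q / S).
have -> : P + 2 * (- Q / S) * Q + (- Q / S) ^+ 2 * S = (P * S - Q ^+ 2) / S.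
  by field; rewrite gt_eqF.
by rewrite pmulr_lge0 ?invr_gt0// subr_ge0.
Qed.

Section cauchy_schwarz.
Context d1 (T1 : measurableType d1) (m1 : {sigma_finite_measure set T1 -> \bar R}).
Context d2 (T2 : measurableType d2) (m2 : {sigma_finite_measure set T2 -> \bar R}).
Variables (z1 : T1 -> Z) (z2 : T2 -> Z).
Hypothesis mz1 : measurable_fun setT z1.
Hypothesis mz2 : measurable_fun setT z2.
Variables (w : X -> R) (h1 : T1 -> R) (h2 : T2 -> R) (b : R).
Hypothesis wi : L.-integrable setT (EFin \o w).
Hypothesis w0 : forall xi, 0 <= w xi.
Hypothesis hi1 : m1.-integrable setT (EFin \o h1).
Hypothesis hi2 : m2.-integrable setT (EFin \o h2).

Let integrable_wM (f g : X -> R) (Mf Mg : R) :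
  measurable_fun setT f -> measurable_fun setT g ->
  (forall xi, `|f xi| <= Mf) -> (forall xi, `|g xi| <= Mg) ->
  L.-integrable setT (EFin \o (fun xi => w xi * (f xi * g xi))).
Proof.
move=> mf mg fM gM; have /integrableP[/measurable_EFinP mw _] := wi.
apply: (@le_integrable_real _ _ _ _ _ _ (fun xi => (Mf * Mg) * `|w xi|)) => //.
- by apply: measurable_funM => //; exact: measurable_funM.
- by move=> xi _; rewrite normrM mulrC ler_wpM2r// normrM ler_pM.
- have := integrableZl measurableT (Mf * Mg) (integrable_norm wi).
  by apply: eq_integrable => // p _ /=; rewrite EFinM.
Qed.

Lemma oform_ge0 : 0 <= oform m1 m1 z1 z1 w 0 h1 h1.
Proof.
rewrite oform_freq//; apply: Rintegral_ge0 => xi _.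
by rewrite add0r mulr_ge0// addr_ge0// -expr2 sqr_ge0.
Qed.

(** In frequency the form is a scalar product with weight [w >= 0], and the squares for [h2] do not
    see the shift [b] (this is [csE]). The inequality is then the discriminant of a nonnegative
    quadratic polynomial. *)
Lemma oform_cauchy_schwarz : (oform m1 m2 z1 z2 w b h1 h2) ^+ 2 <=
  oform m1 m1 z1 z1 w 0 h1 h1 * oform m2 m2 z2 z2 w 0 h2 h2.
Proof.
rewrite (oform_freq mz1 mz2 b wi hi1 hi2) (oform_freq mz1 mz1 0 wi hi1 hi1).
rewrite (oform_freq mz2 mz2 0 wi hi2 hi2) add0r.
set C1 := otransform m1 z1 h1 0; set S1 := otransform m1 z1 h1 (- (pi / 2)).
set C2 := otransform m2 z2 h2 0; set S2 := otransform m2 z2 h2 (- (pi / 2)).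
set c := otransform m2 z2 h2 b; set s := otransform m2 z2 h2 (b - pi / 2).
have csE xi : c xi * c xi + s xi * s xi = C2 xi * C2 xi + S2 xi * S2 xi.
  by rewrite -!expr2; exact: otransform_shift_sq.
pose M1 := \int[m1]_x `|h1 x|; pose M2 := \int[m2]_x `|h2 x|.
have b1 a xi : `|otransform m1 z1 h1 a xi| <= M1 by exact: normr_otransform_le.
have b2 a xi : `|otransform m2 z2 h2 a xi| <= M2 by exact: normr_otransform_le.
have t1 a : measurable_fun setT (otransform m1 z1 h1 a) by exact: measurable_otransform.
have t2 a : measurable_fun setT (otransform m2 z2 h2 a) by exact: measurable_otransform.
have i11 a a' := integrable_wM (t1 a) (t1 a') (b1 a) (b1 a').
have i12 a a' := integrable_wM (t1 a) (t2 a') (b1 a) (b2 a').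
have i22 a a' := integrable_wM (t2 a) (t2 a') (b2 a) (b2 a').
have iD (f g : X -> R) : L.-integrable setT (EFin \o (fun xi => w xi * f xi)) ->
    L.-integrable setT (EFin \o (fun xi => w xi * g xi)) ->
    L.-integrable setT (EFin \o (fun xi => w xi * (f xi + g xi))).
  move=> fi gi; have := integrableD measurableT fi gi.
  by apply: eq_integrable => // xi _ /=; rewrite mulrDr EFinD.
have iZ (l : R) (f : X -> R) : L.-integrable setT (EFin \o (fun xi => w xi * f xi)) ->
    L.-integrable setT (EFin \o (fun xi => l * (w xi * f xi))).
  by move=> fi; have := integrableZl measurableT l fi; apply: eq_integrable.
rewrite [X in _ <= _ * X](_ : _ = \int[L]_xi (w xi * (c xi * c xi + s xi * s xi))); last first.
  by apply: eq_Rintegral => xi _; rewrite csE.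
apply: discriminant_le; last first.
  by apply: Rintegral_ge0 => xi _; rewrite mulr_ge0// addr_ge0// -expr2 sqr_ge0.
move=> l.
have iP := iD _ _ (i11 0 0) (i11 (- (pi / 2)) (- (pi / 2))).
have iQ := iD _ _ (i12 0 b) (i12 (- (pi / 2)) (b - pi / 2)).
have iS := iD _ _ (i22 b b) (i22 (b - pi / 2) (b - pi / 2)).
have iQ' := iZ (2 * l) _ iQ.
have iS' := iZ (l ^+ 2) _ iS.
have iPQ := integrableD measurableT iP iQ'.
rewrite -(RintegralZl (2 * l) measurableT iQ) -(RintegralZl (l ^+ 2) measurableT iS).
rewrite -(RintegralD measurableT iP iQ') -(RintegralD measurableT iPQ iS').
apply: Rintegral_ge0 => xi _.
rewrite (_ : _ + _ = w xi * ((C1 xi + l * c xi) ^+ 2 + (S1 xi + l * s xi) ^+ 2)).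
  by rewrite mulr_ge0// addr_ge0// sqr_ge0.
rewrite /C1 /S1 /c /s; ring.
Qed.

End cauchy_schwarz.

(** A product of intervals, because the one-dimensional oscillatory integral is bounded uniformly
    over all intervals; the later constants are therefore independent of [N]. *)
Definition box_weight (N : R) : X -> R := tensorRV (fun=> \1_(`[(- N), N]%classic)).

Lemma integrable_box_weight N : L.-integrable setT (EFin \o box_weight N).
Proof. by apply: integrable_tensorRV => i; exact: integrable_indic_itv. Qed.

Lemma box_weight_ge0 N xi : 0 <= box_weight N xi.
Proof. by apply: tensorRV_ge0. Qed.

(** Each dimension contributes the van der Corput bound [4 / sqrt |a|] for the time difference [a],
    doubled by the expansion of the cosine; hence [8 ^ n]. *)
Lemma kern_dispersive (N b : R) (z z' : Z) : 0 < N -> z.1 != z'.1 ->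
  `|kern (box_weight N) b z z'| <= 8 ^+ n * `|z.1 - z'.1| `^ (- (n%:R / 2)).
Proof.
move=> N0 zz; set a := z.1 - z'.1.
have a0 : a != 0 by rewrite subr_eq0.
rewrite /kern.
have -> : (fun xi => box_weight N xi * cos (phase z xi - phase z' xi - b)) =
    (fun xi => tensorRV (fun=> \1_(`[(- N), N]%classic)) xi *
       cos (a * dotrV xi xi + dotrV xi (z'.2 - z.2) + (- b))).
  apply/funext => xi; congr (_ * cos _).
  have -> : dotrV xi (z'.2 - z.2) = dotrV z'.2 xi - dotrV z.2 xi.
    by rewrite /dotrV -sumrB; apply: eq_bigr => i _; rewrite !mxE; ring.
  by rewrite /phase /a; ring.
have K0 : 0 <= 4 / Num.sqrt `|a| by rewrite divr_ge0// sqrtr_ge0.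
apply: (le_trans (Rintegral_tensorRV_cos _ _ _ K0 _)).
- exact: integrable_indic_itv.
- move=> b' c'; apply: le_trans (Rintegral_cos_quad b' c' (x := - N) (y := N) a0 _).
    rewrite le_eqVlt; apply/orP; left; apply/eqP; congr Num.norm.
    rewrite [RHS]Rintegral_mkcond; apply: eq_Rintegral => x _.
    by rewrite patchE indicE; case: ifPn; rewrite ?mul1r ?mul0r.
  by rewrite -subr_ge0 opprK addr_ge0// ltW.
rewrite mulrA -natrM exprMn ler_pM2l ?exprn_gt0//.
by rewrite powRN mulrC powRrM powR12_sqrt// powR_mulrn ?sqrtr_ge0// exprVn.
Qed.

Definition fejer_box (N : R) : X -> R := tensorRV (fun=> fejer_weight N).

Lemma box_weight_le_fejer N xi : 0 < N ->
  box_weight N xi <= 2 ^+ n * fejer_box (2 * N) xi.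
Proof.
move=> N0; rewrite /box_weight /fejer_box /tensorRV -[in X in 2 ^+ X](card_ord n).
rewrite -prodr_const -big_split/=; apply: ler_prod => i _.
rewrite indicE; case: (boolP (_ \in _)) => xN /=.
  rewrite ler01/=; have : `|xi ord0 i| <= N.
    by move: xN; rewrite inE/= in_itv/= ler_norml.
  move=> /(fejer_weight_half N0); lra.
by rewrite lexx mulr_ge0// fejer_weight_ge0.
Qed.

Section bessel.
Variables (g : X -> R) (t : R) (N : R).
Hypothesis N0 : 0 < N.
Hypothesis gi : L.-integrable setT (EFin \o g).
Let zt (x : X) : Z := (t, x).

Let mzt : measurable_fun setT zt.
Proof. exact: measurable_fun_pair. Qed.

Lemma kern_fejer (x y : X) : kern (fejer_box N) 0 (zt x) (zt y) =
  \prod_(i < n) fejer_kernel N (y ord0 i - x ord0 i).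
Proof.
transitivity (cos (0 : R) * \prod_(i < n) fejer_kernel N ((y - x) ord0 i)); last first.
  by rewrite cos0 mul1r; apply: eq_bigr => i _; rewrite !mxE.
rewrite -Rintegral_fejer_rV//; apply: eq_Rintegral => xi _; congr (_ * cos _).
have -> : dotrV xi (y - x) = dotrV y xi - dotrV x xi.
  by rewrite /dotrV -sumrB; apply: eq_bigr => i _; rewrite !mxE; ring.
by rewrite /phase/=; ring.
Qed.

Lemma integral_kern_fejer (x : X) :
  (\int[L]_y (kern (fejer_box N) 0 (zt y) (zt x))%:E <= ((10 * pi) ^+ n)%:E)%E.
Proof.
under eq_integral do rewrite kern_fejer.
rewrite (ge0_integral_tensorRV (w := fun i u => fejer_kernel N (x ord0 i - u))); last 2 first.
- by move=> i; exact: measurable_fejer_kernel.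
- by move=> i u; exact: fejer_kernel_ge0.
have -> : ((10 * pi) ^+ n)%:E = (\prod_(i < n) (10 * (pi : R))%:E)%E.
  by rewrite prodEFin prodr_const card_ord.
set A := (X in (X <= _)%E); set B := (X in (_ <= X)%E).
suff : (0 <= A)%E /\ (A <= B)%E by case.
apply: (big_ind2 (fun u v : \bar R => 0 <= u /\ u <= v)%E) => [|u v u' v' [u0 uv] [u0' uv']|i _].
- by rewrite lee01.
- by rewrite mule_ge0// lee_pmul.
- split; last exact: integral_fejer_kernel_le.
  by apply: integral_ge0 => u _; rewrite lee_fin fejer_kernel_ge0.
Qed.

End bessel.

(* Schur's test with the nonnegative Fejer kernel. *)
Lemma oform_fejer_le (g : X -> R) (t N : R) : 0 < N ->
  L.-integrable setT (EFin \o g) ->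
  ((oform L L (fun x => (t, x)) (fun x => (t, x)) (fejer_box N) 0 g g)%:E <=
   ((10 * pi) ^+ n)%:E * \int[L]_x (g x ^+ 2)%:E)%E.
Proof.
move=> N0 gi; have /integrableP[/measurable_EFinP mg _] := gi.
pose zt (x : X) : Z := (t, x).
have mzt : measurable_fun setT zt by exact: measurable_fun_pair.
have wi : L.-integrable setT (EFin \o fejer_box N).
  by apply: integrable_tensorRV => i; exact: integrable_fejer_weight.
pose k (p : X * X) := kern (fejer_box N) 0 (zt p.1) (zt p.2).
have mk : measurable_fun setT k by exact: (measurable_kern_comp mzt mzt 0 wi).
have k0 p : 0 <= k p.
  by rewrite /k kern_fejer//; apply: prodr_ge0 => i _; exact: fejer_kernel_ge0.
have ksym x y : k (x, y) = k (y, x).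
  rewrite /k !kern_fejer//; apply: eq_bigr => i _.
  rewrite -opprB; apply: eq_Rintegral => u _; rewrite mulNr cosN//.
apply: (@le_trans _ _ (\int[L]_x \int[L]_y (`|g x| * `|g y| * `|k (x, y)|)%:E)%E).
  apply: le_trans (normr_oform_le mzt mzt 0 wi gi gi).
  by rewrite lee_fin ler_norm.
(* The symmetric splitting [2 |g x| |g y| <= g x ^ 2 + g y ^ 2] under the kernel; the symmetry of
   [k] makes the two integrals equal. *)
pose f (p : X * X) : \bar R := (2^-1 * (g p.1 ^+ 2 * k p))%:E.
pose f' (p : X * X) : \bar R := (2^-1 * (g p.2 ^+ 2 * k p))%:E.
have mf : measurable_fun setT f.
  apply/measurable_EFinP; apply: measurable_funM => //; apply: measurable_funM => //.
  by apply: measurable_funX; exact: (measurableT_comp mg measurable_fst).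
have mf' : measurable_fun setT f'.
  apply/measurable_EFinP; apply: measurable_funM => //; apply: measurable_funM => //.
  by apply: measurable_funX; exact: (measurableT_comp mg measurable_snd).
have f0 p : (0 <= f p)%E by rewrite lee_fin mulr_ge0// mulr_ge0// sqr_ge0.
have f'0 p : (0 <= f' p)%E by rewrite lee_fin mulr_ge0// mulr_ge0// sqr_ge0.
have If : (\int[L \x L]_p f p <= (2^-1 * (10 * pi) ^+ n)%:E * \int[L]_x (g x ^+ 2)%:E)%E.
  rewrite fubini_tonelli1// /fubini_F.
  apply: (@le_trans _ _ (\int[L]_x ((2^-1 * (10 * pi) ^+ n)%:E * (g x ^+ 2)%:E))%E).
    apply: ge0_le_integral => //.
    - by move=> x _; apply: integral_ge0.
    - exact: measurable_fun_fubini_tonelli_F.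
    - by apply: measurable_funeM; apply/measurable_EFinP; exact: measurable_funX.
    - move=> x _; rewrite /f/=.
      under eq_integral do rewrite mulrA EFinM ksym.
      rewrite ge0_integralZl_EFin//; last 3 first.
      + by move=> y _; rewrite lee_fin.
      + by apply/measurable_EFinP; exact: (measurable_fun_slicer x mk).
      + by rewrite mulr_ge0// sqr_ge0.
      rewrite -EFinM [X in (_ <= X)%E](_ : _ =
        (2^-1 * g x ^+ 2)%:E * ((10 * pi) ^+ n)%:E)%E; last first.
        by rewrite -EFinM; congr EFin; ring.
      apply: lee_wpmul2l; first by rewrite lee_fin mulr_ge0// sqr_ge0.
      rewrite /k /zt/=; exact: (integral_kern_fejer t N0 x).
  rewrite ge0_integralZl_EFin//.
  - by move=> x _; rewrite lee_fin sqr_ge0.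
  - by apply/measurable_EFinP; exact: measurable_funX.
  - by rewrite mulr_ge0// exprn_ge0// mulr_ge0// pi_ge0.
have If' : (\int[L \x L]_p f' p = \int[L \x L]_p f p)%E.
  rewrite (fubini_tonelli1 f' mf' f'0) (fubini_tonelli2 f mf f0).
  by apply: eq_integral => x _; apply: eq_integral => y _; rewrite /f /f'/= ksym.
rewrite -[X in (X <= _)%E](_ : (\int[L \x L]_p (`|g p.1| * `|g p.2| * `|k p|)%:E = _)%E); last first.
  rewrite fubini_tonelli1//.
  apply/measurable_EFinP; apply: measurable_funM; last exact: measurableT_comp.
  by apply: measurable_funM; apply: measurableT_comp => //;
    [exact: (measurableT_comp mg measurable_fst)|exact: (measurableT_comp mg measurable_snd)].
apply: (@le_trans _ _ (\int[L \x L]_p (f p + f' p))%E).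
  apply: ge0_le_integral => //.
  - apply/measurable_EFinP; apply: measurable_funM; last exact: measurableT_comp.
    by apply: measurable_funM; apply: measurableT_comp => //;
      [exact: (measurableT_comp mg measurable_fst)|exact: (measurableT_comp mg measurable_snd)].
  - exact: emeasurable_funD.
  - move=> p _; rewrite /f /f' -EFinD lee_fin (ger0_norm (k0 p)).
    rewrite -mulrDr -mulrDl mulrA ler_wpM2r//.
    have := sqr_ge0 (`|g p.1| - `|g p.2|).
    rewrite sqrrB !real_normK ?num_real//.
    have -> : `|g p.1| * `|g p.2| *+ 2 = 2 * (`|g p.1| * `|g p.2|) by rewrite mulr_natl.
    lra.
rewrite ge0_integralD// If'.
apply: (le_trans (leeD If If)); rewrite -ge0_muleDl; last 2 first.
- by rewrite lee_fin mulr_ge0// exprn_ge0// mulr_ge0// pi_ge0.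
- by rewrite lee_fin mulr_ge0// exprn_ge0// mulr_ge0// pi_ge0.
rewrite -EFinD -mulrDl (_ : 2^-1 + 2^-1 = 1 :> R) ?mul1r//; lra.
Qed.

(** The kernel of the sharp cut-off is not absolutely integrable, so Schur's test does not apply to
    it. In frequency, however, the diagonal form integrates the weight against a sum of squares, so
    the weight may first be enlarged to a multiple of the Fejer weight. *)
Lemma oform_box_le (g : X -> R) (t N : R) : 0 < N ->
  L.-integrable setT (EFin \o g) ->
  ((oform L L (fun x => (t, x)) (fun x => (t, x)) (box_weight N) 0 g g)%:E <=
   ((20 * pi) ^+ n)%:E * \int[L]_x (g x ^+ 2)%:E)%E.
Proof.
move=> N0 gi; have N20 : 0 < 2 * N by rewrite mulr_gt0.
have mzt : measurable_fun setT (fun x : X => (t, x) : Z) by exact: measurable_fun_pair.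
have wi : L.-integrable setT (EFin \o fejer_box (2 * N)).
  by apply: integrable_tensorRV => i; exact: integrable_fejer_weight.
apply: (@le_trans _ _ ((2 ^+ n)%:E * (oform L L (fun x => (t, x)) (fun x => (t, x))
    (fejer_box (2 * N)) 0 g g)%:E)%E); last first.
  apply: (@le_trans _ _ ((2 ^+ n)%:E * (((10 * pi) ^+ n)%:E * \int[L]_x (g x ^+ 2)%:E))%E).
    by rewrite lee_wpmul2l ?lee_fin ?exprn_ge0// oform_fejer_le.
  by rewrite muleA -EFinM -exprMn mulrA -natrM.
rewrite -EFinM lee_fin !oform_freq//; last exact: integrable_box_weight.
have bi := integrable_box_weight N.
pose T a := otransform L (fun x => (t, x)) g a.
have mT a : measurable_fun setT (T a) by exact: measurable_otransform.
pose M := \int[L]_x `|g x|.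
have bT a xi : `|T a xi| <= M by exact: normr_otransform_le.
pose H xi := T 0 xi * T 0 xi + T (- (pi / 2)) xi * T (- (pi / 2)) xi.
have H0 xi : 0 <= H xi by rewrite addr_ge0// -expr2 sqr_ge0.
have mH : measurable_fun setT H by apply: measurable_funD; apply: measurable_funM.
have HM xi : `|H xi| <= 2 * M ^+ 2.
  rewrite (le_trans (ler_normD _ _))// !normrM.
  have -> : 2 * M ^+ 2 = M * M + M * M by ring.
  by apply: lerD; apply: ler_pM.
have wHi (w : X -> R) : L.-integrable setT (EFin \o w) ->
    L.-integrable setT (EFin \o (fun xi => w xi * H xi)).
  move=> wi'; have /integrableP[/measurable_EFinP mw _] := wi'.
  apply: (@le_integrable_real _ _ _ _ _ _ (fun xi => (2 * M ^+ 2) * `|w xi|)) => //.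
  - exact: measurable_funM.
  - by move=> xi _; rewrite normrM mulrC ler_wpM2r.
  - have := integrableZl measurableT (2 * M ^+ 2) (integrable_norm wi').
    by apply: eq_integrable => // p _ /=; rewrite EFinM.
rewrite add0r -RintegralZl//; last exact: wHi.
apply: le_Rintegral => //.
- exact: wHi.
- have := integrableZl measurableT (2 ^+ n) (wHi _ wi).
  by apply: eq_integrable => // p _ /=; rewrite EFinM.
- move=> xi _; rewrite [leRHS]mulrA; apply: ler_wpM2r; first exact: H0.
  exact: box_weight_le_fejer.
Qed.

End oscillatory_form.

(** * Functions bounded by a fixed decaying weight *)

Section dominated.
Context {R : realType} (n : nat).
Notation mu := (@lebesgue_measure R).
Notation X := 'rV[R]_n.
Notation L := (@lebesgue_rV R n).
Notation Z := (measurableTypeR R * X)%type.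
Definition spacetime : {sigma_finite_measure set Z -> \bar R} := prodm mu L.
Notation M := spacetime.

Definition decay (s : R) : R := (oneDsqr s)^-1.

Lemma decay_gt0 s : 0 < decay s.
Proof. by rewrite /decay invr_gt0 (lt_le_trans ltr01)// oneDsqr_ge1. Qed.

Lemma decay_le1 s : decay s <= 1.
Proof. exact: oneDsqrV_le1. Qed.

Lemma measurable_decay : measurable_fun setT decay.
Proof. by apply: continuous_measurable_fun; exact: continuous_oneDsqrV. Qed.

Lemma integrable_decay : mu.-integrable setT (EFin \o decay).
Proof.
apply: ge0_integrable => //; first exact: measurable_decay.
  by move=> x _; rewrite ltW// decay_gt0.
by rewrite integral_oneDsqrV ltry.
Qed.

Definition decayX : X -> R := tensorRV (fun=> decay).

Lemma decayX_gt0 x : 0 < decayX x.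
Proof. by apply: prodr_gt0 => i _; exact: decay_gt0. Qed.

Lemma decayX_le1 x : decayX x <= 1.
Proof.
suff : 0 <= decayX x <= 1 by case/andP.
rewrite /decayX /tensorRV; elim/big_ind : _ => [|u v /andP[u0 u1] /andP[v0 v1]|i _].
- by rewrite ler01 lexx.
- by rewrite mulr_ge0//= mulr_ile1.
- by rewrite decay_le1 ltW// decay_gt0.
Qed.

Lemma integrable_decayX : L.-integrable setT (EFin \o decayX).
Proof. by apply: integrable_tensorRV => i; exact: integrable_decay. Qed.

(* Unlike the Schwartz class, this class is stable under restriction to
   measurable sets. *)
Definition dominated (F : Z -> R) : Prop := measurable_fun setT F /\
  exists K, 0 <= K /\ forall s x, `|F (s, x)| <= K * (decay s * decayX x).

Definition dominatedX (g : X -> R) : Prop := measurable_fun setT g /\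
  exists K, 0 <= K /\ forall x, `|g x| <= K * decayX x.

Lemma dominated_integrable F : dominated F -> M.-integrable setT (EFin \o F).
Proof.
move=> [mF [K [K0 FK]]].
apply: (@le_integrable_real _ _ _ _ _ _ (fun z : Z => K * (decay z.1 * decayX z.2))) => //.
  by move=> [s x] _; exact: FK.
have := integrableZl measurableT K (integrable_tensor integrable_decay integrable_decayX).
by apply: eq_integrable => // z _ /=; rewrite EFinM.
Qed.

Lemma dominatedX_integrable g : dominatedX g -> L.-integrable setT (EFin \o g).
Proof.
move=> [mg [K [K0 gK]]].
apply: (@le_integrable_real _ _ _ _ _ _ (fun x => K * decayX x)) => //.
have := integrableZl measurableT K integrable_decayX.
by apply: eq_integrable => // z _ /=; rewrite EFinM.
Qed.

Lemma dominated_slice F s : dominated F -> dominatedX (fun x => F (s, x)).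
Proof.
move=> [mF [K [K0 FK]]]; split; first exact: measurable_fun_slice.
exists K; split => // x; apply: le_trans (FK s x) _; rewrite ler_wpM2l//.
by rewrite ler_piMl ?decay_le1// ltW// decayX_gt0.
Qed.

Lemma dominated_le (F G : Z -> R) : dominated F -> measurable_fun setT G ->
  (forall z : Z, `|G z| <= `|F z|) -> dominated G.
Proof.
move=> [mF [K [K0 FK]]] mG GF; split => //; exists K; split => // s x.
exact: le_trans (GF (s, x)) (FK s x).
Qed.

Lemma dominated_restrict F (E : set Z) : dominated F -> measurable E ->
  dominated (fun z => F z * \1_E z).
Proof.
move=> dF mE; apply: (dominated_le dF).
  by apply: measurable_funM; [case: dF|exact: measurable_indic].
by move=> z; rewrite normrM ler_piMr// indicE; case: (z \in E); rewrite ?normr1 ?normr0.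
Qed.

Lemma dominatedX_sqr_integrable g : dominatedX g ->
  L.-integrable setT (EFin \o (fun x => g x ^+ 2)).
Proof.
move=> dg; have gi := dominatedX_integrable dg; have [mg [K [K0 gK]]] := dg.
apply: (@le_integrable_real _ _ _ _ _ _ (fun x => K * `|g x|)) => //.
- exact: measurable_funX.
- move=> x _; rewrite normrX expr2 ler_wpM2r// (le_trans (gK x))//.
  by rewrite ler_piMr// decayX_le1.
- have := integrableZl measurableT K (integrable_norm gi).
  by apply: eq_integrable => // z _ /=; rewrite EFinM.
Qed.

Variable N : R.
Hypothesis N0 : 0 < N.
Notation w := (box_weight N).

Let wi : L.-integrable setT (EFin \o w).
Proof. exact: integrable_box_weight. Qed.

Definition at_time (t : R) (x : X) : Z := (t, x).

Lemma measurable_at_time t : measurable_fun setT (at_time t).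
Proof. exact: measurable_fun_pair. Qed.

Definition idZ (z : Z) : Z := z.

Lemma measurable_idZ : measurable_fun setT idZ.
Proof. exact: measurable_id. Qed.

(** Exchanging the arguments reverses the difference of phases, which the evenness of the cosine
    turns into the sign of [b]. *)
Lemma oformC d1 (T1 : measurableType d1) (m1 : {sigma_finite_measure set T1 -> \bar R})
    d2 (T2 : measurableType d2) (m2 : {sigma_finite_measure set T2 -> \bar R})
    (z1 : T1 -> Z) (z2 : T2 -> Z) b h1 h2 :
  measurable_fun setT z1 -> measurable_fun setT z2 ->
  m1.-integrable setT (EFin \o h1) -> m2.-integrable setT (EFin \o h2) ->
  oform m1 m2 z1 z2 w b h1 h2 = oform m2 m1 z2 z1 w (- b) h2 h1.
Proof.
move=> mz1 mz2 hi1 hi2; rewrite (oform_iter12 mz1 mz2 b wi hi1 hi2).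
rewrite (oform_iter21 mz2 mz1 (- b) wi hi2 hi1).
apply: eq_Rintegral => x _; apply: eq_Rintegral => y _.
rewrite (mulrC (h1 x)); congr *%R; apply: eq_Rintegral => xi _.
by rewrite -cosN; congr (_ * cos _); ring.
Qed.

Lemma oform_slice d1 (T1 : measurableType d1) (m1 : {sigma_finite_measure set T1 -> \bar R})
    (z1 : T1 -> Z) b h1 (G : Z -> R) :
  measurable_fun setT z1 -> m1.-integrable setT (EFin \o h1) -> dominated G ->
  oform m1 M z1 idZ w b h1 G =
  \int[mu]_t oform m1 L z1 (at_time t) w b h1 (fun y => G (t, y)).
Proof.
move=> mz1 hi1 dG; have Gi := dominated_integrable dG.
rewrite (oform_iter21 mz1 measurable_idZ b wi hi1 Gi).
pose f (z : Z) := \int[m1]_x (h1 x * G z * kern w b (z1 x) z).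
have oi := integrable_oform mz1 measurable_idZ b wi hi1 Gi.
have fi : (mu \x L)%E.-integrable setT (EFin \o f).
  pose g (q : Z * T1) := h1 q.2 * G q.1 * kern w b (z1 q.2) q.1.
  suff : (M \x m1)%E.-integrable setT (EFin \o g).
    by move=> /integrable_Rintegral_param.
  have /integrableP[mo foo] := oi; apply/integrable21ltyP => //=.
    have := measurableT_comp mo (measurable_fun_pair (@measurable_snd _ _ Z T1) (@measurable_fst _ _ Z T1)).
    by [].
  by have /integrable12ltyP := oi; apply.
transitivity (\int[(mu \x L)%E]_z f z); first by [].
rewrite -(Rintegral_prod12 fi); apply: eq_Rintegral => t _.
rewrite (oform_iter21 mz1 (measurable_at_time t) b wi hi1)//.
exact/dominatedX_integrable/dominated_slice.
Qed.

End dominated.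

(** * Young's inequality for kernels *)

Section powR_facts.
Context {R : realType}.

Lemma ln_eq (a b : R) : 0 < a -> 0 < b -> ln a = ln b -> a = b.
Proof. by move=> a0 b0 /ln_inj; apply; rewrite posrE. Qed.

(** The weights add up to one, so the mean is at most the maximum. *)
Lemma geomean3_le_add (x y z s : R) : 0 <= x -> 0 <= y -> 0 <= z -> 0 < s -> s <= 2^-1 ->
  x `^ (1 - 2 * s) * y `^ s * z `^ s <= x + y + z.
Proof.
move=> x0 y0 z0 s0 s1; pose m := Num.max x (Num.max y z).
have mx : x <= m by rewrite le_max lexx.
have my : y <= m by rewrite !le_max lexx !orbT.
have mz : z <= m by rewrite !le_max lexx !orbT.
have m0 : 0 <= m by exact: le_trans mx.
apply: (@le_trans _ _ m); last first.
  by rewrite /m !ge_max; apply/andP; split; [|apply/andP; split]; lra.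
have [M0|M0] := eqVneq m 0.
  have -> : y = 0 by apply/eqP; rewrite eq_le y0 andbT -M0.
  by rewrite powR0 ?gt_eqF// mulr0 mul0r.
apply: (@le_trans _ _ (m `^ (1 - 2 * s) * m `^ s * m `^ s)).
  apply: ler_pM; rewrite ?mulr_ge0 ?powR_ge0//; last by apply: ge0_ler_powR; rewrite ?nnegrE ?(ltW s0).
  apply: ler_pM; rewrite ?powR_ge0//; last by apply: ge0_ler_powR; rewrite ?nnegrE ?(ltW s0).
  by apply: ge0_ler_powR; rewrite ?nnegrE//; lra.
rewrite -!powRD ?M0 ?implybT// (_ : 1 - 2 * s + s + s = 1) ?powRr1//; lra.
Qed.

Lemma geomean2_le_add (x y s : R) : 0 <= x -> 0 <= y -> 0 <= s -> s <= 1 ->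
  x `^ (1 - s) * y `^ s <= x + y.
Proof.
move=> x0 y0 s0 s1; pose m := Num.max x y.
have mx : x <= m by rewrite le_max lexx.
have my : y <= m by rewrite le_max lexx orbT.
have m0 : 0 <= m by exact: le_trans mx.
apply: (@le_trans _ _ m); last first.
  by rewrite /m ge_max; apply/andP; split; lra.
apply: (@le_trans _ _ (m `^ (1 - s) * m `^ s)).
  apply: ler_pM; rewrite ?powR_ge0//; last by apply: ge0_ler_powR; rewrite ?nnegrE.
  by apply: ge0_ler_powR; rewrite ?nnegrE ?subr_ge0.
have [M0|M0] := eqVneq m 0.
  rewrite M0; have [->|s0'] := eqVneq s 0; first by rewrite subr0 powRr1// mul0r.
  by rewrite (powR0 s0') mulr0.
by rewrite -powRD ?M0 ?implybT// subrK powRr1.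
Qed.

(** Takes the place of an interpolation of operators: a number below two bounds is below each of
    their geometric means. *)
Lemma le_powR_mean (b x y th : R) : 0 <= b -> b <= x -> b <= y -> 0 <= th -> th <= 1 ->
  b <= x `^ th * y `^ (1 - th).
Proof.
move=> b0 bx by_ t0 t1.
have [->|B0] := eqVneq b 0; first by rewrite mulr_ge0 ?powR_ge0.
rewrite -[leLHS]powRr1// -[X in _ `^ X](subrKC th) powRD ?B0 ?implybT//.
apply: ler_pM; rewrite ?powR_ge0//; apply: ge0_ler_powR; rewrite ?nnegrE ?subr_ge0//;
  exact: le_trans b0 _.
Qed.

(** The mean of [x y], [x z] and [y z] with weights [1 - 2 s], [s] and [s] is
    [x ^ (1 - s) y ^ (1 - s) z ^ (2 s)], which is [a b c] up to the power of [B]. *)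
Lemma young_pointwise (a b c B s : R) : 0 < s -> s <= 2^-1 -> 0 < B ->
  0 <= a -> 0 <= b -> 0 <= c ->
  c * (a * b) <= B `^ (2 * s) * (a `^ (1 - s)^-1 * b `^ (1 - s)^-1 +
    a `^ (1 - s)^-1 * (c `^ (2 * s)^-1 / B) + b `^ (1 - s)^-1 * (c `^ (2 * s)^-1 / B)).
Proof.
move=> s0 s1 B0 a0 b0 c0.
have s10 : 1 - s != 0 by rewrite gt_eqF//; lra.
set x := a `^ _; set y := b `^ _; set z := _ / B.
have x0 : 0 <= x by exact: powR_ge0.
have y0 : 0 <= y by exact: powR_ge0.
have z0 : 0 <= z by rewrite divr_ge0 ?powR_ge0// ltW.
have rhs0 : 0 <= B `^ (2 * s) * (x * y + x * z + y * z).
  by rewrite mulr_ge0 ?powR_ge0// !addr_ge0// mulr_ge0.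
have [aE|a1] := eqVneq a 0; first by rewrite aE mul0r mulr0.
have [bE|b1] := eqVneq b 0; first by rewrite bE !mulr0.
have [cE|c1] := eqVneq c 0; first by rewrite cE mul0r.
have pa : 0 < a by rewrite lt_def a1.
have pb : 0 < b by rewrite lt_def b1.
have pc : 0 < c by rewrite lt_def c1.
have px : 0 < x by exact: powR_gt0.
have py : 0 < y by exact: powR_gt0.
have pz : 0 < z by rewrite divr_gt0// powR_gt0.
have lx : ln x = (1 - s)^-1 * ln a by rewrite ln_powR.
have ly : ln y = (1 - s)^-1 * ln b by rewrite ln_powR.
have lz : ln z = (2 * s)^-1 * ln c - ln B.
  by rewrite ln_div ?posrE ?powR_gt0// ln_powR.
clearbody x y z; have := geomean3_le_add (mulr_ge0 x0 y0) (mulr_ge0 x0 z0) (mulr_ge0 y0 z0) s0 s1.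
move=> /(ler_wpM2l (powR_ge0 B (2 * s))); apply: le_trans.
rewrite le_eqVlt; apply/orP; left; apply/eqP.
have pxy : 0 < (x * y) `^ (1 - 2 * s) by rewrite powR_gt0// mulr_gt0.
have pxz : 0 < (x * z) `^ s by rewrite powR_gt0// mulr_gt0.
have pyz : 0 < (y * z) `^ s by rewrite powR_gt0// mulr_gt0.
apply: ln_eq.
- by rewrite mulr_gt0// mulr_gt0.
- by apply: mulr_gt0; [exact: powR_gt0|apply: mulr_gt0 => //; exact: mulr_gt0].
have -> : ln (c * (a * b)) = ln c + (ln a + ln b).
  by rewrite !lnM ?posrE// mulr_gt0.
have pB : 0 < B `^ (2 * s) by exact: powR_gt0.
have p1 := mulr_gt0 pxy pxz; have p2 := mulr_gt0 p1 pyz.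
rewrite (lnM _ p2) ?posrE// (lnM _ pyz) ?posrE// (lnM _ pxz) ?posrE//.
rewrite !ln_powR (lnM px py) (lnM px pz) (lnM py pz) lx ly lz; field.
by rewrite s10 gt_eqF.
Qed.

End powR_facts.

Section young.
Context {R : realType}.
Notation mu := (@lebesgue_measure R).

(** Young's inequality with exponents [1 / (2 s)] for the kernel and [1 / (1 - s)] for both
    functions. By the normalisations each of the three terms of the pointwise bound has integral at
    most one, whence the factor 3. *)
Lemma young_kernel (k : R * R -> R) (h g : R -> R) (s A B : R) :
  0 < s -> s <= 2^-1 -> A = (1 - s)^-1 -> 0 < B ->
  measurable_fun setT k -> measurable_fun setT h -> measurable_fun setT g ->
  (forall p, 0 <= k p) -> (forall x, 0 <= h x) -> (forall x, 0 <= g x) ->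
  (forall t, \int[mu]_x (k (x, t) `^ (2 * s)^-1)%:E <= B%:E)%E ->
  (forall x, \int[mu]_t (k (x, t) `^ (2 * s)^-1)%:E <= B%:E)%E ->
  (\int[mu]_x (h x `^ A)%:E <= 1)%E -> (\int[mu]_x (g x `^ A)%:E <= 1)%E ->
  (\int[mu]_t \int[mu]_x (k (x, t) * (h x * g t))%:E <= (3 * B `^ (2 * s))%:E)%E.
Proof.
move=> s0 s1 AE B0 mk mh mg k0 h0 g0 kB kB' hA gA.
have s10 : 0 < 1 - s by lra.
have ss0 : 0 < 2 * s by lra.
have A0 : 0 < A by rewrite AE invr_gt0.
pose k' p := k p `^ (2 * s)^-1 / B.
have k'0 p : 0 <= k' p by rewrite divr_ge0 ?powR_ge0// ltW.
have pw (x t : R) : k (x, t) * (h x * g t) <= B `^ (2 * s) *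
    (h x `^ A * g t `^ A + h x `^ A * k' (x, t) + g t `^ A * k' (x, t)).
  by rewrite AE; exact: young_pointwise.
have mk' : measurable_fun setT k'.
  apply: measurable_funM => //.
  exact: (measurableT_comp (measurable_powR _) mk).
have mhA : measurable_fun setT (fun x => h x `^ A).
  exact: (measurableT_comp (measurable_powR _) mh).
have mgA : measurable_fun setT (fun x => g x `^ A).
  exact: (measurableT_comp (measurable_powR _) mg).
have mhp : measurable_fun setT (fun p : R * R => h p.1 `^ A).
  exact: (measurableT_comp mhA measurable_fst).
have mgp : measurable_fun setT (fun p : R * R => g p.2 `^ A).
  exact: (measurableT_comp mgA measurable_snd).
pose f1 (p : R * R) := (h p.1 `^ A * g p.2 `^ A)%:E.
pose f2 (p : R * R) := (h p.1 `^ A * k' p)%:E.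
pose f3 (p : R * R) := (g p.2 `^ A * k' p)%:E.
have mf1 : measurable_fun setT f1 by apply/measurable_EFinP; exact: measurable_funM.
have mf2 : measurable_fun setT f2 by apply/measurable_EFinP; exact: measurable_funM.
have mf3 : measurable_fun setT f3 by apply/measurable_EFinP; exact: measurable_funM.
have f10 p : (0 <= f1 p)%E by rewrite lee_fin mulr_ge0 ?powR_ge0.
have f20 p : (0 <= f2 p)%E by rewrite lee_fin mulr_ge0 ?powR_ge0.
have f30 p : (0 <= f3 p)%E by rewrite lee_fin mulr_ge0 ?powR_ge0.
have k'B1 (x : R) : (\int[mu]_t (k' (x, t))%:E <= 1)%E.
  rewrite /k'; under eq_integral do rewrite mulrC EFinM.
  rewrite ge0_integralZl_EFin//; last 3 first.
  - by move=> t _; rewrite lee_fin powR_ge0.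
  - apply/measurable_EFinP; apply: (measurableT_comp (measurable_powR _)).
    exact: measurable_fun_slice.
  - by rewrite invr_ge0 ltW.
  apply: (@le_trans _ _ ((B^-1)%:E * B%:E)%E).
    by rewrite lee_wpmul2l// lee_fin invr_ge0 ltW.
  by rewrite -EFinM mulVf// gt_eqF.
have k'B2 (t : R) : (\int[mu]_x (k' (x, t))%:E <= 1)%E.
  rewrite /k'; under eq_integral do rewrite mulrC EFinM.
  rewrite ge0_integralZl_EFin//; last 3 first.
  - by move=> x _; rewrite lee_fin powR_ge0.
  - apply/measurable_EFinP; apply: (measurableT_comp (measurable_powR _)).
    exact: measurable_fun_slicer.
  - by rewrite invr_ge0 ltW.
  apply: (@le_trans _ _ ((B^-1)%:E * B%:E)%E).
    by rewrite lee_wpmul2l// lee_fin invr_ge0 ltW.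
  by rewrite -EFinM mulVf// gt_eqF.
have I1 : (\int[mu \x mu]_p f1 p <= 1)%E.
  rewrite (@ge0_integral_tensor _ _ _ _ R mu mu (fun x => h x `^ A) (fun x => g x `^ A))//; last 2 first.
  - by move=> x; rewrite powR_ge0.
  - by move=> x; rewrite powR_ge0.
  apply: (@le_trans _ _ (1 * 1)%E); last by rewrite mul1e.
  by apply: lee_pmul; rewrite ?hA ?gA//; apply: integral_ge0 => x _; rewrite lee_fin; exact: powR_ge0.
have I2 : (\int[mu \x mu]_p f2 p <= 1)%E.
  have -> : (\int[mu \x mu]_p f2 p = \int[mu]_x \int[mu]_y f2 (x, y))%E.
    exact: (@fubini_tonelli1 _ _ _ _ R mu mu f2 mf2 f20).
  apply: le_trans hA.
  apply: ge0_le_integral => //.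
  - by move=> x _; apply: integral_ge0.
  - exact: (@measurable_fun_fubini_tonelli_F _ _ _ _ R mu f2 mf2).
  - exact/measurable_EFinP.
  - move=> x _; rewrite /fubini_F /f2/=.
    under eq_integral do rewrite EFinM.
    rewrite ge0_integralZl_EFin//; last 3 first.
    + by move=> y _; rewrite lee_fin.
    + by apply/measurable_EFinP; exact: (measurable_fun_slice x mk').
    + by rewrite powR_ge0.
    by rewrite -[leRHS]mule1 lee_wpmul2l// lee_fin powR_ge0.
have I3 : (\int[mu \x mu]_p f3 p <= 1)%E.
  have -> : (\int[mu \x mu]_p f3 p = \int[mu]_y \int[mu]_x f3 (x, y))%E.
    exact: (@fubini_tonelli2 _ _ _ _ R mu mu f3 mf3 f30).
  apply: le_trans gA.
  apply: ge0_le_integral => //.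
  - by move=> y _; apply: integral_ge0.
  - exact: (@measurable_fun_fubini_tonelli_G _ _ _ _ R mu f3 mf3).
  - exact/measurable_EFinP.
  - move=> t _; rewrite /fubini_G /f3/=.
    under eq_integral do rewrite EFinM.
    rewrite ge0_integralZl_EFin//; last 3 first.
    + by move=> y _; rewrite lee_fin.
    + by apply/measurable_EFinP; exact: (measurable_fun_slicer t mk').
    + by rewrite powR_ge0.
    by rewrite -[leRHS]mule1 lee_wpmul2l// lee_fin powR_ge0.
have mkhg : measurable_fun setT (fun p : R * R => k p * (h p.1 * g p.2)).
  apply: measurable_funM => //; apply: measurable_funM.
    exact: (measurableT_comp mh measurable_fst).
  exact: (measurableT_comp mg measurable_snd).
pose f p : \bar R := (k p * (h p.1 * g p.2))%:E.
have mf : measurable_fun setT f by exact/measurable_EFinP.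
have f0 p : (0 <= f p)%E by rewrite lee_fin !mulr_ge0.
have <- : (\int[mu \x mu]_p f p = \int[mu]_t \int[mu]_x f (x, t))%E.
  exact: (@fubini_tonelli2 _ _ _ _ R mu mu f mf f0).
apply: (@le_trans _ _ (\int[mu \x mu]_p ((B `^ (2 * s))%:E * (f1 p + f2 p + f3 p)))%E).
  apply: ge0_le_integral => //.
  - apply: measurable_funeM; apply: emeasurable_funD => //.
    exact: emeasurable_funD.
  - by move=> [x t] _; rewrite /f /f1 /f2 /f3/= -!EFinD -EFinM lee_fin pw.
rewrite ge0_integralZl_EFin ?powR_ge0//; last 2 first.
- by move=> p _; rewrite !adde_ge0.
- by apply: emeasurable_funD => //; exact: emeasurable_funD.
rewrite ge0_integralD//; last 2 first.
- by move=> p _; rewrite adde_ge0.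
- exact: emeasurable_funD.
rewrite ge0_integralD// (mulrC 3) EFinM; apply: lee_wpmul2l; first by rewrite lee_fin powR_ge0.
apply: (@le_trans _ _ (1 + 1 + 1)%E); last by rewrite -!EFinD lee_fin; lra.
exact: (leeD (leeD I1 I2) I3).
Qed.

End young.

Arguments idZ {R n} z.
Arguments measurable_idZ {R n}.

(** * Forms on time slices *)

Section slices.
Context {R : realType} (n : nat).
Notation mu := (@lebesgue_measure R).
Notation X := 'rV[R]_n.
Notation L := (@lebesgue_rV R n).
Notation Z := (measurableTypeR R * X)%type.
Notation M := (@spacetime R n).

(** The dispersive bound is silent at coinciding times, which form a null set. *)
Lemma ge0_le_integral_except (t : R) (f1 f2 : R -> \bar R) :
  (forall s, 0 <= f1 s)%E -> (forall s, 0 <= f2 s)%E ->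
  measurable_fun setT f1 -> measurable_fun setT f2 ->
  (forall s, s != t -> f1 s <= f2 s)%E ->
  (\int[mu]_s f1 s <= \int[mu]_s f2 s)%E.
Proof.
move=> f10 f20 mf1 mf2 f12; apply: ae_ge0_le_integral => //.
exists [set t]; split => //; first exact: lebesgue_measure_set1.
move=> s /=; apply: contra_notP => /eqP st _; exact: f12.
Qed.

Variable N : R.
Hypothesis N0 : 0 < N.
Notation w := (@box_weight R n N).

Let wi : L.-integrable setT (EFin \o w).
Proof. exact: integrable_box_weight. Qed.

Let mw : measurable_fun setT w.
Proof. by case/integrableP : wi => /measurable_EFinP. Qed.

Section general.
Context d1 (T1 : measurableType d1) (m1 : {sigma_finite_measure set T1 -> \bar R}).
Variables (z1 : T1 -> Z) (h1 : T1 -> R) (b : R).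
Hypothesis mz1 : measurable_fun setT z1.
Hypothesis hi1 : m1.-integrable setT (EFin \o h1).

Lemma measurable_oform_slice (G : Z -> R) : measurable_fun setT G ->
  measurable_fun setT (fun t : R => oform m1 L z1 (at_time t) w b h1 (fun y => G (t, y))).
Proof.
move=> mG; have /integrableP[/measurable_EFinP mh _] := hi1.
apply: (@measurable_Rintegral_param _ _ _ _ R (prodm m1 L)
  (fun q : R * (T1 * X) => h1 q.2.1 * G (q.1, q.2.2) * kern w b (z1 q.2.1) (q.1, q.2.2))).
have m2 : measurable_fun setT (fun q : R * (T1 * X) => (q.1, q.2.2) : Z).
  apply: measurable_fun_pair; first exact: measurable_fst.
  exact: (measurableT_comp measurable_snd measurable_snd).
have m1' : measurable_fun setT (fun q : R * (T1 * X) => q.2.1).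
  exact: (measurableT_comp measurable_fst measurable_snd).
apply: measurable_funM.
  apply: measurable_funM; first exact: (measurableT_comp mh m1').
  exact: (measurableT_comp mG m2).
apply: (measurableT_comp (measurable_kern b mw)
  (g := fun q : R * (T1 * X) => (z1 q.2.1, (q.1, q.2.2) : Z))).
apply: measurable_fun_pair => //.
exact: (measurableT_comp mz1 m1').
Qed.

Lemma normr_oform_slice_le (G : Z -> R) : dominated G ->
  (`|oform m1 M z1 idZ w b h1 G|%:E <=
   \int[mu]_t `|oform m1 L z1 (at_time t) w b h1 (fun y => G (t, y))|%:E)%E.
Proof.
move=> dG; rewrite oform_slice//; apply: normr_Rintegral_le => //.
by apply: measurable_oform_slice; case: dG.
Qed.

End general.

Lemma normr_oform_slicel_le d2 (T2 : measurableType d2)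
    (m2 : {sigma_finite_measure set T2 -> \bar R}) (z2 : T2 -> Z) (h2 : T2 -> R) b (F : Z -> R) :
  measurable_fun setT z2 -> m2.-integrable setT (EFin \o h2) -> dominated F ->
  (`|oform M m2 idZ z2 w b F h2|%:E <=
   \int[mu]_s `|oform L m2 (at_time s) z2 w b (fun y => F (s, y)) h2|%:E)%E.
Proof.
move=> mz2 hi2 dF; rewrite (oformC N b measurable_idZ mz2)//; last exact: dominated_integrable.
apply: (le_trans (normr_oform_slice_le (- b) mz2 hi2 dF)).
rewrite le_eqVlt; apply/orP; left; apply/eqP; apply: eq_integral => s _.
rewrite (oformC N (- b) mz2 (measurable_at_time s)) ?opprK//.
exact/dominatedX_integrable/dominated_slice.
Qed.

Lemma measurable_oform_slicel d2 (T2 : measurableType d2)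
    (m2 : {sigma_finite_measure set T2 -> \bar R}) (z2 : T2 -> Z) (h2 : T2 -> R) b (F : Z -> R) :
  measurable_fun setT z2 -> m2.-integrable setT (EFin \o h2) -> dominated F ->
  measurable_fun setT (fun s : R => oform L m2 (at_time s) z2 w b (fun y => F (s, y)) h2).
Proof.
move=> mz2 hi2 dF; have [mF _] := dF.
apply: (eq_measurable_fun _ _ (measurable_oform_slice (- b) mz2 hi2 mF)) => s _.
rewrite (oformC N (- b) mz2 (measurable_at_time s)) ?opprK//.
exact/dominatedX_integrable/dominated_slice.
Qed.

Lemma oform_dispersive (s t b : R) (f g : X -> R) : s != t ->
  dominatedX f -> dominatedX g ->
  `|oform L L (at_time s) (at_time t) w b f g| <=
  8 ^+ n * `|s - t| `^ (- (n%:R / 2)) * ((\int[L]_x `|f x|) * \int[L]_x `|g x|).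
Proof.
move=> st df dg; have fi := dominatedX_integrable df; have gi := dominatedX_integrable dg.
have [mf _] := df; have [mg _] := dg.
set c := 8 ^+ n * _; have c0 : 0 <= c by rewrite mulr_ge0 ?powR_ge0// exprn_ge0.
have kc x y : `|kern w b (at_time s x) (at_time t y)| <= c by exact: kern_dispersive.
clearbody c; rewrite -lee_fin.
apply: le_trans (normr_oform_le (measurable_at_time _) (measurable_at_time _) b wi fi gi) _.
have fi' := integrable_norm fi; have gi' := integrable_norm gi.
rewrite EFinM EFinM !Rintegral_EFin//.
have -> : ((\int[L]_x `|f x|%:E) * \int[L]_x `|g x|%:E =
    \int[(L \x L)%E]_z (`|f z.1| * `|g z.2|)%:E)%E.
  by rewrite (@ge0_integral_tensor _ _ _ _ R L L (fun x => `|f x|) (fun x => `|g x|))//;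
    exact: measurableT_comp.
have mfg : measurable_fun setT (fun z : X * X => (`|f z.1| * `|g z.2|)%:E).
  by apply/measurable_EFinP; apply: (measurable_tensor (f := fun x => `|f x|) (g := fun x => `|g x|));
    exact: measurableT_comp.
rewrite -ge0_integralZl_EFin//.
have mcfg := measurable_funeM c%:E mfg.
rewrite (@fubini_tonelli1 _ _ _ _ R L L _ mcfg)/fubini_F; last first.
  by move=> z; rewrite mule_ge0// lee_fin mulr_ge0.
apply: ge0_le_integral => //.
- by move=> x _; apply: integral_ge0 => y _; rewrite lee_fin !mulr_ge0.
- have := @measurable_fun_fubini_tonelli_F _ _ _ _ R L (fun z : X * X =>
    (`|f z.1| * `|g z.2| * `|kern w b (at_time s z.1) (at_time t z.2)|)%:E).
  apply => [|z]; last by rewrite lee_fin !mulr_ge0.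
  apply/measurable_EFinP; apply: measurable_funM; first exact/measurable_EFinP.
  apply: measurableT_comp => //.
  exact: (measurable_kern_comp (measurable_at_time _) (measurable_at_time _) b wi).
- apply: (@measurable_fun_fubini_tonelli_F _ _ _ _ R L _ mcfg) => z.
  by rewrite mule_ge0// lee_fin mulr_ge0.
- move=> x _; apply: ge0_le_integral => //.
  + apply/measurable_EFinP; apply: measurable_funM.
      by apply: measurable_funM => //; exact: measurableT_comp.
    apply: measurableT_comp => //.
    exact: (measurable_fun_slice x (measurable_kern_comp (measurable_at_time s) (measurable_at_time t) b wi)).
  + apply: measurable_funeM; apply/measurable_EFinP.
    have mgn : measurable_fun setT (fun y => `|g y|) by exact: measurableT_comp.
    exact: (measurable_funM (measurable_cst `|f x|) mgn).
  + by move=> y _; rewrite -EFinM lee_fin mulrC; apply: ler_wpM2r; rewrite ?mulr_ge0.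
Qed.

Lemma oform_slice_sqr_le (t : R) (f : X -> R) (u : R) : dominatedX f ->
  (\int[L]_x (f x ^+ 2)%:E <= (u ^+ 2)%:E)%E ->
  oform L L (at_time t) (at_time t) w 0 f f <= (20 * pi) ^+ n * u ^+ 2.
Proof.
move=> df fu; rewrite -lee_fin; apply: (le_trans (oform_box_le t N0 (dominatedX_integrable df))).
by rewrite EFinM; apply: lee_wpmul2l => //; rewrite lee_fin exprn_ge0// mulr_ge0// pi_ge0.
Qed.

(** Against a single time slice the energy bound takes care of [g], so only the diagonal form of [h]
    is left to estimate. The energy constant would enter as a square root; it is at least one and is
    rounded up. *)
Lemma oform_slice_cs d1 (T1 : measurableType d1) (m1 : {sigma_finite_measure set T1 -> \bar R})
    (z1 : T1 -> Z) (h : T1 -> R) (t b : R) (g : X -> R) (P v : R) :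
  measurable_fun setT z1 -> m1.-integrable setT (EFin \o h) -> dominatedX g ->
  0 <= v -> 0 <= P -> (\int[L]_x (g x ^+ 2)%:E <= (v ^+ 2)%:E)%E ->
  oform m1 m1 z1 z1 w 0 h h <= P ^+ 2 ->
  `|oform m1 L z1 (at_time t) w b h g| <= (20 * pi) ^+ n * (P * v).
Proof.
move=> mz1 hi dg v0 P0 gv QP; have gi := dominatedX_integrable dg.
have c1 : 1 <= (20 * pi) ^+ n :> R by rewrite exprn_ege1//; have := @pi_ge2 R; lra.
have c0 := le_trans ler01 c1.
rewrite -(@ler_pXn2r _ 2)// ?nnegrE ?mulr_ge0//.
rewrite real_normK ?num_real//.
have := oform_cauchy_schwarz mz1 (measurable_at_time t) b wi (@box_weight_ge0 R n N) hi gi.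
move=> /le_trans; apply.
apply: le_trans (_ : P ^+ 2 * ((20 * pi) ^+ n * v ^+ 2) <= _).
  apply: ler_pM => //.
  - exact: (oform_ge0 mz1 wi (@box_weight_ge0 R n N) hi).
  - exact: (oform_ge0 (measurable_at_time t) wi (@box_weight_ge0 R n N) gi).
  - exact: oform_slice_sqr_le.
move: c1 c0; set c := (20 * pi) ^+ n => c1 c0; clearbody c.
rewrite (_ : P ^+ 2 * (c * v ^+ 2) = c * (P * v) ^+ 2); last by ring.
rewrite [X in _ <= X]exprMn; apply: ler_wpM2r; first exact: sqr_ge0.
by rewrite expr2 ler_peMl.
Qed.

Lemma oform_split d2 (T2 : measurableType d2)
    (m2 : {sigma_finite_measure set T2 -> \bar R}) (z2 : T2 -> Z) (h2 : T2 -> R) b (F : Z -> R) E :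
  measurable_fun setT z2 -> m2.-integrable setT (EFin \o h2) -> dominated F -> measurable E ->
  oform M m2 idZ z2 w b F h2 = oform M m2 idZ z2 w b (fun z => F z * \1_E z) h2 +
    oform M m2 idZ z2 w b (fun z => F z * \1_(~` E) z) h2.
Proof.
move=> mz2 hi2 dF mE; have mEc := measurableC mE.
have dE := dominated_restrict dF mE; have dEc := dominated_restrict dF mEc.
have := integrable_oform measurable_idZ mz2 b wi (dominated_integrable dE) hi2.
have := integrable_oform measurable_idZ mz2 b wi (dominated_integrable dEc) hi2.
move=> i2 i1; rewrite /oform -RintegralD//; apply: eq_Rintegral => p _.
have -> : F p.1 = F p.1 * \1_E p.1 + F p.1 * \1_(~` E) p.1.
  by rewrite -mulrDr !indicE in_setC; case: (p.1 \in E); rewrite /= ?addr0 ?add0r mulr1.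
rewrite -[in RHS](_ : F p.1 = F p.1 * \1_E p.1 + F p.1 * \1_(~` E) p.1).
  by ring.
by rewrite -mulrDr !indicE in_setC; case: (p.1 \in E); rewrite /= ?addr0 ?add0r mulr1.
Qed.

End slices.

Lemma indic_eq (R : realType) T T' (E : set T) (E' : set T') x y :
  (E x <-> E' y) -> \1_E x = \1_E' y :> R.
Proof.
move=> [h1 h2]; rewrite !indicE; congr (nat_of_bool _)%:R.
by apply/idP/idP; rewrite !inE.
Qed.

Section young_scaled.
Context {R : realType}.
Notation mu := (@lebesgue_measure R).

Lemma young_kernel_scaled (k : R * R -> R) (h g : R -> R) (s A B a a' : R) :
  0 < s -> s <= 2^-1 -> A = (1 - s)^-1 -> 0 < B -> 0 < a -> 0 < a' ->
  measurable_fun setT k -> measurable_fun setT h -> measurable_fun setT g ->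
  (forall p, 0 <= k p) -> (forall x, 0 <= h x) -> (forall x, 0 <= g x) ->
  (forall t, \int[mu]_x (k (x, t) `^ (2 * s)^-1)%:E <= B%:E)%E ->
  (forall x, \int[mu]_t (k (x, t) `^ (2 * s)^-1)%:E <= B%:E)%E ->
  (\int[mu]_x (h x `^ A)%:E <= a%:E)%E -> (\int[mu]_x (g x `^ A)%:E <= a'%:E)%E ->
  (\int[mu]_t \int[mu]_x (k (x, t) * (h x * g t))%:E <=
   (3 * B `^ (2 * s) * (a `^ (1 - s) * a' `^ (1 - s)))%:E)%E.
Proof.
move=> s0 s1 AE B0 a0 a'0 mk mh mg k0 h0 g0 kB kB' ha ga.
have s10 : 0 < 1 - s by lra.
have norm1 (f : R -> R) c : 0 < c -> measurable_fun setT f -> (forall x, 0 <= f x) ->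
    (\int[mu]_x (f x `^ A)%:E <= c%:E)%E ->
    (\int[mu]_x ((f x / c `^ (1 - s)) `^ A)%:E <= 1)%E.
  move=> c0 mf f0 fc.
  have -> : (\int[mu]_x ((f x / c `^ (1 - s)) `^ A)%:E =
      \int[mu]_x ((c^-1)%:E * (f x `^ A)%:E))%E.
    apply: eq_integral => x _; rewrite -EFinM; congr EFin.
    rewrite powRM// ?invr_ge0 ?powR_ge0// mulrC -powR_inv1 ?powR_ge0// -!powRrM.
    by rewrite (_ : (1 - s) * (-1 * A) = -1) ?powR_inv1 ?ltW// AE; field; rewrite gt_eqF.
  rewrite ge0_integralZl_EFin//; last 3 first.
  - by move=> x _; rewrite lee_fin powR_ge0.
  - by apply/measurable_EFinP; exact: (measurableT_comp (measurable_powR _) mf).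
  - by rewrite invr_ge0 ltW.
  apply: (@le_trans _ _ ((c^-1)%:E * c%:E)%E).
    by apply: lee_wpmul2l => //; rewrite lee_fin invr_ge0 ltW.
  by rewrite -EFinM mulVf// gt_eqF.
have ca : 0 < a `^ (1 - s) by exact: powR_gt0.
have ca' : 0 < a' `^ (1 - s) by exact: powR_gt0.
pose h' x := h x / a `^ (1 - s); pose g' x := g x / a' `^ (1 - s).
have mh' : measurable_fun setT h' by exact: measurable_funM.
have mg' : measurable_fun setT g' by exact: measurable_funM.
have h'0 x : 0 <= h' x by rewrite divr_ge0// ltW.
have g'0 x : 0 <= g' x by rewrite divr_ge0// ltW.
have Y := young_kernel s0 s1 AE B0 mk mh' mg' k0 h'0 g'0 kB kB'
  (norm1 _ _ a0 mh h0 ha) (norm1 _ _ a'0 mg g0 ga).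
set c := a `^ (1 - s) * a' `^ (1 - s).
have c0 : 0 < c by rewrite mulr_gt0.
have mkhg : measurable_fun setT (fun p : R * R => (k p * (h' p.1 * g' p.2))%:E).
  apply/measurable_EFinP; apply: measurable_funM => //; apply: measurable_funM.
    exact: (measurableT_comp mh' measurable_fst).
  exact: (measurableT_comp mg' measurable_snd).
have -> : (\int[mu]_t \int[mu]_x (k (x, t) * (h x * g t))%:E =
    \int[mu]_t (c%:E * \int[mu]_x (k (x, t) * (h' x * g' t))%:E))%E.
  apply: eq_integral => t _; rewrite -ge0_integralZl_EFin//; last 3 first.
  - by move=> x _; rewrite lee_fin mulr_ge0// mulr_ge0.
  - exact: (measurableT_comp mkhg (pair2_measurable t)).
  - exact: ltW.
  apply: eq_integral => x _; rewrite -EFinM /c /h' /g'; congr EFin.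
  by field; rewrite !gt_eqF.
rewrite ge0_integralZl_EFin//; last 3 first.
- by move=> t _; apply: integral_ge0 => x _; rewrite lee_fin mulr_ge0// mulr_ge0.
- apply: (@measurable_fun_fubini_tonelli_G _ _ _ _ R mu _ mkhg) => p.
  by rewrite lee_fin mulr_ge0// mulr_ge0.
- exact: ltW.
by clearbody c; rewrite mulrC EFinM; apply: lee_wpmul2l => //; rewrite lee_fin ltW.
Qed.

Lemma integral_indic_le (E : set R) (f : R -> R) (B : \bar R) : measurable E ->
  (\int[mu]_(x in E) (f x)%:E <= B)%E -> (\int[mu]_x (f x * \1_E x)%:E <= B)%E.
Proof.
move=> mE; rewrite integral_mkcond; apply: le_trans; rewrite le_eqVlt.
apply/orP; left; apply/eqP; apply: eq_integral => x _.
by rewrite patchE indicE; case: (x \in E); rewrite ?mulr1 ?mulr0.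
Qed.

Lemma powR_indic (E : set R) (c p : R) (x : R) : p != 0 ->
  (c * \1_E x) `^ p = c `^ p * \1_E x.
Proof. by move=> p0; rewrite indicE; case: (x \in E); rewrite ?mulr1// !mulr0 powR0. Qed.

Definition near_kernel (s H : R) (p : R * R) : R :=
  `|p.1 - p.2| `^ (- s) * \1_[set y : R | `|p.2 - y| <= H] p.1.

Definition far_kernel (D H : R) (p : R * R) : R :=
  `|p.1 - p.2| `^ (- D) * \1_[set y : R | H <= `|p.2 - y|] p.1.

Lemma near_kernelC s H x t : near_kernel s H (x, t) = near_kernel s H (t, x).
Proof. by rewrite /near_kernel/= distrC; congr *%R; apply: indic_eq; rewrite /= distrC. Qed.

Lemma far_kernelC D H x t : far_kernel D H (x, t) = far_kernel D H (t, x).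
Proof. by rewrite /far_kernel/= distrC; congr *%R; apply: indic_eq; rewrite /= distrC. Qed.

Lemma measurable_dist_ge (t h : R) : measurable [set y : R | h <= `|t - y|].
Proof.
rewrite (_ : [set y | _] = ~` [set y : R | `|t - y| < h]).
  apply: measurableC; rewrite (_ : [set y | _] = `]t - h, t + h[%classic)//.
  by apply/seteqP; split => y /=; rewrite in_itv/= distrC ltr_distl.
by apply/seteqP; split => y /=; [move=> ?; apply/negP; rewrite -leNgt|move=> /negP; rewrite -leNgt].
Qed.

Let measurable_dist : measurable_fun setT (fun p : R * R => `|p.1 - p.2|).
Proof. by apply: measurableT_comp => //; exact: measurable_funB. Qed.

Lemma measurable_near_kernel s H : measurable_fun setT (near_kernel s H).
Proof.
apply: measurable_funM; first exact: (measurableT_comp (measurable_powR _) measurable_dist).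
rewrite (_ : (fun p : R * R => _) = \1_([set p : R * R | `|p.1 - p.2| <= H])).
  apply: measurable_indic; rewrite (_ : [set p | _] = (fun p : R * R => `|p.1 - p.2|) @^-1` `]-oo, H]%classic).
    by rewrite -[X in measurable X]setTI; exact: measurable_dist.
  by apply/seteqP; split => p /=; rewrite in_itv.
by apply/funext => p; apply: indic_eq; rewrite /= distrC.
Qed.

Lemma measurable_far_kernel D H : measurable_fun setT (far_kernel D H).
Proof.
apply: measurable_funM; first exact: (measurableT_comp (measurable_powR _) measurable_dist).
rewrite (_ : (fun p : R * R => _) = \1_([set p : R * R | H <= `|p.1 - p.2|])).
  apply: measurable_indic; rewrite (_ : [set p | _] = (fun p : R * R => `|p.1 - p.2|) @^-1` `[H, +oo[%classic).
    by rewrite -[X in measurable X]setTI; exact: measurable_dist.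
  by apply/seteqP; split => p /=; rewrite in_itv/= andbT.
by apply/funext => p; apply: indic_eq; rewrite /= distrC.
Qed.

Lemma near_kernel_ge0 s H p : 0 <= near_kernel s H p.
Proof. by rewrite mulr_ge0 ?powR_ge0. Qed.

Lemma far_kernel_ge0 s H p : 0 <= far_kernel s H p.
Proof. by rewrite mulr_ge0 ?powR_ge0. Qed.

(** The power [1 / (2 s)] turns the kernel into an inverse square root, locally integrable whatever
    [s] is. *)
Lemma integral_near_kernel s H t : 0 < s -> 0 < H ->
  (\int[mu]_x (near_kernel s H (x, t) `^ (2 * s)^-1)%:E <= (4 * H `^ 2^-1)%:E)%E.
Proof.
move=> s0 H0; rewrite /near_kernel/=.
have p0 : (2 * s)^-1 != 0 by rewrite invr_eq0 gt_eqF// mulr_gt0.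
under eq_integral do rewrite powR_indic// -powRrM.
apply: integral_indic_le; first exact: measurable_dist_le.
rewrite (_ : - s * (2 * s)^-1 = - 2^-1); last by field; rewrite gt_eqF.
under eq_integral do rewrite distrC.
have h := @integral_powR_near R t H 2^-1.
apply: (le_trans (h ltac:(lra) ltac:(lra) H0)).
rewrite lee_fin (_ : 1 - 2^-1 = 2^-1); last lra.
by rewrite invrK; apply: ler_wpM2r; [exact: powR_ge0|lra].
Qed.

(** The power [1 / (D e)] turns the kernel into [|x - t| ^ (- 1 / e)], which is integrable at
    infinity because [e < 1]. *)
Lemma integral_far_kernel e D H t : 0 < e -> e < 1 -> 0 < D -> 0 < H ->
  (\int[mu]_x (far_kernel D H (x, t) `^ (D * e)^-1)%:E <=
   (2 / (e^-1 - 1) * H `^ (1 - e^-1))%:E)%E.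
Proof.
move=> e0 e1 D0 H0; rewrite /far_kernel/=.
have p0 : (D * e)^-1 != 0 by rewrite invr_eq0 gt_eqF// mulr_gt0.
under eq_integral do rewrite powR_indic// -powRrM.
apply: integral_indic_le; first exact: measurable_dist_ge.
rewrite (_ : - D * (D * e)^-1 = - e^-1); last by field; rewrite !gt_eqF.
under eq_integral do rewrite distrC.
by apply: integral_powR_far => //; rewrite invf_gt1.
Qed.

End young_scaled.

(** * Pairs of functions at close and at distant times *)

Section near_far.
Context {R : realType} (n : nat).
Notation mu := (@lebesgue_measure R).
Notation X := 'rV[R]_n.
Notation L := (@lebesgue_rV R n).
Notation Z := (measurableTypeR R * X)%type.
Notation M := (@spacetime R n).

(** One time profile [h] serves two norms of the slices: [L^1], which the dispersive estimate
    consumes, and [L^2], which the energy estimate consumes. The dyadic levels of a function have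
    this form. *)
Definition slice_bound (F : Z -> R) (al be : R) (h : R -> R) : Prop :=
  [/\ dominated F, measurable_fun setT h, forall s, 0 <= h s,
    forall s, \int[L]_x `|F (s, x)| <= al * h s &
    forall s, (\int[L]_x (F (s, x) ^+ 2)%:E <= ((be * h s) ^+ 2)%:E)%E].

Definition time_set (I : set R) : set Z := [set z | I z.1].

Lemma measurable_time_set I : measurable I -> measurable (time_set I).
Proof.
by move=> mI; rewrite -[X in measurable X]setTI; exact: (@measurable_fst _ _ (measurableTypeR R) X).
Qed.

Lemma indic_time_set I s x : \1_(time_set I) ((s, x) : Z) = \1_I s :> R.
Proof. exact: indic_eq. Qed.

Lemma slice_bound_restrict F al be h I : measurable I -> slice_bound F al be h ->
  slice_bound (fun z => F z * \1_(time_set I) z) al be (fun s => h s * \1_I s).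
Proof.
move=> mI [dF mh h0 F1 F2]; split.
- by apply: dominated_restrict => //; exact: measurable_time_set.
- by apply: measurable_funM => //; exact: measurable_indic.
- by move=> s; rewrite mulr_ge0.
- move=> s; under eq_Rintegral do rewrite indic_time_set.
  rewrite indicE; case: (s \in I).
    by under eq_Rintegral do rewrite mulr1; rewrite mulr1.
  by under eq_Rintegral do rewrite mulr0 normr0; rewrite !mulr0 Rintegral_cst// mul0r.
- move=> s; under eq_integral do rewrite indic_time_set.
  rewrite indicE; case: (s \in I).
    by under eq_integral do rewrite mulr1; rewrite mulr1.
  under eq_integral do rewrite mulr0 expr0n/=.
  by rewrite integral0 lee_fin sqr_ge0.
Qed.

Definition hdim : R := n%:R / 2.

(** Above the dispersive constant [8 ^ n] and above the square of the energy constant [(20 pi) ^ n],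
    so that one constant serves both estimates. *)
Definition form_cst : R := (8 ^+ n + (20 * pi) ^+ n) ^+ 2.

Lemma form_cst_ge1 : 1 <= form_cst.
Proof.
have c1 : 1 <= 8 ^+ n :> R by rewrite exprn_ege1//; lra.
have c2 : 0 <= (20 * pi) ^+ n :> R by rewrite exprn_ge0// mulr_ge0// pi_ge0.
by rewrite /form_cst exprn_ege1//; lra.
Qed.

Lemma form_cst_ge8 : 8 ^+ n <= form_cst.
Proof.
have c1 : 1 <= 8 ^+ n :> R by rewrite exprn_ege1//; lra.
have c2 : 0 <= (20 * pi) ^+ n :> R by rewrite exprn_ge0// mulr_ge0// pi_ge0.
rewrite /form_cst; set a := 8 ^+ n in c1 *; set c := _ ^+ n in c2 *; nra.
Qed.

Lemma form_cst_ge_pi : (20 * pi) ^+ n * (20 * pi) ^+ n <= form_cst.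
Proof.
have c1 : 1 <= 8 ^+ n :> R by rewrite exprn_ege1//; lra.
have c2 : 0 <= (20 * pi) ^+ n :> R by rewrite exprn_ge0// mulr_ge0// pi_ge0.
rewrite /form_cst; set a := 8 ^+ n in c1 *; set c := _ ^+ n in c2 *; nra.
Qed.

Variable N : R.
Hypothesis N0 : 0 < N.
Notation w := (@box_weight R n N).

Let wi : L.-integrable setT (EFin \o w).
Proof. exact: integrable_box_weight. Qed.

(** Both slices are measured by the energy bound, each contributing one energy constant. *)
Lemma oform_slices_le (s t b : R) (f g : X -> R) (u v : R) :
  dominatedX f -> dominatedX g -> 0 <= u -> 0 <= v ->
  (\int[L]_x (f x ^+ 2)%:E <= (u ^+ 2)%:E)%E ->
  (\int[L]_x (g x ^+ 2)%:E <= (v ^+ 2)%:E)%E ->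
  `|oform L L (at_time s) (at_time t) w b f g| <= form_cst * (u * v).
Proof.
move=> df dg u0 v0 fu gv.
have c1 : 1 <= (20 * pi) ^+ n :> R by rewrite exprn_ege1//; have := @pi_ge2 R; lra.
set c := (20 * pi) ^+ n in c1; have c0 := le_trans ler01 c1.
have h := @oform_slice_cs R n N N0 _ _ L (at_time s) f t b g (c * u) v.
apply: le_trans (h _ _ _ _ _ _ _) _ => //.
- exact: measurable_at_time.
- exact: dominatedX_integrable.
- exact: mulr_ge0.
- apply: le_trans (oform_slice_sqr_le N0 s df fu) _.
  by rewrite -/c [X in _ <= X]exprMn; apply: ler_wpM2r; rewrite ?sqr_ge0// expr2 ler_peMl.
- by rewrite -mulrA mulrA ler_wpM2r ?form_cst_ge_pi// mulr_ge0.
Qed.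

Variable e : R.
Hypotheses (n0 : (0 < n)%N) (e0 : 0 < e) (e1 : e < 1) (De : hdim * e <= 1).
Let D : R := hdim.
(** For the Strichartz pair whose dual space exponent is [2 / (1 + e)], [sg] is the reciprocal of
    the time exponent and [A] is the dual time exponent; the double endpoint is [sg = 1 / 2]. *)
Let sg : R := D * e / 2.
Let A : R := (1 - sg)^-1.
(** Half of the weight that scaling suggests. With weight [e] the kernel would be
    [|s - t| ^ (- 2 sg)], which the power [1 / (2 sg)] of Young's inequality turns into the
    non-integrable [1 / |s - t|]; with [e / 2] it becomes an inverse square root. *)
Let th : R := e / 2.

Let D0 : 0 < D. Proof. by rewrite divr_gt0// ltr0n. Qed.
Let sg0 : 0 < sg. Proof. by rewrite /sg divr_gt0// mulr_gt0. Qed.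
Let sg1 : sg <= 2^-1. Proof. by rewrite /sg /D; move: De; lra. Qed.

Lemma oform_slices_mean (s t b : R) (F G : Z -> R) al be al' be' h g : s != t ->
  0 <= al -> 0 <= be -> 0 <= al' -> 0 <= be' ->
  slice_bound F al be h -> slice_bound G al' be' g ->
  `|oform L L (at_time s) (at_time t) w b (fun x => F (s, x)) (fun x => G (t, x))| <=
  form_cst * ((al * al') `^ th * (be * be') `^ (1 - th)) * (`|s - t| `^ (- sg) * (h s * g t)).
Proof.
move=> st al0 be0 al'0 be'0 [dF mh h0 F1 F2] [dG mg g0 G1 G2].
have K1 := form_cst_ge1; have K0 := le_trans ler01 K1.
have th0 : 0 < th by rewrite divr_gt0.
have th1 : 0 < 1 - th by rewrite /th; move: e0 e1; lra.
have hg0 : 0 <= h s * g t by rewrite mulr_ge0.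
have dp0 : 0 <= `|s - t| `^ (- D) by exact: powR_ge0.
apply: (@le_trans _ _ ((form_cst * `|s - t| `^ (- D) * ((al * al') * (h s * g t))) `^ th *
   (form_cst * ((be * be') * (h s * g t))) `^ (1 - th))).
  apply: le_powR_mean => //; [| |exact: ltW|by rewrite /th; move: e0 e1; lra].
  - apply: le_trans (oform_dispersive N0 b st (dominated_slice s dF) (dominated_slice t dG)) _.
    apply: ler_pM.
    + by rewrite mulr_ge0 ?powR_ge0// exprn_ge0.
    + by rewrite mulr_ge0// Rintegral_ge0.
    + by rewrite ler_wpM2r ?form_cst_ge8.
    + rewrite mulrACA; apply: ler_pM; rewrite ?Rintegral_ge0//.
  - apply: le_trans (oform_slices_le s t b (dominated_slice s dF) (dominated_slice t dG)
      _ _ (F2 s) (G2 t)) _; rewrite ?mulr_ge0//.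
    by rewrite (mulrACA be).
have sp x : 0 <= x -> x `^ th * x `^ (1 - th) = x.
  rewrite le_eqVlt => /predU1P[<-|x0]; first by rewrite powR0 ?mul0r ?gt_eqF.
  by rewrite -powRD ?subrKC ?powRr1 ?(ltW x0)// gt_eqF// implybT.
rewrite -[in leRHS](sp _ hg0) -[form_cst in leRHS](sp _ K0).
have a10 : 0 <= al * al' by exact: mulr_ge0.
have b10 : 0 <= be * be' by exact: mulr_ge0.
rewrite (powRM _ (mulr_ge0 K0 dp0) (mulr_ge0 a10 hg0)) (powRM _ K0 dp0) (powRM _ a10 hg0).
rewrite (powRM _ K0 (mulr_ge0 b10 hg0)) (powRM _ b10 hg0) -powRrM.
have -> : - D * th = - sg by rewrite /sg /th; field.
by rewrite le_eqVlt; apply/orP; left; apply/eqP; ring.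
Qed.

(** All times in the support of [h] are within [2 H] of each other, so the kernel may be truncated
    there and Young's inequality applies. The bound is written as a square because it will enter
    Cauchy-Schwarz. *)
Lemma oform_near_le (F : Z -> R) al be h t H a : 0 <= al -> 0 <= be -> 0 < H -> 0 < a ->
  slice_bound F al be h -> (forall s, h s != 0 -> `|t - s| <= H) ->
  (\int[mu]_s (h s `^ A)%:E <= a%:E)%E ->
  oform M M idZ idZ w 0 F F <= (12 * form_cst * (al `^ th * be `^ (1 - th)) *
    H `^ (sg / 2) * a `^ (1 - sg)) ^+ 2.
Proof.
move=> al0 be0 H0 a0 sF hH ha; have [dF mh h0 F1 F2] := sF.
have K1 := form_cst_ge1; have K0 := le_trans ler01 K1.
set c := form_cst * ((al * al) `^ th * (be * be) `^ (1 - th)).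
have c0 : 0 <= c by apply: mulr_ge0 => //; apply: mulr_ge0; exact: powR_ge0.
have H20 : 0 < 2 * H by rewrite mulr_gt0.
pose k := near_kernel sg (2 * H).
have mk : measurable_fun setT k by exact: measurable_near_kernel.
have k0 p : 0 <= k p by exact: near_kernel_ge0.
have B0 : 0 < 4 * (2 * H) `^ 2^-1 by rewrite mulr_gt0// powR_gt0.
have kB t' : (\int[mu]_x (k (x, t') `^ (2 * sg)^-1)%:E <= (4 * (2 * H) `^ 2^-1)%:E)%E.
  exact: integral_near_kernel.
have kB' x : (\int[mu]_t' (k (x, t') `^ (2 * sg)^-1)%:E <= (4 * (2 * H) `^ 2^-1)%:E)%E.
  by under eq_integral do rewrite /k near_kernelC; exact: integral_near_kernel.
have Y := young_kernel_scaled sg0 sg1 (erefl A) B0 a0 a0 mk mh mh k0 h0 h0 kB kB' ha ha.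
have mkhh : measurable_fun setT (fun p : R * R => (k p * (h p.1 * h p.2))%:E).
  apply/measurable_EFinP; apply: measurable_funM => //; apply: measurable_funM.
    exact: (measurableT_comp mh measurable_fst).
  exact: (measurableT_comp mh measurable_snd).
have Q : (`|oform M M idZ idZ w 0 F F|%:E <=
    c%:E * \int[mu]_t \int[mu]_s (k (s, t) * (h s * h t))%:E)%E.
  apply: (le_trans (normr_oform_slice_le N 0 measurable_idZ (dominated_integrable dF) dF)).
  rewrite -ge0_integralZl_EFin//; last 2 first.
  - by move=> x _; apply: integral_ge0 => y _; rewrite lee_fin mulr_ge0// mulr_ge0.
  - apply: (@measurable_fun_fubini_tonelli_G _ _ _ _ R mu _ mkhh) => p.
    by rewrite lee_fin mulr_ge0// mulr_ge0.
  apply: ge0_le_integral => //.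
  - apply/measurable_EFinP; apply: measurableT_comp => //.
    by apply: (measurable_oform_slice N 0 measurable_idZ (dominated_integrable dF)); case: dF.
  - apply: measurable_funeM; apply: (@measurable_fun_fubini_tonelli_G _ _ _ _ R mu _ mkhh) => p.
    by rewrite lee_fin mulr_ge0// mulr_ge0.
  move=> t' _.
  have Fti := dominatedX_integrable (dominated_slice t' dF).
  apply: (le_trans (normr_oform_slicel_le N 0 (measurable_at_time t') Fti dF)).
  rewrite -ge0_integralZl_EFin//; last 2 first.
  - by move=> y _; rewrite lee_fin mulr_ge0// mulr_ge0.
  - exact: (measurableT_comp mkhh (pair2_measurable t')).
  apply: (@ge0_le_integral_except _ t') => //.
  - by move=> s; rewrite mule_ge0// lee_fin mulr_ge0// mulr_ge0.
  - apply/measurable_EFinP; apply: measurableT_comp => //.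
    by apply: measurable_oform_slicel => //; exact: measurable_at_time.
  - apply: measurable_funeM; exact: (measurableT_comp mkhh (pair2_measurable t')).
  move=> s st; rewrite -EFinM lee_fin.
  apply: le_trans (oform_slices_mean 0 st al0 be0 al0 be0 sF sF) _.
  rewrite -/c; apply: ler_wpM2l => //.
  have [hs|hs] := eqVneq (h s) 0; first by rewrite hs !(mul0r, mulr0).
  have [ht|ht] := eqVneq (h t') 0; first by rewrite ht !(mul0r, mulr0).
  rewrite /k /near_kernel/= indicE mem_set ?mulr1//=.
  rewrite (_ : t' - s = (t - s) - (t - t')); last by ring.
  by rewrite (le_trans (ler_normB _ _))// mulr_natl mulr2n lerD// hH.
rewrite -lee_fin; apply: le_trans (_ : (`|oform M M idZ idZ w 0 F F|%:E <= _)%E).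
  by rewrite lee_fin ler_norm.
apply: (le_trans Q); apply: le_trans (lee_wpmul2l _ Y) _; first by rewrite lee_fin.
rewrite -EFinM lee_fin /c.
have -> : (12 * form_cst * (al `^ th * be `^ (1 - th)) * H `^ (sg / 2) * a `^ (1 - sg)) ^+ 2 =
  (144 * form_cst ^+ 2) * ((al `^ th * be `^ (1 - th)) ^+ 2 * (H `^ (sg / 2)) ^+ 2 *
   (a `^ (1 - sg) * a `^ (1 - sg))) by ring.
have al1 : 0 <= al `^ th by exact: powR_ge0.
have be1 : 0 <= be `^ (1 - th) by exact: powR_ge0.
have hs0 : 0 <= H `^ (sg / 2) by exact: powR_ge0.
have as0 : 0 <= a `^ (1 - sg) by exact: powR_ge0.
have BE : (4 * (2 * H) `^ 2^-1) `^ (2 * sg) <= 8 * (H `^ (sg / 2)) ^+ 2.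
  rewrite powRM ?powR_ge0// -powRrM (_ : 2^-1 * (2 * sg) = sg); last by field.
  rewrite powRM ?(ltW H0)// mulrA.
  have -> : (H `^ (sg / 2)) ^+ 2 = H `^ sg.
    by rewrite expr2 -powRD ?gt_eqF ?implybT// -splitr.
  apply: ler_wpM2r; first exact: powR_ge0.
  have h4 : 4 `^ (2 * sg) <= 4 :> R.
    by rewrite -[leRHS]powRr1// ler_powR//; [lra|move: sg1; lra].
  have h2 : 2 `^ sg <= 2 :> R.
    by rewrite -[leRHS]powRr1// ler_powR//; [lra|move: sg1; lra].
  have := powR_ge0 4 (2 * sg); have := powR_ge0 2 sg; nra.
rewrite (powRM th al0 al0) (powRM (1 - th) be0 be0).
move: al1 be1 hs0 as0 BE.
set x1 := al `^ th; set x2 := be `^ _; set x3 := H `^ _; set x4 := a `^ _; set x5 := _ `^ (2 * sg).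
move=> al1 be1 hs0 as0 BE.
apply: le_trans (_ : form_cst * (x1 * x1 * (x2 * x2)) * (3 * (8 * x3 ^+ 2) * (x4 * x4)) <= _).
  apply: ler_wpM2l; first by rewrite mulr_ge0// mulr_ge0// mulr_ge0.
  by apply: ler_wpM2r; [rewrite mulr_ge0|rewrite ler_wpM2l].
rewrite [leLHS](_ : _ = 24 * form_cst * ((x1 * x2) ^+ 2 * x3 ^+ 2 * (x4 * x4))); last by ring.
apply: ler_wpM2r; first by rewrite !mulr_ge0// sqr_ge0.
by move: K1; set K := form_cst => K1; nra.
Qed.

(** The first term covers close times; the second covers distant times and carries the norm of the
    truncated kernel in Young's inequality. *)
Definition pair_cst : R :=
  240 * form_cst ^+ 2 + 3 * form_cst * (2 / (e^-1 - 1)) `^ (D * e).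

Lemma pair_cst_gt0 : 0 < pair_cst.
Proof.
move: form_cst_ge1; rewrite /pair_cst; set K := form_cst; clearbody K => K1.
have P0 := powR_ge0 (2 / (e^-1 - 1)) (D * e); move: P0; set P := _ `^ _; clearbody P; nra.
Qed.

Lemma near_kernel0 H s t : near_kernel 0 H (s, t) = \1_[set y : R | `|t - y| <= H] s.
Proof. by rewrite /near_kernel oppr0 powRr0 mul1r. Qed.

(** * The mass of a time profile in a moving window *)

Section window.
Variables (h : R -> R) (H : R).
Hypotheses (H0 : 0 < H) (mh : measurable_fun setT h) (h0 : forall s, 0 <= h s).
Hypothesis hA : (\int[mu]_s (h s `^ A)%:E <= 1)%E.

Let window_mass (t : R) : R := \int[mu]_s (h s `^ A * near_kernel 0 H (s, t)).

(* The decaying term keeps the window sum positive. *)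
Definition window_sum (t : R) : R := window_mass t + Num.min H 1 * decay t.

Let mhA : measurable_fun setT (fun s => h s `^ A).
Proof. exact: (measurableT_comp (measurable_powR _) mh). Qed.

Let mhk : measurable_fun setT (fun p : R * R => h p.1 `^ A * near_kernel 0 H p).
Proof.
apply: measurable_funM; last exact: measurable_near_kernel.
exact: (measurableT_comp mhA measurable_fst).
Qed.

Let hk0 p : 0 <= h p.1 `^ A * near_kernel 0 H p.
Proof. by rewrite mulr_ge0 ?powR_ge0// near_kernel_ge0. Qed.

Let window_mass_le t : (\int[mu]_s (h s `^ A * near_kernel 0 H (s, t))%:E <= 1)%E.
Proof.
apply: le_trans hA; apply: ge0_le_integral => //.
- by move=> s _; rewrite lee_fin (hk0 (s, t)).
- by apply/measurable_EFinP; exact: (measurable_fun_slicer t mhk).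
- exact/measurable_EFinP.
- move=> s _; rewrite lee_fin near_kernel0 ler_piMr ?powR_ge0//.
Qed.

Let window_massE t : (window_mass t)%:E = (\int[mu]_s (h s `^ A * near_kernel 0 H (s, t))%:E)%E.
Proof.
rewrite /window_mass Rintegral_EFin//; apply: ge0_integrable => //.
- exact: (measurable_fun_slicer t mhk).
- by move=> s _; exact: (hk0 (s, t)).
- by apply: le_lt_trans (window_mass_le t) _; rewrite ltry.
Qed.

Let window_mass_ge0 t : 0 <= window_mass t.
Proof. by apply: Rintegral_ge0 => s _; exact: (hk0 (s, t)). Qed.

Let min0 : 0 < Num.min H 1. Proof. by rewrite lt_min H0 ltr01. Qed.

Lemma window_sum_gt0 t : 0 < window_sum t.
Proof. by rewrite ltr_wpDl// mulr_gt0// decay_gt0. Qed.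

Lemma window_sum_le2 t : window_sum t <= 2.
Proof.
rewrite (_ : 2 = 1 + 1); last by ring.
apply: lerD; first by rewrite -lee_fin window_massE; exact: window_mass_le.
by rewrite mulr_ile1// ?(ltW min0) ?(ltW (decay_gt0 _)) ?decay_le1// ge_min lexx orbT.
Qed.

Lemma measurable_window_sum : measurable_fun setT window_sum.
Proof.
apply: measurable_funD.
  apply: (@measurable_Rintegral_param _ _ _ _ R mu
    (fun p : R * R => h p.2 `^ A * near_kernel 0 H (p.2, p.1))).
  exact: (measurableT_comp mhk (measurable_fun_pair measurable_snd measurable_fst)).
by apply: measurable_funM => //; exact: measurable_decay.
Qed.

Lemma integral_window_le (t : R) :
  (\int[mu]_s ((h s * \1_[set y : R | `|t - y| <= H] s) `^ A)%:E <= (window_sum t)%:E)%E.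
Proof.
have A0 : A != 0 by rewrite invr_eq0 gt_eqF//; move: sg1; lra.
under eq_integral do rewrite powR_indic// -near_kernel0.
by rewrite -window_massE lee_fin lerDl mulr_ge0 ?(ltW min0)// ltW// decay_gt0.
Qed.

(** By Tonelli's theorem each time is counted over a window of length [2 H]; the decaying term adds
    at most [pi H]. *)
Lemma integral_window_sum_le : (\int[mu]_t (window_sum t)%:E <= ((2 + pi) * H)%:E)%E.
Proof.
rewrite /window_sum; under eq_integral do rewrite EFinD.
rewrite ge0_integralD//; last 4 first.
- by move=> t _; rewrite lee_fin.
- apply/measurable_EFinP; apply: (@measurable_Rintegral_param _ _ _ _ R mu
    (fun p : R * R => h p.2 `^ A * near_kernel 0 H (p.2, p.1))).
  exact: (measurableT_comp mhk (measurable_fun_pair measurable_snd measurable_fst)).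
- by move=> t _; rewrite lee_fin mulr_ge0 ?(ltW min0)// ltW// decay_gt0.
- by apply/measurable_EFinP; apply: measurable_funM => //; exact: measurable_decay.
rewrite mulrDl EFinD; apply: leeD.
  under eq_integral do rewrite window_massE.
  have mhk' : measurable_fun setT (fun p : R * R => (h p.1 `^ A * near_kernel 0 H p)%:E).
    exact/measurable_EFinP.
  have hk0' p : (0 <= (h p.1 `^ A * near_kernel 0 H p)%:E)%E by rewrite lee_fin.
  have E1 := @fubini_tonelli1 _ _ _ _ R mu mu _ mhk' hk0'.
  have E2 := @fubini_tonelli2 _ _ _ _ R mu mu _ mhk' hk0'.
  apply: (@le_trans _ _ (\int[mu]_s \int[mu]_t (h s `^ A * near_kernel 0 H (s, t))%:E)%E).
    by rewrite le_eqVlt; apply/orP; left; apply/eqP; exact: (etrans (esym E2) E1).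
  apply: (@le_trans _ _ (\int[mu]_s ((2 * H)%:E * (h s `^ A)%:E))%E); last first.
    rewrite ge0_integralZl_EFin//; last 3 first.
    - by move=> s _; rewrite lee_fin powR_ge0.
    - exact/measurable_EFinP.
    - by rewrite mulr_ge0// ltW.
    by rewrite -[leRHS]mule1; apply: lee_wpmul2l => //; rewrite lee_fin mulr_ge0// ltW.
  apply: ge0_le_integral => //.
  - by move=> s _; apply: integral_ge0 => t _; rewrite lee_fin; exact: (hk0 (s, t)).
  - exact: (@measurable_fun_fubini_tonelli_F _ _ _ _ R mu _ mhk' hk0').
  - by apply: measurable_funeM; exact/measurable_EFinP.
  move=> s _; under eq_integral do rewrite EFinM.
  rewrite ge0_integralZl_EFin//; last 3 first.
  - by move=> t _; rewrite lee_fin near_kernel_ge0.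
  - by apply/measurable_EFinP; exact: (measurable_fun_slice s (measurable_near_kernel 0 H)).
  - exact: powR_ge0.
  rewrite muleC; apply: lee_wpmul2r; first by rewrite lee_fin powR_ge0.
  under eq_integral do rewrite near_kernelC near_kernel0.
  rewrite integral_indic//; last exact: measurable_dist_le.
  rewrite setIT (_ : [set y | _] = `[s - H, s + H]%classic); last first.
    by apply/seteqP; split => y /=; rewrite in_itv/= distrC ler_distl.
  have := @lebesgue_measure_itv R `[s - H, s + H]; rewrite /= => ->.
  rewrite lte_fin ltrD2l gtrN// -EFinB lee_fin; lra.
under eq_integral do rewrite EFinM.
rewrite ge0_integralZl_EFin//; last 3 first.
- by move=> t _; rewrite lee_fin ltW// decay_gt0.
- by apply/measurable_EFinP; exact: measurable_decay.
- exact: ltW.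
rewrite integral_oneDsqrV -EFinM lee_fin mulrC; apply: ler_wpM2l; first exact: pi_ge0.
by rewrite ge_min lexx.
Qed.

(** Trades a fractional power of the local mass for quantities that can be integrated over all [t].
    The surplus power [1 - 2 sg], nonnegative since [D e <= 1], costs a factor 2 because the window
    sum is at most 2. *)
Lemma mul_window_sum_le (x t : R) : 0 <= x ->
  x * window_sum t `^ (1 - sg) <= 2 * H `^ sg * (x `^ A + window_sum t / H).
Proof.
move=> x0; have a0 := window_sum_gt0 t; have a2 := window_sum_le2 t.
set a := window_sum t in a0 a2 *; clearbody a.
have s1 : sg <= 1 by move: sg1; lra.
have s2 : 0 < 1 - sg by move: sg1; lra.
have E1 : x = (x `^ A) `^ (1 - sg) by rewrite -powRrM /A mulVf ?gt_eqF// powRr1.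
have E2 : a `^ (1 - sg) = a `^ (1 - 2 * sg) * (H `^ sg * (a / H) `^ sg).
  rewrite -powRM ?(ltW H0) ?divr_ge0 ?(ltW a0) ?(ltW H0)//.
  rewrite (_ : H * (a / H) = a); last by field; rewrite gt_eqF.
  by rewrite -powRD ?(gt_eqF a0) ?implybT//; congr (_ `^ _); ring.
have h2 : a `^ (1 - 2 * sg) <= 2.
  apply: (@le_trans _ _ (2 `^ (1 - 2 * sg))).
    by apply: ge0_ler_powR; rewrite ?nnegrE ?(ltW a0)//; move: sg1; lra.
  by rewrite -[leRHS]powRr1// ler_powR//; [lra|move: sg0; lra].
rewrite E2 [leLHS](_ : _ = a `^ (1 - 2 * sg) * H `^ sg * (x * (a / H) `^ sg)); last by ring.
apply: ler_pM; rewrite ?mulr_ge0 ?powR_ge0//.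
  by apply: ler_wpM2r; rewrite ?powR_ge0.
rewrite [x in leLHS]E1; apply: geomean2_le_add; rewrite ?powR_ge0 ?divr_ge0 ?(ltW a0) ?(ltW H0)//.
exact: (mulr_ge0 (ltW D0) (ltW e0)).
Qed.

End window.

(** The cut at distance [H] is made separately for each time [t] of [G], so that near [t] the
    diagonal form of a localised piece of [F] appears, with the mass in the window as its size. The
    powers of [H] in the two terms have opposite signs, which leaves [H] free to be tuned to the
    sizes of [F] and [G]. *)
Lemma oform_pair_le (F G : Z -> R) al be al' be' h g b H :
  0 <= al -> 0 <= be -> 0 <= al' -> 0 <= be' -> 0 < H ->
  slice_bound F al be h -> slice_bound G al' be' g ->
  (\int[mu]_s (h s `^ A)%:E <= 1)%E -> (\int[mu]_s (g s `^ A)%:E <= 1)%E ->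
  `|oform M M idZ idZ w b F G| <= pair_cst *
    (al * al' * H `^ (- (D * (1 - e))) + al `^ th * be `^ (1 - th) * be' * H `^ (3 * sg / 2)).
Proof.
move=> al0 be0 al'0 be'0 H0 sF sG hA gA.
have [dF mh h0 F1 F2] := sF; have [dG mg g0 G1 G2] := sG.
have K1 := form_cst_ge1; have K0 := le_trans ler01 K1.
pose I t : set R := [set y : R | `|t - y| <= H].
have mI t : measurable (I t) by exact: measurable_dist_le.
pose a := window_sum h H.
have ma : measurable_fun setT a by exact: measurable_window_sum.
have a0 t : 0 < a t by exact: window_sum_gt0.
set ga := al `^ th * be `^ (1 - th).
have ga0 : 0 <= ga by rewrite mulr_ge0 ?powR_ge0.
pose k := far_kernel D H.
have mk : measurable_fun setT k by exact: measurable_far_kernel.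
have k0 p : 0 <= k p by exact: far_kernel_ge0.
have mkhg : measurable_fun setT (fun p : R * R => (k p * (h p.1 * g p.2))%:E).
  apply/measurable_EFinP; apply: measurable_funM => //; apply: measurable_funM.
    exact: (measurableT_comp mh measurable_fst).
  exact: (measurableT_comp mg measurable_snd).
have khg0 p : (0 <= (k p * (h p.1 * g p.2))%:E)%E by rewrite lee_fin mulr_ge0// mulr_ge0.
pose C1 : R := (20 * pi) ^+ n * (12 * form_cst * ga * H `^ (sg / 2) * be' * (2 * H `^ sg)).
have c0 : 0 <= (20 * pi) ^+ n :> R by rewrite exprn_ge0// mulr_ge0// pi_ge0.
have C10 : 0 <= C1.
  by apply: mulr_ge0 => //; do ?apply: mulr_ge0 => //; exact: powR_ge0.
pose U1 (t : R) : \bar R := (C1%:E * (g t `^ A + a t / H)%:E)%E.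
pose C2 : R := form_cst * (al * al').
have C20 : 0 <= C2 by apply: mulr_ge0 => //; exact: mulr_ge0.
pose U2 (t : R) : \bar R := (C2%:E * \int[mu]_s (k (s, t) * (h s * g t))%:E)%E.
have mgA : measurable_fun setT (fun s => g s `^ A).
  exact: (measurableT_comp (measurable_powR _) mg).
have mI2 : measurable_fun setT (fun t => \int[mu]_s (k (s, t) * (h s * g t))%:E)%E.
  exact: (@measurable_fun_fubini_tonelli_G _ _ _ _ R mu _ mkhg khg0).
have mga : measurable_fun setT (fun t => g t `^ A + a t / H).
  by apply: measurable_funD => //; exact: measurable_funM.
have ga1 t : 0 <= g t `^ A + a t / H.
  by rewrite addr_ge0 ?powR_ge0// divr_ge0// ltW.
have mU1 : measurable_fun setT U1.
  by apply: measurable_funeM; exact/measurable_EFinP.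
have mU2 : measurable_fun setT U2 by exact: measurable_funeM.
have U10 t : (0 <= U1 t)%E by rewrite /U1 mule_ge0// lee_fin.
have U20 t : (0 <= U2 t)%E by rewrite /U2 mule_ge0// ?lee_fin//; apply: integral_ge0 => s _; exact: (khg0 (s, t)).
have slice t : (`|oform M L idZ (at_time t) w b F (fun y => G (t, y))|%:E <= U1 t + U2 t)%E.
  have dGt := dominated_slice t dG; have Gti := dominatedX_integrable dGt.
  rewrite (oform_split N b (measurable_at_time t) Gti dF (measurable_time_set (mI t))).
  apply: (@le_trans _ _ ((`|oform M L idZ (at_time t) w b
      (fun z => F z * \1_(time_set (I t)) z) (fun y => G (t, y))|)%:E +
      (`|oform M L idZ (at_time t) w b
      (fun z => F z * \1_(~` time_set (I t)) z) (fun y => G (t, y))|)%:E)%E).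
    by rewrite -EFinD lee_fin ler_normD.
  apply: leeD.
    have sFI := slice_bound_restrict (mI t) sF; have [dFI _ _ _ _] := sFI.
    have Q := oform_near_le al0 be0 H0 (a0 t) sFI _ (integral_window_le H0 mh hA t).
    have {}Q := Q t (fun s => _).
    rewrite /U1 -EFinM lee_fin.
    set P := 12 * form_cst * ga * H `^ (sg / 2) * a t `^ (1 - sg).
    have P0 : 0 <= P by do ?apply: mulr_ge0 => //; exact: powR_ge0.
    apply: le_trans (oform_slice_cs N0 t b measurable_idZ (dominated_integrable dFI) dGt
      (mulr_ge0 be'0 (g0 t)) P0 (G2 t) _) _.
      apply: Q => s; apply: contra_neqP => /negP Is.
      by rewrite indicE memNset ?mulr0//; exact/negP.
    rewrite /C1 -(mulrA ((20 * pi) ^+ n)); apply: ler_wpM2l => //.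
    rewrite [leLHS](_ : _ = 12 * form_cst * ga * H `^ (sg / 2) * be' * (g t * a t `^ (1 - sg))); last first.
      by rewrite /P; ring.
    rewrite -(mulrA (12 * form_cst * ga * H `^ (sg / 2) * be')); apply: ler_wpM2l.
      by do ?apply: mulr_ge0 => //; exact: powR_ge0.
    exact: mul_window_sum_le.
  rewrite [~` time_set (I t)](_ : _ = time_set (~` I t))//.
  have mIc := measurableC (mI t).
  have [dFI _ _ FI1 FI2] := slice_bound_restrict mIc sF.
  apply: (le_trans (normr_oform_slicel_le N b (measurable_at_time t) Gti dFI)).
  rewrite /U2 -ge0_integralZl_EFin//; last first.
    exact: (measurableT_comp mkhg (pair2_measurable t)).
  apply: ge0_le_integral => //.
  - apply/measurable_EFinP; apply: measurableT_comp => //.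
    exact: (measurable_oform_slicel N b (measurable_at_time t) Gti dFI).
  - apply: measurable_funeM; exact: (measurableT_comp mkhg (pair2_measurable t)).
  move=> s _; rewrite -EFinM lee_fin.
  (* At distance at most [H] the cut slice vanishes, and the energy bound with [u = 0] says so; this
     also disposes of [s = t]. *)
  have [Is|Is] := boolP (`|t - s| <= H).
    apply: (@le_trans _ _ 0); last by rewrite mulr_ge0// mulr_ge0// mulr_ge0.
    have := oform_slices_le s t b (dominated_slice s dFI) dGt (lexx 0) (mulr_ge0 be'0 (g0 t)) _ (G2 t).
    rewrite mul0r mulr0; apply.
    apply: (le_trans (FI2 s)); rewrite indicE memNset; last by move=> /(_ Is).
    by rewrite !mulr0 lexx.
  have st : s != t by apply: contraNneq Is => ->; rewrite subrr normr0 ltW.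
  apply: (le_trans (oform_dispersive N0 b st (dominated_slice s dFI) dGt)).
  rewrite /k /far_kernel/= indicE mem_set ?mulr1/=; last by rewrite ltW// ltNge.
  rewrite /C2 -/hdim -/D.
  have FI1' := FI1 s; rewrite indicE mem_set ?mulr1 in FI1'; last by move=> /= ?; move/negP : Is.
  rewrite [leRHS](_ : _ = form_cst * `|s - t| `^ (- D) * ((al * h s) * (al' * g t))); last by ring.
  apply: ler_pM.
  - by rewrite mulr_ge0 ?powR_ge0// exprn_ge0.
  - by rewrite mulr_ge0// Rintegral_ge0.
  - by apply: ler_wpM2r; [exact: powR_ge0|exact: form_cst_ge8].
  - by apply: ler_pM => //; rewrite Rintegral_ge0.
rewrite -lee_fin.
apply: (le_trans (normr_oform_slice_le N b measurable_idZ (dominated_integrable dF) dG)).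
apply: (@le_trans _ _ (\int[mu]_t (U1 t + U2 t))%E).
  apply: ge0_le_integral => //.
  - apply/measurable_EFinP; apply: measurableT_comp => //.
    by apply: (measurable_oform_slice N b measurable_idZ (dominated_integrable dF)); case: dG.
  - exact: emeasurable_funD.
rewrite ge0_integralD//.
rewrite [leRHS](_ : _ = (pair_cst * (ga * be' * H `^ (3 * sg / 2)))%:E +
  (pair_cst * (al * al' * H `^ (- (D * (1 - e)))))%:E)%E; last first.
  by rewrite -EFinD -mulrDr addrC.
apply: leeD.
  rewrite /U1 ge0_integralZl_EFin//; last 2 first.
  - by move=> t _; rewrite lee_fin.
  - exact/measurable_EFinP.
  (* The integral of [g ^ A] is at most 1 and that of the window sum divided by [H] at most
     [2 + pi]; with [pi < 4] the total stays below 7. *)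
  apply: (@le_trans _ _ (C1%:E * 7%:E)%E).
    apply: lee_wpmul2l; first by rewrite lee_fin.
    under eq_integral do rewrite EFinD.
    rewrite ge0_integralD//; last 4 first.
    - by move=> t _; rewrite lee_fin powR_ge0.
    - exact/measurable_EFinP.
    - by move=> t _; rewrite lee_fin divr_ge0// ltW.
    - by apply/measurable_EFinP; exact: measurable_funM.
    apply: (@le_trans _ _ (1 + (2 + pi)%:E)%E); last first.
      by rewrite -EFinD lee_fin; have := @pihalf_lt2 R; lra.
    apply: leeD => //.
    under eq_integral do rewrite mulrC EFinM.
    rewrite ge0_integralZl_EFin//; last 3 first.
    - by move=> t _; rewrite lee_fin ltW.
    - exact/measurable_EFinP.
    - by rewrite invr_ge0 ltW.
    apply: (@le_trans _ _ ((H^-1)%:E * ((2 + pi) * H)%:E)%E).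
      apply: lee_wpmul2l; first by rewrite lee_fin invr_ge0 ltW.
      exact: integral_window_sum_le.
    by rewrite -EFinM lee_fin mulrC mulfK// gt_eqF.
  rewrite -EFinM lee_fin /C1.
  have -> : H `^ (3 * sg / 2) = H `^ (sg / 2) * H `^ sg.
    by rewrite -powRD ?(gt_eqF H0) ?implybT//; congr (_ `^ _); field.
  rewrite [leLHS](_ : _ = (168 * ((20 * pi) ^+ n * form_cst)) * (ga * be' * (H `^ (sg / 2) * H `^ sg))); last by ring.
  apply: ler_wpM2r.
    by rewrite !mulr_ge0 ?powR_ge0.
  have c1 : (20 * pi) ^+ n <= form_cst.
    have := form_cst_ge_pi; have : 1 <= (20 * pi) ^+ n :> R.
      by rewrite exprn_ege1//; have := @pi_ge2 R; lra.
    by set c := _ ^+ n; set K := form_cst; nra.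
  apply: (@le_trans _ _ (240 * form_cst ^+ 2)); last first.
    by rewrite lerDl mulr_ge0 ?powR_ge0// mulr_ge0.
  rewrite expr2; apply: ler_pM => //; [exact: mulr_ge0|lra|].
  exact: ler_wpM2r.
rewrite /U2 ge0_integralZl_EFin//; last first.
  by move=> t _; apply: integral_ge0 => s _; exact: (khg0 (s, t)).
have e10 : 0 < e^-1 - 1 by rewrite subr_gt0 invf_gt1.
have B0 : 0 < 2 / (e^-1 - 1) * H `^ (1 - e^-1) by rewrite mulr_gt0 ?powR_gt0// divr_gt0.
have ss : 2 * sg = D * e by rewrite /sg; field.
have kB t : (\int[mu]_x (k (x, t) `^ (2 * sg)^-1)%:E <= (2 / (e^-1 - 1) * H `^ (1 - e^-1))%:E)%E.
  by rewrite ss; exact: integral_far_kernel.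
have kB' x : (\int[mu]_t (k (x, t) `^ (2 * sg)^-1)%:E <= (2 / (e^-1 - 1) * H `^ (1 - e^-1))%:E)%E.
  by under eq_integral do rewrite /k far_kernelC; exact: kB.
have Y := young_kernel sg0 sg1 (erefl A) B0 mk mh mg k0 h0 g0 kB kB' hA gA.
apply: le_trans (lee_wpmul2l _ Y) _; first by rewrite lee_fin.
rewrite -EFinM lee_fin /C2 ss powRM ?powR_ge0//; last by rewrite divr_ge0// ltW.
rewrite -powRrM (_ : (1 - e^-1) * (D * e) = - (D * (1 - e))); last by field; rewrite gt_eqF.
rewrite [leLHS](_ : _ = (3 * form_cst * (2 / (e^-1 - 1)) `^ (D * e)) *
  (al * al' * H `^ (- (D * (1 - e))))); last by ring.
apply: ler_wpM2r; first by rewrite !mulr_ge0 ?powR_ge0.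
by rewrite lerDr mulr_ge0// sqr_ge0.
Qed.

End near_far.

(** * Strichartz estimates *)

Section limit_bound.
Context d (T : measurableType d) (R : realType) (m : {measure set T -> \bar R}).

(** Dominated convergence in the form used for cut-offs: at each point they eventually equal the
    limit. *)
Lemma Rintegral_le_lim (f_ : nat -> T -> R) (f g : T -> R) (C : R) :
  (forall k, measurable_fun setT (f_ k)) -> measurable_fun setT f ->
  m.-integrable setT (EFin \o g) -> (forall k x, `|f_ k x| <= g x) ->
  (forall x, exists k0, forall k, (k0 <= k)%N -> f_ k x = f x) ->
  (forall k, \int[m]_x f_ k x <= C) -> \int[m]_x f x <= C.
Proof.
move=> mf_ mf gi fg flim fC.
have f_i k : m.-integrable setT (EFin \o f_ k).
  by apply: (le_integrable_real measurableT (mf_ k)) gi => x _; exact: fg.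
have fg' x : `|f x| <= g x.
  by have [k0 h] := flim x; rewrite -(h k0 (leqnn _)).
have fi : m.-integrable setT (EFin \o f).
  by apply: (le_integrable_real measurableT mf) gi => x _; exact: fg'.
rewrite -lee_fin Rintegral_EFin//.
have cv : (\int[m]_x (f_ k x)%:E @[k --> \oo] --> \int[m]_x (f x)%:E)%E.
  apply: (@dominated_cvg _ _ _ m setT measurableT (fun k x => (f_ k x)%:E) _ (EFin \o g)) => //.
  - by move=> k; apply/measurable_EFinP.
  - move=> x _; apply: cvg_near_cst; have [k0 h] := flim x.
    by near=> k; rewrite h//; near: k; exact: nbhs_infty_ge.
  - by move=> k x _ /=; rewrite lee_fin.
move/cvg_lim : (cv) => <-//; apply: lime_le; first by apply/cvg_ex; eexists; exact: cv.
by apply: nearW => k; rewrite -Rintegral_EFin// lee_fin.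
Unshelve. all: by end_near. Qed.

Lemma integrable_sum_ord (k : nat) (f : nat -> T -> R) :
  (forall i, m.-integrable setT (EFin \o f i)) ->
  m.-integrable setT (EFin \o (fun x => \sum_(i < k) f i x)).
Proof.
move=> fi; elim: k => [|k IH].
  have : m.-integrable setT (cst 0 : T -> \bar R) by exact: integrable0.
  by apply: eq_integrable => // x _ /=; rewrite big_ord0.
have := integrableD measurableT IH (fi k).
by apply: eq_integrable => // x _ /=; rewrite big_ord_recr/= EFinD.
Qed.

Lemma Rintegral_sum_ord (k : nat) (f : nat -> T -> R) :
  (forall i, m.-integrable setT (EFin \o f i)) ->
  \int[m]_x (\sum_(i < k) f i x) = \sum_(i < k) \int[m]_x f i x.
Proof.
move=> fi; elim: k => [|k IH].
  rewrite big_ord0 (_ : (fun x => _) = (fun=> 0)); last by apply/funext => x; rewrite big_ord0.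
  by rewrite /Rintegral integral0.
rewrite big_ord_recr/= -IH -RintegralD//; last exact: integrable_sum_ord.
by apply: eq_Rintegral => x _; rewrite big_ord_recr.
Qed.

End limit_bound.

(** * Geometric sums over pairs of levels *)

Section schur_sum.
Context {R : realType}.

Lemma sum_geometric_le (rho : R) (m : nat) : 0 <= rho -> rho < 1 ->
  \sum_(j < m) rho ^+ j <= (1 - rho)^-1.
Proof.
move=> r0 r1; have h : 0 < 1 - rho by rewrite subr_gt0.
rewrite -(ler_pM2l h) mulfV ?gt_eqF// -opprB mulNr -subrX1 opprB lerBlDr lerDl.
exact: exprn_ge0.
Qed.

(** Subtraction of natural numbers is truncated, so [(i - j) + (j - i)] is the distance between [i]
    and [j]. *)
Lemma sum_dist_geometric_le (rho : R) (m i : nat) : 0 <= rho -> rho < 1 ->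
  \sum_(j < m) rho ^+ ((i - j) + (j - i)) <= 2 / (1 - rho).
Proof.
move=> r0 r1; rewrite -(big_mkord xpredT (fun j => rho ^+ ((i - j) + (j - i)))).
have h : 0 < (1 - rho)^-1 by rewrite invr_gt0 subr_gt0.
have [mi|im] := leqP m i.
  apply: (@le_trans _ _ (\sum_(0 <= j < i) rho ^+ ((i - j) + (j - i)))).
    rewrite [leRHS](big_cat_nat (n := m))//= lerDl; apply: sumr_ge0 => j _.
    exact: exprn_ge0.
  rewrite big_nat_rev/= add0n big_mkord.
  apply: (@le_trans _ _ (\sum_(j < i) rho ^+ j)).
    apply: ler_sum => j _; have ji := ltn_ord j.
    rewrite subKn// (_ : i - j.+1 - i = 0)%N ?addn0; last by apply/eqP; rewrite subn_eq0 leq_subr.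
    by rewrite exprS ler_piMl ?exprn_ge0// ltW.
  by apply: le_trans (sum_geometric_le _ r0 r1) _; move: h; set x := _^-1; lra.
rewrite (big_cat_nat (n := i)) ?(ltnW im)//= (_ : 2 / (1 - rho) = (1 - rho)^-1 + (1 - rho)^-1); last by ring.
apply: lerD.
  rewrite big_nat_rev/= add0n big_mkord.
  apply: le_trans (sum_geometric_le i r0 r1).
  apply: ler_sum => j _; have ji := ltn_ord j.
  rewrite subKn// (_ : i - j.+1 - i = 0)%N ?addn0; last by apply/eqP; rewrite subn_eq0 leq_subr.
  by rewrite exprS ler_piMl ?exprn_ge0// ltW.
rewrite -{1}(add0n i) big_addn big_mkord.
apply: le_trans (sum_geometric_le (m - i) r0 r1).
by apply: ler_sum => j _; rewrite addnK (_ : i - (j + i) = 0)%N// ; apply/eqP; rewrite subn_eq0 leq_addl.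
Qed.

(** Schur's test for the symmetric matrix [rho ^ |i - j|]: [2 k_i k_j <= k_i ^ 2 + k_j ^ 2] and the
    row sums are bounded. *)
Lemma schur_geometric (rho : R) (m : nat) (k : nat -> R) : 0 <= rho -> rho < 1 ->
  \sum_(i < m) \sum_(j < m) k i * k j * rho ^+ ((i - j) + (j - i)) <=
  2 / (1 - rho) * \sum_(i < m) k i ^+ 2.
Proof.
move=> r0 r1.
pose S (f : nat -> nat -> R) := \sum_(i < m) \sum_(j < m) f i j * rho ^+ ((i - j) + (j - i)).
have S1 : S (fun i _ => k i ^+ 2) <= 2 / (1 - rho) * \sum_(i < m) k i ^+ 2.
  rewrite mulr_sumr; apply: ler_sum => i _; rewrite -mulr_sumr mulrC.
  by apply: ler_wpM2r; [exact: sqr_ge0|exact: sum_dist_geometric_le].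
have S2 : S (fun _ j => k j ^+ 2) = S (fun i _ => k i ^+ 2).
  rewrite /S exchange_big/=; apply: eq_bigr => i _; apply: eq_bigr => j _.
  by rewrite addnC.
have -> : 2 / (1 - rho) * \sum_(i < m) k i ^+ 2 = 2^-1 * (2 / (1 - rho) * \sum_(i < m) k i ^+ 2) +
  2^-1 * (2 / (1 - rho) * \sum_(i < m) k i ^+ 2) by lra.
apply: (@le_trans _ _ (2^-1 * S (fun i _ => k i ^+ 2) + 2^-1 * S (fun _ j => k j ^+ 2))).
  rewrite /S !mulr_sumr -big_split/=; apply: ler_sum => i _.
  rewrite !mulr_sumr -big_split/=; apply: ler_sum => j _.
  rewrite !mulrA -mulrDl; apply: ler_wpM2r; first exact: exprn_ge0.
  by have := sqr_ge0 (k i - k j); rewrite sqrrB; lra.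
by rewrite S2; apply: lerD; apply: ler_wpM2l; rewrite ?invr_ge0.
Qed.

End schur_sum.

(** * Dyadic levels relative to the slice norm *)

Section levels.
Context {R : realType} (n : nat).
Notation mu := (@lebesgue_measure R).
Notation X := 'rV[R]_n.
Notation L := (@lebesgue_rV R n).
Notation Z := (measurableTypeR R * X)%type.
Notation M := (@spacetime R n).

Lemma dominatedX_powR (g : X -> R) p : 1 <= p -> dominatedX g ->
  dominatedX (fun x => `|g x| `^ p).
Proof.
move=> p1 [mg [K [K0 gK]]]; split.
  by apply: (measurableT_comp (measurable_powR _)); exact: measurableT_comp.
exists (K `^ p); split; first exact: powR_ge0.
move=> x; rewrite ger0_norm ?powR_ge0//.
have J0 := decayX_gt0 x; have J1 := decayX_le1 x.
apply: (@le_trans _ _ ((K * decayX x) `^ p)).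
  by apply: ge0_ler_powR; rewrite ?nnegrE ?mulr_ge0 ?(ltW J0)//; lra.
rewrite powRM ?(ltW J0)//; apply: ler_wpM2l; first exact: powR_ge0.
by rewrite -[leRHS]powRr1 ?(ltW J0)// ger_powR ?J0.
Qed.

Variables (F : Z -> R) (phi : R -> R) (p : R).
Hypotheses (dF : dominated F) (mphi : measurable_fun setT phi) (phi0 : forall s, 0 < phi s).
Hypotheses (p1 : 1 < p) (p2 : p < 2).
Hypothesis Fp : forall s, \int[L]_x `|F (s, x)| `^ p <= phi s `^ p.
Variable om : nat -> R.
Hypotheses (om0 : forall i, 0 < om i) (om_incr : forall i, om i <= om i.+1).

(** Heights are measured in units of [phi], a bound for the slice norm, so that one sequence [om]
    serves all times. *)
Definition level_set (i : nat) : set Z := [set z | om i * phi z.1 <= `|F z|].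

Lemma measurable_level_set i : measurable (level_set i).
Proof.
have [mF _] := dF.
have m1 : measurable_fun setT (fun z : Z => `|F z| - om i * phi z.1).
  apply: measurable_funB; first exact: measurableT_comp.
  apply: measurable_funM => //.
  exact: (measurableT_comp mphi (@measurable_fst _ _ (measurableTypeR R) X)).
rewrite (_ : level_set i = (fun z : Z => `|F z| - om i * phi z.1) @^-1` `[0, +oo[%classic).
  by rewrite -[X in measurable X]setTI; exact: m1.
by apply/seteqP; split => z /=; rewrite in_itv/= andbT subr_ge0.
Qed.

Definition level (i : nat) (z : Z) : R :=
  F z * (\1_(level_set i) z - \1_(level_set i.+1) z).

Lemma levelP i z : (level i z = 0) \/ (level i z = F z /\
  om i * phi z.1 <= `|F z| < om i.+1 * phi z.1).
Proof.
rewrite /level !indicE; have [h1|h1] := pselect (level_set i z);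
  have [h2|h2] := pselect (level_set i.+1 z);
  rewrite ?(mem_set h1) ?(memNset h1) ?(mem_set h2) ?(memNset h2)/=.
- by left; rewrite subrr mulr0.
- right; rewrite subr0 mulr1; split => //; apply/andP; split; first exact: h1.
  by rewrite ltNge; apply/negP.
- by case: h1; apply: le_trans h2; rewrite ler_wpM2r// ltW.
- by left; rewrite subrr mulr0.
Qed.

Lemma normr_level_le i z : `|level i z| <= `|F z|.
Proof. by have [->|[-> _]] := levelP i z; rewrite ?normr0. Qed.

Lemma measurable_level i : measurable_fun setT (level i).
Proof.
have [mF _] := dF; apply: measurable_funM => //; apply: measurable_funB.
  exact: measurable_indic (measurable_level_set i).
exact: measurable_indic (measurable_level_set i.+1).
Qed.

Lemma dominated_level i : dominated (level i).
Proof. by apply: (dominated_le dF); [exact: measurable_level|exact: normr_level_le]. Qed.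

(** The share of the level in the [L^p] mass allowed to the slice by [phi]. *)
Definition level_mass (i : nat) (s : R) : R :=
  phi s `^ (- p) * \int[L]_x `|level i (s, x)| `^ p.

Lemma level_mass_ge0 i s : 0 <= level_mass i s.
Proof. by rewrite mulr_ge0 ?powR_ge0// Rintegral_ge0// => x _; exact: powR_ge0. Qed.

Let pi1 i s : L.-integrable setT (EFin \o (fun x => `|level i (s, x)| `^ p)).
Proof.
apply/dominatedX_integrable/dominatedX_powR; first exact: ltW.
exact: (dominated_slice s (dominated_level i)).
Qed.

Let piF s : L.-integrable setT (EFin \o (fun x => `|F (s, x)| `^ p)).
Proof.
by apply/dominatedX_integrable/dominatedX_powR; [exact: ltW|exact: (dominated_slice s dF)].
Qed.

(** The differences of indicators telescope, so the levels together carry no more than the mass of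
    [F]. *)
Lemma sum_level_mass_le m s : \sum_(i < m) level_mass i s <= 1.
Proof.
rewrite -mulr_sumr.
have p0 : p != 0 by rewrite gt_eqF//; move: p1; lra.
have -> : 1 = phi s `^ (- p) * phi s `^ p :> R.
  by rewrite powRN mulVf// gt_eqF// powR_gt0.
apply: ler_wpM2l; first exact: powR_ge0.
apply: le_trans (Fp s).
rewrite -(Rintegral_sum_ord m (fun i => pi1 i s)); apply: le_Rintegral => //.
  exact: (integrable_sum_ord m (fun i => pi1 i s)).
move=> x _.
have E i : `|level i (s, x)| `^ p =
    `|F (s, x)| `^ p * (\1_(level_set i) ((s, x) : Z) - \1_(level_set i.+1) ((s, x) : Z)).
  rewrite /level; set u := _ - _.
  have [u0|u1] : u = 0 \/ u = 1.
    rewrite /u !indicE; have [h1|h1] := pselect (level_set i ((s, x) : Z));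
      have [h2|h2] := pselect (level_set i.+1 ((s, x) : Z));
      rewrite ?(mem_set h1) ?(memNset h1) ?(mem_set h2) ?(memNset h2)/=.
    - by left; rewrite subrr.
    - by right; rewrite subr0.
    - by case: h1; apply: le_trans h2; rewrite ler_wpM2r// ltW.
    - by left; rewrite subrr.
  - by rewrite u0 !mulr0 normr0 powR0.
  - by rewrite u1 !mulr1.
under eq_bigr do rewrite E.
rewrite -mulr_sumr ler_piMr ?powR_ge0//.
rewrite -(big_mkord xpredT (fun i => \1_(level_set i) ((s, x) : Z) - \1_(level_set i.+1) ((s, x) : Z))).
under eq_bigr do rewrite -opprB.
rewrite sumrN telescope_sumr// opprB !indicE.
Qed.

Lemma level_mass_le1 i s : level_mass i s <= 1.
Proof.
apply: le_trans (sum_level_mass_le i.+1 s).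
by rewrite big_ord_recr/= lerDr sumr_ge0// => j _; exact: level_mass_ge0.
Qed.

Lemma measurable_level_mass i : measurable_fun setT (level_mass i).
Proof.
apply: measurable_funM; first exact: (measurableT_comp (measurable_powR _) mphi).
apply: (@measurable_Rintegral_param _ _ _ _ R L (fun z : Z => `|level i z| `^ p)).
by apply: (measurableT_comp (measurable_powR _)); apply: measurableT_comp => //; exact: measurable_level.
Qed.

(** The square root is what the [L^2] norm of the level carries; in [L^1] the mass enters to the
    first power, which is smaller because it is at most one. The squares are summable over the
    levels. *)
Definition level_height (i : nat) (s : R) : R := phi s * level_mass i s `^ 2^-1.

(** On the level, [|F|] is at least [om i] and below [om i.+1] in units of [phi]: the lower bound
    compares [L^1] with [L^p] because [p > 1], the upper bound compares [L^2] with [L^p] because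
    [p < 2]. *)
Lemma level_slice_bound i :
  slice_bound (level i) (om i `^ (1 - p)) (om i.+1 `^ (1 - p / 2)) (level_height i).
Proof.
have dl := dominated_level i.
have massE s : \int[L]_x `|level i (s, x)| `^ p = phi s `^ p * level_mass i s.
  rewrite /level_mass mulrA -powRD ?subrr ?powRr0 ?mul1r//.
  by rewrite (gt_eqF (phi0 s)) implybT.
have i1 s : L.-integrable setT (EFin \o (fun x => level i (s, x))).
  exact/dominatedX_integrable/dominated_slice.
split => //.
- apply: measurable_funM => //; apply: (measurableT_comp (measurable_powR _)).
  exact: measurable_level_mass.
- by move=> s; rewrite mulr_ge0 ?powR_ge0// ltW.
- move=> s; have omphi : 0 < om i * phi s by rewrite mulr_gt0.
  apply: (@le_trans _ _ ((om i * phi s) `^ (1 - p) * \int[L]_x `|level i (s, x)| `^ p)).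
    rewrite -RintegralZl//; apply: le_Rintegral => //.
    + exact: (integrable_norm (i1 s)).
    + by have := integrableZl measurableT ((om i * phi s) `^ (1 - p)) (pi1 i s); apply: eq_integrable.
    move=> x _; have [->|[lF /andP[h1 h2]]] := levelP i (s, x).
      by rewrite normr0 mulr_ge0 ?powR_ge0.
    rewrite lF; have F0 : 0 < `|F (s, x)| by apply: lt_le_trans h1.
    rewrite -[leLHS]powRr1 ?(ltW F0)// -[X in _ `^ X](subrK p) powRD ?(gt_eqF F0) ?implybT//.
    apply: ler_wpM2r; first exact: powR_ge0.
    by rewrite -opprB !powRN lef_pV2 ?posrE ?powR_gt0// ge0_ler_powR ?nnegrE ?(ltW omphi) ?(ltW F0)//; move: p1; lra.
  rewrite massE powRM ?(ltW (om0 _)) ?(ltW (phi0 _))// -mulrA; apply: ler_wpM2l; first exact: powR_ge0.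
  rewrite mulrA -powRD ?(gt_eqF (phi0 s)) ?implybT// subrK powRr1 ?(ltW (phi0 s))//.
  apply: ler_wpM2l; first exact: ltW.
  rewrite -[leLHS]powRr1 ?level_mass_ge0//.
  have [->|m0] := eqVneq (level_mass i s) 0; first by rewrite !powR0 ?invr_eq0 ?oner_eq0.
  apply: ger_powR; last lra.
  by rewrite level_mass_le1 lt_def m0 level_mass_ge0.
- move=> s; have omphi : 0 < om i.+1 * phi s by rewrite mulr_gt0.
  have sqE : (om i.+1 `^ (1 - p / 2) * level_height i s) ^+ 2 =
      (om i.+1 * phi s) `^ (2 - p) * \int[L]_x `|level i (s, x)| `^ p.
    rewrite massE /level_height !exprMn -!powR_mulrn ?powR_ge0 ?(ltW (phi0 s))// -!powRrM.
    rewrite mulVf// powRr1 ?level_mass_ge0// powRM ?(ltW (om0 _)) ?(ltW (phi0 _))//.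
    rewrite (_ : (1 - p / 2) * 2 = 2 - p); last by field.
    rewrite -[in RHS]mulrA; congr *%R; rewrite mulrA; congr *%R.
    by rewrite -powRD ?(gt_eqF (phi0 s)) ?implybT// subrK.
  rewrite sqE EFinM Rintegral_EFin// -ge0_integralZl_EFin ?powR_ge0//; last first.
  + by case/integrableP : (pi1 i s).
  apply: ge0_le_integral => //.
  + by move=> x _; rewrite lee_fin sqr_ge0.
  + apply/measurable_EFinP; apply: measurable_funX.
    exact: (measurable_fun_slice s (measurable_level i)).
  + by apply: measurable_funeM; case/integrableP : (pi1 i s).
  move=> x _; rewrite -EFinM lee_fin.
  have [->|[lF /andP[h1 h2]]] := levelP i (s, x).
    by rewrite expr0n mulr_ge0 ?powR_ge0.
  rewrite lF -real_normK ?num_real//.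
  have F0 : 0 < `|F (s, x)| by apply: lt_le_trans h1; rewrite mulr_gt0.
  rewrite -powR_mulrn// -[X in _ `^ X <= _](subrK p) powRD ?(gt_eqF F0) ?implybT//.
  apply: ler_wpM2r; first exact: powR_ge0.
  by apply: ge0_ler_powR; rewrite ?nnegrE ?(ltW omphi) ?(ltW F0) ?(ltW h2)//; move: p2; lra.
Qed.

End levels.

Lemma powR_invr {R : realType} (x p : R) : 0 <= x -> x^-1 `^ p = (x `^ p)^-1.
Proof. by move=> x0; rewrite -[x^-1]powR_inv1// -powRrM mulN1r powRN. Qed.

Lemma pi_le4 {R : realType} : pi <= 4 :> R.
Proof. by have := @pihalf_lt2 R; lra. Qed.

Lemma pow2_le4 {R : realType} (x : R) : x <= 2 -> 2 `^ x <= 4.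
Proof.
move=> x2; apply: (@le_trans _ _ (2 `^ 2)); last by rewrite powR_mulrn//; lra.
by apply: ler_powR => //; lra.
Qed.

(** * The choice of the time threshold *)

Section level_exponents.
Context {R : realType}.
Variables (e D l k c c' : R).
Hypotheses (D0 : D != 0) (c0 : 0 < c).

Let pow2D (a b : R) : 2 `^ a * 2 `^ b = 2 `^ (a + b) :> R.
Proof. by rewrite powRD// pnatr_eq0 implybT. Qed.

(** The threshold is [H = 2 ^ (((l - k) / 6 - l - k) / D)]. With [- l - k] alone the far term would
    show no decay in [l - k]; the tilt [(l - k) / 6] provides the rate [(1 - e) / 6]. *)
Lemma far_exponent : 2 `^ (- (1 - e) * l) * c * (2 `^ (- (1 - e) * k) * c') *
    (2 `^ (((l - k) / 6 - l - k) / D)) `^ (- (D * (1 - e))) =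
  c * c' * 2 `^ (- ((1 - e) / 6 * (l - k))).
Proof.
rewrite -powRrM.
have -> : - ((1 - e) / 6 * (l - k)) = - (1 - e) * l + - (1 - e) * k +
    ((l - k) / 6 - l - k) / D * - (D * (1 - e)) by field.
by rewrite -!pow2D; ring.
Qed.

(** Without the tilt the near term would decay in [l - k] at the rate [e / 4]; the tilt spends half
    of it and leaves [e / 8]. *)
Lemma near_exponent : (2 `^ (- (1 - e) * l) * c) `^ (e / 2) *
    (2 `^ (e * (l + 1)) * c) `^ (1 - e / 2) * (2 `^ (e * (k + 1)) * c') *
    (2 `^ (((l - k) / 6 - l - k) / D)) `^ (3 * (D * e / 2) / 2) =
  c * c' * (2 `^ (e * (1 - e / 2) + e) * 2 `^ (- (e / 8 * (l - k)))).
Proof.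
have cE : c `^ (e / 2) * c `^ (1 - e / 2) = c.
  by rewrite -powRD ?(gt_eqF c0) ?implybT// subrKC powRr1// ltW.
rewrite !powRM ?powR_ge0 ?(ltW c0)// -!powRrM.
rewrite [LHS](_ : _ = (c `^ (e / 2) * c `^ (1 - e / 2)) * c' *
  (2 `^ (- (1 - e) * l * (e / 2)) * 2 `^ (e * (l + 1) * (1 - e / 2)) * 2 `^ (e * (k + 1)) *
   2 `^ (((l - k) / 6 - l - k) / D * (3 * (D * e / 2) / 2)))); last by ring.
rewrite cE !pow2D; congr (_ * _ `^ _).
by field.
Qed.

Lemma exponent_sum_le (x : R) : 0 < e -> e < 1 -> 0 <= x ->
  2 `^ (- ((1 - e) / 6 * x)) + 2 `^ (e * (1 - e / 2) + e) * 2 `^ (- (e / 8 * x)) <=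
  5 * 2 `^ (- (Num.min (e / 8) ((1 - e) / 6) * x)).
Proof.
move=> e0 e1 x0; set eps := Num.min _ _.
have mono a : eps <= a -> 2 `^ (- (a * x)) <= 2 `^ (- (eps * x)) :> R.
  move=> ea; apply: ler_powR; first by lra.
  by rewrite lerN2; exact: ler_wpM2r.
rewrite (_ : 5 * _ = 2 `^ (- (eps * x)) + 4 * 2 `^ (- (eps * x))); last by ring.
apply: lerD; first by apply: mono; rewrite /eps ge_min lexx orbT.
apply: ler_pM; rewrite ?powR_ge0//; last by apply: mono; rewrite /eps ge_min lexx.
apply: (@le_trans _ _ (2 `^ 2)); last by rewrite powR_mulrn//; lra.
by apply: ler_powR; [lra|nra].
Qed.

End level_exponents.

(** * Summation over the levels *)

Section strichartz.
Context {R : realType} (n : nat).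
Notation mu := (@lebesgue_measure R).
Notation X := 'rV[R]_n.
Notation L := (@lebesgue_rV R n).
Notation Z := (measurableTypeR R * X)%type.
Notation M := (@spacetime R n).

(** Moves a constant from the time profile to the coefficients, so that the profile can be
    normalised in [L^A]. *)
Lemma slice_bound_scale (F : Z -> R) al be h k : 0 < k -> slice_bound F al be h ->
  slice_bound F (al * k) (be * k) (fun s => h s / k).
Proof.
move=> k0 [dF mh h0 F1 F2]; split => //.
- exact: measurable_funM.
- by move=> s; rewrite divr_ge0// ltW.
- by move=> s; rewrite mulrACA mulrC mulfV ?mul1r// ?gt_eqF// mulrC -mulrA mulfV ?mulr1// gt_eqF.
- by move=> s; rewrite (_ : be * k * (h s / k) = be * h s)//; field; rewrite gt_eqF.
Qed.

Variables (N e : R).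
Hypothesis N0 : 0 < N.
Hypotheses (n0 : (0 < n)%N) (e0 : 0 < e) (e1 : e < 1) (De : hdim n * e <= 1).
Notation w := (@box_weight R n N).
Let D : R := hdim n.
Let sg : R := D * e / 2.
Let A : R := (1 - sg)^-1.
Let th : R := e / 2.
Let p : R := 2 / (1 + e).

Let wi : L.-integrable setT (EFin \o w).
Proof. exact: integrable_box_weight. Qed.

Let D0 : 0 < D. Proof. by rewrite divr_gt0// ltr0n. Qed.
Let sg0 : 0 < sg. Proof. by rewrite /sg divr_gt0// mulr_gt0. Qed.
Let sg1 : sg <= 2^-1. Proof. by rewrite /sg /D; move: De; lra. Qed.
Let A1 : 1 <= A. Proof. by rewrite /A invf_ge1; move: sg0 sg1; lra. Qed.
Let A2 : A <= 2.
Proof. by rewrite /A invf_ple ?posrE//; move: sg1; lra. Qed.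
Let p1 : 1 < p. Proof. by rewrite /p ltr_pdivlMr; move: e0 e1; lra. Qed.
Let p0 : 0 < p. Proof. exact: lt_trans ltr01 p1. Qed.
Let p2 : p < 2. Proof. by rewrite /p ltr_pdivrMr; move: e0 e1; lra. Qed.

Section one.
Variables (F : Z -> R) (phi : R -> R).
Hypotheses (dF : dominated F) (mphi : measurable_fun setT phi) (phi0 : forall s, 0 < phi s).
Hypothesis Fp : forall s, \int[L]_x `|F (s, x)| `^ p <= phi s `^ p.
Hypothesis phiA : (\int[mu]_s (phi s `^ A)%:E <= 1)%E.

Let mphiA : measurable_fun setT (fun s => phi s `^ A).
Proof. exact: (measurableT_comp (measurable_powR _) mphi). Qed.

Let phiAi : mu.-integrable setT (EFin \o (fun s => phi s `^ A)).
Proof.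
apply: ge0_integrable => // [s _|]; first exact: powR_ge0.
by apply: le_lt_trans phiA _; rewrite ltry.
Qed.

Let phiA_le1 : \int[mu]_s (phi s `^ A) <= 1.
Proof. by rewrite -lee_fin Rintegral_EFin. Qed.

Variable m : nat.
Let nu (i : nat) : R := i%:R - m%:R.
(** The ratio [2 ^ (1 + e)] fits [p = 2 / (1 + e)]: the coefficients in [L^1] and [L^2] become
    [2 ^ (- (1 - e) nu)] and [2 ^ (e (nu + 1))]. The [2 m + 1] levels are centred at height one. *)
Let om (i : nat) : R := 2 `^ ((1 + e) * nu i).
Let K : nat := (2 * m).+1.

Let om0 i : 0 < om i. Proof. by rewrite powR_gt0. Qed.
Let om_incr i : om i <= om i.+1.
Proof.
apply: ler_powR; first by lra.
by apply: ler_wpM2l; [move: e0; lra|rewrite /nu -natr1; lra].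
Qed.

Notation lev := (level F phi om).
Notation mass := (level_mass F phi p om).

Let massi i : mu.-integrable setT (EFin \o (fun s => phi s `^ A * mass i s)).
Proof.
apply: (le_integrable_real measurableT _ _ phiAi).
  by apply: measurable_funM => //; exact: measurable_level_mass.
move=> s _; have X0 : 0 <= mass i s by exact: level_mass_ge0.
rewrite ger0_norm ?(mulr_ge0 (powR_ge0 _ _) X0)//.
by rewrite ler_piMr ?powR_ge0//; exact: (level_mass_le1 dF mphi phi0 p1 Fp om_incr).
Qed.

(** The weighted mass of the level over all times; the term [1 / K] keeps it positive and adds up to
    one over the [K] levels. *)
Let c (i : nat) : R := \int[mu]_s (phi s `^ A * mass i s) + K%:R^-1.

Let massR_ge0 i : 0 <= \int[mu]_s (phi s `^ A * mass i s).
Proof. by apply: Rintegral_ge0 => s _; rewrite mulr_ge0 ?powR_ge0 ?level_mass_ge0. Qed.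

Let c0 i : 0 < c i.
Proof. by apply: ltr_wpDl => //; rewrite invr_gt0 ltr0n. Qed.

Let ka (i : nat) : R := 2 * c i `^ 2^-1.

Let ka0 i : 0 < ka i. Proof. by rewrite mulr_gt0// powR_gt0. Qed.

Let sum_ka : \sum_(i < K) ka i ^+ 2 <= 8.
Proof.
have kaE i : ka i ^+ 2 = 4 * c i.
  by rewrite /ka exprMn -[_ `^ _ ^+ 2]powR_mulrn ?powR_ge0// -powRrM mulVf// powRr1 ?(ltW (c0 i))//; ring.
under eq_bigr do rewrite kaE.
rewrite -mulr_sumr.
have -> : \sum_(i < K) c i = \sum_(i < K) \int[mu]_s (phi s `^ A * mass i s) + 1.
  rewrite /c big_split/=; congr +%R.
  by rewrite sumr_const card_ord -[_ *+ _]mulr_natl mulfV ?pnatr_eq0.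
have : \sum_(i < K) \int[mu]_s (phi s `^ A * mass i s) <= 1.
  rewrite -(Rintegral_sum_ord K massi); apply: le_trans phiA_le1.
  apply: le_Rintegral => //; first exact: (integrable_sum_ord K massi).
  move=> s _; rewrite -mulr_sumr ler_piMr ?powR_ge0//.
  exact: (sum_level_mass_le dF mphi phi0 p1 Fp om_incr).
by lra.
Qed.

(** With [u] the mass of the level divided by [c i], [u ^ (A / 2) <= 1 + u] because [A <= 2], which
    is [D e <= 1]. Integrated against [phi ^ A] the right-hand side gives at most 2, for which the
    factor 2 in [ka] compensates. *)
Let height_norm i : (\int[mu]_s ((level_height F phi p om i s / ka i) `^ A)%:E <= 1)%E.
Proof.
have mh : measurable_fun setT (fun s => phi s `^ A + (c i)^-1 * (phi s `^ A * mass i s)).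
  apply: measurable_funD => //; apply: measurable_funM => //.
  by apply: measurable_funM => //; exact: measurable_level_mass.
apply: (@le_trans _ _ (\int[mu]_s (2^-1 * (phi s `^ A + (c i)^-1 * (phi s `^ A * mass i s)))%:E)%E).
  apply: ge0_le_integral => //.
  - by move=> s _; rewrite lee_fin powR_ge0.
  - apply/measurable_EFinP; apply: (measurableT_comp (measurable_powR _)).
    apply: measurable_funM => //; apply: measurable_funM => //.
    by apply: (measurableT_comp (measurable_powR _)); exact: measurable_level_mass.
  - by apply/measurable_EFinP; exact: measurable_funM.
  move=> s _; rewrite lee_fin /level_height /ka.
  have X0 : 0 <= mass i s by exact: level_mass_ge0.
  have ci := c0 i; move: X0 ci; set x := mass i s; set cc := c i => X0 ci.
  have -> : phi s * x `^ 2^-1 / (2 * cc `^ 2^-1) = phi s * (2^-1 * (x / cc) `^ 2^-1).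
    have y0 : cc `^ 2^-1 != 0 by rewrite gt_eqF// powR_gt0.
    have -> : (x / cc) `^ 2^-1 = x `^ 2^-1 / cc `^ 2^-1.
      apply: (canRL (mulfK y0)); rewrite -powRM ?divr_ge0 ?(ltW ci)// divfK// gt_eqF//.
    by field.
  rewrite powRM ?(ltW (phi0 s)) ?mulr_ge0 ?powR_ge0 ?invr_ge0//.
  rewrite (@powRM _ 2^-1 ((x / cc) `^ 2^-1) A) ?powR_ge0 ?invr_ge0// -powRrM.
  have -> : 2^-1 * (phi s `^ A + cc^-1 * (phi s `^ A * x)) = phi s `^ A * (2^-1 * (1 + x / cc)) by field; rewrite gt_eqF.
  apply: ler_wpM2l; first exact: powR_ge0.
  apply: ler_pM; rewrite ?powR_ge0//.
    rewrite -[leRHS]powRr1 ?invr_ge0//; apply: ger_powR => //.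
    by apply/andP; split; lra.
  have u0 : 0 <= x / cc by rewrite divr_ge0// ltW.
  move: u0; set u := x / cc => u0.
  have [u1|u1] := leP u 1.
    apply: (@le_trans _ _ (1 `^ (2^-1 * A))); last by rewrite powR1; lra.
    by apply: ge0_ler_powR; rewrite ?nnegrE//; move: A1; lra.
  apply: (@le_trans _ _ (u `^ 1)); last by rewrite powRr1; lra.
  by apply: ler_powR; [lra|move: A2; lra].
rewrite -Rintegral_EFin//; last first.
  have := integrableZl measurableT 2^-1 (integrableD measurableT phiAi (integrableZl measurableT (c i)^-1 (massi i))).
  by apply: eq_integrable.
rewrite lee_fin RintegralZl//; last first.
  by have := integrableD measurableT phiAi (integrableZl measurableT (c i)^-1 (massi i)); apply: eq_integrable.
rewrite RintegralD//; last first.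
  by have := integrableZl measurableT (c i)^-1 (massi i); apply: eq_integrable.
rewrite RintegralZl//.
have : (c i)^-1 * \int[mu]_s (phi s `^ A * mass i s) <= 1.
  rewrite ler_pdivrMl// mulr1 /c lerDl invr_ge0 ler0n//.
by move: phiA_le1; lra.
Qed.

Let lev_bound i : slice_bound (lev i) (2 `^ (- (1 - e) * nu i) * ka i)
  (2 `^ (e * (nu i + 1)) * ka i) (fun s => level_height F phi p om i s / ka i).
Proof.
have e10 : 1 + e != 0 by rewrite gt_eqF//; move: e0; lra.
have := slice_bound_scale (ka0 i) (level_slice_bound dF mphi phi0 p1 p2 Fp om0 om_incr i).
rewrite -!powRrM (_ : (1 + e) * nu i * (1 - p) = - (1 - e) * nu i); last first.
  by rewrite /p; field.
rewrite (_ : (1 + e) * nu i.+1 * (1 - p / 2) = e * (nu i + 1))//.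
by rewrite /p /nu -natr1; field.
Qed.

Let eps : R := Num.min (e / 8) ((1 - e) / 6).
Let rho : R := 2 `^ (- eps).

(** The higher level takes the first place, so that [l - k >= 0] and the tilted threshold yields
    decay in both terms. *)
Let pair_ge (i j : nat) : (j <= i)%N ->
  `|oform M M idZ idZ w 0 (lev i) (lev j)| <=
  5 * pair_cst n e * (ka i * ka j * rho ^+ (i - j)).
Proof.
move=> ji.
set l := nu i; set k := nu j.
have lk : l - k = (i - j)%N%:R by rewrite /l /k /nu natrB//; ring.
have lk0 : 0 <= l - k by rewrite lk ler0n.
pose H : R := 2 `^ (((l - k) / 6 - l - k) / D).
have H0 : 0 < H by rewrite powR_gt0.
have := oform_pair_le N0 n0 e0 e1 De 0 _ _ _ _ H0 (lev_bound i) (lev_bound j) (height_norm i) (height_norm j).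
rewrite -/l -/k -/D -/sg -/th => /(_ _ _ _ _)/le_trans; apply; rewrite ?mulr_ge0 ?powR_ge0 ?(ltW (ka0 _))//.
have ki := ka0 i; have kj := ka0 j.
rewrite -[leRHS]mulrA [leRHS]mulrCA.
apply: ler_wpM2l; first exact/ltW/pair_cst_gt0.
have D0' : D != 0 by rewrite gt_eqF.
rewrite /H (@far_exponent R e D l k (ka i) (ka j) D0') (@near_exponent R e D l k (ka i) (ka j) D0' ki).
have kk0 : 0 <= ka i * ka j by exact: (mulr_ge0 (ltW ki) (ltW kj)).
move: kk0; generalize (ka i * ka j) => kk kk0.
rewrite -mulrDr [leRHS]mulrCA; apply: ler_wpM2l; first exact: kk0.
have -> : rho ^+ (i - j) = 2 `^ (- (eps * (l - k))).
  by rewrite /rho -powR_mulrn ?powR_ge0// -powRrM lk mulNr.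
exact: exponent_sum_le.
Qed.

Let pair_all (i j : nat) : `|oform M M idZ idZ w 0 (lev i) (lev j)| <=
  5 * pair_cst n e * (ka i * ka j * rho ^+ ((i - j) + (j - i))).
Proof.
have [ji|ij] := leqP j i.
  by rewrite (_ : (j - i = 0)%N) ?addn0; [exact: pair_ge|apply/eqP; rewrite subn_eq0].
rewrite (_ : (i - j = 0)%N) ?add0n; last by apply/eqP; rewrite subn_eq0 ltnW.
have li k : M.-integrable setT (EFin \o lev k).
  exact/dominated_integrable/(dominated_level dF mphi phi0 om_incr).
rewrite (oformC N 0 measurable_idZ measurable_idZ (li i) (li j)) oppr0 (mulrC (ka i)).
exact/pair_ge/ltnW.
Qed.

Let trunc (z : Z) : R := \sum_(i < K) lev i z.

(** Expanding over pairs of levels leaves a matrix of geometric decay acting on [ka], whose squares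
    add up to at most 8. The constant 80 is 5 times 2 times 8. *)
Lemma oform_levels_le : \int[(M \x M)%E]_q (trunc q.1 * trunc q.2 * kern w 0 q.1 q.2) <=
  80 * pair_cst n e / (1 - 2 `^ (- Num.min (e / 8) ((1 - e) / 6))).
Proof.
have li i : M.-integrable setT (EFin \o lev i).
  exact/dominated_integrable/(dominated_level dF mphi phi0 om_incr).
have eps0 : 0 < eps by rewrite /eps lt_min; move: e0 e1; lra.
have rho0 : 0 <= rho by exact: powR_ge0.
have rho1 : rho < 1.
  rewrite /rho powRN invf_lt1 ?powR_gt0// [X in X < _](_ : 1 = 1 `^ eps); last by rewrite powR1.
  by apply: gt0_ltr_powR => //; rewrite ?nnegrE//; lra.
have oi i j := integrable_oform measurable_idZ measurable_idZ 0 wi (li i) (li j).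
pose f i j (q : Z * Z) := lev i q.1 * lev j q.2 * kern w 0 (idZ q.1) (idZ q.2).
have -> : \int[(M \x M)%E]_q (trunc q.1 * trunc q.2 * kern w 0 q.1 q.2) =
    \sum_(i < K) \sum_(j < K) oform M M idZ idZ w 0 (lev i) (lev j).
  under [RHS]eq_bigr => i _ do rewrite -(Rintegral_sum_ord K (f := f i) (fun j => oi i j)).
  rewrite -(Rintegral_sum_ord K (f := fun i q => \sum_(j < K) f i j q)); last first.
    by move=> i; exact: (integrable_sum_ord K (fun j => oi i j)).
  apply: eq_Rintegral => q _; rewrite /trunc mulr_suml mulr_suml; apply: eq_bigr => i _.
  by rewrite mulr_sumr mulr_suml.
apply: le_trans (ler_norm _) _; apply: le_trans (ler_norm_sum _ _ _) _.
apply: (@le_trans _ _ (5 * pair_cst n e * \sum_(i < K) \sum_(j < K) ka i * ka j * rho ^+ ((i - j) + (j - i)))).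
  rewrite mulr_sumr; apply: ler_sum => i _; apply: le_trans (ler_norm_sum _ _ _) _.
  by rewrite mulr_sumr; apply: ler_sum => j _; exact: pair_all.
have P0 : 0 < pair_cst n e by exact: pair_cst_gt0.
apply: (@le_trans _ _ (5 * pair_cst n e * (2 / (1 - rho) * 8))).
  apply: ler_wpM2l; first by rewrite mulr_ge0// ltW.
  apply: (le_trans (schur_geometric _ _ rho0 rho1)); apply: ler_wpM2l => //.
  by rewrite divr_ge0// subr_ge0 ltW.
by rewrite le_eqVlt; apply/orP; left; apply/eqP; rewrite -/eps -/rho; field; rewrite subr_eq0 gt_eqF.
Qed.

Lemma truncE z : trunc z = F z * (\1_(level_set F phi om 0) z - \1_(level_set F phi om K) z).
Proof.
rewrite /trunc -mulr_sumr -(big_mkord xpredT (fun i => \1_(level_set F phi om i) z - \1_(level_set F phi om i.+1) z)).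
by under eq_bigr do rewrite -opprB; rewrite sumrN telescope_sumr// opprB.
Qed.

End one.

Definition strichartz_cst : R :=
  80 * pair_cst n e / (1 - 2 `^ (- Num.min (e / 8) ((1 - e) / 6))).

Lemma strichartz_cst_gt0 : 0 < strichartz_cst.
Proof.
have eps0 : 0 < Num.min (e / 8) ((1 - e) / 6) by rewrite lt_min; move: e0 e1; lra.
move: eps0; set eps := Num.min _ _ => eps0.
apply: divr_gt0; first by rewrite mulr_gt0// pair_cst_gt0.
rewrite subr_gt0 powRN invf_lt1 ?powR_gt0//.
rewrite [X in X < _](_ : 1 = 1 `^ eps); last by rewrite powR1.
by apply: gt0_ltr_powR => //; rewrite ?nnegrE//; lra.
Qed.

(** The truncation to [2 m + 1] levels agrees with [F] at a given point once [m] exceeds [|F| / phi]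
    and its inverse there, so the uniform bound passes to the limit. *)
Lemma oform_normalized_le (F : Z -> R) (phi : R -> R) :
  dominated F -> measurable_fun setT phi -> (forall s, 0 < phi s) ->
  (forall s, \int[L]_x `|F (s, x)| `^ p <= phi s `^ p) ->
  (\int[mu]_s (phi s `^ A)%:E <= 1)%E ->
  oform M M idZ idZ w 0 F F <= strichartz_cst.
Proof.
move=> dF mphi phi0 Fp phiA.
have Fi := dominated_integrable dF.
have oF := integrable_oform measurable_idZ measurable_idZ 0 wi Fi Fi.
pose om (m i : nat) : R := 2 `^ ((1 + e) * (i%:R - m%:R)).
have om_incr m i : om m i <= om m i.+1.
  apply: ler_powR; first by lra.
  by apply: ler_wpM2l; [move: e0; lra|rewrite -natr1; lra].
pose S (m : nat) (z : Z) := \sum_(i < (2 * m).+1) level F phi (om m) i z.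
have SE m z : S m z = F z * (\1_(level_set F phi (om m) 0) z - \1_(level_set F phi (om m) (2 * m).+1) z).
  exact: truncE.
have SF m z : `|S m z| <= `|F z|.
  rewrite SE normrM ler_piMr// !indicE.
  by case: (_ \in _); case: (_ \in _); rewrite /= ?subrr ?subr0 ?sub0r ?normrN ?normr1 ?normr0.
have mS m : measurable_fun setT (S m).
  by apply: measurable_sum => i; exact: (measurable_level dF mphi).
have mw : measurable_fun setT (fun q : Z * Z => kern w 0 q.1 q.2).
  by apply: measurable_kern; case/integrableP : wi => /measurable_EFinP.
apply: (@Rintegral_le_lim _ _ R (M \x M)%E
  (fun m (q : Z * Z) => S m q.1 * S m q.2 * kern w 0 q.1 q.2) _
  (fun q : Z * Z => `|F q.1 * F q.2 * kern w 0 q.1 q.2|)).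
- move=> m; apply: measurable_funM => //; apply: measurable_funM.
    exact: (measurableT_comp (mS m) measurable_fst).
  exact: (measurableT_comp (mS m) measurable_snd).
- by case/integrableP : oF => /measurable_EFinP.
- exact: (integrable_norm oF).
- move=> m q; rewrite !normrM; apply: ler_wpM2r => //.
  by apply: ler_pM.
- have SlimF z : exists m0, forall m, (m0 <= m)%N -> S m z = F z.
    have [Fz|Fz] := eqVneq (F z) 0; first by exists 0%N => m _; rewrite SE Fz mul0r.
    have F0 : 0 < `|F z| by rewrite normr_gt0.
    pose q := `|F z| / phi z.1; have q0 : 0 < q by rewrite divr_gt0.
    have FE : `|F z| = q * phi z.1 by rewrite divfK// gt_eqF.
    exists (maxn (Num.bound q) (Num.bound q^-1)) => m; rewrite geq_max => /andP[m1 m2].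
    have qm : q < m%:R.
      apply: lt_le_trans (_ : (Num.bound q)%:R <= _); last by rewrite ler_nat.
      exact/archi_boundP/ltW.
    have qm' : q^-1 < m%:R.
      apply: lt_le_trans (_ : (Num.bound q^-1)%:R <= _); last by rewrite ler_nat.
      by apply: archi_boundP; rewrite invr_ge0 ltW.
    have m2m : m%:R <= 2 `^ m%:R :> R.
      by rewrite powR_mulrn// -natrX ler_nat ltnW// ltn_expl.
    have em : m%:R <= (1 + e) * m%:R by rewrite ler_peMl//; move: e0; lra.
    rewrite SE !indicE mem_set; last first.
      rewrite /level_set/= FE; apply: ler_wpM2r; first exact: ltW.
      rewrite /om sub0r mulrN powRN invf_ple ?posrE ?powR_gt0//.
      apply: (le_trans (ltW qm')); apply: (le_trans m2m); apply: ler_powR => //; lra.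
    rewrite memNset ?subr0 ?mulr1//= /level_set/= FE; apply/negP; rewrite -ltNge ltr_pM2r//.
    apply: (lt_le_trans qm); apply: (le_trans m2m); apply: ler_powR; first by lra.
    rewrite -natr1 natrM (_ : 2 * m%:R + 1 - m%:R = m%:R + 1); last by ring.
    by rewrite mulrDr mulr1 (le_trans em)// lerDl; move: e0; lra.
  move=> [z z']; have [m1 h1] := SlimF z; have [m2 h2] := SlimF z'.
  by exists (maxn m1 m2) => m; rewrite geq_max => /andP[m1m m2m]/=; rewrite h1// h2.
- move=> m; exact: (oform_levels_le dF mphi phi0 Fp phiA m).
Qed.

End strichartz.

(** * Removing the normalisation of the time norm *)

Section rescale.
Context {R : realType} (n : nat).
Notation mu := (@lebesgue_measure R).
Notation X := 'rV[R]_n.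
Notation L := (@lebesgue_rV R n).
Notation Z := (measurableTypeR R * X)%type.
Notation M := (@spacetime R n).
Variable N : R.
Notation w := (@box_weight R n N).

(** The form is quadratic in [F], so dividing by [la] normalises the time norm. The normalised
    estimate asks for a strictly positive profile, and [phi] is first raised to a small multiple of
    [decay]. *)
Lemma oform_rescale (p sg C : R) : 1 <= p -> 0 <= sg -> sg <= 2^-1 -> 0 <= C ->
  (forall (F : Z -> R) (phi : R -> R),
    dominated F -> measurable_fun setT phi -> (forall s, 0 < phi s) ->
    (forall s, \int[L]_x `|F (s, x)| `^ p <= phi s `^ p) ->
    (\int[mu]_s (phi s `^ (1 - sg)^-1)%:E <= 1)%E ->
    oform M M idZ idZ w 0 F F <= C) ->
  forall (F : Z -> R) (phi : R -> R) (a : R), 0 < a ->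
    dominated F -> measurable_fun setT phi -> (forall s, 0 <= phi s) ->
    (forall s, \int[L]_x `|F (s, x)| `^ p <= phi s `^ p) ->
    (\int[mu]_s (phi s `^ (1 - sg)^-1)%:E <= a%:E)%E ->
    oform M M idZ idZ w 0 F F <= 4 * C * a `^ (2 * (1 - sg)).
Proof.
move=> p1 sg0 sg1 C0 norm F phi a a0 dF mphi phi0 Fp phiA.
set A := (1 - sg)^-1 in norm phiA.
have A1 : 1 <= A by rewrite /A invf_ge1; lra.
have A0 : 0 < A by exact: lt_le_trans ltr01 A1.
have p0 : 0 < p by exact: lt_le_trans ltr01 p1.
have sA : (1 - sg) * A = 1 by rewrite /A mulfV// gt_eqF//; lra.
have wi : L.-integrable setT (EFin \o w) by exact: integrable_box_weight.
clearbody A.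
(* [la ^ A = 2 a] leaves room for the raised profile, whose extra contribution is at most
   [pi a / 4 <= a]. *)
pose la := (2 * a) `^ (1 - sg); have la0 : 0 < la by rewrite powR_gt0// mulr_gt0.
pose de := (a / 4) `^ (1 - sg); have de0 : 0 < de by rewrite powR_gt0// divr_gt0.
have laA : la `^ A = 2 * a by rewrite /la -powRrM sA powRr1// mulr_ge0// ltW.
have deA : de `^ A = a / 4 by rewrite /de -powRrM sA powRr1// divr_ge0// ltW.
pose phi' s := Num.max (phi s) (de * decay s) / la.
pose F' (z : Z) := la^-1 * F z.
have phi'0 s : 0 < phi' s.
  by rewrite divr_gt0// lt_max mulr_gt0 ?decay_gt0// orbT.
have mphi' : measurable_fun setT phi'.
  apply: measurable_funM => //; apply: measurable_maxr => //.
  by apply: measurable_funM => //; exact: measurable_decay.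
have dF' : dominated F'.
  have [mF [K [K0 FK]]] := dF; split; first exact: measurable_funM.
  exists (la^-1 * K); split; first by rewrite mulr_ge0// invr_ge0 ltW.
  move=> s x; rewrite normrM gtr0_norm ?invr_gt0// -mulrA; apply: ler_wpM2l => //.
  by rewrite invr_ge0 ltW.
have Fp' s : \int[L]_x `|F' (s, x)| `^ p <= phi' s `^ p.
  have -> : \int[L]_x `|F' (s, x)| `^ p = la^-1 `^ p * \int[L]_x `|F (s, x)| `^ p.
    rewrite -RintegralZl//; last first.
      by apply/dominatedX_integrable/dominatedX_powR; [exact: p1|exact: (dominated_slice s dF)].
    apply: eq_Rintegral => x _; rewrite /F' normrM gtr0_norm ?invr_gt0// powRM//.
    by rewrite invr_ge0 ltW.
  have mx0 : 0 <= Num.max (phi s) (de * decay s) by rewrite le_max phi0.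
  rewrite /phi' powRM ?invr_ge0 ?(ltW la0)// mulrC; apply: ler_wpM2r; first exact: powR_ge0.
  apply: (le_trans (Fp s)); apply: ge0_ler_powR; rewrite ?nnegrE ?phi0 ?(ltW p0)//.
  by rewrite le_max lexx.
have mphiA : measurable_fun setT (fun s => phi s `^ A).
  exact: (measurableT_comp (measurable_powR _) mphi).
have phiA' : (\int[mu]_s (phi' s `^ A)%:E <= 1)%E.
  apply: (@le_trans _ _ (\int[mu]_s ((2 * a)^-1%:E * ((phi s `^ A)%:E + (a / 4)%:E * (decay s)%:E)))%E).
    apply: ge0_le_integral => //.
    - by move=> s _; rewrite lee_fin powR_ge0.
    - by apply/measurable_EFinP; apply: (measurableT_comp (measurable_powR _)).
    - apply: measurable_funeM; apply: emeasurable_funD; first exact/measurable_EFinP.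
      by apply: measurable_funeM; apply/measurable_EFinP; exact: measurable_decay.
    move=> s _; rewrite -(EFinM (a / 4)) -EFinD -EFinM lee_fin /phi'.
    have d0 := decay_gt0 s; have dd0 : 0 <= de * decay s by rewrite mulr_ge0// ltW.
    have mx0 : 0 <= Num.max (phi s) (de * decay s) by rewrite le_max phi0.
    rewrite powRM ?invr_ge0 ?(ltW la0)// mulrC.
    have -> : la^-1 `^ A = (2 * a)^-1.
      by rewrite powR_invr ?(ltW la0)// laA.
    apply: ler_wpM2l; first by rewrite invr_ge0 mulr_ge0// ltW.
    have dA : (de * decay s) `^ A <= a / 4 * decay s.
      rewrite powRM ?(ltW de0) ?(ltW d0)// deA; apply: ler_wpM2l; first by rewrite divr_ge0// ltW.
      by rewrite -[leRHS]powRr1 ?(ltW d0)//; apply: ger_powR => //; rewrite d0 decay_le1.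
    rewrite /Num.max; case: ifPn => _.
      by apply: (le_trans dA); rewrite lerDr powR_ge0.
    by rewrite lerDl mulr_ge0 ?(ltW d0)// divr_ge0// ltW.
  rewrite ge0_integralZl_EFin//; last 3 first.
  - by move=> s _; rewrite -(EFinM (a / 4)) -EFinD lee_fin addr_ge0 ?powR_ge0// mulr_ge0 ?divr_ge0 ?(ltW a0)// ltW// decay_gt0.
  - apply: emeasurable_funD; first exact/measurable_EFinP.
    by apply: measurable_funeM; apply/measurable_EFinP; exact: measurable_decay.
  - by rewrite invr_ge0 mulr_ge0// ltW.
  rewrite ge0_integralD//; last 4 first.
  - by move=> s _; rewrite lee_fin powR_ge0.
  - exact/measurable_EFinP.
  - by move=> s _; rewrite -(EFinM (a / 4)) lee_fin mulr_ge0 ?divr_ge0 ?(ltW a0)// ltW// decay_gt0.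
  - by apply: measurable_funeM; apply/measurable_EFinP; exact: measurable_decay.
  rewrite ge0_integralZl_EFin//; last 3 first.
  - by move=> s _; rewrite lee_fin ltW// decay_gt0.
  - by apply/measurable_EFinP; exact: measurable_decay.
  - by rewrite divr_ge0// ltW.
  rewrite integral_oneDsqrV -EFinM.
  apply: (@le_trans _ _ ((2 * a)^-1%:E * (a%:E + (a / 4 * pi)%:E))%E).
    apply: lee_wpmul2l; first by rewrite lee_fin invr_ge0 mulr_ge0// ltW.
    exact: leeD.
  rewrite -EFinD -EFinM lee_fin ler_pdivrMl ?mulr_gt0// mulr1.
  rewrite mulr_natl mulr2n lerD2l; apply: le_trans (_ : a / 4 * 4 <= _).
    by apply: ler_wpM2l; [rewrite divr_ge0// ltW|exact: pi_le4].
  by rewrite divfK// pnatr_eq0.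
have Q := norm _ _ dF' mphi' phi'0 Fp' phiA'.
have QE : oform M M idZ idZ w 0 F F = la ^+ 2 * oform M M idZ idZ w 0 F' F'.
  have F'i := dominated_integrable dF'.
  rewrite /oform -RintegralZl//; last exact: (integrable_oform measurable_idZ measurable_idZ 0 wi F'i F'i).
  by apply: eq_Rintegral => q _; rewrite /F'; field; rewrite gt_eqF.
have la2 : la ^+ 2 <= 4 * a `^ (2 * (1 - sg)).
  rewrite /la -powR_mulrn ?powR_ge0// -powRrM (mulrC _ 2) powRM ?(ltW a0)//.
  apply: ler_wpM2r; first exact: powR_ge0.
  by apply: pow2_le4; rewrite ler_piMr// gerBl.
rewrite QE; apply: (@le_trans _ _ (la ^+ 2 * C)).
  by apply: ler_wpM2l => //; exact: sqr_ge0.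
rewrite -[leRHS]mulrA [leRHS]mulrCA mulrC.
by apply: ler_wpM2l; [exact: C0|exact: la2].
Qed.

End rescale.

(** * The Hardy-Littlewood-Sobolev inequality *)

Section hls.
Context {R : realType}.
Notation mu := (@lebesgue_measure R).
Variable sg : R.
Hypotheses (sg0 : 0 < sg) (sg1 : sg < 2^-1).

(** The kernel [z ^ (- 2 sg)] up to the scale [1 / m] and [z ^ (- 2)] beyond it, matched at that
    scale, so that the integral over the line is proportional to [m]. *)
Definition hls_weight (m : R) (z : R) : R :=
  m `^ (2 - 2 * sg) * (z `^ (- (2 * sg)) * \1_[set y : R | y <= m^-1] z) +
  z `^ (- 2) * \1_[set y : R | m^-1 <= y] z.

Lemma hls_weight_ge0 m z : 0 <= hls_weight m z.
Proof. by rewrite addr_ge0 ?mulr_ge0 ?powR_ge0. Qed.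

(** Let [x <= y]. For [z <= 1 / y], [x] is replaced by [y]; for larger [z] the left-hand side is [y]
    times the geometric mean of [x] and [z ^ (- 2) / y] with weights [1 - sg] and [sg]. *)
Lemma hls_pointwise (x y z : R) : 0 < x -> 0 < y -> 0 < z ->
  z `^ (- (2 * sg)) * (x `^ (1 - sg) * y `^ (1 - sg)) <=
  hls_weight x z + hls_weight y z + x * y.
Proof.
move=> x0 y0 z0.
wlog xy : x y x0 y0 / x <= y.
  move=> H; have [xy|/ltW yx] := leP x y; first exact: H.
  by rewrite (mulrC (x `^ _)) (addrC (hls_weight x z)) (mulrC x); exact: H.
have wx := hls_weight_ge0 x z; have xy0 : 0 < x * y by exact: mulr_gt0.
have s1 : 0 < 1 - sg by move: sg1; lra.
apply: (@le_trans _ _ (hls_weight y z + x * y)); last by lra.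
have [zy|zy] := leP z y^-1.
  apply: (@le_trans _ _ (y `^ (2 - 2 * sg) * (z `^ (- (2 * sg)) * \1_[set y0 : R | y0 <= y^-1] z))); last first.
    apply: (@le_trans _ _ (hls_weight y z)); last by rewrite lerDl ltW.
    by rewrite /hls_weight lerDl mulr_ge0 ?powR_ge0.
  rewrite indicE mem_set//= mulr1 mulrC; apply: ler_wpM2r; first exact: powR_ge0.
  have -> : 2 - 2 * sg = (1 - sg) + (1 - sg) by ring.
  rewrite [y `^ (_ + _ + _)]powRD ?(gt_eqF y0) ?implybT//; apply: ler_wpM2r; first exact: powR_ge0.
  by apply: ge0_ler_powR; rewrite ?nnegrE ?(ltW s1) ?(ltW x0) ?(ltW y0).
apply: (@le_trans _ _ (y * (x + z `^ (- 2) / y))); last first.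
  rewrite /hls_weight [\1_[set y0 | y^-1 <= y0] z]indicE mem_set ?mulr1/=; last exact: ltW.
  rewrite mulrDr mulrCA mulfV ?gt_eqF// mulr1 (mulrC y) addrC lerD2r lerDr.
  by rewrite mulr_ge0 ?powR_ge0// mulr_ge0 ?powR_ge0.
apply: (@le_trans _ _ (y * (x `^ (1 - sg) * (z `^ (- 2) / y) `^ sg))); last first.
  apply: ler_wpM2l; first exact: ltW.
  apply: geomean2_le_add; rewrite ?(ltW x0) ?(ltW sg0)//; last by move: sg1; lra.
  by rewrite divr_ge0 ?powR_ge0// ltW.
rewrite le_eqVlt; apply/orP; left; apply/eqP.
rewrite powRM ?powR_ge0 ?invr_ge0 ?(ltW y0)// -powRrM powR_invr ?(ltW y0)//.
have yE : y = y `^ (1 - sg) * y `^ sg.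
  by rewrite -powRD ?(gt_eqF y0) ?implybT// subrK powRr1// ltW.
transitivity (y `^ (1 - sg) * y `^ sg * (x `^ (1 - sg) * (z `^ (- 2 * sg) / y `^ sg))); last by rewrite -yE.
by rewrite mulNr; field; rewrite gt_eqF// powR_gt0.
Qed.

Lemma integral_hls_weight (m t : R) : 0 < m ->
  (\int[mu]_s (hls_weight m `|t - s|)%:E <= ((2 / (1 - 2 * sg) + 2) * m)%:E)%E.
Proof.
move=> m0; have mi : 0 < m^-1 by rewrite invr_gt0.
have k1 : 0 < 1 - 2 * sg by move: sg1; lra.
have md : measurable_fun setT (fun s : R => `|t - s|).
  by apply: measurableT_comp => //; exact: measurable_funB.
have mp q : measurable_fun setT (fun s : R => `|t - s| `^ q).
  exact: (measurableT_comp (measurable_powR _) md).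
have m1 : measurable_fun setT (fun s : R => `|t - s| `^ (- (2 * sg)) * \1_[set y : R | `|t - y| <= m^-1] s).
  by apply: measurable_funM => //; apply: measurable_indic; exact: measurable_dist_le.
have m2 : measurable_fun setT (fun s : R => `|t - s| `^ (- 2) * \1_[set y : R | m^-1 <= `|t - y|] s).
  by apply: measurable_funM => //; apply: measurable_indic; exact: measurable_dist_ge.
have -> : (\int[mu]_s (hls_weight m `|t - s|)%:E = \int[mu]_s
    ((m `^ (2 - 2 * sg))%:E * (`|t - s| `^ (- (2 * sg)) * \1_[set y : R | (`|t - y| <= m^-1)%R] s)%:E +
     (`|t - s| `^ (- 2) * \1_[set y : R | (m^-1 <= `|t - y|)%R] s)%:E))%E.
  by apply: eq_integral => s _; rewrite -EFinM -EFinD.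
have a10 s : (0 <= (`|t - s| `^ (- (2 * sg)) * \1_[set y : R | (`|t - y| <= m^-1)%R] s)%:E)%E.
  by rewrite lee_fin mulr_ge0 ?powR_ge0.
have a1m := (@measurable_EFinP _ _ _ _ _).2 m1; have a2m := (@measurable_EFinP _ _ _ _ _).2 m2.
have a20 s : (0 <= (`|t - s| `^ (- 2) * \1_[set y : R | (m^-1 <= `|t - y|)%R] s)%:E)%E.
  by rewrite lee_fin mulr_ge0 ?powR_ge0.
have p0 : (0 <= (m `^ (2 - 2 * sg))%:E)%E by rewrite lee_fin powR_ge0.
rewrite (ge0_integralD mu measurableT (fun s _ => mule_ge0 p0 (a10 s))
  (measurable_funeM _ a1m) (fun s _ => a20 s) a2m).
rewrite (ge0_integralZl_EFin mu measurableT (fun s _ => a10 s) a1m (powR_ge0 _ _)).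
rewrite [leRHS](_ : _ = ((2 / (1 - 2 * sg)) * m)%:E + (2 * m)%:E)%E; last first.
  by rewrite -EFinD -mulrDl.
apply: leeD.
  apply: (@le_trans _ _ ((m `^ (2 - 2 * sg))%:E * (2 / (1 - 2 * sg) * m^-1 `^ (1 - 2 * sg))%:E)%E).
    apply: lee_wpmul2l; first by rewrite lee_fin powR_ge0.
    apply: integral_indic_le; first exact: measurable_dist_le.
    by apply: integral_powR_near => //; move: sg0 sg1; lra.
  rewrite -EFinM lee_fin powR_invr ?(ltW m0)// mulrCA; apply: ler_wpM2l.
    by rewrite divr_ge0// ltW.
  have -> : 2 - 2 * sg = 1 + (1 - 2 * sg) by ring.
  by rewrite powRD ?(gt_eqF m0) ?implybT// mulfK ?gt_eqF ?powR_gt0// powRr1// ltW.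
apply: integral_indic_le; first exact: measurable_dist_ge.
apply: (le_trans (integral_powR_far t _ mi)); first by lra.
rewrite lee_fin (_ : 1 - 2 = -1); last by ring.
rewrite (_ : 2 - 1 = 1); last by ring.
by rewrite divr1 powR_invr ?(ltW m0)// powR_inv1 ?(ltW m0)// invrK.
Qed.

(** Writing [phi = x ^ (1 - sg)], the normalisation says that [x] has integral at most one. The two
    weights integrate in one variable to a multiple of [x] in the other, and the last term is a
    product. *)
Lemma hls (phi : R -> R) : measurable_fun setT phi -> (forall s, 0 < phi s) ->
  (\int[mu]_s (phi s `^ (1 - sg)^-1)%:E <= 1)%E ->
  (\int[mu]_t \int[mu]_s (`|s - t| `^ (- (2 * sg)) * (phi s * phi t))%:E <=
   (4 / (1 - 2 * sg) + 5)%:E)%E.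
Proof.
move=> mphi phi0 phiA; set A := (1 - sg)^-1.
have s1 : 0 < 1 - sg by move: sg1; lra.
have k1 : 0 < 1 - 2 * sg by move: sg1; lra.
pose x (s : R) := phi s `^ A.
have x0 s : 0 < x s by exact: powR_gt0.
have mx : measurable_fun setT x by exact: (measurableT_comp (measurable_powR _) mphi).
have phiE s : phi s = x s `^ (1 - sg).
  by rewrite /x -powRrM /A mulVf ?gt_eqF// powRr1 ?(ltW (phi0 s)).
have md : measurable_fun setT (fun p : R * R => `|p.1 - p.2|).
  by apply: measurableT_comp => //; exact: measurable_funB.
have mx1 : measurable_fun setT (fun p : R * R => x p.1) by exact: (measurableT_comp mx measurable_fst).
have mx2 : measurable_fun setT (fun p : R * R => x p.2) by exact: (measurableT_comp mx measurable_snd).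
have mle (f g : R * R -> R) : measurable_fun setT f -> measurable_fun setT g ->
    measurable_fun setT (\1_[set p | f p <= g p] : R * R -> R).
  move=> mf mg; apply: measurable_indic.
  rewrite (_ : [set p | _] = (fun p => g p - f p) @^-1` `[0, +oo[%classic).
    by rewrite -[X in measurable X]setTI; exact: measurable_funB.
  by apply/seteqP; split => p /=; rewrite in_itv/= andbT subr_ge0.
have mw (y : R * R -> R) : measurable_fun setT y -> (forall p, 0 < y p) ->
    measurable_fun setT (fun p : R * R => hls_weight (y p) `|p.1 - p.2|).
  move=> my y0.
  have myi : measurable_fun setT (fun p => (y p)^-1).
    rewrite (_ : (fun p => (y p)^-1) = (fun p => y p `^ (- 1))).
      exact: (measurableT_comp (measurable_powR _) my).
    by apply/funext => p; rewrite powR_inv1// ltW.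
  have mi : measurable_fun setT (fun p : R * R => \1_[set z : R | z <= (y p)^-1] `|p.1 - p.2| : R).
    by apply: (eq_measurable_fun _ _ (mle _ _ md myi)) => p _; exact: indic_eq.
  have mi' : measurable_fun setT (fun p : R * R => \1_[set z : R | (y p)^-1 <= z] `|p.1 - p.2| : R).
    by apply: (eq_measurable_fun _ _ (mle _ _ myi md)) => p _; exact: indic_eq.
  apply: measurable_funD; apply: measurable_funM.
  - exact: (measurableT_comp (measurable_powR _) my).
  - apply: measurable_funM; last exact: mi.
    exact: (measurableT_comp (measurable_powR _) md).
  - exact: (measurableT_comp (measurable_powR _) md).
  - exact: mi'.
pose f1 (p : R * R) := (hls_weight (x p.1) `|p.1 - p.2|)%:E.
pose f2 (p : R * R) := (hls_weight (x p.2) `|p.1 - p.2|)%:E.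
pose f3 (p : R * R) := (x p.1 * x p.2)%:E.
have mf1 : measurable_fun setT f1 by apply/measurable_EFinP; apply: mw.
have mf2 : measurable_fun setT f2 by apply/measurable_EFinP; apply: mw.
have mf3 : measurable_fun setT f3 by apply/measurable_EFinP; exact: measurable_funM.
have f10 p : (0 <= f1 p)%E by rewrite lee_fin hls_weight_ge0.
have f20 p : (0 <= f2 p)%E by rewrite lee_fin hls_weight_ge0.
have f30 p : (0 <= f3 p)%E by rewrite lee_fin mulr_ge0// ltW.
have xi : (\int[mu]_s (x s)%:E <= 1)%E by [].
pose C := 2 / (1 - 2 * sg) + 2.
have C0 : 0 <= C by rewrite addr_ge0// divr_ge0// ltW.
have Cx : (\int[mu]_s (C * x s)%:E <= C%:E)%E.
  under eq_integral do rewrite EFinM.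
  rewrite ge0_integralZl_EFin//; last 2 first.
  - by move=> s _; rewrite lee_fin ltW.
  - exact/measurable_EFinP.
  by rewrite -[leRHS]mule1; apply: lee_wpmul2l.
have I1 : (\int[mu \x mu]_p f1 p <= C%:E)%E.
  have -> : (\int[mu \x mu]_p f1 p = \int[mu]_s \int[mu]_t f1 (s, t))%E.
    exact: (@fubini_tonelli1 _ _ _ _ R mu mu f1 mf1 f10).
  apply: le_trans Cx; apply: ge0_le_integral => //.
  - by move=> s _; apply: integral_ge0.
  - exact: (@measurable_fun_fubini_tonelli_F _ _ _ _ R mu f1 mf1).
  - by apply/measurable_EFinP; exact: measurable_funM.
  - by move=> s _; exact: (integral_hls_weight s (x0 s)).
have I2 : (\int[mu \x mu]_p f2 p <= C%:E)%E.
  have -> : (\int[mu \x mu]_p f2 p = \int[mu]_t \int[mu]_s f2 (s, t))%E.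
    exact: (@fubini_tonelli2 _ _ _ _ R mu mu f2 mf2 f20).
  apply: le_trans Cx; apply: ge0_le_integral => //.
  - by move=> s _; apply: integral_ge0.
  - exact: (@measurable_fun_fubini_tonelli_G _ _ _ _ R mu f2 mf2).
  - by apply/measurable_EFinP; exact: measurable_funM.
  - move=> t _; rewrite /f2/=; under eq_integral do rewrite distrC.
    exact: (integral_hls_weight t (x0 t)).
have I3 : (\int[mu \x mu]_p f3 p <= 1)%E.
  rewrite (@ge0_integral_tensor _ _ _ _ R mu mu x x)//; last 2 first.
  - by move=> s; rewrite ltW.
  - by move=> s; rewrite ltW.
  apply: (@le_trans _ _ (1 * 1)%E); last by rewrite mul1e.
  by apply: lee_pmul; rewrite ?xi//; apply: integral_ge0 => s _; rewrite lee_fin ltW.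
pose f (p : R * R) := (`|p.1 - p.2| `^ (- (2 * sg)) * (phi p.1 * phi p.2))%:E.
have mf : measurable_fun setT f.
  apply/measurable_EFinP; apply: measurable_funM.
    exact: (measurableT_comp (measurable_powR _) md).
  apply: measurable_funM.
    exact: (measurableT_comp mphi measurable_fst).
  exact: (measurableT_comp mphi measurable_snd).
have f0 p : (0 <= f p)%E.
  by rewrite lee_fin mulr_ge0 ?powR_ge0// mulr_ge0// ltW.
have <- : (\int[mu \x mu]_p f p = \int[mu]_t \int[mu]_s f (s, t))%E.
  exact: (@fubini_tonelli2 _ _ _ _ R mu mu f mf f0).
apply: (@le_trans _ _ (\int[mu \x mu]_p (f1 p + f2 p + f3 p))%E).
  apply: ge0_le_integral => //.
  - by apply: emeasurable_funD => //; exact: emeasurable_funD.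
  - move=> [s t] _; rewrite /f /f1 /f2 /f3/= -!EFinD lee_fin.
    have [->|st] := eqVneq s t.
      rewrite subrr normr0 powR0 ?mul0r; last by rewrite oppr_eq0 mulf_neq0// gt_eqF.
      apply: addr_ge0; last by rewrite mulr_ge0// ltW.
      by apply: addr_ge0; exact: hls_weight_ge0.
    by rewrite !phiE; apply: hls_pointwise => //; rewrite normr_gt0 subr_eq0.
rewrite ge0_integralD//; last 2 first.
- by move=> p _; rewrite adde_ge0.
- exact: emeasurable_funD.
rewrite ge0_integralD//.
apply: (@le_trans _ _ (C%:E + C%:E + 1)%E); first exact: (leeD (leeD I1 I2) I3).
rewrite -!EFinD lee_fin /C; lra.
Qed.

End hls.

(** * Strichartz's inequality for all e between 0 and 1 *)

Section strichartz_range.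
Context {R : realType} (n : nat).
Notation mu := (@lebesgue_measure R).
Notation X := 'rV[R]_n.
Notation L := (@lebesgue_rV R n).
Notation Z := (measurableTypeR R * X)%type.
Notation M := (@spacetime R n).

Lemma oform_le_slices (N : R) (F : Z -> R) (k : R * R -> R) : 0 < N ->
  dominated F -> measurable_fun setT k -> (forall p, 0 <= k p) ->
  (forall s t, s != t -> `|oform L L (at_time s) (at_time t) (@box_weight R n N) 0
     (fun x => F (s, x)) (fun x => F (t, x))| <= k (s, t)) ->
  ((oform M M idZ idZ (@box_weight R n N) 0 F F)%:E <= \int[mu]_t \int[mu]_s (k (s, t))%:E)%E.
Proof.
move=> N0 dF mk k0 Fk.
have mkE : measurable_fun setT (fun p => (k p)%:E) by exact/measurable_EFinP.
have k0E p : (0 <= (k p)%:E)%E by rewrite lee_fin.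
apply: (@le_trans _ _ (`|oform M M idZ idZ (@box_weight R n N) 0 F F|%:E)%E).
  by rewrite lee_fin ler_norm.
apply: (le_trans (normr_oform_slice_le N 0 measurable_idZ (dominated_integrable dF) dF)).
apply: ge0_le_integral => //.
- apply/measurable_EFinP; apply: measurableT_comp => //.
  by apply: (measurable_oform_slice N 0 measurable_idZ (dominated_integrable dF)); case: dF.
- exact: (@measurable_fun_fubini_tonelli_G _ _ _ _ R mu _ mkE k0E).
move=> t _; have Fti := dominatedX_integrable (dominated_slice t dF).
apply: (le_trans (normr_oform_slicel_le N 0 (measurable_at_time t) Fti dF)).
apply: (@ge0_le_integral_except _ t) => //.
- apply/measurable_EFinP; apply: measurableT_comp => //.
  exact: (measurable_oform_slicel N 0 (measurable_at_time t) Fti dF).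
- exact: (measurableT_comp mkE (pair2_measurable t)).
- by move=> s st; rewrite lee_fin Fk.
Qed.

(** The energy bound for a pair of slices does not depend on the two times, so the double time
    integral is the square of the integral of [phi]. *)
Lemma oform_energy (N : R) (F : Z -> R) (phi : R -> R) : 0 < N ->
  dominated F -> measurable_fun setT phi -> (forall s, 0 < phi s) ->
  (forall s, \int[L]_x `|F (s, x)| `^ 2 <= phi s `^ 2) ->
  (\int[mu]_s (phi s)%:E <= 1)%E ->
  oform M M idZ idZ (@box_weight R n N) 0 F F <= @form_cst R n.
Proof.
move=> N0 dF mphi phi0 F2 phi1; rewrite -lee_fin.
have K0 : 0 <= @form_cst R n := le_trans ler01 (@form_cst_ge1 R n).
have mpp : measurable_fun setT (fun p : R * R => phi p.1 * phi p.2).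
  exact: measurable_tensor.
apply: (le_trans (@oform_le_slices N F (fun p => @form_cst R n * (phi p.1 * phi p.2)) N0 dF _ _ _)).
- exact: measurable_funM.
- by move=> p; rewrite mulr_ge0// mulr_ge0// ltW.
- move=> s t _.
  have F2E u : (\int[L]_x (F (u, x) ^+ 2)%:E <= (phi u ^+ 2)%:E)%E.
    rewrite -Rintegral_EFin//; last exact/dominatedX_sqr_integrable/dominated_slice.
    rewrite lee_fin -[X in _ <= X]powR_mulrn ?(ltW (phi0 u))//; apply: le_trans (F2 u).
    rewrite le_eqVlt; apply/orP; left; apply/eqP; apply: eq_Rintegral => x _.
    by rewrite powR_mulrn// real_normK ?num_real.
  apply: (oform_slices_le N0 s t 0 (dominated_slice s dF) (dominated_slice t dF)
    (ltW (phi0 s)) (ltW (phi0 t)) (F2E s) (F2E t)).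
have mppE : measurable_fun setT (fun p : R * R => (@form_cst R n * (phi p.1 * phi p.2))%:E).
  by apply/measurable_EFinP; exact: measurable_funM.
have <- : (\int[mu \x mu]_p (@form_cst R n * (phi p.1 * phi p.2))%:E =
    \int[mu]_t \int[mu]_s (@form_cst R n * (phi s * phi t))%:E)%E.
  apply: (@fubini_tonelli2 _ _ _ _ R mu mu _ mppE) => p.
  by rewrite lee_fin mulr_ge0// mulr_ge0// ltW.
under eq_integral do rewrite EFinM.
rewrite ge0_integralZl_EFin//; last 2 first.
- by move=> p _; rewrite lee_fin mulr_ge0// ltW.
- exact/measurable_EFinP.
rewrite (@ge0_integral_tensor _ _ _ _ R mu mu phi phi)//; last 2 first.
- by move=> s; rewrite ltW.
- by move=> s; rewrite ltW.
rewrite -[leRHS]mule1; apply: lee_wpmul2l; first by rewrite lee_fin.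
apply: (@le_trans _ _ (1 * 1)%E); last by rewrite mul1e.
by apply: lee_pmul; rewrite ?phi1//; apply: integral_ge0 => s _; rewrite lee_fin ltW.
Qed.

(** The slices are controlled in [L^1], so the dispersive bound serves all pairs of distinct times
    and leaves the kernel [|s - t| ^ (- D)] with [D < 1]. *)
Lemma oform_hls (N : R) (F : Z -> R) (phi : R -> R) : 0 < N -> (0 < n)%N -> @hdim R n < 1 ->
  dominated F -> measurable_fun setT phi -> (forall s, 0 < phi s) ->
  (forall s, \int[L]_x `|F (s, x)| `^ 1 <= phi s `^ 1) ->
  (\int[mu]_s (phi s `^ (1 - @hdim R n / 2)^-1)%:E <= 1)%E ->
  oform M M idZ idZ (@box_weight R n N) 0 F F <= @form_cst R n * (4 / (1 - @hdim R n) + 5).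
Proof.
move=> N0 n0 D1 dF mphi phi0 F1 phiA; rewrite -lee_fin.
have K0 : 0 <= @form_cst R n := le_trans ler01 (@form_cst_ge1 R n).
have D0 : 0 < @hdim R n by rewrite divr_gt0// ltr0n.
have sg0 : 0 < @hdim R n / 2 by rewrite divr_gt0.
have sg1 : @hdim R n / 2 < 2^-1 by move: D1; set D := @hdim R n; clearbody D; lra.
have H := hls sg0 sg1 mphi phi0 phiA.
rewrite mulrCA mulfV ?mulr1// in H.
have md : measurable_fun setT (fun p : R * R => `|p.1 - p.2|).
  by apply: measurableT_comp => //; exact: measurable_funB.
pose k (p : R * R) := `|p.1 - p.2| `^ (- @hdim R n) * (phi p.1 * phi p.2).
have mk : measurable_fun setT k.
  apply: measurable_funM; first exact: (measurableT_comp (measurable_powR _) md).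
  exact: measurable_tensor.
have k0 p : 0 <= k p by rewrite mulr_ge0 ?powR_ge0// mulr_ge0// ltW.
apply: (le_trans (@oform_le_slices N F (fun p => @form_cst R n * k p) N0 dF _ _ _)).
- exact: measurable_funM.
- by move=> p; rewrite mulr_ge0.
- move=> s t st.
  apply: (le_trans (oform_dispersive N0 0 st (dominated_slice s dF) (dominated_slice t dF))).
  rewrite /k/= mulrA; apply: ler_pM.
  + by rewrite mulr_ge0 ?powR_ge0// exprn_ge0.
  + by rewrite mulr_ge0// Rintegral_ge0.
  + by apply: ler_wpM2r; [exact: powR_ge0|exact: form_cst_ge8].
  have F1' u : \int[L]_x `|F (u, x)| <= phi u.
    have := F1 u; rewrite powRr1 ?(ltW (phi0 u))//; apply: le_trans.
    rewrite le_eqVlt; apply/orP; left; apply/eqP; apply: eq_Rintegral => x _.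
    by rewrite powRr1.
  by apply: ler_pM => //; rewrite Rintegral_ge0.
have mkE : measurable_fun setT (fun p => (k p)%:E) by exact/measurable_EFinP.
have k0E p : (0 <= (k p)%:E)%E by rewrite lee_fin.
apply: (@le_trans _ _ (\int[mu]_t ((@form_cst R n)%:E * \int[mu]_s (k (s, t))%:E))%E).
  rewrite le_eqVlt; apply/orP; left; apply/eqP; apply: eq_integral => t _.
  under eq_integral do rewrite EFinM.
  rewrite ge0_integralZl_EFin//; exact: (measurableT_comp mkE (pair2_measurable t)).
rewrite ge0_integralZl_EFin//; last 2 first.
- by move=> t _; apply: integral_ge0.
- exact: (@measurable_fun_fubini_tonelli_G _ _ _ _ R mu _ mkE k0E).
rewrite [leRHS](_ : _ = (@form_cst R n)%:E * (4 / (1 - @hdim R n) + 5)%:E)%E; last by rewrite -EFinM.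
by apply: lee_wpmul2l => //; rewrite lee_fin.
Qed.

(* Keel and Tao's estimate: [e = 0] is conservation of energy, [e = 1] is the
   Hardy-Littlewood-Sobolev inequality, and in between the double endpoint
   [hdim * e = 1] is allowed. *)
Lemma oform_strichartz_range (e : R) : (0 < n)%N -> 0 <= e -> e <= 1 ->
  @hdim R n * e <= 1 -> (e = 1 -> @hdim R n < 1) ->
  exists2 C : R, 0 < C & forall (N : R) (F : Z -> R) (phi : R -> R) (a : R),
    0 < N -> 0 < a -> dominated F -> measurable_fun setT phi -> (forall s, 0 <= phi s) ->
    (forall s, \int[L]_x `|F (s, x)| `^ (2 / (1 + e)) <= phi s `^ (2 / (1 + e))) ->
    (\int[mu]_s (phi s `^ (1 - @hdim R n * e / 2)^-1)%:E <= a%:E)%E ->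
    oform M M idZ idZ (@box_weight R n N) 0 F F <= C * a `^ (2 * (1 - @hdim R n * e / 2)).
Proof.
move=> n0 e0 e1 De eD.
have K1 := @form_cst_ge1 R n; have K0 : 0 < @form_cst R n := lt_le_trans ltr01 K1.
have D0 : 0 < @hdim R n by rewrite divr_gt0// ltr0n.
have sg0 : 0 <= @hdim R n * e / 2 by rewrite divr_ge0// mulr_ge0// ltW.
have sg1 : @hdim R n * e / 2 <= 2^-1.
  by move: De; set x := @hdim R n * e; clearbody x; lra.
have p1 : 1 <= 2 / (1 + e) by rewrite ler_pdivlMr; lra.
move: e0; rewrite le_eqVlt => /predU1P[e0|e0].
  exists (4 * @form_cst R n); first by rewrite mulr_gt0.
  move=> N F phi a N0 a0; apply: (oform_rescale p1 sg0 sg1 (ltW K0)) => //.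
  move=> {}F {}phi dF mphi phi0; rewrite -e0.
  rewrite (_ : 2 / (1 + 0) = 2) ?addr0 ?divr1// (_ : (1 - @hdim R n * 0 / 2)^-1 = 1); last first.
    by rewrite mulr0 mul0r subr0 invr1.
  move=> Fp phiA; apply: (oform_energy N0 dF mphi phi0 Fp).
  move: phiA; under eq_integral do rewrite powRr1 ?(ltW (phi0 _))//; exact.
move: e1; rewrite le_eqVlt => /predU1P[e1|e1].
  have D1 := eD e1.
  have C0 : 0 < @form_cst R n * (4 / (1 - @hdim R n) + 5).
    by rewrite mulr_gt0// addr_gt0// divr_gt0// subr_gt0.
  exists (4 * (@form_cst R n * (4 / (1 - @hdim R n) + 5))); first by rewrite mulr_gt0.
  move=> N F phi a N0 a0; apply: (oform_rescale p1 sg0 sg1 (ltW C0)) => //.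
  move=> {}F {}phi dF mphi phi0; rewrite e1 mulr1 (_ : 2 / (1 + 1) = 1); last by field.
  by move=> Fp phiA; exact: (oform_hls N0 n0 D1 dF mphi phi0 Fp).
have C0 := strichartz_cst_gt0 n e0 e1.
exists (4 * strichartz_cst n e); first by rewrite mulr_gt0.
move=> N F phi a N0 a0; apply: (oform_rescale p1 sg0 sg1 (ltW C0)) => //.
by move=> {}F {}phi dF mphi phi0 Fp phiA; exact: (oform_normalized_le N0 n0 e0 e1 De dF mphi phi0 Fp).
Qed.

End strichartz_range.

Lemma powRM3 {R : realType} (x y z q : R) : 0 <= x -> 0 <= y -> 0 <= z ->
  (x * y * z) `^ q = x `^ q * y `^ q * z `^ q.
Proof. by move=> x0 y0 z0; rewrite powRM ?mulr_ge0// powRM. Qed.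

(** * The bound at a fixed time *)

Section jensen.
Context d (T : measurableType d) (R : realType) (m : {measure set T -> \bar R}).

(* Jensen's inequality up to a factor 2, from [f <= de + de ^ (1 - q) f ^ q]. *)
Lemma jensen_le (f rho : T -> R) (c K q : R) : 1 <= q -> 0 < c -> 0 <= K ->
  measurable_fun setT f -> measurable_fun setT rho ->
  (forall x, 0 <= f x) -> (forall x, 0 <= rho x) ->
  (\int[m]_x (rho x)%:E <= c%:E)%E ->
  (\int[m]_x (f x `^ q * rho x)%:E <= K%:E)%E ->
  (\int[m]_x (f x * rho x)%:E <= (2 * (c `^ (1 - q^-1) * K `^ q^-1))%:E)%E.
Proof.
move=> q1 c0 K0 mf mr f0 r0 rc fK.
have q0 : 0 < q by exact: lt_le_trans q1.
have mfq : measurable_fun setT (fun x => f x `^ q * rho x).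
  by apply: measurable_funM => //; exact: (measurableT_comp (measurable_powR _) mf).
have pw de x : 0 < de -> f x * rho x <= de * rho x + de `^ (1 - q) * (f x `^ q * rho x).
  move=> de0; rewrite mulrA -mulrDl; apply: ler_wpM2r => //.
  have [fd|fd] := leP (f x) de.
    by apply: le_trans fd _; rewrite lerDl mulr_ge0 ?powR_ge0.
  apply: (@le_trans _ _ (de `^ (1 - q) * f x `^ q)); last by rewrite lerDr ltW.
  have fx0 : 0 < f x by exact: lt_trans fd.
  rewrite -[leLHS]powRr1 ?(ltW fx0)// -[X in _ `^ X <= _](subrK q) powRD ?(gt_eqF fx0) ?implybT//.
  apply: ler_wpM2r; first exact: powR_ge0.
  by rewrite -opprB !powRN lef_pV2 ?posrE ?powR_gt0// ge0_ler_powR ?nnegrE ?subr_ge0 ?(ltW fd) ?(ltW fx0) ?(ltW de0).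
have bound de : 0 < de -> (\int[m]_x (f x * rho x)%:E <= (de * c + de `^ (1 - q) * K)%:E)%E.
  move=> de0; apply: (@le_trans _ _ (\int[m]_x (de%:E * (rho x)%:E +
      (de `^ (1 - q))%:E * (f x `^ q * rho x)%:E))%E).
    apply: ge0_le_integral => //.
    - by move=> x _; rewrite lee_fin mulr_ge0.
    - by apply/measurable_EFinP; exact: measurable_funM.
    - apply: emeasurable_funD; apply: measurable_funeM; exact/measurable_EFinP.
    - by move=> x _; rewrite -!EFinM -EFinD lee_fin; exact: pw.
  have mrE : measurable_fun setT (fun x => (rho x)%:E) by exact/measurable_EFinP.
  have mfqE : measurable_fun setT (fun x => (f x `^ q * rho x)%:E) by exact/measurable_EFinP.
  have r0E x : (0 <= (rho x)%:E)%E by rewrite lee_fin.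
  have fq0E x : (0 <= (f x `^ q * rho x)%:E)%E by rewrite lee_fin mulr_ge0 ?powR_ge0.
  have de0E : (0 <= de%:E)%E by rewrite lee_fin ltW.
  have dq0E : (0 <= (de `^ (1 - q))%:E)%E by rewrite lee_fin powR_ge0.
  rewrite (ge0_integralD m measurableT (fun x _ => mule_ge0 de0E (r0E x))
    (measurable_funeM _ mrE) (fun x _ => mule_ge0 dq0E (fq0E x)) (measurable_funeM _ mfqE)).
  rewrite (ge0_integralZl_EFin m measurableT (fun x _ => r0E x) mrE (ltW de0)).
  rewrite (ge0_integralZl_EFin m measurableT (fun x _ => fq0E x) mfqE (powR_ge0 _ _)).
  by rewrite EFinD !EFinM; apply: leeD; apply: lee_wpmul2l.
move: K0; rewrite le_eqVlt => /predU1P[K0|K0].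
  rewrite -K0 powR0 ?invr_eq0 ?gt_eqF// !mulr0.
  apply/lee_addgt0Pr => eps eps0; rewrite add0e.
  apply: le_trans (bound (eps / c) _) _; first by rewrite divr_gt0.
  by rewrite -K0 mulr0 addr0 divfK// gt_eqF.
have de0 : 0 < (K / c) `^ q^-1 by rewrite powR_gt0// divr_gt0.
apply: le_trans (bound _ de0) _; rewrite lee_fin.
have Kc0 : 0 < K / c by rewrite divr_gt0.
have E1 : (K / c) `^ q^-1 * c = c `^ (1 - q^-1) * K `^ q^-1.
  rewrite powRM ?(ltW K0) ?invr_ge0 ?(ltW c0)// powR_invr ?(ltW c0)//.
  rewrite powRD ?(gt_eqF c0) ?implybT// powRr1 ?(ltW c0)// powRN; ring.
have E2 : ((K / c) `^ q^-1) `^ (1 - q) * K = c `^ (1 - q^-1) * K `^ q^-1.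
  rewrite -powRrM mulrBr mulr1 mulVf ?gt_eqF// powRD ?(gt_eqF Kc0) ?implybT// -E1.
  rewrite -mulrA; congr *%R; rewrite powR_inv1 ?(ltW Kc0)//.
  by field; rewrite !gt_eqF.
by rewrite E1 E2; lra.
Qed.

End jensen.

(** A geometric sequence of ratio [2 ^ g] stopped at the height [b] is governed by its last term. *)
Lemma sum_cutoff_le {R : realType} (g b : R) (x : R) (m : nat) : 0 < g -> 0 <= b ->
  \sum_(i < m) 2 `^ ((i%:R + x) * g) * (2 `^ (i%:R + x) <= b)%R%:R <= (1 - 2 `^ (- g))^-1 * b `^ g.
Proof.
move=> g0 b0.
have r1 : 2 `^ (- g) < 1 :> R.
  rewrite powRN invf_lt1 ?powR_gt0// [X in X < _](_ : 1 = 1 `^ g); last by rewrite powR1.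
  by apply: gt0_ltr_powR => //; rewrite ?nnegrE//; lra.
have c0 : 0 < (1 - 2 `^ (- g))^-1 by rewrite invr_gt0 subr_gt0.
elim: m b b0 => [|m IH] b b0.
  by rewrite big_ord0 mulr_ge0 ?powR_ge0// ltW.
rewrite big_ord_recr/=; have [bm|bm] := boolP (2 `^ (m%:R + x) <= b); last first.
  by rewrite mulr0 addr0; exact: IH.
rewrite mulr1.
apply: (@le_trans _ _ ((1 - 2 `^ (- g))^-1 * (2 `^ (m%:R + x)) `^ g)); last first.
  apply: ler_wpM2l; first exact: ltW.
  by apply: ge0_ler_powR; rewrite ?nnegrE ?powR_ge0 ?(ltW g0).
apply: (@le_trans _ _ ((1 - 2 `^ (- g))^-1 * (2 `^ (m%:R + x - 1)) `^ g + 2 `^ ((m%:R + x) * g))).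
  rewrite lerD2r; apply: le_trans (IH _ (powR_ge0 _ _)).
  apply: ler_sum => i _; apply: ler_wpM2l; first exact: powR_ge0.
  suff -> : 2 `^ (i%:R + x) <= 2 `^ (m%:R + x - 1) by rewrite lern1 leq_b1.
  apply: ler_powR; first by lra.
  have : (i.+1%:R <= m%:R :> R) by rewrite ler_nat ltn_ord.
  by rewrite -natr1; lra.
rewrite -!powRrM mulrBl mul1r powRD ?pnatr_eq0 ?implybT//.
set y := 2 `^ ((m%:R + x) * g); rewrite mulrCA -{2}(mulr1 y) -mulrDr mulrC.
rewrite le_eqVlt; apply/orP; left; apply/eqP; congr (_ * _).
by field; rewrite subr_eq0 gt_eqF.
Qed.

(** * Exhaustion of space by boxes *)

Section boxes.
Context {R : realType} (n : nat).
Notation X := 'rV[R]_n.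
Notation L := (@lebesgue_rV R n).

Definition box (m : nat) : set X := [set x | forall i, `|x ord0 i| <= m%:R].

Lemma measurable_box m : measurable (box m).
Proof.
rewrite (_ : box m = \bigcap_(i in [set: 'I_n]) [set x : X | `|x ord0 i| <= m%:R]); last first.
  by apply/seteqP; split=> v Bv i; [move=> _; exact: Bv|exact: (Bv i I)].
apply: fin_bigcap_measurable => // i _.
rewrite (_ : [set x : X | _] = (fun x : X => `|x ord0 i|) @^-1` `]-oo, m%:R]%classic).
  rewrite -[X in measurable X]setTI.
  have mi : measurable_fun setT (fun x : X => `|x ord0 i|).
    by apply: measurableT_comp => //; exact: measurable_rV_coord.
  exact: mi.
by apply/seteqP; split => x /=; rewrite in_itv.
Qed.

Lemma box_incr m m' : (m <= m')%N -> box m `<=` box m'.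
Proof. by move=> mm x xm i; apply: le_trans (xm i) _; rewrite ler_nat. Qed.

Lemma box_exhaust x : exists m, box m x.
Proof.
have [m hm] : exists m : nat, forall i : 'I_n, `|x ord0 i| <= m%:R.
  exists (\max_(i < n) Num.bound `|x ord0 i|)%N => i.
  apply: (@le_trans _ _ (Num.bound `|x ord0 i|)%:R); first exact/ltW/archi_boundP.
  by rewrite ler_nat; apply: leq_bigmax.
by exists m.
Qed.

(** The decaying weight is bounded below on a box, so indicators of bounded sets can serve as test
    functions. *)
Lemma dominatedX_box m (A : set X) : measurable A -> A `<=` box m ->
  dominatedX (\1_A : X -> R).
Proof.
move=> mA Am; split; first exact: measurable_indic.
exists ((1 + m%:R ^+ 2) ^+ n); split; first by rewrite exprn_ge0// addr_ge0// sqr_ge0.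
move=> x; rewrite indicE; have [xA|xA] := boolP (x \in A); last first.
  by rewrite normr0 mulr_ge0 ?exprn_ge0 ?addr_ge0 ?sqr_ge0// ltW// decayX_gt0.
rewrite normr1 /decayX /tensorRV -[in (_ + _) ^+ n](card_ord n) -prodr_const -big_split/=.
have xm := Am x; rewrite inE in xA; have {}xm := xm xA.
rewrite -[leLHS](_ : \prod_(i < n) (1 : R) = 1); last by rewrite big1.
apply: ler_prod => i _; rewrite ler01/= /decay /oneDsqr ler_pdivlMr ?mul1r.
  rewrite lerD2l -[x ord0 i ^+ 2]real_normK ?num_real//.
  by apply: lerXn2r; rewrite ?nnegrE.
by rewrite ltr_pwDl// sqr_ge0.
Qed.

End boxes.

(** * Splitting the past at a height *)

Section pointwise.
Context {R : realType} (n : nat).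
Notation mu := (@lebesgue_measure R).
Notation X := 'rV[R]_n.
Notation L := (@lebesgue_rV R n).
Notation Z := (measurableTypeR R * X)%type.
Notation M := (@spacetime R n).
Notation D := (@hdim R n).

Variables (e r : R).
Hypotheses (n0 : (0 < n)%N) (e0 : 0 <= e) (e1 : e <= 1) (De : D * e <= 1) (r2 : 2 < r).
(** With [e = 1 - r / rt] this is [rt']; by the scaling relations the next two are [qt'] and
    [qt' / q]. The parameters [e] and [r] determine all the other exponents. *)
Definition dual_exp : R := r / (r - 1 + e).
Definition time_exp : R := r / (r - D * e).
Definition decay_exp : R := D * (r - 2) / (r - D * e).
Notation P := dual_exp.
Notation p := time_exp.
Notation ka := decay_exp.

Let D0 : 0 < D. Proof. by rewrite divr_gt0// ltr0n. Qed.
Let De0 : 0 <= D * e. Proof. by rewrite mulr_ge0// ltW. Qed.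
Let rDe : 0 < r - D * e. Proof. by move: r2 De; set x := D * e; clearbody x; lra. Qed.
Let re : 0 < r - 1 + e. Proof. by move: r2 e0; lra. Qed.
Let P1 : 1 <= P. Proof. by rewrite /P ler_pdivlMr//; move: e1; lra. Qed.

Variables (F : Z -> R) (phi : R -> R) (t a : R).
Hypotheses (dF : dominated F) (mphi : measurable_fun setT phi) (phi0 : forall s, 0 < phi s).
Hypothesis FP : forall s, \int[L]_x `|F (s, x)| `^ P <= phi s `^ P.

Definition past : set R := [set s | s < t].

Lemma measurable_past : measurable past.
Proof.
rewrite (_ : past = `]-oo, t[%classic)//.
Qed.

(** The integrand on the right of the fixed-time bound; [a] is a bound for its integral. *)
Definition past_weight (s : R) : R := phi s `^ p * (t - s) `^ (- ka) * \1_past s.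

Hypotheses (a0 : 0 < a) (va : (\int[mu]_s (past_weight s)%:E <= a%:E)%E).

Definition past_part (z : Z) : R := F z * \1_(time_set past) z.

(* The exponents make the dispersive estimate of the part of [F] above height [l]
   integrate to [past_weight / l], whatever the values of [phi] and [t - s]. *)
Definition threshold (z : Z) : R :=
  phi z.1 `^ (p - P) * `|F z| `^ (P - 1) * (t - z.1) `^ (D - ka).

(** [past_weight] spread over space in proportion to [|F| ^ P], so that its slice at time [s] has
    integral at most [past_weight s]. *)
Definition past_density (z : Z) : R :=
  phi z.1 `^ (p - P) * (t - z.1) `^ (- ka) * `|F z| `^ P * \1_(time_set past) z.

Let mF : measurable_fun setT F. Proof. by case: dF. Qed.

Let mphi1 q : measurable_fun setT (fun z : Z => phi z.1 `^ q).
Proof.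
apply: (measurableT_comp (measurable_powR _)).
exact: (measurableT_comp mphi (@measurable_fst _ _ (measurableTypeR R) X)).
Qed.

Let mF1 q : measurable_fun setT (fun z : Z => `|F z| `^ q).
Proof. by apply: (measurableT_comp (measurable_powR _)); exact: measurableT_comp. Qed.

Let mt1 q : measurable_fun setT (fun z : Z => (t - z.1) `^ q).
Proof.
apply: (measurableT_comp (measurable_powR _)); exact: measurable_funB.
Qed.

Lemma measurable_threshold : measurable_fun setT threshold.
Proof. by apply: measurable_funM => //; exact: measurable_funM. Qed.

Lemma measurable_past_density : measurable_fun setT past_density.
Proof.
apply: measurable_funM.
  by apply: measurable_funM => //; exact: measurable_funM.
by apply: measurable_indic; apply: measurable_time_set; exact: measurable_past.
Qed.

Lemma threshold_ge0 z : 0 <= threshold z.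
Proof. by rewrite !mulr_ge0 ?powR_ge0. Qed.

Lemma past_density_ge0 z : 0 <= past_density z.
Proof. by rewrite !mulr_ge0 ?powR_ge0. Qed.

Let FPi s : L.-integrable setT (EFin \o (fun x => `|F (s, x)| `^ P)).
Proof.
by apply/dominatedX_integrable/dominatedX_powR => //; exact: (dominated_slice s dF).
Qed.

Let FPE s : (\int[L]_x (`|F (s, x)| `^ P)%:E <= (phi s `^ P)%:E)%E.
Proof. by rewrite -Rintegral_EFin// lee_fin. Qed.

Lemma integral_past_density_slice s :
  (\int[L]_x (past_density (s, x))%:E <= (past_weight s)%:E)%E.
Proof.
rewrite /past_density /past_weight/=.
under eq_integral do rewrite indic_time_set mulrAC EFinM.
rewrite ge0_integralZl_EFin ?mulr_ge0 ?powR_ge0//; last by case/integrableP : (FPi s).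
apply: (@le_trans _ _ ((phi s `^ (p - P) * (t - s) `^ (- ka) * \1_past s)%:E * (phi s `^ P)%:E)%E).
  by apply: lee_wpmul2l => //; rewrite lee_fin !mulr_ge0 ?powR_ge0.
have phiE : phi s `^ p = phi s `^ (p - P) * phi s `^ P.
  by rewrite -powRD ?(gt_eqF (phi0 s)) ?implybT// subrK.
rewrite -EFinM lee_fin phiE.
by rewrite le_eqVlt; apply/orP; left; apply/eqP; ring.
Qed.

Lemma integral_past_density : (\int[(mu \x L)%E]_z (past_density z)%:E <= a%:E)%E.
Proof.
have mE : measurable_fun setT (fun z : Z => (past_density z)%:E).
  by apply/measurable_EFinP; exact: measurable_past_density.
have E0 (z : Z) : (0 <= (past_density z)%:E)%E by rewrite lee_fin past_density_ge0.
rewrite (@fubini_tonelli1 _ _ _ _ R mu L _ mE E0); apply: le_trans va.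
apply: ge0_le_integral => //.
- by move=> s _; apply: integral_ge0.
- exact: (@measurable_fun_fubini_tonelli_F _ _ _ _ R L _ mE E0).
- apply/measurable_EFinP; apply: measurable_funM; last exact: measurable_indic measurable_past.
  apply: measurable_funM; first exact: (measurableT_comp (measurable_powR _) mphi).
  by apply: (measurableT_comp (measurable_powR _)); exact: measurable_funB.
- by move=> s _; exact: integral_past_density_slice.
Qed.

Variables (N : R).
Hypothesis N0 : 0 < N.
Notation w := (@box_weight R n N).

Definition above (l : R) : set Z := [set z | l < threshold z].

Lemma measurable_above l : measurable (above l).
Proof.
rewrite (_ : above l = threshold @^-1` `]l, +oo[%classic).
  by rewrite -[X in measurable X]setTI; exact: measurable_threshold.
by apply/seteqP; split => z /=; rewrite in_itv/= andbT.
Qed.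

Lemma dominated_past : dominated past_part.
Proof. by apply: dominated_restrict => //; apply: measurable_time_set; exact: measurable_past. Qed.

(** As in Markov's inequality, [|F| <= |F| threshold / l] above the height [l]. The factor
    [threshold] completes [|F|] to [|F| ^ P], and with the dispersive factor [(t - s) ^ (- D)]
    exactly [past_weight / l] remains. *)
Lemma oform_above_le (l b : R) (g : X -> R) : 0 < l -> dominatedX g ->
  `|oform M L idZ (at_time t) w b (fun z => past_part z * \1_(above l) z) g| <=
  8 ^+ n * (a / l) * \int[L]_x `|g x|.
Proof.
move=> l0 dg; have gi := dominatedX_integrable dg.
have dF1 := dominated_restrict dominated_past (measurable_above l).
rewrite -lee_fin; apply: (le_trans (normr_oform_slicel_le N b (measurable_at_time t) gi dF1)).
have mv : measurable_fun setT past_weight.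
  apply: measurable_funM; last exact: measurable_indic measurable_past.
  apply: measurable_funM; first exact: (measurableT_comp (measurable_powR _) mphi).
  by apply: (measurableT_comp (measurable_powR _)); exact: measurable_funB.
have v0 s : 0 <= past_weight s by rewrite !mulr_ge0 ?powR_ge0.
set Ig := \int[L]_x `|g x|; have Ig0 : 0 <= Ig by exact: Rintegral_ge0.
pose c : R := 8 ^+ n * l^-1 * Ig.
have c0 : 0 <= c by rewrite mulr_ge0// mulr_ge0 ?invr_ge0 ?(ltW l0)// exprn_ge0.
apply: (@le_trans _ _ (\int[mu]_s (c%:E * (past_weight s)%:E))%E).
  apply: (@ge0_le_integral_except _ t) => //.
  - by move=> s; rewrite mule_ge0// lee_fin.
  - apply/measurable_EFinP; apply: measurableT_comp => //.
    exact: (measurable_oform_slicel N b (measurable_at_time t) gi dF1).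
  - by apply: measurable_funeM; exact/measurable_EFinP.
  move=> s st; rewrite -EFinM lee_fin.
  apply: (le_trans (oform_dispersive N0 b st (dominated_slice s dF1) dg)).
  rewrite -/Ig mulrA [leRHS](_ : _ = 8 ^+ n * (l^-1 * past_weight s) * Ig); last by rewrite /c; ring.
  apply: ler_wpM2r => //; rewrite -mulrA; apply: ler_wpM2l; first exact: exprn_ge0.
  have [ts|ts] := boolP (s < t); last first.
    have -> : \int[L]_x `|past_part (s, x) * \1_(above l) (s, x)| = 0.
      rewrite /past_part; under eq_Rintegral => x _.
        rewrite indic_time_set indicE memNset ?mulr0 ?mul0r ?normr0; last exact/negP.
        over.
      by rewrite Rintegral_cst// mul0r.
    by rewrite mulr0 mulr_ge0// invr_ge0 ltW.
  have t0 : 0 < t - s by rewrite subr_gt0.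
  have -> : `|s - t| = t - s by rewrite distrC gtr0_norm.
  have bx : \int[L]_x `|past_part (s, x) * \1_(above l) (s, x)| <=
      l^-1 * (phi s `^ p * (t - s) `^ (D - ka)).
    pose c' : R := l^-1 * (phi s `^ (p - P) * (t - s) `^ (D - ka)).
    have c'0 : 0 <= c' by rewrite mulr_ge0 ?invr_ge0 ?(ltW l0)// mulr_ge0 ?powR_ge0.
    apply: (@le_trans _ _ (\int[L]_x (c' * `|F (s, x)| `^ P))).
      apply: le_Rintegral => //.
      - exact: (integrable_norm (dominatedX_integrable (dominated_slice s dF1))).
      - by have := integrableZl measurableT c' (FPi s); apply: eq_integrable.
      move=> x _; rewrite indicE; have [h|h] := boolP (_ \in above l); last first.
        by rewrite mulr0 normr0 mulr_ge0 ?powR_ge0.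
      rewrite mulr1 /past_part indic_time_set indicE mem_set// mulr1.
      move: h; rewrite inE /above/= => h.
      have -> : c' * `|F (s, x)| `^ P = `|F (s, x)| * (threshold (s, x) / l).
        have [Fz|Fz] := eqVneq (F (s, x)) 0.
          by rewrite Fz normr0 powR0 ?mulr0 ?mul0r// gt_eqF// (lt_le_trans ltr01).
        have Fn : 0 < `|F (s, x)| by rewrite normr_gt0.
        have FE : `|F (s, x)| `^ P = `|F (s, x)| * `|F (s, x)| `^ (P - 1).
          by rewrite -[X in X * _]powRr1// -powRD ?(gt_eqF Fn) ?implybT// subrKC.
        by rewrite FE /c' /threshold/=; ring.
      by rewrite ler_peMr// ler_pdivlMr// mul1r ltW.
    rewrite RintegralZl//; apply: (@le_trans _ _ (c' * phi s `^ P)).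
      exact: ler_wpM2l.
    have -> : phi s `^ p = phi s `^ (p - P) * phi s `^ P.
      by rewrite -powRD ?(gt_eqF (phi0 s)) ?implybT// subrK.
    rewrite /c'.
    by rewrite le_eqVlt; apply/orP; left; apply/eqP; ring.
  apply: (@le_trans _ _ ((t - s) `^ (- D) * (l^-1 * (phi s `^ p * (t - s) `^ (D - ka))))).
    by apply: ler_wpM2l => //; exact: powR_ge0.
  rewrite /past_weight indicE mem_set// mulr1.
  have -> : (t - s) `^ (- ka) = (t - s) `^ (- D) * (t - s) `^ (D - ka).
    by rewrite -powRD ?(gt_eqF t0) ?implybT// addKr.
  by rewrite le_eqVlt; apply/orP; left; apply/eqP; ring.
rewrite ge0_integralZl_EFin//; last 2 first.
- by move=> s _; rewrite lee_fin.
- exact/measurable_EFinP.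
apply: (@le_trans _ _ (c%:E * a%:E)%E); first by apply: lee_wpmul2l.
by rewrite -EFinM lee_fin /c; rewrite le_eqVlt; apply/orP; left; apply/eqP; ring.
Qed.

Definition strichartz_bound (C : R) : Prop :=
  forall (N : R) (F : Z -> R) (phi : R -> R) (a : R),
    0 < N -> 0 < a -> dominated F -> measurable_fun setT phi -> (forall s, 0 <= phi s) ->
    (forall s, \int[L]_x `|F (s, x)| `^ (2 / (1 + e)) <= phi s `^ (2 / (1 + e))) ->
    (\int[mu]_s (phi s `^ (1 - D * e / 2)^-1)%:E <= a%:E)%E ->
    oform M M idZ idZ (@box_weight R n N) 0 F F <= C * a `^ (2 * (1 - D * e / 2)).

Variable Cs : R.
Hypotheses (Cs0 : 0 < Cs) (Str : strichartz_bound Cs).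

Section below.
Variable l : R.
Let F2 (z : Z) : R := past_part z * \1_(~` above l) z.
Let dens (z : Z) : R := past_density z * threshold z `^ (r - 2) * \1_(~` above l) z.
Let H (s : R) : R := \int[L]_x dens (s, x).
(** [E1] and [E2] are the exponents for which [psi] bounds the slices of [F2] in [L^S]; they are
    dictated by the powers of [phi] and [t - s] in [threshold] and [past_density]. *)
Let E1 : R := r - p * (r - 1).
Let E2 : R := ka * (r - 1) - D * (r - 2).
Let psi (s : R) : R := 2 * (phi s `^ E1 * (t - s) `^ E2 * H s) `^ 2^-1 * \1_past s.
Let S : R := 2 / (1 + e).

Let dens0 z : 0 <= dens z.
Proof. by rewrite mulr_ge0// mulr_ge0 ?powR_ge0 ?past_density_ge0. Qed.

Let mdens : measurable_fun setT dens.
Proof.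
apply: measurable_funM; last exact: measurable_indic (measurableC (measurable_above l)).
apply: measurable_funM; first exact: measurable_past_density.
exact: (measurableT_comp (measurable_powR _) measurable_threshold).
Qed.

Let dF2 : dominated F2.
Proof. exact: dominated_restrict dominated_past (measurableC (measurable_above l)). Qed.

Let densi s : L.-integrable setT (EFin \o (fun x => dens (s, x))).
Proof.
pose c := phi s `^ (p - P) * (t - s) `^ (- ka) * l `^ (r - 2).
apply: (@le_integrable_real _ _ _ _ _ _ (fun x => c * `|F (s, x)| `^ P)) => //.
- exact: (measurable_fun_slice s mdens).
- move=> x _; rewrite ger0_norm// /dens /past_density/=.
  have -> : c * `|F (s, x)| `^ P = phi s `^ (p - P) * (t - s) `^ (- ka) * `|F (s, x)| `^ P * 1 * l `^ (r - 2) * 1.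
    by rewrite /c; ring.
  have K0 : 0 <= phi s `^ (p - P) * (t - s) `^ (- ka) * `|F (s, x)| `^ P by rewrite !mulr_ge0 ?powR_ge0.
  move: K0; set K := _ * _ `^ P => K0.
  rewrite [X in _ * X]indicE; have [h|h] := boolP (_ \in _); last first.
    by rewrite mulr0 mulr_ge0// mulr_ge0 ?powR_ge0// mulr1.
  rewrite !mulr1; apply: ler_pM; rewrite ?mulr_ge0 ?powR_ge0//.
    by rewrite ler_piMr// indicE; case: (_ \in _).
  have tl : threshold (s, x) <= l.
    by move: h; rewrite inE /above/= => /negP; rewrite -leNgt.
  apply: ge0_ler_powR; rewrite ?nnegrE ?threshold_ge0//; first by move: r2; lra.
  exact: le_trans (threshold_ge0 _) tl.
- by have := integrableZl measurableT c (FPi s); apply: eq_integrable.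
Qed.

Let H0 s : 0 <= H s. Proof. by apply: Rintegral_ge0 => x _. Qed.

Let mH : measurable_fun setT H.
Proof. exact: (@measurable_Rintegral_param _ _ _ _ R L dens mdens). Qed.

Let HE s : (H s)%:E = (\int[L]_x (dens (s, x))%:E)%E.
Proof. by rewrite /H Rintegral_EFin. Qed.

Let psi0 s : 0 <= psi s.
Proof. by rewrite mulr_ge0// mulr_ge0 ?powR_ge0. Qed.

Let mpsi : measurable_fun setT psi.
Proof.
apply: measurable_funM; last exact: measurable_indic measurable_past.
apply: measurable_funM => //; apply: (measurableT_comp (measurable_powR _)).
apply: measurable_funM => //; apply: measurable_funM.
  exact: (measurableT_comp (measurable_powR _) mphi).
by apply: (measurableT_comp (measurable_powR _)); exact: measurable_funB.
Qed.

Let PE : P * (r - 1 + e) = r. Proof. by rewrite /P divfK// gt_eqF. Qed.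
Let pE : p * (r - D * e) = r. Proof. by rewrite /p divfK// gt_eqF. Qed.
Let kE : ka * (r - D * e) = D * (r - 2). Proof. by rewrite /ka divfK// gt_eqF. Qed.
Let e10 : 0 < 1 + e. Proof. by move: e0; lra. Qed.
Let S0 : 0 < S. Proof. exact: divr_gt0. Qed.
Let S1 : 1 <= S. Proof. by rewrite /S ler_pdivlMr//; move: e1; lra. Qed.
Let SP : P <= S.
Proof.
rewrite /S /P ler_pdivrMr// mulrAC ler_pdivlMr// -subr_ge0.
rewrite (_ : 2 * (r - 1 + e) - r * (1 + e) = (r - 2) * (1 - e)); last by ring.
by rewrite mulr_ge0// subr_ge0// ltW.
Qed.

(** Jensen's inequality with exponent [1 + e] on the slice, for the density [|F| ^ P / phi ^ P]. It
    fits because [(S - P) (1 + e) = (P - 1) (r - 2)]: the power of [|F|] that arises is the one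
    contained in [threshold ^ (r - 2)]. *)
Let slice_le s : \int[L]_x `|F2 (s, x)| `^ S <= psi s `^ S.
Proof.
have [ts|ts] := boolP (s < t); last first.
  rewrite (_ : \int[L]_x `|F2 (s, x)| `^ S = 0) ?powR_ge0//.
  under eq_Rintegral => x _.
    rewrite /F2 /past_part indic_time_set indicE memNset; last exact/negP.
    rewrite mulr0 mul0r normr0 powR0 ?gt_eqF//; over.
  by rewrite Rintegral_cst// mul0r.
have t0 : 0 < t - s by rewrite subr_gt0.
pose rho x := phi s `^ (- P) * `|F (s, x)| `^ P.
pose f x := `|F (s, x)| `^ (S - P) * \1_(~` above l) ((s, x) : Z).
pose k := phi s `^ (- p - (p - P) * (r - 2)) * (t - s) `^ (ka - (D - ka) * (r - 2)).
have mFs q : measurable_fun setT (fun x => `|F (s, x)| `^ q).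
  exact: (measurable_fun_slice s (mF1 q)).
have mrho : measurable_fun setT rho by exact: measurable_funM.
have mf : measurable_fun setT f.
  apply: measurable_funM => //.
  exact: (measurable_fun_slice s (measurable_indic (R := R) (measurableC (measurable_above l)))).
have rho0 x : 0 <= rho x by rewrite mulr_ge0 ?powR_ge0.
have f0 x : 0 <= f x by rewrite mulr_ge0 ?powR_ge0.
have k0 : 0 <= k by rewrite mulr_ge0 ?powR_ge0.
have rho1 : (\int[L]_x (rho x)%:E <= 1%:E)%E.
  under eq_integral do rewrite EFinM.
  rewrite ge0_integralZl_EFin ?powR_ge0//; last by case/integrableP : (FPi s).
  apply: (@le_trans _ _ ((phi s `^ (- P))%:E * (phi s `^ P)%:E)%E).
    by apply: lee_wpmul2l => //; rewrite lee_fin powR_ge0.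
  by rewrite -EFinM powRN mulVf// gt_eqF// powR_gt0.
have fE x : f x `^ (1 + e) * rho x = k * dens (s, x).
  rewrite /f /rho /k /dens /past_density/= [\1_(time_set past) _]indicE mem_set// mulr1.
  rewrite indicE; case: (_ \in ~` above l); last first.
    by rewrite !mulr0 powR0 ?mul0r// gt_eqF.
  rewrite !mulr1 /threshold/= -powRrM.
  have -> : (S - P) * (1 + e) = (P - 1) * (r - 2).
    rewrite /S mulrBl divfK ?gt_eqF//; move: PE; set x0 := P; clearbody x0 => PE'.
    by rewrite -(addrK (x0 * (r - 1 + e)) (2 - _)) {2}PE'; ring.
  rewrite !powRM ?mulr_ge0 ?powR_ge0// -!powRrM.
  have ph : phi s `^ (- p - (p - P) * (r - 2)) * phi s `^ (p - P) * phi s `^ ((p - P) * (r - 2)) = phi s `^ (- P).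
    by rewrite -!powRD ?(gt_eqF (phi0 s)) ?implybT//; congr (_ `^ _); ring.
  have ta : (t - s) `^ (ka - (D - ka) * (r - 2)) * (t - s) `^ (- ka) * (t - s) `^ ((D - ka) * (r - 2)) = 1.
    by rewrite -!powRD ?(gt_eqF t0) ?implybT// -[RHS](powRr0 (t - s)); congr (_ `^ _); ring.
  rewrite -ph; set x1 := `|F (s, x)| `^ _; set x2 := `|F (s, x)| `^ P.
  set y1 := phi s `^ _ in ph *; set y2 := phi s `^ (p - P) in ph *; set y3 := phi s `^ _ in ph *.
  move: ta; set t1 := (t - s) `^ _; set t2 := (t - s) `^ (- ka); set t3 := (t - s) `^ _ => ta.
  transitivity (x1 * (y1 * y2 * y3 * x2) * (t1 * t2 * t3)); first by rewrite ta mulr1.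
  by ring.
have fK : (\int[L]_x (f x `^ (1 + e) * rho x)%:E <= (k * H s)%:E)%E.
  under eq_integral do rewrite fE EFinM.
  rewrite ge0_integralZl_EFin//; last 2 first.
  - by move=> x _; rewrite lee_fin.
  - by case/integrableP : (densi s).
  by rewrite [leRHS]EFinM HE.
have J := jensen_le (_ : 1 <= 1 + e) ltr01 (mulr_ge0 k0 (H0 s)) mf mrho f0 rho0 rho1 fK.
have {}J := J ltac:(by move: e0; lra).
rewrite -lee_fin Rintegral_EFin//; last first.
  by apply/dominatedX_integrable/dominatedX_powR => //; exact: (dominated_slice s dF2).
have -> : (\int[L]_x (`|F2 (s, x)| `^ S)%:E = \int[L]_x ((phi s `^ P)%:E * (f x * rho x)%:E))%E.
  apply: eq_integral => x _; rewrite -EFinM; congr EFin.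
  rewrite /F2 /past_part indic_time_set [\1_past s]indicE mem_set// mulr1 /f /rho.
  rewrite indicE; case: (_ \in _); last by rewrite !mulr0 normr0 powR0 ?gt_eqF// mul0r mulr0.
  rewrite !mulr1.
  have pp : phi s `^ P * phi s `^ (- P) = 1 by rewrite powRN mulfV// gt_eqF// powR_gt0.
  have FS : `|F (s, x)| `^ S = `|F (s, x)| `^ (S - P) * `|F (s, x)| `^ P.
    have [->|Fz] := eqVneq (F (s, x)) 0.
      have P0 : P != 0 by rewrite gt_eqF// (lt_le_trans ltr01).
      by rewrite normr0 !(powR0 P0) mulr0 powR0// gt_eqF.
    by rewrite -powRD ?normr_eq0 ?(negbTE Fz) ?implybT// subrK.
  by rewrite FS -[LHS]mulr1 -pp; ring.
rewrite ge0_integralZl_EFin ?powR_ge0//; last 2 first.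
- by move=> x _; rewrite lee_fin mulr_ge0.
- by apply/measurable_EFinP; exact: measurable_funM.
apply: le_trans (lee_wpmul2l _ J) _; first by rewrite lee_fin powR_ge0.
rewrite -EFinM lee_fin powR1 mul1r /psi indicE mem_set// mulr1.
have S2 : (1 + e)^-1 = S / 2 by rewrite /S; field; rewrite gt_eqF.
rewrite S2 (@powRM _ 2 _ S) ?powR_ge0// -powRrM (mulrC 2^-1).
have -> : phi s `^ P = (phi s `^ (P * (1 + e))) `^ (S / 2).
  by rewrite -powRrM -S2 mulfK// gt_eqF.
rewrite mulrCA -powRM ?powR_ge0 ?(mulr_ge0 k0 (H0 s))//.
have -> : phi s `^ (P * (1 + e)) * (k * H s) = phi s `^ E1 * (t - s) `^ E2 * H s.
  rewrite /k !mulrA -powRD ?(gt_eqF (phi0 s)) ?implybT//; congr (_ `^ _ * _ `^ _ * _).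
    rewrite /E1; move: PE; set x0 := P; clearbody x0 => PE'.
    by rewrite (_ : r - p * (r - 1) = x0 * (r - 1 + e) - p * (r - 1)); [ring|rewrite PE'].
  by rewrite /E2; ring.
apply: ler_wpM2r; first exact: powR_ge0.
by rewrite -[leLHS]powRr1// ler_powR//; lra.
Qed.

Let q2 : R := 2 - D * e.

(** Prepares Jensen's inequality in time with exponent [q2 = 2 - D e]. Since
    [q2 / (1 - D e / 2) = 2], the square of [psi] appears, and the values of [p] and [ka] make all
    powers of [phi] and [t - s] cancel. *)
Let slice_sqr s : (psi s `^ (1 - D * e / 2)^-1 * phi s `^ (- p) * (t - s) `^ ka) `^ q2 * past_weight s <=
  4 * H s.
Proof.
have q20 : 0 < q2 by rewrite /q2; move: De; set x := D * e; clearbody x; lra.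
rewrite /past_weight indicE; have [ts|ts] := boolP (s \in past); last first.
  by rewrite !mulr0 mulr_ge0.
rewrite mulr1; have t0 : 0 < t - s by move: ts; rewrite inE /past/= subr_gt0.
rewrite powRM3 ?powR_ge0// -!powRrM.
have -> : (1 - D * e / 2)^-1 * q2 = 2.
  by rewrite /q2; field; rewrite gt_eqF//; move: De; set x := D * e; clearbody x; lra.
rewrite /psi indicE ts mulr1 powRM ?powR_ge0// -powRrM mulVf// powRr1; last first.
  by rewrite mulr_ge0// mulr_ge0 ?powR_ge0.
have -> : 2 `^ 2 = 4 :> R by rewrite powR_mulrn//; ring.
have ph : phi s `^ E1 * phi s `^ (- p * q2) * phi s `^ p = 1.
  rewrite -!powRD ?(gt_eqF (phi0 s)) ?implybT// -[RHS](powRr0 (phi s)); congr (_ `^ _).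
  rewrite /E1 /q2; move: pE; set x0 := p; clearbody x0 => pE'; by rewrite (_ : r - x0 * (r - 1) = x0 * (r - D * e) - x0 * (r - 1)); [ring|rewrite pE'].
have ta : (t - s) `^ E2 * (t - s) `^ (ka * q2) * (t - s) `^ (- ka) = 1.
  rewrite -!powRD ?(gt_eqF t0) ?implybT// -[RHS](powRr0 (t - s)); congr (_ `^ _).
  rewrite /E2 /q2; move: kE; set x0 := ka; clearbody x0 => kE'; rewrite -kE'; ring.
rewrite le_eqVlt; apply/orP; left; apply/eqP.
transitivity (4 * H s * ((phi s `^ E1 * phi s `^ (- p * q2) * phi s `^ p) *
  ((t - s) `^ E2 * (t - s) `^ (ka * q2) * (t - s) `^ (- ka)))); first by ring.
by rewrite ph ta !mulr1.
Qed.

(** Jensen's inequality in time against [past_weight], of mass at most [a], bounds the time norm of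
    [psi]; Strichartz's inequality then brings in the power [q2]. The result is linear in [J], which
    is what allows summation over heights. *)
Lemma oform_below_le (J : R) :
  (\int[(mu \x L)%E]_z (past_density z * threshold z `^ (r - 2) * \1_(~` above l) z)%:E <= J%:E)%E ->
  oform M M idZ idZ w 0 (fun z => past_part z * \1_(~` above l) z)
    (fun z => past_part z * \1_(~` above l) z) <= 16 * Cs * a `^ (1 - D * e) * J.
Proof.
move=> HJ; rewrite -/F2.
have mE : measurable_fun setT (fun z : Z => (dens z)%:E) by exact/measurable_EFinP.
have E0 (z : Z) : (0 <= (dens z)%:E)%E by rewrite lee_fin.
have HJ' : (\int[mu]_s (H s)%:E <= J%:E)%E.
  by under eq_integral do rewrite HE; rewrite -(@fubini_tonelli1 _ _ _ _ R mu L _ mE E0).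
have J0 : 0 <= J by rewrite -lee_fin; apply: le_trans HJ'; apply: integral_ge0 => s _; rewrite lee_fin.
set cc := 16 * Cs * a `^ (1 - D * e).
have cc0 : 0 < cc by rewrite mulr_gt0 ?powR_gt0// mulr_gt0.
(* [J] may vanish, whereas Strichartz's inequality asks for a positive bound on the time norm. *)
suff main J' : J < J' -> oform M M idZ idZ w 0 F2 F2 <= cc * J'.
  apply/ler_addgt0Pr => eps eps0; have := main (J + eps / cc).
  by rewrite ltrDl divr_gt0// mulrDr mulrCA mulfV ?mulr1 ?gt_eqF//; exact.
move=> JJ'; have J'0 : 0 < J' by exact: le_lt_trans JJ'.
have q21 : 1 <= q2 by rewrite /q2; move: De; set x := D * e; clearbody x; lra.
have q20 : 0 < q2 by exact: lt_le_trans ltr01 q21.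
pose f s := psi s `^ (1 - D * e / 2)^-1 * phi s `^ (- p) * (t - s) `^ ka.
have mv : measurable_fun setT past_weight.
  apply: measurable_funM; last exact: measurable_indic measurable_past.
  apply: measurable_funM; first exact: (measurableT_comp (measurable_powR _) mphi).
  by apply: (measurableT_comp (measurable_powR _)); exact: measurable_funB.
have v0 s : 0 <= past_weight s by rewrite !mulr_ge0 ?powR_ge0.
have mf : measurable_fun setT f.
  apply: measurable_funM; last first.
    by apply: (measurableT_comp (measurable_powR _)); exact: measurable_funB.
  apply: measurable_funM; first exact: (measurableT_comp (measurable_powR _) mpsi).
  exact: (measurableT_comp (measurable_powR _) mphi).
have f0 s : 0 <= f s by rewrite !mulr_ge0 ?powR_ge0.
have fK : (\int[mu]_s (f s `^ q2 * past_weight s)%:E <= (4 * J')%:E)%E.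
  apply: (@le_trans _ _ (\int[mu]_s (4%:E * (H s)%:E))%E).
    apply: ge0_le_integral => //.
    - by move=> s _; rewrite lee_fin mulr_ge0 ?powR_ge0.
    - apply/measurable_EFinP; apply: measurable_funM => //.
      exact: (measurableT_comp (measurable_powR _) mf).
    - by apply: measurable_funeM; exact/measurable_EFinP.
    - by move=> s _; rewrite -EFinM lee_fin; exact: slice_sqr.
  rewrite ge0_integralZl_EFin//; last 2 first.
  - by move=> s _; rewrite lee_fin.
  - exact/measurable_EFinP.
  rewrite EFinM; apply: lee_wpmul2l => //; apply: le_trans HJ' _.
  by rewrite lee_fin ltW.
have J40 : 0 <= 4 * J' by rewrite mulr_ge0// ltW.
have JJ := @jensen_le _ _ R (@lebesgue_measure R) _ _ _ _ _ q21 a0 J40 mf mv f0 v0 va fK.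
set a' := 2 * (a `^ (1 - q2^-1) * (4 * J') `^ q2^-1) in JJ.
have a'0 : 0 < a' by rewrite mulr_gt0// mulr_gt0 ?powR_gt0// mulr_gt0.
have psia : (\int[mu]_s (psi s `^ (1 - D * e / 2)^-1)%:E <= a'%:E)%E.
  apply: le_trans JJ; rewrite le_eqVlt; apply/orP; left; apply/eqP.
  apply: eq_integral => s _; congr EFin; rewrite /f /past_weight.
  have [ts|ts] := boolP (s \in past); last first.
    rewrite indicE (negbTE ts) !mulr0 /psi indicE (negbTE ts) mulr0 powR0//.
    rewrite invr_eq0 gt_eqF//; move: De; set x := D * e; clearbody x; lra.
  rewrite indicE ts mulr1; have t0 : 0 < t - s by move: ts; rewrite inE /past/= subr_gt0.
  rewrite !powRN; field.
  by rewrite !gt_eqF// powR_gt0.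
have Q := Str N0 a'0 dF2 mpsi psi0 slice_le psia.
apply: (le_trans Q).
have -> : 2 * (1 - D * e / 2) = q2 by rewrite /q2; field.
rewrite /a' !powRM ?mulr_ge0 ?powR_ge0 ?(ltW J'0)// -!powRrM.
rewrite mulVf ?gt_eqF// !powRr1 ?(ltW J'0)//.
have -> : (1 - q2^-1) * q2 = 1 - D * e by rewrite mulrBl mul1r mulVf ?gt_eqF// /q2; ring.
rewrite /cc [leRHS](_ : _ = Cs * (4 * (a `^ (1 - D * e) * (4 * J')))); last by ring.
apply: ler_wpM2l; first exact: ltW.
apply: ler_wpM2r; first by rewrite mulr_ge0 ?powR_ge0.
by apply: pow2_le4; rewrite /q2 gerBl.
Qed.

End below.

End pointwise.

(** * Level sets of the solution at one time *)

Section levels.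
Context {R : realType} (n : nat).
Notation mu := (@lebesgue_measure R).
Notation X := 'rV[R]_n.
Notation L := (@lebesgue_rV R n).
Notation Z := (measurableTypeR R * X)%type.
Notation M := (@spacetime R n).
Notation D := (@hdim R n).

(* [u] is the value at time [t] of the oscillatory integral of [F] over [s < t]
   with the frequency cut-off removed; this weak form is all that is used. *)
Definition represents (t b : R) (F : Z -> R) (u : X -> R) : Prop :=
  forall (g : X -> R) (B : R), dominatedX g ->
    (forall N : R, 0 < N ->
       `|oform M L idZ (at_time t) (@box_weight R n N) b (past_part F t) g| <= B) ->
    \int[L]_x (u x * g x) <= B.

Definition signed_indic (u : X -> R) (E : set X) (x : X) : R :=
  \1_E x * (2 * \1_[set x | 0 <= u x] x - 1).

Lemma signed_indicE u E x : u x * signed_indic u E x = `|u x| * \1_E x.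
Proof.
rewrite /signed_indic; set k := \1_E x; rewrite [in LHS]indicE.
have [h|h] := leP 0 (u x).
  by rewrite (mem_set (_ : [set x | 0 <= u x] x))//= mulr1n ger0_norm//; ring.
rewrite memNset; last by apply/negP; rewrite -ltNge.
by rewrite ltr0_norm//= mulr0n; ring.
Qed.

Lemma normr_signed_indic u E x : `|signed_indic u E x| = \1_E x.
Proof.
rewrite /signed_indic !indicE normrM; have -> : `|2 * (x \in [set x | 0 <= u x])%:R - 1| = 1 :> R.
  case: (_ \in _); last by rewrite mulr0 sub0r normrN normr1.
  by rewrite mulr1 (_ : 2 - 1 = 1 :> R) ?normr1//; ring.
by rewrite mulr1; case: (_ \in _); rewrite ?normr1 ?normr0.
Qed.

Lemma dominatedX_signed_indic m u E : measurable_fun setT u -> measurable E ->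
  E `<=` box m -> dominatedX (signed_indic u E).
Proof.
move=> mu_ mE Em; have [_ [K [K0 HK]]] := dominatedX_box mE Em; split.
  apply: measurable_funM; first exact: measurable_indic.
  apply: measurable_funB => //; apply: measurable_funM => //.
  apply: measurable_indic.
  rewrite (_ : [set x | _] = u @^-1` `[0, +oo[%classic).
    by rewrite -[X in measurable X]setTI; exact: mu_.
  by apply/seteqP; split => x /=; rewrite in_itv/= andbT.
exists K; split => // x; rewrite normr_signed_indic; apply: le_trans (HK x).
exact: ler_norm.
Qed.

(** The first term on the right is absorbed by half of the left-hand side; dividing by [sqrt v] and
    squaring does the rest. *)
Lemma level_bound (l v P K : R) : 0 < l -> 0 <= v -> 0 <= K -> 0 <= P ->
  l * v <= l / 2 * v + K * (P * Num.sqrt v) -> v <= 4 * K ^+ 2 * l ^- 2 * P ^+ 2.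
Proof.
move=> l0 v0 K0 P0; have s0 := sqrtr_ge0 v; rewrite -{1 2 4}(sqr_sqrtr v0).
move: s0; set s := Num.sqrt v => s0 h.
have ls : l * s <= 2 * K * P.
  have [->|sn] := eqVneq s 0; first by rewrite mulr0 mulr_ge0// mulr_ge0.
  have sp : 0 < s by rewrite lt_def sn.
  by rewrite -(ler_pM2r sp); move: h; lra.
have -> : 4 * K ^+ 2 * l ^- 2 * P ^+ 2 = (2 * K * P / l) ^+ 2.
  by field; rewrite gt_eqF.
rewrite ler_sqr ?nnegrE//; last by rewrite divr_ge0 ?(ltW l0)// mulr_ge0// mulr_ge0.
by rewrite ler_pdivlMr// mulrC.
Qed.

Variables (e r : R).
Hypotheses (n0 : (0 < n)%N) (e0 : 0 <= e) (e1 : e <= 1) (De : D * e <= 1) (r2 : 2 < r).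
Notation P := (dual_exp e r).
Notation p := (@time_exp R n e r).
Variables (F : Z -> R) (phi : R -> R) (t a b : R) (u : X -> R).
Hypotheses (dF : dominated F) (mphi : measurable_fun setT phi) (phi0 : forall s, 0 < phi s).
Hypothesis FP : forall s, \int[L]_x `|F (s, x)| `^ P <= phi s `^ P.
Hypotheses (a0 : 0 < a) (va : (\int[mu]_s (past_weight n e r phi t s)%:E <= a%:E)%E).
Variable Cs : R.
Hypotheses (Cs0 : 0 < Cs) (Str : strichartz_bound n e Cs).
Hypotheses (mu_ : measurable_fun setT u) (ru : represents t b F u).

(** By duality: [u] is tested against its sign on [E], which gives at least [l |E|]. That [E] lies
    in a box makes the test function admissible. *)
Lemma level_measure_le m (E : set X) (l J : R) : measurable E -> E `<=` box m -> 0 < l ->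
  (forall x, E x -> l <= `|u x| <= 2 * l) ->
  (\int[(mu \x L)%E]_z (past_density e r F phi t z * threshold e r F phi t z `^ (r - 2) *
    \1_(~` above e r F phi t (2 * 8 ^+ n * a / l)) z)%:E <= J%:E)%E ->
  (L E <= (4 * (20 * pi) ^+ n ^+ 2 * l ^- 2 * (16 * Cs * a `^ (1 - D * e) * J))%:E)%E.
Proof.
move=> mE Em l0 lu HJ.
have J0 : 0 <= J.
  rewrite -lee_fin; apply: le_trans HJ; apply: integral_ge0 => z _; rewrite lee_fin.
  by rewrite mulr_ge0// mulr_ge0 ?powR_ge0 ?past_density_ge0.
pose c8 : R := 8 ^+ n; have c80 : 0 < c8 by rewrite exprn_gt0.
(* The height at which the dispersive estimate of the large part, [8 ^ n a / th] per unit of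
   measure, equals [l / 2]. *)
pose th : R := 2 * c8 * a / l.
have th0 : 0 < th by rewrite divr_gt0// mulr_gt0// mulr_gt0.
pose P' := Num.sqrt (16 * Cs * a `^ (1 - D * e) * J).
have c0 : 0 <= 16 * Cs * a `^ (1 - D * e) * J by rewrite mulr_ge0// mulr_ge0 ?powR_ge0// mulr_ge0// ltW.
have P'E : P' ^+ 2 = 16 * Cs * a `^ (1 - D * e) * J by rewrite sqr_sqrtr.
rewrite -P'E.
have dg := dominatedX_signed_indic mu_ mE Em.
set g := signed_indic u E in dg.
have di := dominatedX_integrable (dominatedX_box mE Em).
pose v := \int[L]_x (\1_E x : R).
have vE : L E = v%:E by rewrite /v Rintegral_EFin// integral_indic// setIT.
have v0 : 0 <= v by rewrite -lee_fin -vE.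
rewrite vE lee_fin; apply: level_bound => //; first by rewrite exprn_ge0// mulr_ge0// pi_ge0.
  exact: sqrtr_ge0.
have ug : \int[L]_x (u x * g x) <= l / 2 * v + (20 * pi) ^+ n * (P' * Num.sqrt v).
  apply: ru => // N N0.
  have dF0 := dominated_past t dF.
  rewrite (oform_split N b (measurable_at_time t) (dominatedX_integrable dg) dF0
    (measurable_above e r t dF mphi th)).
  apply: le_trans (ler_normD _ _) _; apply: lerD.
    apply: le_trans (oform_above_le e0 e1 r2 dF mphi phi0 FP va N0 b th0 dg) _.
    rewrite (_ : \int[L]_x `|g x| = v); last by apply: eq_Rintegral => x _; rewrite normr_signed_indic.
    rewrite -/c8 (_ : c8 * (a / th) = l / 2)//.
    by rewrite /th; field; rewrite !gt_eqF.
  apply: (oform_slice_cs N0 t b measurable_idZ _ dg (sqrtr_ge0 _) (sqrtr_ge0 _)).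
  - apply: dominated_integrable; apply: dominated_restrict => //.
    by apply: measurableC; exact: measurable_above.
  - rewrite sqr_sqrtr// /v Rintegral_EFin//.
    rewrite le_eqVlt; apply/orP; left; apply/eqP; apply: eq_integral => x _.
    by rewrite -real_normK ?num_real// normr_signed_indic !indicE; case: (_ \in _); rewrite ?expr1n ?expr0n.
  - by rewrite P'E; exact: (oform_below_le n0 e0 e1 De r2 dF mphi phi0 FP a0 va N0 Cs0 Str HJ).
apply: le_trans ug.
rewrite /v -RintegralZl//; apply: le_Rintegral => //.
- by have := integrableZl measurableT l di; apply: eq_integrable.
- apply: (@le_integrable_real _ _ _ _ _ _ (fun x => 2 * l * \1_E x)) => //.
  + by apply: measurable_funM => //; case: dg.
  + move=> x _; rewrite signed_indicE normrM normr_id (ger0_norm (_ : 0 <= \1_E x))//.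
    rewrite indicE; have [h|h] := boolP (x \in E); last by rewrite !mulr0.
    by rewrite !mulr1; move: h; rewrite inE => /lu/andP[].
  + by have := integrableZl measurableT (2 * l) di; apply: eq_integrable.
- move=> x _; rewrite signed_indicE indicE; have [h|h] := boolP (x \in E); last by rewrite !mulr0.
  by rewrite !mulr1; move: h; rewrite inE => /lu/andP[].
Qed.


Let c1 : R := 2 * 8 ^+ n * a.
Let c10 : 0 < c1. Proof. by rewrite mulr_gt0// mulr_gt0// exprn_gt0. Qed.
Let rr : 0 < r - 2. Proof. by rewrite subr_gt0. Qed.

(** The shift [x] lets levels indexed by natural numbers start at an arbitrarily small power of
    two. *)
Definition dyad (x : R) (i : nat) : R := 2 `^ (i%:R + x).

Lemma dyad_gt0 x i : 0 < dyad x i. Proof. exact: powR_gt0. Qed.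

Lemma dyadS x i : dyad x i.+1 = 2 * dyad x i.
Proof.
rewrite /dyad -{2}[2]powRr1// -powRD ?(gt_eqF (_ : 0 < 2)) ?implybT//.
by congr (_ `^ _); rewrite -natr1; ring.
Qed.

Let dens z := past_density e r F phi t z.
Let thr z := threshold e r F phi t z.
Let below x i z := dens z * thr z `^ (r - 2) * \1_(~` above e r F phi t (c1 / dyad x i)) z.

Let below_ge0 x i z : 0 <= below x i z.
Proof. by rewrite mulr_ge0// mulr_ge0 ?powR_ge0 ?past_density_ge0. Qed.

Let measurable_below x i : measurable_fun setT (below x i).
Proof.
apply: measurable_funM; last first.
  by apply: measurable_indic; apply: measurableC; exact: (measurable_above e r t dF mphi).
apply: measurable_funM; first exact: measurable_past_density.
apply: (measurableT_comp (measurable_powR _)); exact: measurable_threshold.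
Qed.

Let cut : R := (1 - 2 `^ (- (r - 2)))^-1.

(** At a point [z] only the levels with [dyad x i <= c1 / threshold z] count. Since [r > 2], the
    largest of them governs the geometric sum, and the powers of [threshold z] cancel. *)
Let sum_below_le x k z : \sum_(i < k) dyad x i `^ (r - 2) * below x i z <= cut * c1 `^ (r - 2) * dens z.
Proof.
have d0 : 0 <= dens z by exact: past_density_ge0.
have h0 : 0 <= thr z by exact: threshold_ge0.
have cut0 : 0 <= cut.
  rewrite invr_ge0 subr_ge0 -[leRHS](powRr0 2); apply: ler_powR => //; first lra.
  by move: rr; lra.
have [t0|tn] := eqVneq (thr z) 0.
  rewrite big1; first by rewrite mulr_ge0// mulr_ge0// powR_ge0.
  by move=> i _; rewrite /below t0 powR0 ?gt_eqF// mulr0 mul0r mulr0.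
have tp : 0 < thr z by rewrite lt_def tn.
apply: (@le_trans _ _ (dens z * thr z `^ (r - 2) *
    \sum_(i < k) 2 `^ ((i%:R + x) * (r - 2)) * (2 `^ (i%:R + x) <= c1 / thr z)%R%:R)).
  rewrite mulr_sumr; apply: ler_sum => i _; rewrite /below /dyad -powRrM.
  rewrite mulrCA; apply: ler_wpM2l; first exact: mulr_ge0 d0 (powR_ge0 _ _).
  apply: ler_wpM2l; first exact: powR_ge0.
  rewrite indicE ler_nat; have [h|//] := boolP (_ \in _).
  rewrite lt0b; move: h; rewrite inE /above/= => /negP; rewrite -leNgt.
  by rewrite ler_pdivlMr ?powR_gt0// ler_pdivlMr// mulrC.
apply: (@le_trans _ _ (dens z * thr z `^ (r - 2) * (cut * (c1 / thr z) `^ (r - 2)))).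
  apply: ler_wpM2l; first exact: mulr_ge0 d0 (powR_ge0 _ _).
  by apply: sum_cutoff_le => //; rewrite divr_ge0// ltW.
rewrite (_ : (c1 / thr z) `^ (r - 2) = c1 `^ (r - 2) * (thr z `^ (r - 2))^-1); last first.
  by rewrite powRM ?invr_ge0 ?(ltW c10)// powR_invr.
rewrite le_eqVlt; apply/orP; left; apply/eqP; field.
by rewrite gt_eqF// powR_gt0.
Qed.

Let lv_set x m i : set X := [set y | dyad x i <= `|u y| < dyad x i.+1] `&` box m.

Let measurable_band c d : measurable [set y | c <= `|u y| < d].
Proof.
rewrite (_ : [set y | _] = (fun y => `|u y|) @^-1` `[c, d[%classic).
  by rewrite -[X in measurable X]setTI; apply: measurableT_comp.
by apply/seteqP; split => y /=; rewrite in_itv/=.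
Qed.

Let measurable_lv x m i : measurable (lv_set x m i).
Proof. by apply: measurableI; [exact: measurable_band|exact: measurable_box]. Qed.

Let powR_le_levels x m k y :
  `|u y| `^ r * \1_([set y | dyad x 0 <= `|u y| < dyad x k] `&` box m) y <=
  \sum_(i < k) (2 * dyad x i) `^ r * \1_(lv_set x m i) y.
Proof.
elim: k => [|k IH].
  rewrite big_ord0 indicE memNset ?mulr0// => -[/= /andP[h1 h2] _].
  by have := le_lt_trans h1 h2; rewrite ltxx.
rewrite big_ord_recr/=.
have s0 : 0 <= \sum_(i < k) (2 * dyad x i) `^ r * \1_(lv_set x m i) y.
  by apply: sumr_ge0 => i _; rewrite mulr_ge0 ?powR_ge0.
rewrite [leLHS](_ : _ = `|u y| `^ r * (y \in [set y | dyad x 0 <= `|u y| < dyad x k.+1] `&` box m)%:R); last by rewrite indicE.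
have [h|_] := boolP (_ \in _); last by rewrite mulr0 addr_ge0// mulr_ge0 ?powR_ge0.
move: h; rewrite inE => -[/= /andP[h1 h2] h3]; rewrite mulr1.
have [h|h] := ltP `|u y| (dyad x k).
  rewrite -[leLHS]addr0; apply: lerD; last by rewrite mulr_ge0 ?powR_ge0.
  apply: le_trans IH; rewrite indicE mem_set ?mulr1//; split => //=.
  by rewrite h1 h.
rewrite -[leLHS]add0r; apply: lerD => //.
rewrite indicE mem_set; last by split => //=; rewrite h h2.
rewrite mulr1; apply: ge0_ler_powR; rewrite ?nnegrE ?mulr_ge0 ?(ltW (dyad_gt0 _ _))//.
  by move: r2; lra.
by rewrite -dyadS ltW.
Qed.

Definition level_cst : R := 2 `^ r * (4 * (20 * pi) ^+ n ^+ 2 * (16 * Cs)) *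
  ((1 - 2 `^ (- (r - 2)))^-1 * (2 * 8 ^+ n) `^ (r - 2)).

(** Below the height, [threshold ^ (r - 2)] is bounded by a constant, so the finiteness of the
    integral of the density is inherited. *)
Let below_fin x i : exists2 J : R, 0 <= J & (\int[(mu \x L)%E]_z (below x i z)%:E = J%:E)%E.
Proof.
have i0 : (0 <= \int[(mu \x L)%E]_z (below x i z)%:E)%E.
  by apply: integral_ge0 => z _; rewrite lee_fin.
have fin : (\int[(mu \x L)%E]_z (below x i z)%:E \is a fin_num)%E.
  rewrite ge0_fin_numE//; apply: (@le_lt_trans _ _ (((c1 / dyad x i) `^ (r - 2))%:E * a%:E)%E); last first.
    by rewrite -EFinM ltry.
  have h1 : (\int[(mu \x L)%E]_z (below x i z)%:E <=
      \int[(mu \x L)%E]_z (((c1 / dyad x i) `^ (r - 2))%:E * (dens z)%:E))%E.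
    apply: ge0_le_integral => //.
    - by move=> z _; rewrite lee_fin.
    - exact/measurable_EFinP.
    - by apply: measurable_funeM; apply/measurable_EFinP; exact: measurable_past_density.
    move=> z _; rewrite -EFinM lee_fin /below.
    have d0 : 0 <= dens z by exact: past_density_ge0.
    have h0 : 0 <= thr z by exact: threshold_ge0.
    rewrite indicE; have [h|h] := boolP (_ \in _); last by rewrite mulr0 mulr_ge0 ?powR_ge0.
    rewrite mulr1 mulrC; apply: ler_wpM2r => //.
    move: h; rewrite inE /above/= => /negP; rewrite -leNgt => h.
    apply: ge0_ler_powR; rewrite ?nnegrE ?(ltW rr)//.
    exact: le_trans h0 h.
  apply: (le_trans h1); rewrite ge0_integralZl_EFin ?powR_ge0//; last 2 first.
  - by move=> z _; rewrite lee_fin past_density_ge0.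
  - by apply/measurable_EFinP; exact: measurable_past_density.
  apply: lee_wpmul2l; first by rewrite lee_fin powR_ge0.
  exact: integral_past_density.
exists (fine (\int[(mu \x L)%E]_z (below x i z)%:E)%E); first by rewrite fine_ge0.
by rewrite fineK.
Qed.

Let U x m k := [set y | dyad x 0 <= `|u y| < dyad x k] `&` box m.

(** Summing [l ^ r |E_l|] over dyadic [l], the level bound leaves [l ^ (r - 2)] times the integral
    below the height. Exchanging sum and integral and summing at each point gives the powers
    [a ^ (1 - D e)], [a ^ (r - 2)] and [a]. *)
Let level_sum_le x m k :
  (\int[L]_(y in U x m k) (`|u y| `^ r)%:E <= (level_cst * a `^ (r - D * e))%:E)%E.
Proof.
have mU : measurable (U x m k).
  by apply: measurableI; [exact: measurable_band|exact: measurable_box].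
have muu : measurable_fun setT (fun y => `|u y| `^ r).
  by apply: (measurableT_comp (measurable_powR _)); exact: measurableT_comp.
have [J J0 JE] : exists2 J : nat -> R, (forall i, 0 <= J i) &
    forall i, (\int[(mu \x L)%E]_z (below x i z)%:E = (J i)%:E)%E.
  have /choice[J HJ] : forall i, exists J : R, 0 <= J /\ (\int[(mu \x L)%E]_z (below x i z)%:E = J%:E)%E.
    by move=> i; have [J J0 JE] := below_fin x i; exists J.
  by exists J => i; have [] := HJ i.
pose K : R := 4 * (20 * pi) ^+ n ^+ 2 * (16 * Cs) * a `^ (1 - D * e).
have K0 : 0 <= K.
  by do ?[exact: powR_ge0|exact: sqr_ge0|exact: ltW Cs0|apply: mulr_ge0].
have LE i : (L (lv_set x m i) <= (K * dyad x i ^- 2 * J i)%:E)%E.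
  apply: le_trans (@level_measure_le m _ (dyad x i) (J i) _ _ (dyad_gt0 _ _) _ _) _ => //.
  - by move=> y [].
  - by move=> y [/= /andP[h1 h2] _]; rewrite h1 -dyadS ltW.
  - by rewrite -JE.
  - by rewrite lee_fin le_eqVlt; apply/orP; left; apply/eqP; rewrite /K; ring.
apply: (@le_trans _ _ (\int[L]_y (\sum_(i < k) ((2 * dyad x i) `^ r * \1_(lv_set x m i) y)%:E))%E).
  rewrite integral_mkcond; apply: ge0_le_integral => //.
  - by move=> y _; rewrite patchE; case: ifP => // _; rewrite lee_fin powR_ge0.
  - by apply/(measurable_restrictT _ _).1 => //; apply/measurable_funTS/measurable_EFinP.
  - apply: emeasurable_sum => i; by apply/measurable_EFinP; exact: measurable_funM.
  move=> y _; rewrite sumEFin; have := powR_le_levels x m k y.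
  rewrite -lee_fin; apply: le_trans; rewrite patchE /U indicE; case: (_ \in _).
    by rewrite mulr1.
  by rewrite mulr0.
rewrite ge0_integral_sum//; last 2 first.
- by move=> i; apply/measurable_EFinP; exact: measurable_funM.
- by move=> i y _; rewrite lee_fin mulr_ge0 ?powR_ge0.
apply: (@le_trans _ _ (\sum_(i < k) (2 `^ r * K * (dyad x i `^ (r - 2) * J i))%:E)%E).
  apply: lee_sum => i _.
  under eq_integral do rewrite EFinM.
  rewrite ge0_integralZl_EFin ?powR_ge0//; last first.
    by apply/measurable_EFinP; exact: measurable_indic.
  rewrite integral_indic// setIT; apply: le_trans (lee_wpmul2l _ (LE i)) _.
    by rewrite lee_fin powR_ge0.
  rewrite -EFinM lee_fin powRM ?(ltW (dyad_gt0 _ _))//.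
  have -> : dyad x i `^ r = dyad x i `^ (r - 2) * dyad x i ^+ 2.
    rewrite -powR_mulrn ?(ltW (dyad_gt0 _ _))// -powRD ?subrK//.
    by rewrite (gt_eqF (dyad_gt0 _ _)) implybT.
  rewrite le_eqVlt; apply/orP; left; apply/eqP; field.
  by rewrite gt_eqF// dyad_gt0.
rewrite sumEFin -mulr_sumr EFinM.
have -> : ((\sum_(i < k) (dyad x i `^ (r - 2) * J i))%:E =
    \int[(mu \x L)%E]_z (\sum_(i < k) (dyad x i `^ (r - 2) * below x i z)%:E))%E.
  rewrite ge0_integral_sum//.
  - rewrite -sumEFin; apply: eq_bigr => i _; under eq_integral do rewrite EFinM.
    rewrite ge0_integralZl_EFin ?powR_ge0 ?JE//; last exact/measurable_EFinP.
    by move=> z _; rewrite lee_fin.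
  - by move=> i; apply/measurable_EFinP; apply: measurable_funM.
  - by move=> i z _; rewrite lee_fin mulr_ge0 ?powR_ge0.
have cut0 : 0 <= cut * c1 `^ (r - 2).
  rewrite mulr_ge0 ?powR_ge0// invr_ge0 subr_ge0 -[leRHS](powRr0 2).
  by apply: ler_powR; [lra|move: rr; lra].
apply: (@le_trans _ _ ((2 `^ r * K)%:E * ((cut * c1 `^ (r - 2))%:E * a%:E))%E); last first.
  rewrite -!EFinM lee_fin /level_cst /K -/cut /c1 powRM ?(ltW a0) ?mulr_ge0 ?exprn_ge0//.
  have -> : a `^ (r - D * e) = a `^ (1 - D * e) * a `^ (r - 2) * a.
    rewrite -{4}[a]powRr1 ?(ltW a0)// -!powRD ?(gt_eqF a0) ?implybT//.
    by congr (_ `^ _); ring.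
  by rewrite le_eqVlt; apply/orP; left; apply/eqP; ring.
apply: lee_wpmul2l; first by rewrite lee_fin mulr_ge0 ?powR_ge0.
apply: (@le_trans _ _ (\int[(mu \x L)%E]_z ((cut * c1 `^ (r - 2))%:E * (dens z)%:E))%E).
  apply: ge0_le_integral => //.
  - by move=> z _; apply: sume_ge0 => i _; rewrite lee_fin mulr_ge0 ?powR_ge0.
  - by apply: emeasurable_sum => i; apply/measurable_EFinP; apply: measurable_funM.
  - by apply: measurable_funeM; apply/measurable_EFinP; exact: measurable_past_density.
  - by move=> z _; rewrite sumEFin -EFinM lee_fin; exact: sum_below_le.
rewrite ge0_integralZl_EFin//; last 2 first.
- by move=> z _; rewrite lee_fin past_density_ge0.
- by apply/measurable_EFinP; exact: measurable_past_density.
by apply: lee_wpmul2l => //; exact: integral_past_density.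
Qed.

(** Boxes and dyadic ranges exhaust the points where [u] does not vanish; the other points
    contribute nothing. *)
Lemma integral_powR_past_le :
  (\int[L]_y (`|u y| `^ r)%:E <= (level_cst * a `^ (r - D * e))%:E)%E.
Proof.
have muu : measurable_fun setT (fun y => `|u y| `^ r).
  by apply: (measurableT_comp (measurable_powR _)); exact: measurableT_comp.
pose V m := U (- m%:R) m (m + m)%N.
have dy0 m : dyad (- m%:R) 0 = 2 `^ (- m%:R) by rewrite /dyad add0r.
have dy2 m : dyad (- m%:R) (m + m) = 2 `^ m%:R by rewrite /dyad natrD addrK.
have mV m : measurable (V m).
  by apply: measurableI; [exact: measurable_band|exact: measurable_box].
have ndV : nondecreasing_seq V.
  move=> m m' mm; apply/subsetPset => y [/= /andP[h1 h2] h3]; split; last exact: box_incr h3.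
  rewrite /= dy0 dy2; move: h1 h2; rewrite dy0 dy2 => h1 h2; apply/andP; split.
    by apply: le_trans h1; apply: ler_powR; rewrite ?lerN2 ?ler_nat//; lra.
  by apply: lt_le_trans h2 _; apply: ler_powR; rewrite ?ler_nat//; lra.
have VE y : u y != 0 -> (\bigcup_m V m) y.
  move=> uy; have up : 0 < `|u y| by rewrite normr_gt0.
  have [m0 hm0] := box_exhaust y.
  pose m1 := Num.bound `|u y|; pose m2 := Num.bound `|u y|^-1.
  have big k : k%:R < 2 `^ k%:R :> R.
    by rewrite powR_mulrn// -natrX ltr_nat ltn_expl.
  exists (m0 + m1 + m2)%N => //; split => /=; last first.
    by apply: box_incr hm0; rewrite -addnA leq_addr.
  rewrite dy0 dy2; apply/andP; split.
    rewrite powRN -[leRHS]invrK lef_pV2 ?posrE ?invr_gt0 ?powR_gt0//.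
    apply: (@le_trans _ _ m2%:R); first by rewrite ltW// archi_boundP// invr_ge0 ltW.
    apply: (@le_trans _ _ (2 `^ m2%:R)); first exact: ltW.
    by apply: ler_powR; [lra|rewrite ler_nat leq_addl].
  apply: (@lt_le_trans _ _ m1%:R); first by rewrite archi_boundP// ltW.
  apply: (@le_trans _ _ (2 `^ m1%:R)); first exact: ltW.
  by apply: ler_powR; [lra|rewrite ler_nat -addnAC leq_addl].
have H := @ge0_integral_bigcup_le _ _ _ L V (fun y => (`|u y| `^ r)%:E) _ ndV mV
  ((@measurable_EFinP _ _ _ _ _).2 muu) _ (fun m => level_sum_le _ _ _).
apply: le_trans (H _); last by move=> *; rewrite lee_fin powR_ge0.
rewrite [leRHS]integral_mkcond le_eqVlt; apply/orP; left; apply/eqP.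
apply: eq_integral => y _; rewrite patchE; case: ifPn => // /negP h.
have [->|uy] := eqVneq (u y) 0.
  by rewrite normr0 powR0// gt_eqF//; move: r2; lra.
by exfalso; apply: h; rewrite inE; exact: VE.
Qed.

End levels.

(** * The cases r = 2 and r = oo *)

Section endpoints.
Context {R : realType} (n : nat).
Notation mu := (@lebesgue_measure R).
Notation X := 'rV[R]_n.
Notation L := (@lebesgue_rV R n).
Notation Z := (measurableTypeR R * X)%type.
Notation M := (@spacetime R n).
Notation D := (@hdim R n).

Lemma self_bound (v P K : R) : 0 <= v -> 0 <= K -> 0 <= P ->
  v <= K * (P * Num.sqrt v) -> v <= K ^+ 2 * P ^+ 2.
Proof.
move=> v0 K0 P0; have s0 := sqrtr_ge0 v; rewrite -{1 3}(sqr_sqrtr v0).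
move: s0; set s := Num.sqrt v => s0 h.
rewrite -exprMn ler_sqr ?nnegrE ?mulr_ge0//.
have [->|sn] := eqVneq s 0; first exact: mulr_ge0.
have sp : 0 < s by rewrite lt_def sn.
by rewrite -(ler_pM2r sp) -expr2 -mulrA.
Qed.

Variables (e : R).
Hypotheses (n0 : (0 < n)%N) (e0 : 0 <= e) (e1 : e <= 1) (De : D * e <= 1).
Variables (F : Z -> R) (phi : R -> R) (t a b : R) (u : X -> R).
Hypotheses (dF : dominated F) (mphi : measurable_fun setT phi) (phi0 : forall s, 0 < phi s).
Hypotheses (mu_ : measurable_fun setT u) (ru : represents t b F u) (a0 : 0 < a).

Let measurable_cut m : measurable ([set y | `|u y| <= m%:R] `&` box m).
Proof.
apply: measurableI; last exact: measurable_box.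
rewrite (_ : [set y | _] = (fun y => `|u y|) @^-1` `]-oo, m%:R]%classic).
  by rewrite -[X in measurable X]setTI; apply: measurableT_comp.
by apply/seteqP; split => y /=; rewrite in_itv/=.
Qed.

(** Here [decay_exp] is zero and [time_exp] is the dual Strichartz exponent in time. [u] is tested
    against itself, cut to a box and to bounded values in order to be admissible. *)
Lemma integral_sqr_past_le (Cs : R) : 0 < Cs -> strichartz_bound n e Cs ->
  (forall s, \int[L]_x `|F (s, x)| `^ dual_exp e 2 <= phi s `^ dual_exp e 2) ->
  (\int[mu]_s (past_weight n e 2 phi t s)%:E <= a%:E)%E ->
  (\int[L]_y (`|u y| `^ 2)%:E <= ((20 * pi) ^+ n ^+ 2 * Cs * a `^ (2 - D * e))%:E)%E.
Proof.
move=> Cs0 Str FP va; set K := (20 * pi) ^+ n.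
have K0 : 0 <= K by rewrite exprn_ge0// mulr_ge0// pi_ge0.
have PE : dual_exp e 2 = 2 / (1 + e) by rewrite /dual_exp; congr (_ / _); ring.
have pE : @time_exp R n e 2 = (1 - D * e / 2)^-1.
  rewrite /time_exp; move: De; set x := D * e; clearbody x => x1; field.
  by rewrite !gt_eqF//; move: x1; lra.
have x0 : 2 - D * e > 0 by move: De; set x := D * e; clearbody x; lra.
have kE : @decay_exp R n e 2 = 0 by rewrite /decay_exp subrr mulr0 mul0r.
pose E m := [set y | `|u y| <= m%:R] `&` box m.
have ndE : nondecreasing_seq E.
  move=> m m' mm; apply/subsetPset => y [/= h1 h3]; split; last exact: box_incr h3.
  by apply: le_trans h1 _; rewrite ler_nat.
have bE m : (\int[L]_(y in E m) (`|u y| `^ 2)%:E <= (K ^+ 2 * Cs * a `^ (2 - D * e))%:E)%E.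
  have mE : measurable (E m) by exact: measurable_cut.
  have dE : dominatedX (\1_(E m) : X -> R) by apply: (@dominatedX_box _ _ m _ mE) => y [].
  pose g y := u y * \1_(E m) y.
  have dg : dominatedX g.
    have [_ [K1 [K10 HK]]] := dE; split; first exact: measurable_funM.
    exists (m%:R * K1); split; first by rewrite mulr_ge0.
    move=> y; rewrite /g normrM -mulrA; move: (HK y).
    rewrite indicE; have [h|h] := boolP (y \in E m).
      by move=> h'; apply: ler_pM => //; move: h; rewrite inE => -[].
    by rewrite normr0 mulr0 => h'; rewrite mulr_ge0.
  have gi := dominatedX_sqr_integrable dg.
  pose v := \int[L]_y (g y ^+ 2); have v0 : 0 <= v by apply: Rintegral_ge0 => y _; exact: sqr_ge0.
  have vE : (\int[L]_(y in E m) (`|u y| `^ 2)%:E)%E = v%:E.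
    rewrite [RHS]Rintegral_EFin// [LHS]integral_mkcond; apply: eq_integral => y _.
    rewrite patchE /g indicE; case: (_ \in _); last by rewrite mulr0 expr0n.
    by rewrite mulr1 powR_mulrn// real_normK// num_real.
  rewrite vE lee_fin; pose P' := Num.sqrt (Cs * a `^ (2 - D * e)).
  have P'E : P' ^+ 2 = Cs * a `^ (2 - D * e) by rewrite sqr_sqrtr// mulr_ge0 ?powR_ge0// ltW.
  rewrite -mulrA -P'E; apply: self_bound => //; first exact: sqrtr_ge0.
  rewrite [leLHS](_ : _ = \int[L]_y (u y * g y)); last first.
    apply: eq_Rintegral => y _; rewrite /g indicE; case: (_ \in _); last by rewrite !mulr0 expr0n.
    by rewrite mulr1 expr2.
  apply: ru => // N N0.
  apply: (oform_slice_cs N0 t b measurable_idZ _ dg (sqrtr_ge0 _) (sqrtr_ge0 _)).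
  - by apply: dominated_integrable; exact: dominated_past.
  - by rewrite sqr_sqrtr// /v Rintegral_EFin.
  rewrite P'E (_ : 2 - D * e = 2 * (1 - D * e / 2)); last by field.
  apply: (Str N _ (fun s => phi s * \1_(past t) s)) => //.
  - exact: dominated_past.
  - by apply: measurable_funM => //; exact: measurable_indic (measurable_past t).
  - by move=> s; rewrite mulr_ge0// ltW.
  - move=> s; rewrite -PE /past_part; under eq_Rintegral do rewrite indic_time_set.
    rewrite indicE; case: (_ \in _).
      by rewrite mulr1; under eq_Rintegral do rewrite mulr1; exact: FP.
    have z : 0 `^ dual_exp e 2 = 0 :> R.
      by rewrite powR0// PE gt_eqF// divr_gt0//; move: e0; lra.
    rewrite mulr0 z; under eq_Rintegral do rewrite mulr0 normr0 z.
    by rewrite Rintegral_cst// mul0r.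
  apply: le_trans va; rewrite le_eqVlt; apply/orP; left; apply/eqP.
  apply: eq_integral => s _; congr EFin; rewrite /past_weight kE oppr0 powRr0 mulr1 -pE.
  rewrite indicE; case: (_ \in _); first by rewrite !mulr1.
  by rewrite !mulr0 powR0// pE invr_eq0 gt_eqF//; move: x0; lra.
have muu : measurable_fun setT (fun y => `|u y| `^ 2).
  by apply: (measurableT_comp (measurable_powR _)); exact: measurableT_comp.
have H := @ge0_integral_bigcup_le _ _ _ L E (fun y => (`|u y| `^ 2)%:E) _ ndE measurable_cut
  ((@measurable_EFinP _ _ _ _ _).2 muu) _ bE.
apply: le_trans (H _); last by move=> *; rewrite lee_fin powR_ge0.
rewrite (_ : \bigcup_m E m = setT)//; apply/seteqP; split => // y _.
have [m0 hm0] := box_exhaust y.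
exists (m0 + Num.bound `|u y|)%N => //; split => /=; last by apply: box_incr hm0; rewrite leq_addr.
apply: (@le_trans _ _ (Num.bound `|u y|)%:R); first by rewrite ltW// archi_boundP.
by rewrite ler_nat leq_addl.
Qed.

(** Testing against the sign of [u] on a bounded set where [|u|] exceeds the bound by at least
    [1 / (k + 1)] shows that this set is null. *)
Lemma ae_past_le : (forall s, \int[L]_x `|F (s, x)| <= phi s) ->
  (\int[mu]_s (phi s * (t - s) `^ (- D) * \1_(past t) s)%:E <= a%:E)%E ->
  {ae L, forall y, `|u y| <= 8 ^+ n * a}.
Proof.
move=> FP va; pose c : R := 8 ^+ n * a.
pose w s : R := phi s * (t - s) `^ (- D) * \1_(past t) s.
have mw : measurable_fun setT w.
  apply: measurable_funM; last exact: measurable_indic (measurable_past t).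
  apply: measurable_funM => //.
  by apply: (measurableT_comp (measurable_powR _)); exact: measurable_funB.
have w0 s : 0 <= w s by rewrite mulr_ge0// mulr_ge0 ?powR_ge0// ltW.
pose E k := [set y | c + k.+1%:R^-1 <= `|u y| <= k%:R] `&` box k.
have mE k : measurable (E k).
  apply: measurableI; last exact: measurable_box.
  rewrite (_ : [set y | _] = (fun y => `|u y|) @^-1` `[c + k.+1%:R^-1, k%:R]%classic).
    by rewrite -[X in measurable X]setTI; apply: measurableT_comp.
  by apply/seteqP; split => y /=; rewrite in_itv/=.
have EB k : E k `<=` box k by move=> y [].
have EZ k : L (E k) = 0%E.
  have dE := dominatedX_box (mE k) (EB k); have Ei := dominatedX_integrable dE.
  have dg := dominatedX_signed_indic mu_ (mE k) (EB k).
  set g := signed_indic u (E k) in dg.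
  pose v := \int[L]_x (\1_(E k) x : R).
  have vE : L (E k) = v%:E by rewrite /v Rintegral_EFin// integral_indic// setIT.
  have v0 : 0 <= v by rewrite -lee_fin -vE.
  have h1 : \int[L]_x (u x * g x) <= c * v.
    apply: ru => // N N0; have dF0 := dominated_past t dF.
    have gi := dominatedX_integrable dg.
    rewrite -lee_fin; apply: (le_trans (normr_oform_slicel_le N b (measurable_at_time t) gi dF0)).
    apply: (@le_trans _ _ (\int[mu]_s ((8 ^+ n * v)%:E * (w s)%:E))%E).
      apply: (@ge0_le_integral_except _ t) => //.
      - by move=> s; rewrite mule_ge0// lee_fin// mulr_ge0.
      - apply/measurable_EFinP; apply: measurableT_comp => //.
        exact: (measurable_oform_slicel N b (measurable_at_time t) gi dF0).
      - by apply: measurable_funeM; exact/measurable_EFinP.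
      move=> s st; rewrite -EFinM lee_fin.
      apply: (le_trans (oform_dispersive N0 b st (dominated_slice s dF0) dg)).
      rewrite (_ : \int[L]_x `|g x| = v); last by apply: eq_Rintegral => x _; rewrite normr_signed_indic.
      rewrite -mulrA -[leRHS]mulrA; apply: ler_wpM2l; first exact: exprn_ge0.
      rewrite mulrA mulrC; apply: ler_wpM2l => //; rewrite /w /past_part.
      under eq_Rintegral do rewrite indic_time_set.
      rewrite indicE; have [h|h] := boolP (_ \in _); last first.
        under eq_Rintegral do rewrite mulr0 normr0.
        by rewrite Rintegral_cst// mul0r !mulr0.
      under eq_Rintegral do rewrite mulr1.
      move: h; rewrite inE /past/= => ts.
      rewrite mulr1 mulrC distrC gtr0_norm ?subr_gt0//; apply: ler_wpM2r; first exact: powR_ge0.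
      exact: FP.
    rewrite ge0_integralZl_EFin ?mulr_ge0//; last 2 first.
    - by move=> s _; rewrite lee_fin.
    - exact/measurable_EFinP.
    apply: (@le_trans _ _ ((8 ^+ n * v)%:E * a%:E)%E).
      by apply: lee_wpmul2l => //; rewrite lee_fin mulr_ge0.
    by rewrite -EFinM lee_fin /c mulrAC.
  have h2 : (c + k.+1%:R^-1) * v <= \int[L]_x (u x * g x).
    rewrite /v -RintegralZl//; apply: le_Rintegral => //.
    - by have := integrableZl measurableT (c + k.+1%:R^-1) Ei; apply: eq_integrable.
    - apply: (@le_integrable_real _ _ _ _ _ _ (fun x => k%:R * \1_(E k) x)) => //.
      + by apply: measurable_funM => //; case: dg.
      + move=> x _; rewrite signed_indicE normrM normr_id (ger0_norm (_ : 0 <= \1_(E k) x))//.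
        rewrite indicE; have [h|h] := boolP (x \in E k); last by rewrite !mulr0.
        by rewrite !mulr1; move: h; rewrite inE => -[/= /andP[]].
      + by have := integrableZl measurableT k%:R Ei; apply: eq_integrable.
    - move=> x _; rewrite signed_indicE indicE; have [h|h] := boolP (x \in E k); last by rewrite !mulr0.
      by rewrite !mulr1; move: h; rewrite inE => -[/= /andP[]].
  have : (c + k.+1%:R^-1) * v <= c * v by exact: le_trans h2 h1.
  rewrite mulrDl gerDl pmulr_rle0 ?invr_gt0// => vn.
  by rewrite vE; congr EFin; apply/eqP; rewrite eq_le vn.
apply: (negligibleS _ (@negligible_bigcup _ _ _ _ E _)); last first.
  by move=> k; exists (E k); split => //; exact: EZ.
move=> y /=; move/negP; rewrite -ltNge => cy.
have [m0 hm0] := box_exhaust y.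
pose m1 := Num.bound `|u y|; pose m2 := Num.bound (`|u y| - c)^-1.
have d0 : 0 < `|u y| - c by rewrite subr_gt0.
exists (m0 + m1 + m2)%N => //; split => /=; last by apply: box_incr hm0; rewrite -addnA leq_addr.
apply/andP; split; last first.
  apply: (@le_trans _ _ m1%:R); first by rewrite ltW// archi_boundP.
  by rewrite ler_nat -addnAC leq_addl.
rewrite addrC -lerBrDr -[leRHS]invrK lef_pV2 ?posrE ?invr_gt0//.
apply: (@le_trans _ _ m2%:R); first by rewrite ltW// archi_boundP// invr_ge0 ltW.
by rewrite ler_nat (leq_trans (leq_addl _ _) (leqnSn _)).
Qed.

End endpoints.

Lemma past_bound {R : realType} (n : nat) (e r : R) : (0 < n)%N -> 0 <= e -> e <= 1 ->
  @hdim R n * e <= 1 -> (e = 1 -> @hdim R n < 1) -> 2 <= r ->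
  exists2 C : R, 0 < C & forall (F : measurableTypeR R * 'rV[R]_n -> R) (phi : R -> R)
      (t a b : R) (u : 'rV[R]_n -> R),
    dominated F -> measurable_fun setT phi -> (forall s, 0 < phi s) ->
    (forall s, \int[@lebesgue_rV R n]_x `|F (s, x)| `^ dual_exp e r <= phi s `^ dual_exp e r) ->
    0 < a -> (\int[@lebesgue_measure R]_s (past_weight n e r phi t s)%:E <= a%:E)%E ->
    measurable_fun setT u -> represents t b F u ->
    (\int[@lebesgue_rV R n]_y (`|u y| `^ r)%:E <= (C * a `^ (r - @hdim R n * e))%:E)%E.
Proof.
move=> n0 e0 e1 De eD; rewrite le_eqVlt => r2.
have [Cs Cs0 Str] := oform_strichartz_range n0 e0 e1 De eD.
have pi0 : 0 < (20 * pi) ^+ n ^+ 2 :> R by rewrite !exprn_gt0// mulr_gt0// pi_gt0.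
case/orP: r2 => [/eqP <-|r2].
  exists ((20 * pi) ^+ n ^+ 2 * Cs); first exact: mulr_gt0.
  by move=> F phi t a b u dF mphi phi0 FP a0 va mu_ ru; exact: (integral_sqr_past_le e0 De dF mphi phi0 mu_ ru a0 Cs0 Str FP va).
exists (level_cst n r Cs).
  rewrite mulr_gt0 ?powR_gt0//.
    by do ?[exact: pi0|exact: Cs0|exact: powR_gt0|apply: mulr_gt0].
  rewrite mulr_gt0 ?powR_gt0 ?mulr_gt0 ?exprn_gt0//.
  rewrite invr_gt0 subr_gt0 powRN invf_lt1 ?powR_gt0//.
  rewrite [X in X < _](_ : 1 = 1 `^ (r - 2)); last by rewrite powR1.
  by apply: gt0_ltr_powR => //; rewrite ?nnegrE ?subr_gt0//; lra.
move=> F phi t a b u dF mphi phi0 FP a0 va mu_ ru.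
exact: (integral_powR_past_le n0 e0 e1 De r2 dF mphi phi0 FP a0 va Cs0 Str mu_ ru).
Qed.

(** * The weak-type estimate in time *)

Section weak_type.
Context {R : realType}.
Notation mu := (@lebesgue_measure R).

(* No measurability is needed: [lebesgue_measure] is an outer measure. *)
Lemma le_lebesgue_measure (A B : set R) : A `<=` B -> (mu A <= mu B)%E.
Proof. by move=> AB; exact: (le_outer_measure (mu_ext _)). Qed.

Lemma measure_le_bounded_parts (E : set R) (K : \bar R) : measurable E ->
  (forall m : nat, (mu (E `&` `[(- m%:R)%R, (m%:R)%R]%classic) <= K)%E) -> (mu E <= K)%E.
Proof.
move=> mE EK; pose V (m : nat) := E `&` `[- m%:R, m%:R]%classic.
have mV m : measurable (V m) by exact: measurableI.
have ndV : nondecreasing_seq V.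
  move=> m m' mm; apply/subsetPset => y []; rewrite /= in_itv/= => Ey /andP[h1 h2].
  split => //; rewrite /= in_itv/=; have mm' : m%:R <= m'%:R :> R by rewrite ler_nat.
  by apply/andP; split; lra.
have H := @ge0_integral_bigcup_le _ _ _ mu V (fun=> 1%E) K ndV mV (measurable_cst _).
have -> : E = \bigcup_m V m.
  apply/seteqP; split => [y Ey|y [m _ []]//].
  exists (Num.bound `|y|) => //; split => //; rewrite /= in_itv/= -ler_norml.
  by rewrite ltW// archi_boundP.
have mB : measurable (\bigcup_m V m) by apply: bigcup_measurable => m _; exact: mV.
rewrite -[leLHS]mul1e -integral_cst//.
by apply: H => // m; rewrite (integral_cst mu (mV m)) mul1e; exact: EK.
Qed.

Variables (h : R -> R) (k H : R).
Hypotheses (mh : measurable_fun setT h) (h0 : forall s, 0 <= h s) (k0 : 0 < k) (k1 : k < 1).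
Hypothesis hH : (\int[mu]_s (h s)%:E <= H%:E)%E.

Definition past_potential (t : R) : \bar R :=
  (\int[mu]_s (h s * (t - s) `^ (- k) * \1_(past t) s)%:E)%E.

Let f (z : measurableTypeR R * measurableTypeR R) : R :=
  h z.2 * (z.1 - z.2) `^ (- k) * \1_(past z.1) z.2.

Let mf : measurable_fun setT f.
Proof.
apply: measurable_funM.
  apply: measurable_funM; first exact: (measurableT_comp mh measurable_snd).
  by apply: (measurableT_comp (measurable_powR _)); exact: measurable_funB.
rewrite (_ : (fun _ => _) = \1_[set z : measurableTypeR R * measurableTypeR R | z.2 < z.1]).
  apply: measurable_indic.
  rewrite (_ : [set _ | _] = (fun z : measurableTypeR R * measurableTypeR R => z.1 - z.2) @^-1` `]0, +oo[%classic).
    by rewrite -[X in measurable X]setTI; exact: measurable_funB.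
  by apply/seteqP; split => y /=; rewrite in_itv/= andbT subr_gt0.
by apply/funext => z; rewrite !indicE; congr (_ %:R); apply/idP/idP; rewrite !inE.
Qed.

Let f0 z : 0 <= f z. Proof. by rewrite mulr_ge0// mulr_ge0 ?powR_ge0. Qed.

Let mfE : measurable_fun setT (fun z => (f z)%:E). Proof. exact/measurable_EFinP. Qed.
Let fE0 z : (0 <= (f z)%:E)%E. Proof. by rewrite lee_fin. Qed.

Lemma measurable_past_potential : measurable_fun setT past_potential.
Proof. exact: (@measurable_fun_fubini_tonelli_F _ _ _ _ R mu _ mfE fE0). Qed.

Let above_potential (l : R) := [set t | (l%:E < past_potential t)%E].

Let measurable_above_potential l : measurable (above_potential l).
Proof.
rewrite -[X in measurable X]setTI; apply: emeasurable_fun_o_infty => //.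
exact: measurable_past_potential.
Qed.

Let C := 2 / (1 - k) + 1.
Let C0 : 0 < C.
Proof. by rewrite addr_gt0// divr_gt0// subr_gt0. Qed.

(** Integrating the potential over [E] and exchanging the integrals moves the kernel onto [E], where
    its integral is at most a multiple of [|E| ^ (1 - k)], uniformly in [s]. *)
Let part_le (l : R) (E : set R) : 0 < l -> measurable E -> (mu E < +oo)%E ->
  E `<=` above_potential l -> l * fine (mu E) <= C * H * fine (mu E) `^ (1 - k).
Proof.
move=> l0 mE Efin El.
have H0 : 0 <= H by rewrite -lee_fin; apply: le_trans hH; apply: integral_ge0 => s _; rewrite lee_fin.
set c := C * fine (mu E) `^ (1 - k).
have c0 : 0 <= c by rewrite mulr_ge0 ?powR_ge0// ltW.
have muEf : mu E \is a fin_num by rewrite ge0_fin_numE.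
rewrite -lee_fin EFinM fineK//.
rewrite -integral_cst//.
apply: (@le_trans _ _ (\int[mu]_(t in E) past_potential t)%E).
  apply: ge0_le_integral => //.
  - by move=> t _; rewrite lee_fin ltW.
  - exact: measurable_funTS measurable_past_potential.
  - by move=> t Et; apply/ltW/El.
have -> : (\int[mu]_(t in E) past_potential t =
    \int[mu]_t \int[mu]_s (f (t, s) * \1_E t)%:E)%E.
  rewrite integral_mkcond; apply: eq_integral => t _; rewrite patchE indicE.
  case: (_ \in _).
    by apply: eq_integral => s _; rewrite mulr1.
  by rewrite (eq_integral (fun=> 0%E)) ?integral0// => s _; rewrite mulr0.
pose fe (z : measurableTypeR R * measurableTypeR R) := (f z * \1_E z.1)%:E.
have mfe : measurable_fun setT fe.
  apply/measurable_EFinP; apply: measurable_funM => //.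
  exact: (measurableT_comp (measurable_indic mE) measurable_fst).
have fe0 z : (0 <= fe z)%E by rewrite lee_fin mulr_ge0.
rewrite -[leLHS]/(\int[mu]_t \int[mu]_s fe (t, s))%E.
rewrite -(@fubini_tonelli1 _ _ _ _ R mu mu _ mfe fe0) (@fubini_tonelli2 _ _ _ _ R mu mu _ mfe fe0).
apply: (@le_trans _ _ (\int[mu]_s (c%:E * (h s)%:E))%E).
  apply: ge0_le_integral => //.
  - by move=> s _; apply: integral_ge0.
  - exact: (@measurable_fun_fubini_tonelli_G _ _ _ _ R mu _ mfe fe0).
  - by apply: measurable_funeM; exact/measurable_EFinP.
  move=> s _; rewrite /fubini_G.
  apply: (@le_trans _ _ (\int[mu]_t ((h s)%:E * (`|s - t| `^ (- k) * \1_E t)%:E))%E).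
    apply: ge0_le_integral => //.
    - exact: (measurableT_comp mfe (pair2_measurable s)).
    - apply: measurable_funeM; apply/measurable_EFinP; apply: measurable_funM => //.
      exact: measurable_powR_dist.
    move=> t _; rewrite /fe /f/= -EFinM lee_fin -!mulrA; apply: ler_wpM2l => //.
    rewrite mulrA; apply: ler_wpM2r => //; rewrite indicE; have [h1|h1] := boolP (_ \in _).
      by move: h1; rewrite inE /past/= => h1; rewrite mulr1 distrC gtr0_norm// subr_gt0.
    by rewrite mulr0 powR_ge0.
  rewrite ge0_integralZl_EFin//; last first.
    by apply/measurable_EFinP; apply: measurable_funM => //; exact: measurable_powR_dist.
  rewrite muleC; apply: lee_wpmul2r; first by rewrite lee_fin.
  apply: le_trans (integral_powR_set s (ltW k0) k1 mE Efin).
  rewrite le_eqVlt; apply/orP; left; apply/eqP; rewrite [RHS]integral_mkcond.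
  apply: eq_integral => t _; rewrite patchE indicE; case: (_ \in _); by rewrite ?mulr1 ?mulr0.
rewrite ge0_integralZl_EFin//; last 2 first.
- by move=> s _; rewrite lee_fin.
- exact/measurable_EFinP.
apply: le_trans (lee_wpmul2l _ hH) _; first by rewrite lee_fin.
by rewrite -EFinM lee_fin /c mulrAC.
Qed.

(** The inequality for parts has to be divided by [|E| ^ (1 - k)], so it is used on bounded pieces,
    of finite measure. The bound [|E| <= (C H / l) ^ (1 / k)] does not depend on the piece and
    passes to the union. *)
Lemma past_potential_weak_type (l : R) : 0 < l ->
  (l%:E * mu [set t | (l%:E < past_potential t)%E] `^ k <= ((2 / (1 - k) + 1) * H)%:E)%E.
Proof.
move=> l0; rewrite -/(above_potential l) -/C.
have H0 : 0 <= H by rewrite -lee_fin; apply: le_trans hH; apply: integral_ge0 => s _; rewrite lee_fin.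
have CH0 : 0 <= C * H / l by rewrite divr_ge0 ?(ltW l0)// mulr_ge0// ltW.
have bd : (mu (above_potential l) <= ((C * H / l) `^ k^-1)%:E)%E.
  apply: measure_le_bounded_parts => // m; set E := _ `&` _.
  have mE : measurable E by exact: measurableI.
  have Efin : (mu E < +oo)%E.
    apply: (@le_lt_trans _ _ (mu `[- m%:R, m%:R]%classic)).
      by apply: le_lebesgue_measure => t [].
    by rewrite lebesgue_measure_itv/=; case: ifP => // _; rewrite -EFinB ltry.
  have muEf : mu E \is a fin_num by rewrite ge0_fin_numE.
  have := part_le l0 mE Efin; rewrite -[X in (X <= _)%E](fineK muEf) lee_fin.
  set v := fine (mu E) => hv; have v0 : 0 <= v by rewrite fine_ge0.
  have {hv} : l * v <= C * H * v `^ (1 - k) by apply: hv => t [].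
  have [->|vn] := eqVneq v 0; first by rewrite powR_ge0.
  have vp : 0 < v by rewrite lt_def vn.
  have vE : v = v `^ k * v `^ (1 - k).
    by rewrite -powRD ?(negbTE vn) ?implybT// subrKC powRr1.
  rewrite {1}vE mulrA ler_pM2r ?powR_gt0// => h1.
  rewrite -[leLHS](powRr1 v0) -(mulfV (lt0r_neq0 k0)) powRrM.
  apply: ge0_ler_powR; rewrite ?nnegrE ?powR_ge0 ?invr_ge0 ?(ltW k0)//.
  by rewrite ler_pdivlMr// mulrC.
have h1 := @gt0_ler_poweR R k (ltW k0) (mu (above_potential l)) ((C * H / l) `^ k^-1)%:E.
apply: (@le_trans _ _ (l%:E * (((C * H / l) `^ k^-1)%:E `^ k))%E).
  apply: lee_wpmul2l; first by rewrite lee_fin ltW.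
  by apply: h1 => //; rewrite in_itv/= ?leey ?andbT// lee_fin powR_ge0.
rewrite poweR_EFin -EFinM lee_fin -powRrM mulVf ?gt_eqF// powRr1//.
by rewrite mulrC divfK// gt_eqF.
Qed.

End weak_type.

(** * Schwartz functions *)

Section spacetime_continuous.
Context {R : realType} (n : nat).
Notation X := 'rV[R]_n.
Notation Z := (measurableTypeR R * X)%type.

Let cell (p : rat * 'rV[rat]_n * nat) : set (R * X) :=
  [set z : R * X | `|z.1 - ratr p.1.1| < p.2.+1%:R^-1 /\
           forall i, `|z.2 ord0 i - ratr (p.1.2 ord0 i)| < p.2.+1%:R^-1].

Let measurable_cell p : measurable (cell p : set Z).
Proof.
have mS (g : Z -> R) (c e : R) : measurable_fun setT g -> measurable [set z : Z | `|g z - c| < e].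
  move=> mg; rewrite (_ : [set z | _] = (fun z => `|g z - c|) @^-1` `]-oo, e[%classic).
    rewrite -[X in measurable X]setTI; apply: measurableT_comp => //.
    exact: measurable_funB.
  by apply/seteqP; split => z /=; rewrite in_itv.
rewrite (_ : cell p = [set z : Z | `|z.1 - ratr p.1.1| < p.2.+1%:R^-1] `&`
    \bigcap_(i in [set: 'I_n]) [set z : Z | `|z.2 ord0 i - ratr (p.1.2 ord0 i)| < p.2.+1%:R^-1]); last first.
  by apply/seteqP; split => z [h1 h2]; split => // i; [move=> _; exact: h2|exact: (h2 i)].
apply: measurableI; first exact: mS measurable_fst.
apply: fin_bigcap_measurable => // i _; apply: mS.
exact: (measurableT_comp (measurable_rV_coord i) measurable_snd).
Qed.

Let near_rat (x e : R) : 0 < e -> exists q : rat, `|x - ratr q| < e.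
Proof.
move=> e0; have [q] := @rat_in_itvoo R (x - e) (x + e) ltac:(lra).
by rewrite in_itv/= => /andP[h1 h2]; exists q; rewrite ltr_norml; apply/andP; split; lra.
Qed.

(** Spacetime carries the sigma-algebra generated by the coordinates, so the open superlevel set is
    written as the countable union of the rational cells that it contains. *)
Lemma measurable_continuous_spacetime (f : R * X -> R) : continuous f ->
  measurable_fun setT (f : Z -> R).
Proof.
move=> cf; apply: (measurability _ (RGenOInfty.measurableE R)) => _ [_ [a ->] <-].
rewrite setTI (_ : f @^-1` _ = \bigcup_p
    (if `[< cell p `<=` [set z | a < f z] >] then cell p else set0)).
  apply: countable_bigcupT_measurable; first exact: countableP.
  by move=> p; case: ifP => // _; exact: measurable_cell.
apply/seteqP; split; last first.
  move=> z [p _]; case: ifPn => // /asboolP h /h /= az.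
  by rewrite in_itv/= az.
move=> z /=; rewrite in_itv/= andbT => az; have := cf z; move/cvgrPdist_lt => /(_ (f z - a)); rewrite subr_gt0 => /(_ az).
move/nbhs_ballP => [e /= e0 he].
(* The half-width [d] satisfies [2 d <= e], so two points of one cell are within [e] of each
   other. *)
pose k := Num.bound (2 / e); pose d : R := k.+1%:R^-1.
have d0 : 0 < d by rewrite invr_gt0.
have de : 2 * d <= e.
  rewrite /d ler_pdivrMr// -ler_pdivrMl// mulrC.
  apply: (@le_trans _ _ k%:R); first by rewrite ltW// archi_boundP// ltW// divr_gt0.
  by rewrite ler_nat.
have [q1 hq1] := near_rat z.1 d0.
have /choice[q2 hq2] : forall i : 'I_n, exists q : rat, `|z.2 ord0 i - ratr q| < d.
  by move=> i; exact: near_rat.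
have zc : cell (q1, \row_i q2 i, k) z by split => //= i; rewrite mxE.
exists (q1, \row_i q2 i, k) => //; case: ifPn => // /asboolP []; move=> y [/= y1 y2].
have : ball z e y.
  split => /=.
    have := ler_distD (ratr q1) z.1 y.1; rewrite (distrC (ratr q1) y.1) /ball/=.
    by move: hq1 y1; rewrite -/d; lra.
  rewrite /ball/=; split => // i j; rewrite (ord1 i) /ball/=.
  have := ler_distD (ratr (q2 j)) (z.2 ord0 j) (y.2 ord0 j); rewrite (distrC (ratr (q2 j)) (y.2 ord0 j)).
  by have := y2 j; rewrite mxE; move: (hq2 j); rewrite -/d; lra.
move/he => /=; rewrite ltr_norml => /andP[_]; lra.
Qed.

End spacetime_continuous.

Section schwartz_decay.
Context {R : realType} (n : nat).
Notation X := 'rV[R]_n.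
Notation Z := (measurableTypeR R * X)%type.

Lemma schwartz_derive (V : normedModType R) (f : V -> R) (v : V) :
  schwartz f -> schwartz (fun x => 'D_v f x).
Proof.
move=> sf vs; have := sf (rcons vs v).
by rewrite /iter_derive foldr_rcons.
Qed.

Lemma schwartz_differentiable (V : normedModType R) (f : V -> R) x :
  schwartz f -> differentiable f x.
Proof. by move=> /(_ [::]) []. Qed.

Lemma schwartz_continuous (V : normedModType R) (f : V -> R) : schwartz f -> continuous f.
Proof.
by move=> sf x; apply: differentiable_continuous; exact: schwartz_differentiable.
Qed.

Lemma rV_coord_le_norm (x : X) i : `|x ord0 i| <= `|x|.
Proof.
rewrite [leRHS]/Num.norm/= mx_normrE.
exact: (le_bigmax _ (fun ij => `|x ij.1 ij.2|) (ord0, i)).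
Qed.

Lemma onePX_le (y : R) m : 0 <= y -> (1 + y) ^+ m <= 2 ^+ m * (1 + y ^+ m).
Proof.
move=> y0; have [y1|y1] := leP y 1.
  apply: (@le_trans _ _ (2 ^+ m)); first by apply: lerXn2r; rewrite ?nnegrE//; lra.
  by rewrite ler_peMr ?exprn_ge0// lerDl exprn_ge0.
apply: (@le_trans _ _ ((2 * y) ^+ m)); first by apply: lerXn2r; rewrite ?nnegrE; lra.
by rewrite exprMn; apply: ler_wpM2l; rewrite ?exprn_ge0// lerDr.
Qed.

(** With [N] the sup norm of the point, the product of the [n + 1] factors [1 + y ^ 2] is at most a
    multiple of [1 + N ^ (2 (n + 1))]; the Schwartz bounds of orders [0] and [2 (n + 1)] match these
    two terms. *)
Lemma dominated_schwartz (f : R * X -> R) : schwartz f -> dominated (f : Z -> R).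
Proof.
move=> sf; split; first exact: measurable_continuous_spacetime (schwartz_continuous sf).
have [_ /=] := sf [::]; rewrite /iter_derive/= => h.
have [M0 h0] := h 0%N; have [M1 h1] := h (2 * n.+1)%N.
have M00 : 0 <= M0 by apply: le_trans (h0 0); rewrite expr0 mul1r.
have M10 : 0 <= M1 by apply: le_trans (h1 0); rewrite mulr_ge0// exprn_ge0.
exists (2 ^+ n.+1 * (M0 + M1)); split; first by rewrite mulr_ge0 ?exprn_ge0// addr_ge0.
move=> s x; set N := `|(s, x)|; have N0 : 0 <= N by exact: normr_ge0.
have sN : `|s| <= N by rewrite /N prod_normE/= le_max lexx.
have xN i : `|x ord0 i| <= N.
  by apply: (le_trans (rV_coord_le_norm x i)); rewrite /N prod_normE/= le_max lexx orbT.
have oD (y : R) : `|y| <= N -> oneDsqr y <= 1 + N ^+ 2.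
  move=> yN; rewrite /oneDsqr lerD2l -(real_normK (num_real y)).
  by apply: lerXn2r; rewrite ?nnegrE.
have o0 (y : R) : 0 < oneDsqr y by exact: lt_le_trans ltr01 (oneDsqr_ge1 _).
pose W := oneDsqr s * \prod_(i < n) oneDsqr (x ord0 i).
have W0 : 0 < W by rewrite mulr_gt0// prodr_gt0.
have WE : decay s * decayX x = W^-1.
  rewrite /W invfM /decay /decayX /tensorRV; congr (_ * _).
  by rewrite -prodfV.
have WN : W <= 2 ^+ n.+1 * (1 + N ^+ (2 * n.+1)).
  apply: (@le_trans _ _ ((1 + N ^+ 2) ^+ n.+1)); last by rewrite exprM; apply: onePX_le; exact: sqr_ge0.
  rewrite exprS /W; apply: ler_pM; rewrite ?(ltW (o0 _))//; last 2 first.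
  - exact: oD.
  - apply: (@le_trans _ _ (\prod_(i < n) (1 + N ^+ 2))); last by rewrite prodr_const card_ord.
    by apply: ler_prod => i _; rewrite (ltW (o0 _))/= oD.
  by apply: prodr_ge0 => i _; exact: ltW.
rewrite WE ler_pdivlMr//.
have f0 : 0 <= `|f (s, x)| by [].
apply: (@le_trans _ _ (`|f (s, x)| * (2 ^+ n.+1 * (1 + N ^+ (2 * n.+1))))); first exact: ler_wpM2l.
rewrite mulrCA; apply: ler_wpM2l; first exact: exprn_ge0.
rewrite mulrDr mulr1 (mulrC _ (N ^+ _)); apply: lerD; last exact: h1.
by have := h0 (s, x); rewrite expr0 mul1r.
Qed.

End schwartz_decay.

(** * Integrals of derivatives *)

Section integral_derivative.
Context {R : realType}.
Notation mu := (@lebesgue_measure R).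

(** The fundamental theorem of calculus on growing intervals, with boundary terms of total size at
    most [2 K / (j + 1)]. Applied to [- g] as well, the inequality becomes an equality. *)
Lemma Rintegral_derive_le0 (g g' : R -> R) K :
  (forall x : R, is_derive x 1 g (g' x)) -> continuous g' ->
  (forall x, `|g x| <= K * decay x) -> (forall x, `|g' x| <= K * decay x) ->
  \int[mu]_x g' x <= 0.
Proof.
move=> dg cg' gK g'K.
have K0 : 0 <= K.
  by have := le_trans (normr_ge0 _) (gK 0); rewrite pmulr_lge0 ?decay_gt0.
have mg' : measurable_fun setT g' by exact: continuous_measurable_fun.
suff h j : \int[mu]_x g' x <= 2 * K / j.+1%:R.
  apply/ler_addgt0Pr => eps eps0; rewrite add0r.
  pose j := Num.bound (2 * K / eps); apply: (le_trans (h j)).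
  rewrite ler_pdivrMr// -ler_pdivrMl// [leLHS]mulrC.
  apply: (@le_trans _ _ j%:R); last by rewrite ler_nat.
  by rewrite ltW// archi_boundP// divr_ge0 ?(ltW eps0)// mulr_ge0.
(* [j] sets the accuracy and stays fixed while [k] grows, so every interval of the sequence already
   has boundary terms below the accuracy. *)
pose b k : R := (k + j.+1)%:R.
have b0 k : 0 < b k by rewrite ltr0n addnS.
pose f_ k x := g' x * \1_(`[(- b k), b k]%classic) x.
apply: (@Rintegral_le_lim _ _ _ mu f_ g' (fun x => K * decay x)) => //.
- by move=> k; apply: measurable_funM.
- by have := integrableZl measurableT K (@integrable_decay R); apply: eq_integrable.
- move=> k x; apply: le_trans (g'K x); rewrite /f_ normrM ler_piMr//.
  by rewrite indicE; case: (_ \in _); rewrite ?normr1 ?normr0.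
- move=> x; exists (Num.bound `|x|) => k xk; rewrite /f_ indicE mem_set ?mulr1//.
  rewrite /= in_itv/= -ler_norml (@le_trans _ _ (Num.bound `|x|)%:R)//; first by rewrite ltW// archi_boundP.
  by rewrite ler_nat (leq_trans xk)// leq_addr.
move=> k.
have -> : \int[mu]_x f_ k x = \int[mu]_(x in `[(- b k), b k]) g' x.
  rewrite /Rintegral [in RHS]integral_mkcond; congr fine.
  apply: eq_integral => x _; rewrite patchE /f_ indicE; case: (_ \in _); by rewrite ?mulr1 ?mulr0.
have bb : - b k < b k by rewrite gtrN.
rewrite (Rintegral_FTC bb (fun x _ => cg' x) (fun x _ => dg x)).
have db x : `|x| = b k -> `|g x| <= K / j.+1%:R.
  move=> xb; apply: (le_trans (gK x)); apply: ler_wpM2l => //.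
  rewrite /decay lef_pV2 ?posrE ?(lt_le_trans ltr01 (oneDsqr_ge1 _))//.
  rewrite /oneDsqr -(real_normK (num_real x)) xb.
  apply: (@le_trans _ _ (b k)); first by rewrite ler_nat leq_addl.
  have b1 : 1 <= b k by rewrite ler1n addnS.
  by apply: (@le_trans _ _ (b k ^+ 2)); [rewrite expr2 ler_peMr// ltW|rewrite lerDr].
have := db (b k) (gtr0_norm (b0 k)); have := db (- b k).
rewrite normrN gtr0_norm// => /(_ erefl); rewrite !ler_norml.
by move=> /andP[h1 h2] /andP[h3 h4]; rewrite -mulrA; move: h1 h2 h3 h4; generalize (g (b k)) (g (- b k)) (K / j.+1%:R) => u1 u2 u3; lra.
Qed.

Lemma Rintegral_derive_eq0 (g g' : R -> R) K :
  (forall x : R, is_derive x 1 g (g' x)) -> continuous g' ->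
  (forall x, `|g x| <= K * decay x) -> (forall x, `|g' x| <= K * decay x) ->
  \int[mu]_x g' x = 0.
Proof.
move=> dg cg' gK g'K; apply/eqP; rewrite eq_le (Rintegral_derive_le0 dg cg' gK g'K)/=.
have mg' : measurable_fun setT g' by exact: continuous_measurable_fun.
have gi : mu.-integrable setT (EFin \o g').
  apply: (@le_integrable_real _ _ R mu setT g' (fun x => K * decay x)) => //.
  by have := integrableZl measurableT K (@integrable_decay R); apply: eq_integrable.
have := @Rintegral_derive_le0 (fun x => - g x) (fun x => - g' x) K.
have -> : \int[mu]_x (- g' x) = - \int[mu]_x g' x.
  by under eq_Rintegral do rewrite -mulN1r; rewrite RintegralZl// mulN1r.
rewrite oppr_le0; apply.
- by move=> x; apply: cvgN; exact: cg'.
- by move=> x; rewrite normrN.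
- by move=> x; rewrite normrN.
Qed.

(** A derivative along the coordinate line through every point: this form is inherited when another
    coordinate is frozen, as the induction on [n] requires. *)
Definition line_derive n (i : 'I_n) (g g' : 'rV[R]_n -> R) : Prop := forall x,
  is_derive (0 : R) 1 (fun h : R => g (h *: delta_mx ord0 i + x)) (g' x) /\
  continuous (fun h : R => g' (h *: delta_mx ord0 i + x)).

Lemma decayX_cons n (z : measurableTypeR R * 'rV[R]_n) :
  decayX (consrV z) = decay z.1 * decayX z.2.
Proof. by rewrite /decayX tensorRV_cons. Qed.

Lemma consrV_delta0 n (h a : R) (v : 'rV[R]_n) :
  h *: delta_mx ord0 ord0 + consrV (a, v) = consrV (h + a, v).
Proof.
apply/rowP => i; rewrite mxE [X in X + _]mxE [delta_mx _ _ _ _]mxE.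
have [j ->|->] := unliftP ord0 i.
  by rewrite !consrV_lift/= mulr0 add0r.
by rewrite !consrV0/= mulr1.
Qed.

Lemma consrV_delta_lift n (h a : R) (v : 'rV[R]_n) j :
  h *: delta_mx ord0 (lift ord0 j) + consrV (a, v) = consrV (a, h *: delta_mx ord0 j + v).
Proof.
apply/rowP => i; rewrite mxE [X in X + _]mxE [delta_mx _ _ _ _]mxE.
have [k ->|->] := unliftP ord0 i.
  by rewrite !consrV_lift/= !mxE/= (inj_eq lift_inj).
by rewrite !consrV0/= mulr0 add0r.
Qed.

(** Induction applies to the slices unless [i] is the first coordinate; in that case Fubini's
    theorem brings this coordinate inside, where the one-dimensional statement applies. *)
Lemma Rintegral_line_derive_eq0 n (i : 'I_n) (g g' : 'rV[R]_n -> R) :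
  line_derive i g g' -> dominatedX g -> dominatedX g' ->
  \int[@lebesgue_rV R n]_x g' x = 0.
Proof.
elim: n i g g' => [[]//|n IH] i g g' gg' dg dg'.
have gi' := dominatedX_integrable dg'.
have [mg [K1 [K10 hK1]]] := dg; have [mg' [K2 [K20 hK2]]] := dg'.
have slice_dom (f : 'rV[R]_n.+1 -> R) a : dominatedX f -> dominatedX (fun v => f (consrV (a, v))).
  move=> [mf [K [K0 hK]]]; split.
    exact: (measurableT_comp (measurableT_comp mf (@measurable_consrV R n)) (pair1_measurable a)).
  exists K; split => // v; apply: (le_trans (hK _)); rewrite decayX_cons/=.
  by apply: ler_wpM2l => //; rewrite ler_piMl ?decay_le1// ltW// decayX_gt0.
rewrite Rintegral_rV//; have [j iE|iE] := unliftP ord0 i; rewrite {}iE in gg'.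
  under eq_Rintegral => a _.
    rewrite (IH j (fun v => g (consrV (a, v)))); [over| |exact: slice_dom..].
    move=> v; have [d c] := gg' (consrV (a, v)).
    split; first by under eq_fun do rewrite -consrV_delta_lift.
    by move=> h; under eq_fun do rewrite -consrV_delta_lift; exact: c.
  by rewrite Rintegral_cst// mul0r.
rewrite (@Rintegral_swap _ _ _ _ _ _ _ (fun z => g' (consrV z))); last exact: integrable_rV_cons.
have hh K (a : R) (v : 'rV[R]_n) : 0 <= K -> K <= Num.max K1 K2 ->
    K * (decay a * decayX v) <= Num.max K1 K2 * decay a.
  move=> K0 KK; apply: ler_pM => //.
    by rewrite mulr_ge0// ltW ?decay_gt0 ?decayX_gt0.
  by rewrite ler_piMr ?decayX_le1// ltW// decay_gt0.
suff H v : \int[mu]_a g' (consrV (a, v)) = 0.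
  by under eq_Rintegral do rewrite H; rewrite Rintegral_cst// mul0r.
apply: (@Rintegral_derive_eq0 (fun a => g (consrV (a, v))) _ (Num.max K1 K2)).
  - move=> a; have [d _] := gg' (consrV (a, v)).
    pose tr (a0 : R) := a0 - a; pose gl (h : R) := g (h *: delta_mx ord0 ord0 + consrV (a, v)).
    have -> : (fun a0 : R => g (consrV (a0, v))) = gl \o tr.
      by apply/funext => a0; rewrite /gl /tr/= consrV_delta0 subrK.
    have d' : is_derive (tr a) 1 gl (g' (consrV (a, v))) by rewrite /tr subrr.
    have da : is_derive a 1 tr 1 by apply: is_derive_eq; rewrite subr0.
    have := is_derive1_comp d' da.
    by rewrite mulr1.
  - have [_ c] := gg' (consrV (0, v)) => a.
    have -> : (fun a0 : R => g' (consrV (a0, v))) =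
        (fun h => g' (h *: delta_mx ord0 ord0 + consrV (0, v))).
      by apply/funext => a0 /=; rewrite consrV_delta0 addr0.
    exact: c.
  - move=> a; apply: (le_trans (hK1 _)); rewrite decayX_cons/=.
    by apply: hh; rewrite ?le_max ?lexx.
  - move=> a; apply: (le_trans (hK2 _)); rewrite decayX_cons/=.
    by apply: hh; rewrite ?le_max ?lexx ?orbT.
Qed.

End integral_derivative.

(** * Decay of the spatial Fourier transform *)

Section etransform.
Context {R : realType} (n : nat).
Notation mu := (@lebesgue_measure R).
Notation X := 'rV[R]_n.
Notation L := (@lebesgue_rV R n).
Notation Z := (measurableTypeR R * X)%type.

(** For real [f], the real part of [exp (i a)] times the Fourier transform at [xi] of the slice of
    [f] at time [s]. *)
Definition etransform (f : R * X -> R) (a s : R) (xi : X) : R :=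
  \int[L]_y (f (s, y) * cos (a - dotrV y xi)).

Definition spatial_dir (i : 'I_n) : R * X := (0, delta_mx ord0 i).

Lemma is_derive_path (f : R * X -> R) (z v : R * X) : differentiable f z ->
  is_derive (0 : R) 1 (fun h : R => f (h *: v + z)) ('D_v f z).
Proof.
move=> df; have dfv : derivable f z v by exact: diff_derivable.
apply: DeriveDef; first by move/derivable1P : dfv.
rewrite /derive; set d := (fun _ : R => _); set d' := (fun _ : R => _).
suff -> : d' = fun h => h^-1 *: ((f \o shift z) (h *: v) - f z) by [].
by apply/funext => h; rewrite /d' /d/= addr0 scale0r add0r [h *: 1]mulr1.
Qed.

Lemma continuous_path (f : R * X -> R) (z v : R * X) : schwartz f ->
  continuous (fun h : R => f (h *: v + z)).
Proof.
move=> sf h; apply: differentiable_continuous.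
by apply: differentiable_comp => //; exact: schwartz_differentiable.
Qed.

Lemma dotrV_path (h : R) (x xi : X) i :
  dotrV (h *: delta_mx ord0 i + x) xi = h * xi ord0 i + dotrV x xi.
Proof.
rewrite /dotrV (bigD1 i)//= [X in _ = _ + X](bigD1 i)//= !mxE !eqxx/= mulr1 mulrDl -!addrA.
congr (_ + (_ + _)); apply: eq_bigr => j ji.
by rewrite !mxE eqxx (negbTE ji)/= mulr0 add0r.
Qed.

Lemma spatial_path (h s : R) (y : X) i :
  h *: spatial_dir i + (s, y) = (s, h *: delta_mx ord0 i + y).
Proof. by congr pair; rewrite /= [h *: 0]mulr0 add0r. Qed.

(** Integration by parts in [y_i]; the factor [- i] of the complex identity is the shift of [a] by
    [- pi / 2]. *)
Lemma etransform_derive (f : R * X -> R) i a s (xi : X) : schwartz f ->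
  xi ord0 i * etransform f a s xi =
  etransform (fun z => 'D_(spatial_dir i) f z) (a - pi / 2) s xi.
Proof.
move=> sf; set Df := fun z => _; have sD : schwartz Df by exact: schwartz_derive.
have dF := dominated_slice s (dominated_schwartz sf).
have dD := dominated_slice s (dominated_schwartz sD).
have dmul (h w : X -> R) (c : R) : dominatedX h -> measurable_fun setT w ->
    (forall y, `|w y| <= c) -> dominatedX (fun y => h y * w y).
  move=> [mh [K [K0 hK]]] mw wc; split; first exact: measurable_funM.
  have c0 : 0 <= c := le_trans (normr_ge0 _) (wc 0).
  exists (c * K); split; first exact: mulr_ge0.
  by move=> y; rewrite normrM mulrC -mulrA; apply: ler_pM.
have mdot : measurable_fun setT (fun y : X => a - dotrV y xi).
  by apply: measurable_funB => //; apply: measurable_dotrV.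
have msin : measurable_fun setT (fun y : X => sin (a - dotrV y xi)).
  by apply: (measurableT_comp _ mdot); apply: continuous_measurable_fun; exact: continuous_sin.
have mcos : measurable_fun setT (fun y : X => cos (a - dotrV y xi)).
  exact: (measurableT_comp measurable_fun_cos mdot).
have d1 : dominatedX (fun y => f (s, y) * sin (a - dotrV y xi)).
  by apply: (@dmul _ _ 1) => // y; exact: sin_max.
have d2 : dominatedX (fun y => Df (s, y) * sin (a - dotrV y xi)).
  by apply: (@dmul _ _ 1) => // y; exact: sin_max.
have d3 : dominatedX (fun y => f (s, y) * (xi ord0 i * cos (a - dotrV y xi))).
  apply: (@dmul _ _ `|xi ord0 i|) => //; first exact: measurable_funM.
  by move=> y; rewrite normrM ler_piMr//; exact: cos_max.
have i2 := dominatedX_integrable d2; have i3 := dominatedX_integrable d3.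
have ic : L.-integrable setT (EFin \o (fun y => f (s, y) * cos (a - dotrV y xi))).
  by apply/dominatedX_integrable/(@dmul _ _ 1) => // y; exact: cos_max.
pose g' y := Df (s, y) * sin (a - dotrV y xi) - f (s, y) * (xi ord0 i * cos (a - dotrV y xi)).
have dg' : dominatedX g'.
  have [m2 [K2 [K20 h2]]] := d2; have [m3 [K3 [K30 h3]]] := d3.
  split; first exact: measurable_funB.
  exists (K2 + K3); split; first exact: addr_ge0.
  by move=> y; apply: (le_trans (ler_normB _ _)); rewrite mulrDl lerD.
have gg' : line_derive i (fun y => f (s, y) * sin (a - dotrV y xi)) g'.
  move=> y; pose th (h : R) := a - (h * xi ord0 i + dotrV y xi).
  have dth (h : R) : is_derive h 1 th (- xi ord0 i).
    by apply: is_derive_eq; rewrite /GRing.scale/= ; ring.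
  have ds (h : R) : is_derive h 1 (fun h => sin (th h)) (cos (th h) * - xi ord0 i).
    have -> : (fun h => sin (th h)) = sin \o th by [].
    exact: is_derive1_comp.
  have dc (h : R) : is_derive h 1 (fun h => cos (th h)) (- sin (th h) * - xi ord0 i).
    have -> : (fun h => cos (th h)) = cos \o th by [].
    exact: is_derive1_comp.
  split.
    pose q (h : R) := f (h *: spatial_dir i + (s, y)).
    have dq : is_derive (0 : R) 1 q (Df (s, y)).
      by apply: is_derive_path; exact: schwartz_differentiable.
    rewrite (_ : (fun h : R => _) = fun h => q h * sin (th h)); last first.
      by apply/funext => h; rewrite /q spatial_path dotrV_path.
    have ds0 := ds 0; apply: is_derive_eq.
    rewrite /g' /GRing.scale/= /q spatial_path /th scale0r add0r mul0r add0r.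
    by ring.
  have -> : (fun h : R => g' (h *: delta_mx ord0 i + y)) =
      (fun h => Df (h *: spatial_dir i + (s, y)) * sin (th h) -
        f (h *: spatial_dir i + (s, y)) * (xi ord0 i * cos (th h))).
    by apply/funext => h; rewrite /g' !spatial_path !dotrV_path.
  move=> h; have c1 := @continuous_path Df (s, y) (spatial_dir i) sD h.
  have c2 := @continuous_path f (s, y) (spatial_dir i) sf h.
  have c3 := is_derive_continuous (ds h); have c4 := is_derive_continuous (dc h).
  apply: (@cvgB _ _ _ _ _ _ _ _ _ (cvgM c1 c3)).
  by apply: (cvgM c2); apply: cvgM c4; exact: cvg_cst.
have := Rintegral_line_derive_eq0 gg' d1 dg'.
rewrite RintegralB// => /eqP; rewrite subr_eq0 => /eqP E.
rewrite /etransform -RintegralZl//.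
transitivity (\int[L]_y (f (s, y) * (xi ord0 i * cos (a - dotrV y xi)))).
  by apply: eq_Rintegral => y _; rewrite mulrCA.
rewrite -E; apply: eq_Rintegral => y _; congr (_ * _).
rewrite [RHS](_ : _ = cos (a - dotrV y xi - pi / 2)); last by congr cos; ring.
by rewrite cosB cos_pihalf sin_pihalf mulr0 mulr1 add0r.
Qed.

(* Each factor [1 + xi_i ^ 2] costs two integrations by parts in [y_i]. *)
Lemma etransform_decay (f : R * X -> R) : schwartz f ->
  exists2 K : R, 0 <= K & forall a s xi, `|etransform f a s xi| <= K * (decay s * decayX xi).
Proof.
move=> sf0.
(* Induction over the list of coordinates whose weight is included so far, for all Schwartz
   functions at once because each step passes to a second derivative. *)
suff main (l : seq 'I_n) : forall f : R * X -> R, schwartz f ->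
    exists2 K : R, 0 <= K & forall a s xi,
      `|etransform f a s xi| * \prod_(i <- l) oneDsqr (xi ord0 i) <= K * decay s.
  have [K K0 hK] := main (index_enum 'I_n) f sf0; exists K => // a s xi.
  have p0 : 0 < \prod_(i < n) oneDsqr (xi ord0 i).
    by apply: prodr_gt0 => i _; exact: lt_le_trans ltr01 (oneDsqr_ge1 _).
  have -> : decayX xi = (\prod_(i < n) oneDsqr (xi ord0 i))^-1.
    by rewrite /decayX /tensorRV /decay -prodfV.
  by rewrite mulrA ler_pdivlMr.
elim: l => [|i l IH] {sf0}f sf.
  have df := dominated_schwartz sf; have [_ [K [K0 hK]]] := df.
  pose I := \int[L]_y decayX y.
  have I0 : 0 <= I by apply: Rintegral_ge0 => y _; rewrite ltW// decayX_gt0.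
  exists (K * I); first exact: mulr_ge0.
  move=> a s xi; rewrite big_nil mulr1.
  have mcos : measurable_fun setT (fun y : X => cos (a - dotrV y xi)).
    apply: (measurableT_comp measurable_fun_cos); apply: measurable_funB => //.
    exact: measurable_dotrV.
  have dfs := dominated_slice s df; have [ms _] := dfs.
  have ic : L.-integrable setT (EFin \o (fun y => f (s, y) * cos (a - dotrV y xi))).
    apply: (@le_integrable_real _ _ _ _ _ _ (fun y => `|f (s, y)|)) => //.
    - exact: measurable_funM.
    - by move=> y _; rewrite normrM ler_piMr//; exact: cos_max.
    - exact: integrable_norm (dominatedX_integrable dfs).
  apply: (le_trans (le_normr_Rintegral measurableT ic)).
  have -> : K * I * decay s = \int[L]_y ((K * decay s) * decayX y).
    by rewrite RintegralZl//; [rewrite -/I mulrAC|exact: integrable_decayX].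
  apply: le_Rintegral => //.
  - exact: integrable_norm ic.
  - by have := integrableZl measurableT (K * decay s) (@integrable_decayX R n); apply: eq_integrable.
  move=> y _; rewrite normrM -mulrA; apply: le_trans (hK s y).
  by rewrite ler_piMr//; exact: cos_max.
have sD : schwartz (fun z => 'D_(spatial_dir i) f z) by exact: schwartz_derive.
have sDD : schwartz (fun z => 'D_(spatial_dir i) (fun z => 'D_(spatial_dir i) f z) z).
  exact: schwartz_derive.
have [K1 K10 h1] := IH _ sf; have [K2 K20 h2] := IH _ sDD.
exists (K1 + K2); first exact: addr_ge0.
move=> a s xi; rewrite big_cons mulrA /oneDsqr mulrDr mulr1 mulrDl mulrDl; apply: lerD; first exact: h1.
rewrite [X in X * _](_ : _ = `|etransform (fun z => 'D_(spatial_dir i)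
    (fun z => 'D_(spatial_dir i) f z) z) (a - pi / 2 - pi / 2) s xi|); first exact: h2.
rewrite -(etransform_derive _ _ _ _ sD) -(etransform_derive _ _ _ _ sf) !normrM.
by rewrite -(real_normK (num_real (xi ord0 i))); ring.
Qed.

End etransform.

(** * The Duhamel integral as an oscillatory integral *)

Section solution.
Context {R : realType} (n : nat).
Notation mu := (@lebesgue_measure R).
Notation X := 'rV[R]_n.
Notation L := (@lebesgue_rV R n).
Notation Z := (measurableTypeR R * X)%type.
Notation M := (@spacetime R n).

Lemma integrable_etransform (f : R * X -> R) (a s : R) (xi : X) : schwartz f ->
  L.-integrable setT (EFin \o (fun y => f (s, y) * cos (a - dotrV y xi))).
Proof.
move=> sf; have dfs := dominated_slice s (dominated_schwartz sf); have [ms _] := dfs.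
apply: (@le_integrable_real _ _ _ _ _ _ (fun y => `|f (s, y)|)) => //.
- apply: measurable_funM => //; apply: (measurableT_comp measurable_fun_cos).
  by apply: measurable_funB => //; exact: measurable_dotrV.
- by move=> y _; rewrite normrM ler_piMr//; exact: cos_max.
- exact: integrable_norm (dominatedX_integrable dfs).
Qed.

Lemma etransformD (f : R * X -> R) (c a s : R) (xi : X) : schwartz f ->
  etransform f (c + a) s xi =
  cos a * etransform f c s xi - sin a * etransform f (c - pi / 2) s xi.
Proof.
move=> sf; rewrite /etransform -!RintegralZl ?integrable_etransform// -RintegralB//; last 2 first.
- have := integrableZl measurableT (cos a) (integrable_etransform c s xi sf).
  by apply: eq_integrable.
- have := integrableZl measurableT (sin a) (integrable_etransform (c - pi / 2) s xi sf).
  by apply: eq_integrable.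
apply: eq_Rintegral => y _.
rewrite (_ : c - pi / 2 - dotrV y xi = (c - dotrV y xi) - pi / 2); last by ring.
rewrite (_ : c + a - dotrV y xi = (c - dotrV y xi) + a); last by ring.
by rewrite (cosD (c - dotrV y xi) a) (cosB (c - dotrV y xi) (pi / 2)) cos_pihalf sin_pihalf; ring.
Qed.

Lemma measurable_etransform (f : R * X -> R) (a : R * X -> R) :
  schwartz f -> measurable_fun setT (a : Z -> R) ->
  measurable_fun setT (fun p : Z => etransform f (a p) p.1 p.2).
Proof.
move=> sf ma; have [mf _] := dominated_schwartz sf.
apply: (@measurable_Rintegral_param _ _ _ _ R L
  (fun q : Z * X => f (q.1.1, q.2) * cos (a q.1 - dotrV q.2 q.1.2))).
apply: measurable_funM.
  apply: (measurableT_comp mf (g := fun q : Z * X => (q.1.1, q.2))).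
  apply: measurable_fun_pair => //.
  exact: (measurableT_comp measurable_fst measurable_fst).
apply: (measurableT_comp measurable_fun_cos); apply: measurable_funB.
  exact: (measurableT_comp ma measurable_fst).
by apply: measurable_dotrV => //; exact: (measurableT_comp measurable_snd measurable_fst).
Qed.

Lemma dominated_etransform (f : R * X -> R) (a : R * X -> R) :
  schwartz f -> measurable_fun setT (a : Z -> R) ->
  dominated (fun p : Z => etransform f (a p) p.1 p.2).
Proof.
move=> sf ma; split; first exact: measurable_etransform.
by have [K K0 hK] := etransform_decay sf; exists K; split => // s x; exact: hK.
Qed.

Variables (f : R * X -> R) (t : R).
Hypothesis sf : schwartz f.

Let df : dominated (past_part f t : Z -> R).
Proof. exact: dominated_past (dominated_schwartz sf). Qed.

Lemma otransform_past (a : R) (xi : X) :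
  otransform M idZ (past_part f t) a xi =
  \int[mu]_s (\1_(past t) s * etransform f (s * dotrV xi xi + a) s xi).
Proof.
have Fi := integrable_otransform measurable_idZ (dominated_integrable df) a xi.
apply: etrans (esym (Rintegral_prod12 Fi)) _.
apply: eq_Rintegral => s _; rewrite /etransform -RintegralZl//; last exact: integrable_etransform.
apply: eq_Rintegral => y _; rewrite /past_part indic_time_set mulrAC mulrC mulrA.
by rewrite mulrA; congr (_ * cos _); rewrite /phase/=; ring.
Qed.

Lemma integrable_past_etransform (a : R) (xi : X) : mu.-integrable setT
  (EFin \o (fun s => \1_(past t) s * etransform f (s * dotrV xi xi + a) s xi)).
Proof.
have [K K0 hK] := etransform_decay sf.
have iE : mu.-integrable setT (EFin \o (fun s => (K * decayX xi) * decay s)).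
  by have := integrableZl measurableT (K * decayX xi) (@integrable_decay R); apply: eq_integrable.
have bE s : `|\1_(past t) s * etransform f (s * dotrV xi xi + a) s xi| <= (K * decayX xi) * decay s.
  rewrite normrM mulrAC -mulrA; apply: le_trans (hK (s * dotrV xi xi + a) s xi).
  by rewrite ler_piMl// indicE; case: (_ \in _); rewrite ?normr1 ?normr0.
  apply: (@le_integrable_real _ _ R mu setT _ (fun s => (K * decayX xi) * decay s)) => //.
  apply: measurable_funM; first exact: measurable_indic (measurable_past t).
  pose a' (p : Z) : R := p.1 * dotrV p.2 p.2 + a.
  have ma' : measurable_fun setT a'.
    by apply: measurable_funD => //; apply: measurable_funM => //; apply: measurable_dotrV; exact: measurable_snd.
  exact: (measurableT_comp (measurable_etransform sf ma') (pair2_measurable xi)).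
Qed.

(** The decay of the spatial transform is uniform in the phase, so it survives the time integral;
    this is what makes the removal of the frequency cut-off possible. *)
Lemma dominatedX_otransform_past (a : R) : dominatedX (otransform M idZ (past_part f t) a).
Proof.
split; first exact: (measurable_otransform measurable_idZ (dominated_integrable df)).
have [K K0 hK] := etransform_decay sf.
pose I := \int[mu]_s decay s; have I0 : 0 <= I by apply: Rintegral_ge0 => s _; rewrite ltW// decay_gt0.
exists (K * I); split; first exact: mulr_ge0.
move=> xi; rewrite otransform_past.
have iE : mu.-integrable setT (EFin \o (fun s => (K * decayX xi) * decay s)).
  by have := integrableZl measurableT (K * decayX xi) (@integrable_decay R); apply: eq_integrable.
have ii := integrable_past_etransform a xi.
apply: (le_trans (le_normr_Rintegral measurableT ii)).
apply: (@le_trans _ _ (\int[mu]_s ((K * decayX xi) * decay s))).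
  apply: le_Rintegral => //; first exact: integrable_norm ii.
  move=> s _; rewrite normrM mulrAC -mulrA; apply: le_trans (hK (s * dotrV xi xi + a) s xi).
  by rewrite ler_piMl// indicE; case: (_ \in _); rewrite ?normr1 ?normr0.
by rewrite RintegralZl//; [rewrite -/I mulrAC|exact: integrable_decay].
Qed.

(** The frequency integral is outermost: without a cut-off the kernel is not an absolutely
    convergent integral, whereas the transforms of [past_part] decay. The integrand is the one of
    [oform_freq] with the test function reduced to the point [x]. *)
Definition solution (b : R) (x : X) : R := \int[L]_xi
  (otransform M idZ (past_part f t) 0 xi * cos (phase ((t, x) : Z) xi + b) +
   otransform M idZ (past_part f t) (- (pi / 2)) xi * cos (phase ((t, x) : Z) xi + (b - pi / 2))).

Let T1 := otransform M idZ (past_part f t) 0.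
Let T2 := otransform M idZ (past_part f t) (- (pi / 2)).
Let w b (q : X * X) : R := T1 q.2 * cos (phase ((t, q.1) : Z) q.2 + b) +
   T2 q.2 * cos (phase ((t, q.1) : Z) q.2 + (b - pi / 2)).

Let mcos b : measurable_fun setT (fun q : X * X => cos (phase ((t, q.1) : Z) q.2 + b)).
Proof.
apply: (measurableT_comp measurable_fun_cos); apply: measurable_funD => //.
by apply: measurable_phase_comp => //; exact: measurable_fun_pair.
Qed.

Let mT1 : measurable_fun setT T1. Proof. by case: (dominatedX_otransform_past 0). Qed.
Let mT2 : measurable_fun setT T2. Proof. by case: (dominatedX_otransform_past (- (pi / 2))). Qed.

Let mw b : measurable_fun setT (w b).
Proof.
apply: measurable_funD; apply: measurable_funM => //.
  exact: (measurableT_comp mT1 measurable_snd).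
exact: (measurableT_comp mT2 measurable_snd).
Qed.

Let w_le b : exists2 K : R, 0 <= K & forall q, `|w b q| <= K * decayX q.2.
Proof.
have [_ [K1 [K10 h1]]] := dominatedX_otransform_past 0.
have [_ [K2 [K20 h2]]] := dominatedX_otransform_past (- (pi / 2)).
exists (K1 + K2); first exact: addr_ge0.
move=> q; rewrite [leRHS]mulrDl; apply: (le_trans (ler_normD _ _)); apply: lerD; rewrite normrM.
  by apply: le_trans (h1 q.2); rewrite ler_piMr//; exact: cos_max.
by apply: le_trans (h2 q.2); rewrite ler_piMr//; exact: cos_max.
Qed.

Lemma measurable_solution b : measurable_fun setT (solution b).
Proof. exact: (@measurable_Rintegral_param _ _ _ _ R L (w b) (mw b)). Qed.

(** The frequency boxes exhaust space and the decay of the transforms of [past_part] dominates the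
    integrand, so a bound uniform in [N] passes to the limit. *)
Lemma represents_solution b : represents t b f (solution b).
Proof.
move=> g B dg HB; have [mg _] := dg; have gi := dominatedX_integrable dg.
have [K K0 hK] := w_le b.
pose G (q : X * X) := g q.1 * w b q.
have Gi : (L \x L)%E.-integrable setT (EFin \o G).
  have ti := integrable_tensor (integrable_norm gi) (@integrable_decayX R n).
  apply: (@le_integrable_real _ _ _ _ _ _ (fun q : X * X => K * (`|g q.1| * decayX q.2))) => //.
  - apply: measurable_funM => //; exact: (measurableT_comp mg measurable_fst).
  - move=> q _; rewrite normrM mulrCA; apply: ler_wpM2l => //; exact: hK.
  - by have := integrableZl measurableT K ti; apply: eq_integrable.
pose S xi := T1 xi * otransform L (at_time t) g b xi +
  T2 xi * otransform L (at_time t) g (b - pi / 2) xi.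
have SE xi : \int[L]_x G (x, xi) = S xi.
  have o1 := integrable_otransform (measurable_at_time t) gi b xi.
  have o2 := integrable_otransform (measurable_at_time t) gi (b - pi / 2) xi.
  rewrite /S /otransform -!RintegralZl// -RintegralD//; last 2 first.
  - by have := integrableZl measurableT (T1 xi) o1; apply: eq_integrable.
  - by have := integrableZl measurableT (T2 xi) o2; apply: eq_integrable.
  by apply: eq_Rintegral => x _; rewrite /G /w /=; ring.
have -> : \int[L]_x (solution b x * g x) = \int[L]_xi S xi.
  transitivity (\int[L]_x \int[L]_xi G (x, xi)).
    apply: eq_Rintegral => x _; rewrite /solution mulrC -RintegralZl//.
    apply: (@le_integrable_real _ _ _ _ _ _ (fun xi => K * decayX xi)) => //.
    - exact: (measurable_fun_slice x (mw b)).
    - by move=> xi _; exact: (hK (x, xi)).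
    - by have := integrableZl measurableT K (@integrable_decayX R n); apply: eq_integrable.
  rewrite (@Rintegral_swap _ _ _ _ _ _ _ G Gi).
  by apply: eq_Rintegral => xi _; exact: SE.
pose Ig := \int[L]_x `|g x|.
have Ig0 : 0 <= Ig by apply: Rintegral_ge0.
have [_ [K1 [K10 h1]]] := dominatedX_otransform_past 0.
have [_ [K2 [K20 h2]]] := dominatedX_otransform_past (- (pi / 2)).
have Sle xi : `|S xi| <= (K1 + K2) * Ig * decayX xi.
  rewrite mulrAC [(K1 + K2) * _]mulrDl [leRHS]mulrDl; apply: (le_trans (ler_normD _ _)).
  apply: lerD; rewrite normrM; apply: ler_pM => //.
    exact: (normr_otransform_le (measurable_at_time t) gi).
  exact: (normr_otransform_le (measurable_at_time t) gi).
have mS : measurable_fun setT S.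
  by apply: measurable_funD; apply: measurable_funM => //; exact: (measurable_otransform (measurable_at_time t) gi).
pose S_ k xi := @box_weight R n k.+1%:R xi * S xi.
have bw k xi : 0 <= @box_weight R n k.+1%:R xi <= 1.
  rewrite box_weight_ge0/= /box_weight /tensorRV.
  rewrite -[leRHS](@big1 _ _ *%R _ (index_enum 'I_n) xpredT (fun=> 1))//.
  apply: ler_prod => i _; rewrite indicE; case: (_ \in _) => /=; by rewrite ?ler01 ?lexx.
have mS_ k : measurable_fun setT (S_ k).
  by apply: measurable_funM => //; have /integrableP[/measurable_EFinP] := @integrable_box_weight R n k.+1%:R.
apply: (@Rintegral_le_lim _ _ _ L S_ S (fun xi => (K1 + K2) * Ig * decayX xi)) => //.
- by have := integrableZl measurableT ((K1 + K2) * Ig) (@integrable_decayX R n); apply: eq_integrable.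
- move=> k xi; apply: le_trans (Sle xi); rewrite /S_ normrM ler_piMl//.
  by have /andP[b0 b1] := bw k xi; rewrite ger0_norm.
- move=> xi; have [m hm] := box_exhaust xi; exists m => k mk.
  rewrite /S_ /box_weight /tensorRV big1 ?mul1r// => i _.
  rewrite indicE mem_set//= in_itv/= -ler_norml (le_trans (hm i))// ler_nat.
  exact: leqW.
move=> k; have := HB k.+1%:R (ltr0Sn _ _).
rewrite (oform_freq measurable_idZ (measurable_at_time t) b (@integrable_box_weight R n k.+1%:R)
  (dominated_integrable df) gi).
exact: le_trans (ler_norm _).
Qed.

(** Fubini's theorem restores Duhamel's order, with time outside and frequency inside. *)
Lemma solutionE b x : solution b x = \int[mu]_(s in past t) \int[L]_xi
  etransform f (s * dotrV xi xi - phase ((t, x) : Z) xi - b) s xi.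
Proof.
pose a (p : R * X) : R := p.1 * dotrV p.2 p.2 - phase ((t, x) : Z) p.2 - b.
have ma : measurable_fun setT (a : Z -> R).
  apply: measurable_funB => //; apply: measurable_funB.
    by apply: measurable_funM => //; apply: measurable_dotrV; exact: measurable_snd.
  apply: measurable_phase_comp => //; exact: measurable_snd.
pose e (p : Z) : R := \1_(past t) p.1 * etransform f (a p) p.1 p.2.
have de : dominated e.
  have := dominated_restrict (dominated_etransform sf ma) (measurable_time_set (measurable_past t)).
  by rewrite (_ : (fun z => _) = e)//; apply/funext => -[s y]; rewrite /e indic_time_set mulrC.
transitivity (\int[L]_xi \int[mu]_s e (s, xi)).
  apply: eq_Rintegral => xi _; rewrite !otransform_past.
  set B := phase _ _.
  have int_e := fun c => integrable_past_etransform c xi.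
  rewrite mulrC (mulrC _ (cos (B + (b - pi / 2)))) -!RintegralZl// -RintegralD//; last 2 first.
  - have := integrableZl measurableT (cos (B + b)) (int_e 0); by apply: eq_integrable.
  - have := integrableZl measurableT (cos (B + (b - pi / 2))) (int_e (- (pi / 2))); by apply: eq_integrable.
  apply: eq_Rintegral => s _; rewrite /e /a /= -/B.
  rewrite (_ : s * dotrV xi xi - B - b = s * dotrV xi xi + - (B + b)); last by ring.
  rewrite (etransformD (s * dotrV xi xi) (- (B + b)) s xi sf) cosN sinN addr0 addrA (cosB (B + b)) cos_pihalf sin_pihalf.
  by ring.
rewrite -(@Rintegral_swap _ _ _ _ _ _ _ e); last exact: dominated_integrable.
rewrite /Rintegral [in RHS]integral_mkcond; congr fine; apply: eq_integral => s _.
rewrite patchE; case: ifPn => h; congr EFin.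
  by apply: eq_Rintegral => xi _; rewrite /e/= indicE h mul1r.
under eq_integral do rewrite /e/= indicE (negbTE h) mul0r.
by rewrite integral0.
Qed.

End solution.

Lemma Rintegral_comb d (T : measurableType d) (R : realType) (m : {measure set T -> \bar R})
    (D : set T) (h g1 g2 : T -> R) (c k : R) : measurable D ->
  m.-integrable D (EFin \o g1) -> m.-integrable D (EFin \o g2) ->
  (forall x, D x -> h x = c * (g1 x + k * g2 x)) ->
  \int[m]_(x in D) h x = c * (\int[m]_(x in D) g1 x + k * \int[m]_(x in D) g2 x).
Proof.
move=> mD i1 i2 hE.
have i3 : m.-integrable D (EFin \o (fun x => k * g2 x)).
  by have := integrableZl mD k i2; apply: eq_integrable.
rewrite -RintegralZl// -RintegralD// -RintegralZl//; last first.
  by have := integrableD mD i1 i3; apply: eq_integrable.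
by apply: eq_Rintegral => x; rewrite inE; exact: hE.
Qed.

Section duhamel.
Context {R : realType} (n : nat).
Local Open Scope complex_scope.
Notation mu := (@lebesgue_measure R).
Notation X := 'rV[R]_n.
Notation L := (@lebesgue_rV R n).
Notation Z := (measurableTypeR R * X)%type.

Variable F : R -> X -> R[i].
Hypothesis sF : cschwartz (fun z : R * X => F z.1 z.2).

Let FR (z : R * X) : R := complex.Re (F z.1 z.2).
Let FI (z : R * X) : R := complex.Im (F z.1 z.2).
Let sR : schwartz FR. Proof. by case: sF. Qed.
Let sI : schwartz FI. Proof. by case: sF. Qed.

Lemma cis_mul (a : R) (z : R[i]) :
  cis a * z = (cos a * complex.Re z - sin a * complex.Im z) +i* (cos a * complex.Im z + sin a * complex.Re z).
Proof. by case: z. Qed.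

Let sin_cos (a : R) : sin a = cos (a - pi / 2).
Proof. by rewrite cosB cos_pihalf sin_pihalf mulr0 mulr1 add0r. Qed.

Lemma fourierE s (xi : X) : fourier (F s) xi =
  (etransform FR 0 s xi - etransform FI (- (pi / 2)) s xi) +i*
  (etransform FI 0 s xi + etransform FR (- (pi / 2)) s xi).
Proof.
rewrite /fourier /cintegral; congr (_ +i* _).
  rewrite /etransform -RintegralB//; try exact: integrable_etransform.
  apply: eq_Rintegral => y _; rewrite cis_mul/= sin_cos -/(FR (s, y)) -/(FI (s, y)).
  rewrite mulrC (mulrC _ (FI _)); congr (_ * cos _ - _ * cos _); ring.
rewrite /etransform -RintegralD//; try exact: integrable_etransform.
apply: eq_Rintegral => y _; rewrite cis_mul/= sin_cos -/(FR (s, y)) -/(FI (s, y)).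
rewrite mulrC (mulrC _ (FR _)); congr (_ * cos _ + _ * cos _); ring.
Qed.

Let rotate (a s : R) (xi : X) : cis a * fourier (F s) xi =
  (etransform FR a s xi - etransform FI (a - pi / 2) s xi) +i*
  (etransform FI a s xi + etransform FR (a - pi / 2) s xi).
Proof.
have E f (sf : schwartz f) : etransform f a s xi =
    cos a * etransform f 0 s xi - sin a * etransform f (- (pi / 2)) s xi.
  by rewrite -[in LHS](add0r a) (etransformD 0 a s xi sf) add0r.
have E' f (sf : schwartz f) : etransform f (a - pi / 2) s xi =
    sin a * etransform f 0 s xi + cos a * etransform f (- (pi / 2)) s xi.
  rewrite -[in LHS](add0r (a - pi / 2)) (etransformD 0 _ s xi sf) add0r.
  by rewrite -sin_cos sinB cos_pihalf sin_pihalf; ring.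
rewrite fourierE cis_mul/= !E// !E'//; congr (_ +i* _); ring.
Qed.

Let ang (t : R) (x : X) (s : R) (xi : X) : R := s * dotrV xi xi - phase ((t, x) : Z) xi.

Let cisD (a b : R) (z : R[i]) : cis a * (cis b * z) = cis (a + b) * z.
Proof.
case: z => u v; rewrite !cis_mul/= cosD sinD; congr (_ +i* _); ring.
Qed.

Let schroedingerE (t s : R) (x : X) : schroedinger (t - s) (F s) x =
  ((2 * pi) ^- n * \int[L]_xi (etransform FR (ang t x s xi) s xi - etransform FI (ang t x s xi - pi / 2) s xi)) +i*
  ((2 * pi) ^- n * \int[L]_xi (etransform FI (ang t x s xi) s xi + etransform FR (ang t x s xi - pi / 2) s xi)).
Proof.
rewrite /schroedinger /fourier_multiplier /inv_fourier.
have -> : (fun xi => cis (dotrV x xi) * (cis (- (t - s) * dotrV xi xi) * fourier (F s) xi)) =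
    (fun xi => (etransform FR (ang t x s xi) s xi - etransform FI (ang t x s xi - pi / 2) s xi) +i*
      (etransform FI (ang t x s xi) s xi + etransform FR (ang t x s xi - pi / 2) s xi)).
  apply/funext => xi; rewrite cisD -rotate; congr (cis _ * _).
  by rewrite /ang /phase/=; ring.
by rewrite /cintegral/= /GRing.mul/= !mul0r subr0 addr0.
Qed.

Let mang t x : measurable_fun setT (fun p : Z => ang t x p.1 p.2).
Proof.
apply: measurable_funB; last by apply: measurable_phase_comp => //; exact: measurable_snd.
by apply: measurable_funM => //; apply: measurable_dotrV; exact: measurable_snd.
Qed.

Let integrable_slice f t x b s : schwartz f ->
  L.-integrable setT (EFin \o (fun xi => etransform f (ang t x s xi - b) s xi)).
Proof.
move=> sf; have ma := @measurable_funB _ _ R setT _ (fun=> b) (mang t x) (measurable_cst b).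
have de := dominated_etransform (a := fun p => ang t x p.1 p.2 - b) sf ma.
exact: dominatedX_integrable (dominated_slice s de).
Qed.

Let integrable_time f t x b : schwartz f ->
  mu.-integrable (past t) (EFin \o (fun s => \int[L]_xi etransform f (ang t x s xi - b) s xi)).
Proof.
move=> sf; have ma := @measurable_funB _ _ R setT _ (fun=> b) (mang t x) (measurable_cst b).
have de := dominated_etransform (a := fun p => ang t x p.1 p.2 - b) sf ma.
have := integrable_Rintegral_param (dominated_integrable de).
apply: integrableS => //; exact: measurable_past.
Qed.

Let Re_schroedinger (t s : R) (x : X) : complex.Re (schroedinger (t - s) (F s) x) =
  (2 * pi) ^- n * (\int[L]_xi etransform FR (ang t x s xi - 0) s xi +
    -1 * \int[L]_xi etransform FI (ang t x s xi - pi / 2) s xi).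
Proof.
rewrite schroedingerE; congr (_ * _); rewrite -[RHS]mul1r.
apply: Rintegral_comb => //; [exact: integrable_slice..|].
by move=> xi _; rewrite subr0 mul1r mulN1r.
Qed.

Let Im_schroedinger (t s : R) (x : X) : complex.Im (schroedinger (t - s) (F s) x) =
  (2 * pi) ^- n * (\int[L]_xi etransform FI (ang t x s xi - 0) s xi +
    1 * \int[L]_xi etransform FR (ang t x s xi - pi / 2) s xi).
Proof.
rewrite schroedingerE; congr (_ * _); rewrite -[RHS]mul1r.
apply: Rintegral_comb => //; [exact: integrable_slice..|].
by move=> xi _; rewrite subr0 !mul1r.
Qed.

(** The real and imaginary parts of [F] are treated separately; multiplication by the imaginary unit
    is, up to sign, the shift [b = pi / 2]. *)
Lemma Re_duhamel t x : complex.Re (duhamel F t x) =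
  (2 * pi) ^- n * (solution FR t 0 x - solution FI t (pi / 2) x).
Proof.
rewrite -[LHS]/(\int[mu]_(s in past t) complex.Re (schroedinger (t - s) (F s) x)).
rewrite (solutionE t sR) (solutionE t sI) -[X in _ * (_ + X)]mulN1r.
apply: Rintegral_comb; [exact: measurable_past|exact: integrable_time..|].
by move=> s _; exact: Re_schroedinger.
Qed.

Lemma Im_duhamel t x : complex.Im (duhamel F t x) =
  (2 * pi) ^- n * (solution FI t 0 x + solution FR t (pi / 2) x).
Proof.
rewrite -[LHS]/(\int[mu]_(s in past t) complex.Im (schroedinger (t - s) (F s) x)).
rewrite (solutionE t sR) (solutionE t sI) -[X in _ * (_ + X)]mul1r.
apply: Rintegral_comb; [exact: measurable_past|exact: integrable_time..|].
by move=> s _; exact: Im_schroedinger.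
Qed.

End duhamel.

(** * From fixed times to the weak norm *)

Section weak_type_of_pointwise.
Context {R : realType}.
Notation mu := (@lebesgue_measure R).

Variables (p k C : R) (phi : R -> R) (N : R -> \bar R).
Hypotheses (p1 : 1 <= p) (C0 : 0 < C).
Hypotheses (mphi : measurable_fun setT phi) (phi0 : forall s, 0 <= phi s).
Hypothesis pointwise : forall psi : R -> R, measurable_fun setT psi ->
  (forall s, 0 < psi s) -> (forall s, phi s <= psi s) ->
  forall t a : R, 0 < a -> (past_potential (fun s => psi s `^ p)%R k t <= a%:E)%E ->
  (N t <= (C * a `^ p^-1)%:E)%E.
Hypothesis N0 : forall t, (0 <= N t)%E.
Variable I : R.
Hypothesis phiI : (\int[mu]_s (phi s `^ p)%:E = I%:E)%E.

Let p0 : 0 < p. Proof. exact: lt_le_trans p1. Qed.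

(* The bound at a fixed time divides by powers of the slice norm, which may
   vanish. *)
Let bump (eps s : R) : R := Num.max (phi s) (eps `^ p^-1 * decay s).

Let measurable_bump eps : measurable_fun setT (bump eps).
Proof. by apply: measurable_maxr => //; apply: measurable_funM => //; exact: measurable_decay. Qed.

Let bump_gt0 eps s : 0 < eps -> 0 < bump eps s.
Proof. by move=> e0; rewrite lt_max mulr_gt0 ?powR_gt0 ?decay_gt0 ?orbT. Qed.

Let Id : R := \int[mu]_s decay s + 1.

Let integral_bump_le eps : 0 < eps ->
  (\int[mu]_s (bump eps s `^ p)%:E <= (I + eps * Id)%:E)%E.
Proof.
move=> e0.
have md : measurable_fun setT (fun s => eps * decay s).
  by apply: measurable_funM => //; exact: measurable_decay.
have mp : measurable_fun setT (fun s => phi s `^ p) by exact: (measurableT_comp (measurable_powR _)).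
apply: (@le_trans _ _ (\int[mu]_s ((phi s `^ p)%:E + (eps * decay s)%:E))%E).
  apply: ge0_le_integral => //.
  - by move=> s _; rewrite lee_fin powR_ge0.
  - by apply/measurable_EFinP; exact: (measurableT_comp (measurable_powR _) (measurable_bump eps)).
  - by apply: emeasurable_funD; exact/measurable_EFinP.
  move=> s _; rewrite -EFinD lee_fin /bump.
  have d0 := @decay_gt0 R s.
  case: (leP (phi s) (eps `^ p^-1 * decay s)) => h; last by rewrite lerDl mulr_ge0 ?(ltW e0) ?(ltW d0).
  rewrite powRM ?powR_ge0 ?(ltW d0)// -powRrM mulVf ?gt_eqF// powRr1 ?(ltW e0)//.
  apply: (@le_trans _ _ (eps * decay s)); last by rewrite lerDr powR_ge0.
  apply: ler_wpM2l; first exact: ltW.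
  by rewrite -[leRHS]powRr1 ?(ltW d0)//; apply: ger_powR => //; rewrite d0 decay_le1.
rewrite ge0_integralD//; last 4 first.
- by move=> s _; rewrite lee_fin powR_ge0.
- exact/measurable_EFinP.
- by move=> s _; rewrite lee_fin mulr_ge0 ?(ltW e0)// ltW// decay_gt0.
- exact/measurable_EFinP.
rewrite phiI EFinD; apply: leeD2l; under eq_integral do rewrite EFinM.
rewrite ge0_integralZl_EFin ?(ltW e0)//; last 2 first.
- by move=> s _; rewrite lee_fin ltW// decay_gt0.
- by apply/measurable_EFinP; exact: measurable_decay.
rewrite -Rintegral_EFin//; last exact: integrable_decay.
by rewrite -EFinM lee_fin; apply: ler_wpM2l; [exact: ltW|rewrite lerDl].
Qed.

Let Id0 : 0 < Id.
Proof. by rewrite ltr_wpDl//; apply: Rintegral_ge0 => s _; rewrite ltW// decay_gt0. Qed.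

Let I0 : 0 <= I.
Proof. by rewrite -lee_fin -phiI; apply: integral_ge0 => s _; rewrite lee_fin powR_ge0. Qed.

Let in_nneg (x : \bar R) : (0 <= x)%E -> x \in `[0%E, +oo%E].
Proof. by move=> x0; rewrite in_itv/= leey andbT. Qed.

Let limit_le (x : \bar R) (c : R) : 0 <= c ->
  (forall eps : R, 0 < eps -> (x <= (c * (I + eps * Id))%:E)%E) -> (x <= (c * I)%:E)%E.
Proof.
move=> c0 h; apply/lee_addgt0Pr => eta eta0.
have cI : 0 < c * Id + 1 by rewrite ltr_wpDl// mulr_ge0// ltW.
apply: (le_trans (h (eta / (c * Id + 1)) (divr_gt0 eta0 cI))).
rewrite -EFinD lee_fin mulrDr lerD2l mulrCA mulrAC ler_pdivrMr//.
by rewrite ler_pM2l// lerDl.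
Qed.

(** By the contrapositive of the pointwise bound, [N t > l] forces the potential of [bump ^ p] above
    [(l / C) ^ p]. The weak-type estimate of the potential is then raised to the power [1 / p],
    after the bump has been sent to zero. *)
Lemma weak_type_of_pointwise (l : R) : 0 < k -> k < 1 -> 0 < l ->
  (l%:E * mu [set t | (l%:E < N t)%E] `^ (k / p) <=
   (C * (2 / (1 - k) + 1) `^ p^-1 * I `^ p^-1)%:E)%E.
Proof.
move=> k0 k1 l0; set A := [set t | _]; set cw := 2 / (1 - k) + 1.
have cw0 : 0 < cw by rewrite addr_gt0// divr_gt0// subr_gt0.
pose x : R := (l / C) `^ p; have x0 : 0 < x by rewrite powR_gt0// divr_gt0.
have xE : x `^ p^-1 = l / C by rewrite /x -powRrM mulfV ?gt_eqF// powRr1// divr_ge0// ltW.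
have main : (x%:E * mu A `^ k <= (cw * I)%:E)%E.
  apply: limit_le; first exact: ltW.
  move=> eps e0.
  have mh : measurable_fun setT (fun s => bump eps s `^ p).
    exact: (measurableT_comp (measurable_powR _) (measurable_bump eps)).
  apply: le_trans (past_potential_weak_type mh (fun s => powR_ge0 _ _) k0 k1 (integral_bump_le e0) x0).
  apply: lee_wpmul2l; first by rewrite lee_fin ltW.
  apply: gt0_ler_poweR; rewrite ?(ltW k0) ?in_itv/= ?leey ?andbT ?measure_ge0//.
  apply: le_lebesgue_measure => t; rewrite /A/= !ltNge; apply: contra => h.
  have := pointwise (measurable_bump eps) (fun s => bump_gt0 s e0) _ x0 h.
  rewrite xE mulrC divfK ?gt_eqF//; apply.
  by move=> s; rewrite /bump le_max lexx.
have pV0 : 0 < p^-1 by rewrite invr_gt0.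
have cI0 : 0 <= cw * I by rewrite mulr_ge0// ltW.
have n1 : (0 <= x%:E * mu A `^ k)%E by rewrite mule_ge0 ?poweR_ge0 ?lee_fin ?(ltW x0).
have n2 : (0 <= (cw * I)%:E)%E by rewrite lee_fin.
have := @gt0_ler_poweR R p^-1 (ltW pV0) _ _ (in_nneg n1) (in_nneg n2) main.
rewrite poweRM ?poweR_ge0 ?lee_fin ?(ltW x0)// -poweRrM !poweR_EFin xE.
rewrite powRM ?(ltW cw0)// => h.
rewrite (_ : l%:E = (C%:E * (l / C)%:E)%E); last by rewrite -EFinM mulrC divfK// gt_eqF.
rewrite -muleA -mulrA [leRHS]EFinM; apply: lee_wpmul2l => //.
by rewrite lee_fin ltW.
Qed.

(** Without decay in time the potential is at most the integral over all times, so the bound holds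
    at every [t]. *)
Lemma strong_type_of_pointwise t : k = 0 -> (N t <= (C * I `^ p^-1)%:E)%E.
Proof.
move=> k0.
have main : (N t `^ p <= (C `^ p * I)%:E)%E.
  apply: limit_le; first exact: powR_ge0.
  move=> eps e0; have a0 : 0 < I + eps * Id by rewrite ltr_wpDl// mulr_gt0.
  have h : (past_potential (fun s => bump eps s `^ p)%R k t <= (I + eps * Id)%:E)%E.
    apply: le_trans (integral_bump_le e0); apply: ge0_le_integral => //.
    - by move=> s _; rewrite lee_fin mulr_ge0// mulr_ge0 ?powR_ge0.
    - apply/measurable_EFinP; apply: measurable_funM; last exact: measurable_indic (measurable_past t).
      apply: measurable_funM; first exact: (measurableT_comp (measurable_powR _) (measurable_bump eps)).
      by apply: (measurableT_comp (measurable_powR _)); exact: measurable_funB.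
    - by apply/measurable_EFinP; exact: (measurableT_comp (measurable_powR _) (measurable_bump eps)).
    by move=> s _; rewrite lee_fin k0 oppr0 powRr0 mulr1 ler_piMr ?powR_ge0.
  have hN : (N t <= (C * (I + eps * Id) `^ p^-1)%:E)%E.
    apply: (pointwise (measurable_bump eps) (fun s => bump_gt0 s e0) _ a0 h).
    by move=> s; rewrite /bump le_max lexx.
  have n0 : (0 <= (C * (I + eps * Id) `^ p^-1)%:E)%E by rewrite lee_fin mulr_ge0 ?powR_ge0// ltW.
  have := @gt0_ler_poweR R p (ltW p0) _ _ (in_nneg (N0 t)) (in_nneg n0) hN.
  rewrite poweR_EFin powRM ?powR_ge0 ?(ltW C0)//.
  by rewrite -powRrM mulVf ?gt_eqF// powRr1 ?(ltW a0).
have pV0 : 0 < p^-1 by rewrite invr_gt0.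
have n0 : (0 <= (C `^ p * I)%:E)%E by rewrite lee_fin mulr_ge0 ?powR_ge0.
have := @gt0_ler_poweR R p^-1 (ltW pV0) _ _ (in_nneg (poweR_ge0 _ _)) (in_nneg n0) main.
rewrite -poweRrM mulfV ?gt_eqF// poweRe1// poweR_EFin powRM ?powR_ge0//.
by rewrite -powRrM mulfV ?gt_eqF// powRr1 ?(ltW C0).
Qed.

End weak_type_of_pointwise.

(** * Mixed norms *)

Section norms.
Context {R : realType} (n : nat).
Notation mu := (@lebesgue_measure R).
Notation X := 'rV[R]_n.
Notation L := (@lebesgue_rV R n).
Notation Z := (measurableTypeR R * X)%type.
Notation D := (@hdim R n).

Lemma cmodE (z : R[i]) : cmod z = Num.sqrt (complex.Re z ^+ 2 + complex.Im z ^+ 2).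
Proof. by case: z. Qed.

Lemma cmod_ge0 (z : R[i]) : 0 <= cmod z.
Proof. by rewrite cmodE sqrtr_ge0. Qed.

Lemma normr_Re_le_cmod (z : R[i]) : `|complex.Re z| <= cmod z.
Proof. by rewrite cmodE -sqrtr_sqr ler_sqrt ?lerDl ?sqr_ge0// addr_ge0 ?sqr_ge0. Qed.

Lemma normr_Im_le_cmod (z : R[i]) : `|complex.Im z| <= cmod z.
Proof. by rewrite cmodE -sqrtr_sqr ler_sqrt ?lerDr ?sqr_ge0// addr_ge0 ?sqr_ge0. Qed.

Lemma cmod_le (z : R[i]) : cmod z <= `|complex.Re z| + `|complex.Im z|.
Proof.
rewrite cmodE -[leRHS]ger0_norm ?addr_ge0// -sqrtr_sqr ler_sqrt ?sqr_ge0//.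
rewrite -(real_normK (num_real (complex.Re z))) -(real_normK (num_real (complex.Im z))).
by rewrite sqrrD -addrA lerD2l lerDr mulrn_wge0// mulr_ge0.
Qed.

Lemma measurable_cmod d (T : measurableType d) (f : T -> R[i]) :
  measurable_fun setT (fun x => complex.Re (f x)) ->
  measurable_fun setT (fun x => complex.Im (f x)) ->
  measurable_fun setT (fun x => cmod (f x)).
Proof.
move=> mr mi; under eq_fun do rewrite cmodE.
have ms : measurable_fun setT (@Num.sqrt R) by apply: continuous_measurable_fun; exact: sqrt_continuous.
by apply: (measurableT_comp ms); apply: measurable_funD; exact: measurable_funX.
Qed.

Definition slice_norm (P : R) (F : R -> X -> R[i]) (s : R) : R :=
  (\int[L]_x (cmod (F s x) `^ P)) `^ P^-1.

Lemma space_norm_fin (r : R) (u : X -> R[i]) :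
  space_norm r%:E u = ((\int[L]_x (cmod (u x) `^ r)%:E) `^ r^-1)%E.
Proof.
rewrite /space_norm unlock; apply: (congr1 (poweR ^~ r^-1)).
apply: eq_integral => x _; by rewrite abse_EFin poweR_EFin ger0_norm ?cmod_ge0.
Qed.

Section schwartz_norms.
Variable F : R -> X -> R[i].
Hypothesis sF : cschwartz (fun z : R * X => F z.1 z.2).

Lemma dominated_cmod : dominated (fun z : Z => cmod (F z.1 z.2)).
Proof.
have [[mr [K1 [K10 h1]]] [mi [K2 [K20 h2]]]] := (dominated_schwartz (proj1 sF), dominated_schwartz (proj2 sF)).
split; first exact: measurable_cmod.
exists (K1 + K2); split; first exact: addr_ge0.
move=> s x; rewrite ger0_norm ?cmod_ge0// mulrDl; apply: (le_trans (cmod_le _)).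
by apply: lerD; [exact: h1|exact: h2].
Qed.

Let dP (P : R) s : 1 <= P -> dominatedX (fun x => cmod (F s x) `^ P).
Proof.
move=> P1; have := dominatedX_powR P1 (dominated_slice s dominated_cmod).
by under eq_fun do rewrite ger0_norm ?cmod_ge0//=.
Qed.

Lemma space_normE (P : R) s : 1 <= P -> space_norm P%:E (F s) = (slice_norm P F s)%:E.
Proof.
move=> P1; rewrite space_norm_fin /slice_norm -poweR_EFin; congr (_ `^ _)%E.
by rewrite (Rintegral_EFin (dominatedX_integrable (dP s P1)) measurableT).
Qed.

Lemma slice_norm_powR (P : R) s : 1 <= P ->
  slice_norm P F s `^ P = \int[L]_x (cmod (F s x) `^ P).
Proof.
move=> P1; rewrite -powRrM mulVf ?gt_eqF ?(lt_le_trans ltr01)// powRr1//.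
by apply: Rintegral_ge0 => x _; exact: powR_ge0.
Qed.

Lemma measurable_slice_norm (P : R) : measurable_fun setT (slice_norm P F).
Proof.
have [mc _] := dominated_cmod; apply: (measurableT_comp (measurable_powR _)).
apply: (@measurable_Rintegral_param _ _ _ _ R L (fun z : Z => cmod (F z.1 z.2) `^ P)).
exact: (measurableT_comp (measurable_powR _) mc).
Qed.

Lemma slice_norm_decay (P : R) : 1 <= P ->
  exists2 K : R, 0 <= K & forall s, slice_norm P F s <= K * decay s.
Proof.
move=> P1; have P0 : 0 < P by exact: lt_le_trans P1.
have [_ [K [K0 hK]]] := dominated_cmod; pose I := \int[L]_y decayX y.
have I0 : 0 <= I by apply: Rintegral_ge0 => y _; rewrite ltW// decayX_gt0.
exists (K * I `^ P^-1); first by rewrite mulr_ge0 ?powR_ge0.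
move=> s; have d0 := @decay_gt0 R s.
have -> : K * I `^ P^-1 * decay s = ((K * decay s) `^ P * I) `^ P^-1.
  rewrite powRM ?powR_ge0// -powRrM mulfV ?gt_eqF// powRr1 ?mulr_ge0 ?(ltW d0)//; ring.
have PV : 0 <= P^-1 by rewrite invr_ge0 ltW.
apply: ge0_ler_powR => //; rewrite ?nnegrE ?mulr_ge0 ?powR_ge0//.
  by apply: Rintegral_ge0 => x _; exact: powR_ge0.
rewrite /I -RintegralZl//; last exact: integrable_decayX.
apply: le_Rintegral => //.
- exact: dominatedX_integrable (dP s P1).
- by have := integrableZl measurableT ((K * decay s) `^ P) (@integrable_decayX R n); apply: eq_integrable.
move=> x _; have dx := @decayX_gt0 R n x.
apply: (@le_trans _ _ ((K * decay s * decayX x) `^ P)).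
  apply: ge0_ler_powR; rewrite ?(ltW P0) ?nnegrE ?cmod_ge0 ?mulr_ge0 ?(ltW d0) ?(ltW dx)//.
  by have := hK s x; rewrite /= ger0_norm ?cmod_ge0// mulrA.
rewrite powRM ?mulr_ge0 ?(ltW d0) ?(ltW dx)//; apply: ler_wpM2l; first exact: powR_ge0.
by rewrite -[leRHS]powRr1 ?(ltW dx)//; apply: ger_powR => //; rewrite dx decayX_le1.
Qed.

Lemma slice_norm_ge0 (P : R) s : 0 <= slice_norm P F s.
Proof. exact: powR_ge0. Qed.

Lemma mixed_normE (p P : R) : 1 <= p -> 1 <= P -> exists2 I : R,
  (\int[mu]_s (slice_norm P F s `^ p)%:E = I%:E)%E & mixed_norm p%:E P%:E F = (I `^ p^-1)%:E.
Proof.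
move=> p1 P1; have p0 : 0 < p by exact: lt_le_trans p1.
have [K K0 hK] := slice_norm_decay P1.
have mf : measurable_fun setT (fun s => slice_norm P F s `^ p).
  exact: (measurableT_comp (measurable_powR _) (measurable_slice_norm P)).
have ii : mu.-integrable setT (EFin \o (fun s => slice_norm P F s `^ p)).
  apply: (@le_integrable_real _ _ R mu setT _ (fun s => K `^ p * decay s)) => //.
    move=> s _; have d0 := @decay_gt0 R s.
    rewrite ger0_norm ?powR_ge0//; apply: (@le_trans _ _ ((K * decay s) `^ p)).
      by apply: ge0_ler_powR; rewrite ?(ltW p0) ?nnegrE ?slice_norm_ge0 ?mulr_ge0 ?(ltW d0).
    rewrite powRM ?(ltW d0)//; apply: ler_wpM2l; first exact: powR_ge0.
    by rewrite -[leRHS]powRr1 ?(ltW d0)//; apply: ger_powR => //; rewrite d0 decay_le1.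
  by have := integrableZl measurableT (K `^ p) (@integrable_decay R); apply: eq_integrable.
exists (\int[mu]_s (slice_norm P F s `^ p)); first by rewrite Rintegral_EFin.
rewrite /mixed_norm unlock -poweR_EFin Rintegral_EFin//; congr (_ `^ _)%E.
by apply: eq_integral => s _; rewrite space_normE//= ger0_norm ?slice_norm_ge0.
Qed.

Lemma slice_norm_Re_le (P : R) s psi : 1 <= P -> slice_norm P F s <= psi ->
  \int[L]_x `|complex.Re (F s x)| `^ P <= psi `^ P.
Proof.
move=> P1 h; have P0 : 0 < P by exact: lt_le_trans P1.
apply: (@le_trans _ _ (slice_norm P F s `^ P)); last first.
  by apply: ge0_ler_powR; rewrite ?(ltW P0) ?nnegrE ?slice_norm_ge0 ?(le_trans (slice_norm_ge0 P s) h).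
rewrite (slice_norm_powR s P1); apply: le_Rintegral; first exact: measurableT.
- by apply/dominatedX_integrable/dominatedX_powR => //; exact: (dominated_slice s (dominated_schwartz (proj1 sF))).
- exact: dominatedX_integrable (dP s P1).
- by move=> x _; apply: ge0_ler_powR; rewrite ?(ltW P0) ?nnegrE ?cmod_ge0 ?normr_Re_le_cmod.
Qed.

Lemma slice_norm_Im_le (P : R) s psi : 1 <= P -> slice_norm P F s <= psi ->
  \int[L]_x `|complex.Im (F s x)| `^ P <= psi `^ P.
Proof.
move=> P1 h; have P0 : 0 < P by exact: lt_le_trans P1.
apply: (@le_trans _ _ (slice_norm P F s `^ P)); last first.
  by apply: ge0_ler_powR; rewrite ?(ltW P0) ?nnegrE ?slice_norm_ge0 ?(le_trans (slice_norm_ge0 P s) h).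
rewrite (slice_norm_powR s P1); apply: le_Rintegral; first exact: measurableT.
- by apply/dominatedX_integrable/dominatedX_powR => //; exact: (dominated_slice s (dominated_schwartz (proj2 sF))).
- exact: dominatedX_integrable (dP s P1).
- by move=> x _; apply: ge0_ler_powR; rewrite ?(ltW P0) ?nnegrE ?cmod_ge0 ?normr_Im_le_cmod.
Qed.

Let FR (z : R * X) : R := complex.Re (F z.1 z.2).
Let FI (z : R * X) : R := complex.Im (F z.1 z.2).
Let sR : schwartz FR. Proof. by case: sF. Qed.
Let sI : schwartz FI. Proof. by case: sF. Qed.
Let c : R := (2 * pi) ^- n.
Let c0 : 0 < c. Proof. by rewrite invr_gt0 exprn_gt0// mulr_gt0// pi_gt0. Qed.

Lemma cmod_duhamel_le t x : cmod (duhamel F t x) <=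
  (2 * pi) ^- n * (`|solution FR t 0 x| + `|solution FI t (pi / 2) x| +
    `|solution FI t 0 x| + `|solution FR t (pi / 2) x|).
Proof.
apply: (le_trans (cmod_le _)); rewrite (Re_duhamel sF) (Im_duhamel sF) !normrM.
rewrite !(ger0_norm (ltW c0)) -mulrDr -addrA; apply: ler_wpM2l; first exact: ltW.
by apply: lerD; [exact: ler_normB|exact: ler_normD].
Qed.

Lemma measurable_cmod_duhamel t : measurable_fun setT (fun x => cmod (duhamel F t x)).
Proof.
apply: measurable_cmod.
  under eq_fun do rewrite (Re_duhamel sF).
  by apply: measurable_funM => //; apply: measurable_funB; exact: measurable_solution.
under eq_fun do rewrite (Im_duhamel sF).
by apply: measurable_funM => //; apply: measurable_funD; exact: measurable_solution.
Qed.

End schwartz_norms.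

(** All four terms are compared with the largest one. *)
Lemma powR_add4_le (x y z w r : R) : 0 <= x -> 0 <= y -> 0 <= z -> 0 <= w -> 0 <= r ->
  (x + y + z + w) `^ r <= 4 `^ r * (x `^ r + y `^ r + z `^ r + w `^ r).
Proof.
move=> x0 y0 z0 w0 r0; pose m := Num.max (Num.max x y) (Num.max z w).
have xm : x <= m by rewrite /m !le_max lexx.
have ym : y <= m by rewrite /m !le_max lexx orbT.
have zm : z <= m by rewrite /m !le_max lexx !orbT.
have wm : w <= m by rewrite /m !le_max lexx !orbT.
have mr : m `^ r <= x `^ r + y `^ r + z `^ r + w `^ r.
  have := powR_ge0 x r; have := powR_ge0 y r; have := powR_ge0 z r; have := powR_ge0 w r.
  rewrite /m; case: (leP x y) => _; case: (leP z w) => _.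
  - by case: (leP y w) => _; lra.
  - by case: (leP y z) => _; lra.
  - by case: (leP x w) => _; lra.
  - by case: (leP x z) => _; lra.
have m0 : 0 <= m by exact: le_trans x0 xm.
apply: (@le_trans _ _ ((4 * m) `^ r)).
  apply: ge0_ler_powR; rewrite ?nnegrE ?addr_ge0 ?mulr_ge0//.
  by move: xm ym zm wm; clearbody m; lra.
by rewrite powRM//; apply: ler_wpM2l => //; exact: powR_ge0.
Qed.

Lemma integral_add4_le (f1 f2 f3 f4 : X -> R) (B : R) :
  measurable_fun setT f1 -> measurable_fun setT f2 -> measurable_fun setT f3 -> measurable_fun setT f4 ->
  (forall x, 0 <= f1 x) -> (forall x, 0 <= f2 x) -> (forall x, 0 <= f3 x) -> (forall x, 0 <= f4 x) ->
  (\int[L]_x (f1 x)%:E <= B%:E)%E -> (\int[L]_x (f2 x)%:E <= B%:E)%E ->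
  (\int[L]_x (f3 x)%:E <= B%:E)%E -> (\int[L]_x (f4 x)%:E <= B%:E)%E ->
  (\int[L]_x (f1 x + f2 x + f3 x + f4 x)%:E <= (4 * B)%:E)%E.
Proof.
move=> m1 m2 m3 m4 p1 p2 p3 p4 h1 h2 h3 h4.
have add (f g : X -> R) (a b : R) : measurable_fun setT f -> measurable_fun setT g ->
    (forall x, 0 <= f x) -> (forall x, 0 <= g x) ->
    (\int[L]_x (f x)%:E <= a%:E)%E -> (\int[L]_x (g x)%:E <= b%:E)%E ->
    (\int[L]_x (f x + g x)%:E <= (a + b)%:E)%E.
  move=> mf mg f0 g0 fa gb; under eq_integral do rewrite EFinD.
  rewrite ge0_integralD//; try exact/measurable_EFinP; try by move=> x _; rewrite lee_fin.
  by rewrite EFinD; exact: leeD.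
rewrite (_ : 4 * B = B + B + B + B); last by ring.
apply: (add (fun x => f1 x + f2 x + f3 x)) => //.
- by apply: measurable_funD => //; exact: measurable_funD.
- by move=> x; rewrite !addr_ge0.
apply: (add (fun x => f1 x + f2 x)) => //.
- exact: measurable_funD.
- by move=> x; rewrite addr_ge0.
exact: add.
Qed.

(** The modulus of the Duhamel integral is at most a multiple of a sum of four real solutions.
    Taking the [r]-th root turns [a ^ (r - D e)] into the required power, [(r - D e) / r] being the
    reciprocal of [time_exp]. *)
Lemma space_norm_duhamel_le (e r : R) : (0 < n)%N -> 0 <= e -> e <= 1 -> D * e <= 1 ->
  (e = 1 -> D < 1) -> 2 <= r -> 1 <= dual_exp e r ->
  exists2 C : R, 0 < C & forall F : R -> X -> R[i],
    cschwartz (fun z : R * X => F z.1 z.2) ->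
    forall psi : R -> R, measurable_fun setT psi -> (forall s, 0 < psi s) ->
    (forall s, slice_norm (dual_exp e r) F s <= psi s) ->
    forall t a : R, 0 < a ->
    (past_potential (fun s => psi s `^ @time_exp R n e r)%R (@decay_exp R n e r) t <= a%:E)%E ->
    (space_norm r%:E (duhamel F t) <= (C * a `^ (@time_exp R n e r)^-1)%:E)%E.
Proof.
move=> n0 e0 e1 De eD r2 P1; have [C C0 HC] := past_bound n0 e0 e1 De eD r2.
pose c : R := (2 * pi) ^- n; have c0 : 0 < c by rewrite invr_gt0 exprn_gt0// mulr_gt0// pi_gt0.
have r0 : 0 < r by move: r2; lra.
have rV0 : 0 < r^-1 by rewrite invr_gt0.
pose C' := c `^ r * (4 `^ r * (4 * C)).
have C'0 : 0 < C' by rewrite mulr_gt0 ?powR_gt0// mulr_gt0 ?powR_gt0// mulr_gt0.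
exists (C' `^ r^-1); first exact: powR_gt0.
move=> F sF psi mpsi psi0 Fpsi t a a0 va.
have [sR sI] := sF.
have mpow (u : X -> R) : measurable_fun setT u -> measurable_fun setT (fun y => `|u y| `^ r).
  by move=> mu_; apply: (measurableT_comp (measurable_powR _)); exact: measurableT_comp.
have hR b := HC _ psi t a b _ (dominated_schwartz sR) mpsi psi0
  (fun s => slice_norm_Re_le sF P1 (Fpsi s)) a0 va (measurable_solution t sR b) (@represents_solution _ _ _ t sR b).
have hI b := HC _ psi t a b _ (dominated_schwartz sI) mpsi psi0
  (fun s => slice_norm_Im_le sF P1 (Fpsi s)) a0 va (measurable_solution t sI b) (@represents_solution _ _ _ t sI b).
set FR := fun z : R * X => complex.Re _ in sR hR; set FI := fun z : R * X => complex.Im _ in sI hI.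
have main : (\int[L]_x (cmod (duhamel F t x) `^ r)%:E <= (C' * a `^ (r - D * e))%:E)%E.
  pose S x := `|solution FR t 0 x| `^ r + `|solution FI t (pi / 2) x| `^ r +
    `|solution FI t 0 x| `^ r + `|solution FR t (pi / 2) x| `^ r.
  have mS : measurable_fun setT S.
    by do !apply: measurable_funD; apply: mpow; exact: measurable_solution.
  have S0 x : 0 <= S x by rewrite !addr_ge0 ?powR_ge0.
  apply: (@le_trans _ _ (\int[L]_x ((c `^ r * 4 `^ r)%:E * (S x)%:E))%E).
    apply: ge0_le_integral => //.
    - by move=> x _; rewrite lee_fin powR_ge0.
    - by apply/measurable_EFinP; apply: (measurableT_comp (measurable_powR _)); exact: measurable_cmod_duhamel.
    - by apply: measurable_funeM; exact/measurable_EFinP.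
    move=> x _; rewrite -EFinM lee_fin -mulrA.
    apply: (@le_trans _ _ (c `^ r * (`|solution FR t 0 x| + `|solution FI t (pi / 2) x| +
        `|solution FI t 0 x| + `|solution FR t (pi / 2) x|) `^ r)).
      rewrite -powRM ?(ltW c0) ?addr_ge0//.
      apply: ge0_ler_powR; rewrite ?(ltW r0) ?nnegrE ?cmod_ge0 ?mulr_ge0 ?(ltW c0) ?addr_ge0//.
      exact: cmod_duhamel_le.
    apply: ler_wpM2l; first exact: powR_ge0.
    by apply: powR_add4_le => //; exact: ltW.
  rewrite ge0_integralZl_EFin ?mulr_ge0 ?powR_ge0//; last 2 first.
  - by move=> x _; rewrite lee_fin.
  - exact/measurable_EFinP.
  apply: (@le_trans _ _ ((c `^ r * 4 `^ r)%:E * (4 * (C * a `^ (r - D * e)))%:E)%E).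
    apply: lee_wpmul2l; first by rewrite lee_fin mulr_ge0 ?powR_ge0.
    have mR b := mpow _ (measurable_solution t sR b); have mI b := mpow _ (measurable_solution t sI b).
    exact: (integral_add4_le (mR 0) (mI (pi / 2)) (mI 0) (mR (pi / 2))
      (fun x => powR_ge0 _ _) (fun x => powR_ge0 _ _) (fun x => powR_ge0 _ _) (fun x => powR_ge0 _ _)
      (hR 0) (hI (pi / 2)) (hI 0) (hR (pi / 2))).
  by rewrite -EFinM lee_fin /C' le_eqVlt; apply/orP; left; apply/eqP; ring.
rewrite space_norm_fin.
have in_nneg (x : \bar R) : (0 <= x)%E -> x \in `[0%E, +oo%E] by move=> x0; rewrite in_itv/= leey andbT.
have i0 : (0 <= \int[L]_x (cmod (duhamel F t x) `^ r)%:E)%E.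
  by apply: integral_ge0 => x _; rewrite lee_fin powR_ge0.
have j0 : (0 <= (C' * a `^ (r - D * e))%:E)%E by rewrite lee_fin mulr_ge0 ?powR_ge0// ltW.
apply: le_trans (@gt0_ler_poweR R r^-1 (ltW rV0) _ _ (in_nneg _ i0) (in_nneg _ j0) main) _.
rewrite poweR_EFin powRM ?powR_ge0 ?(ltW C'0)// -powRrM lee_fin.
rewrite (_ : (r - D * e) * r^-1 = (@time_exp R n e r)^-1)//.
by rewrite /time_exp invf_div.
Qed.

Lemma space_norm_oo_duhamel_le : (0 < n)%N ->
  exists2 C : R, 0 < C & forall F : R -> X -> R[i],
    cschwartz (fun z : R * X => F z.1 z.2) ->
    forall psi : R -> R, measurable_fun setT psi -> (forall s, 0 < psi s) ->
    (forall s, slice_norm 1 F s <= psi s) ->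
    forall t a : R, 0 < a -> (past_potential (fun s => psi s `^ 1)%R D t <= a%:E)%E ->
    (space_norm +oo%E (duhamel F t) <= (C * a `^ 1^-1)%:E)%E.
Proof.
move=> n0; pose c : R := (2 * pi) ^- n.
have c0 : 0 < c by rewrite invr_gt0 exprn_gt0// mulr_gt0// pi_gt0.
exists (c * (4 * 8 ^+ n)); first by rewrite !mulr_gt0// exprn_gt0.
move=> F sF psi mpsi psi0 Fpsi t a a0 va.
have [sR sI] := sF.
have va' : (\int[mu]_s (psi s * (t - s) `^ (- D) * \1_(past t) s)%:E <= a%:E)%E.
  apply: le_trans va; rewrite le_eqVlt; apply/orP; left; apply/eqP.
  by apply: eq_integral => s _; rewrite powRr1// ltW.
have bR s : \int[L]_x `|complex.Re (F s x)| <= psi s.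
  have := slice_norm_Re_le sF (lexx 1) (Fpsi s); rewrite powRr1 ?(ltW (psi0 s))//.
  by under eq_Rintegral do rewrite powRr1//.
have bI s : \int[L]_x `|complex.Im (F s x)| <= psi s.
  have := slice_norm_Im_le sF (lexx 1) (Fpsi s); rewrite powRr1 ?(ltW (psi0 s))//.
  by under eq_Rintegral do rewrite powRr1//.
have hR b := ae_past_le (dominated_schwartz sR) mpsi psi0 (measurable_solution t sR b) (@represents_solution _ _ _ t sR b) bR va'.
have hI b := ae_past_le (dominated_schwartz sI) mpsi psi0 (measurable_solution t sI b) (@represents_solution _ _ _ t sI b) bI va'.
rewrite invr1 powRr1 ?(ltW a0)// /space_norm unlock.
have K0 : 0 <= c * (4 * 8 ^+ n) * a by rewrite !mulr_ge0 ?(ltW c0) ?(ltW a0)// exprn_ge0.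
case: ifP => // _; apply/ess_supP.
have [g1 g2] := (hR 0, hR (pi / 2)); have [g3 g4] := (hI 0, hI (pi / 2)).
have gg := negligibleU (negligibleU g1 g2) (negligibleU g3 g4).
apply: (negligibleS _ gg) => x nx; apply: contrapT => hn; apply: nx.
have a1 := contrapT (fun h => hn (or_introl (or_introl h))).
have a2 := contrapT (fun h => hn (or_introl (or_intror h))).
have a3 := contrapT (fun h => hn (or_intror (or_introl h))).
have a4 := contrapT (fun h => hn (or_intror (or_intror h))).
rewrite /= lee_fin ger0_norm ?cmod_ge0//.
apply: (le_trans (cmod_duhamel_le sF t x)); rewrite -/c -!mulrA; apply: ler_wpM2l; first exact: ltW.
have -> : 4 * (8 ^+ n * a) = 8 ^+ n * a + 8 ^+ n * a + 8 ^+ n * a + 8 ^+ n * a by ring.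
exact: lerD (lerD (lerD a1 a4) a3) a2.
Qed.

(** [k = 0] holds exactly when [q] is infinite, which separates the strong estimate from the weak
    one; otherwise [k / p = 1 / q] is the power of the measure in the weak norm. *)
Lemma weak_mixed_norm_le (p P k C : R) (q r : \bar R) (F : R -> X -> R[i]) :
  cschwartz (fun z : R * X => F z.1 z.2) -> 1 <= p -> 1 <= P -> 0 < C -> 0 <= k -> k < 1 ->
  k / p = recip q -> (k == 0) = (q == +oo%E) ->
  (forall psi : R -> R, measurable_fun setT psi -> (forall s, 0 < psi s) ->
    (forall s, slice_norm P F s <= psi s) ->
    forall t a : R, 0 < a -> (past_potential (fun s => psi s `^ p)%R k t <= a%:E)%E ->
    (space_norm r (duhamel F t) <= (C * a `^ p^-1)%:E)%E) ->
  (weak_mixed_norm q r (duhamel F) <=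
    (C * (2 / (1 - k) + 1) `^ p^-1)%:E * mixed_norm p%:E P%:E F)%E.
Proof.
move=> sF p1 P1 C0 k0 k1 kq kqy pt.
have p0 : 0 < p by exact: lt_le_trans p1.
have [I IE ->] := mixed_normE sF p1 P1.
have N0 t : (0 <= space_norm r (duhamel F t))%E by exact: Lnorm_ge0.
rewrite -EFinM /weak_mixed_norm /weak_norm.
have k1' : 0 < 1 - k by rewrite subr_gt0.
case: ifP kqy => qy kqy.
  have k00 : k = 0 by apply/eqP.
  have B0 : 0 <= C * (2 / (1 - k) + 1) `^ p^-1 * I `^ p^-1 by rewrite !mulr_ge0 ?powR_ge0// ltW.
  rewrite unlock; case: ifP => // _; apply/ess_supP; apply: nearW => t /=.
  rewrite gee0_abs//.
  have := strong_type_of_pointwise p1 C0 (measurable_slice_norm sF P)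
    pt N0 IE t k00.
  move/le_trans; apply; rewrite lee_fin; apply: ler_wpM2r; first exact: powR_ge0.
  rewrite ler_peMr ?(ltW C0)// -[leLHS](powRr0 (2 / (1 - k) + 1)); apply: ler_powR.
    by rewrite lerDr divr_ge0// ltW.
  by rewrite invr_ge0 ltW.
have kp : 0 < k by rewrite lt_def k0 andbT kqy.
apply: ge_ereal_sup => _ [l l0 <-]; rewrite -kq.
exact: (weak_type_of_pointwise p1 C0 (measurable_slice_norm sF P)
    pt IE kp k1 l0).
Qed.

End norms.

(** * Reciprocals of exponents *)

Section exponents.
Context {R : realType}.
Implicit Types p : \bar R.

Lemma recipE (x : R) : 0 < x -> recip x%:E = x^-1.
Proof. by move=> x0; rewrite /recip inver gt_eqF. Qed.

Lemma recip_oo : recip (+oo%E : \bar R) = 0.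
Proof. by []. Qed.

Lemma recip_ge0 p : (1 <= p)%E -> 0 <= recip p.
Proof.
case: p => [x||]//; rewrite ?recip_oo// lee_fin => x1.
by rewrite recipE ?invr_ge0 ?(lt_le_trans ltr01)// (le_trans ler01).
Qed.

Lemma recip_le (a : R) p : 1 <= a -> (a%:E <= p)%E -> recip p <= a^-1.
Proof.
move=> a1; have a0 : 0 < a by exact: lt_le_trans a1.
case: p => [x||]//; last by move=> _; rewrite recip_oo invr_ge0 ltW.
by rewrite lee_fin => ax; rewrite recipE ?(lt_le_trans a0)// lef_pV2 ?posrE// (lt_le_trans a0).
Qed.

Lemma recip_eq0 p : (1 <= p)%E -> (recip p == 0) = (p == +oo%E).
Proof.
case: p => [x||]//; last by rewrite recip_oo !eqxx.
rewrite lee_fin => x1; have x0 : 0 < x by exact: lt_le_trans x1.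
by rewrite recipE// invr_eq0 gt_eqF.
Qed.

Lemma hoelder_conjugateE p : (1 < p)%E -> hoelder_conjugate p = ((1 - recip p)^-1)%:E.
Proof.
case: p => [x||]//; last by rewrite hoelder_conjugatey recip_oo subr0 invr1.
rewrite lte_fin => x1; have x0 : 0 < x by exact: lt_trans x1.
rewrite /hoelder_conjugate/= eqe gt_eqF// recipE// -EFinB inver subr_eq0 gt_eqF//.
rewrite -EFinM; congr EFin; field.
by rewrite gt_eqF//= subr_eq0 gt_eqF.
Qed.

Lemma recip_hoelder_conjugate p : (1 < p)%E -> recip (hoelder_conjugate p) = 1 - recip p.
Proof.
move=> p1; rewrite hoelder_conjugateE//.
have h : 0 < 1 - recip p.
  case: p p1 => [x||]//; last by rewrite recip_oo subr0.
  rewrite lte_fin => x1; have x0 : 0 < x by exact: lt_trans x1.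
  by rewrite recipE// subr_gt0 invf_lt1.
by rewrite recipE ?invr_gt0// invrK.
Qed.

End exponents.

Theorem corollary1p2 (R : realType) (d : nat) (r rt q qt : \bar R)
    (hd : (1 <= d)%N)
    (hr : (2%:E <= r)%E) (hrt : (2%:E <= rt)%E)
    (hcond :
      [\/ [/\ d = 1%N, (2%:E < r)%E & (2%:E < rt)%E],
          [/\ d = 2%N, (2%:E < r < +oo)%E & (2%:E < rt < +oo)%E] |
          [/\ (3 <= d)%N,
              (d%:R - 2) * recip r <= d%:R * recip rt &
              (d%:R - 2) * recip rt <= d%:R * recip r]])
    (hq : (1 <= q)%E) (hqt : (1 <= qt)%E)
    (hscal : d%:R * (1 / 2 - recip r) = recip q)
    (hlt : recip q < recip (hoelder_conjugate qt))
    (hscal' : recip (hoelder_conjugate qt) = 1 - d%:R / 2 * (recip r - recip rt))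
    (hle : recip rt <= recip r) :
  exists C : R, 0 < C /\
    forall F : R -> 'rV[R]_d -> R[i],
      cschwartz (fun z : R * 'rV[R]_d => F z.1 z.2) ->
      (weak_mixed_norm q r (duhamel F)
        <= C%:E * mixed_norm (hoelder_conjugate qt) (hoelder_conjugate rt) F)%E.
Proof.
have d0 : 0 < d%:R :> R by rewrite ltr0n.
(* [qt = 1] would make [1 / qt'] vanish, against [0 <= 1 / q < 1 / qt']. *)
have qt1 : (1 < qt)%E.
  rewrite lt_neqAle hqt andbT; apply/eqP => qt1.
  move: hlt; rewrite -qt1 hoelder_conjugate1 recip_oo.
  by rewrite ltNge (recip_ge0 hq).
have rt1 : (1 < rt)%E by apply: lt_le_trans hrt; rewrite lte_fin ltr1n.
have r1 : (1 < r)%E by apply: lt_le_trans hr; rewrite lte_fin ltr1n.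
pose x := recip rt; have x0 : 0 <= x by exact/recip_ge0/ltW.
have x12 : x <= 2^-1 by apply: recip_le hrt; rewrite ler1n.
have x1 : 0 < 1 - x by move: x12; lra.
have q1 : recip q <= 1 by rewrite -invr1; apply: recip_le hq.
have qtE : hoelder_conjugate qt = ((1 - recip qt)^-1)%:E by exact: hoelder_conjugateE.
have y0 := recip_ge0 hqt; have y1 := recip_hoelder_conjugate qt1.
rewrite qtE (hoelder_conjugateE rt1) -/x -y1.
set ip := recip (hoelder_conjugate qt) in y1 hlt hscal' *.
have q0 := recip_ge0 hq.
have ip0 : 0 < ip by exact: le_lt_trans q0 hlt.
have ip1 : ip <= 1 by rewrite y1 gerBl.
have p1 : 1 <= ip^-1 by rewrite invf_ge1.
have P1 : 1 <= (1 - x)^-1 by rewrite invf_ge1// gerBl.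
have kE (k : R) : k = recip q / ip -> 0 <= k /\ k < 1.
  by move=> ->; split; [rewrite divr_ge0// ltW|rewrite ltr_pdivrMr// mul1r].
case: r hr r1 hcond hscal hscal' hle => [r0| |]// hr r1 hcond hscal hscal' hle; last first.
  (* For [r = oo], the inequality [1 / rt <= 1 / r] forces [rt = oo]. The relation
     [d / 2 = 1 / q <= 1] excludes [d >= 3], and [d = 2] demands a finite [r], so [d = 1] and
     [q = 2]. *)
  rewrite recip_oo in hscal hscal' hle hcond.
  have x00 : x = 0 by apply/eqP; rewrite eq_le x0 hle.
  have d1 : d = 1%N.
    case: hcond => [[]//|[_ /andP[]//]|[d3 _ _]].
    exfalso; have : 3 <= d%:R :> R by rewrite ler_nat.
    have := q1; rewrite -hscal subr0 mul1r ler_pdivrMr// mul1r => d2 d3'.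
    by have := le_trans d3' d2; rewrite ler_nat.
  have ipE : ip = 1 by rewrite hscal' -/x x00; lra.
  have DE : @hdim R d = 2^-1 by rewrite /hdim d1 mul1r.
  have qE : recip q = 2^-1 by rewrite -hscal d1; lra.
  have [C C0 HC] := @space_norm_oo_duhamel_le R d hd.
  exists (C * (2 / (1 - @hdim R d) + 1) `^ 1^-1); split.
    by rewrite mulr_gt0// powR_gt0// DE addr_gt0// divr_gt0//; lra.
  have k0 : 0 <= @hdim R d by rewrite DE invr_ge0.
  have k1 : @hdim R d < 1 by rewrite DE invf_lt1// ltr1n.
  have kq : @hdim R d / 1 = recip q by rewrite divr1 DE qE.
  have kqy : (@hdim R d == 0) = (q == +oo%E) by rewrite -recip_eq0// qE DE.
  move=> F sF; rewrite ipE x00 subr0.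
  have := weak_mixed_norm_le sF (lexx 1) (lexx 1) C0 k0 k1 kq kqy (HC F sF).
  by rewrite invr1.
rewrite lee_fin in hr; rewrite lte_fin in r1.
have r00 : 0 < r0 by exact: lt_trans r1.
rewrite recipE// in hscal hscal' hle hcond.
set e := 1 - r0 * x; set D := @hdim R d.
have D0 : 0 < D by rewrite divr_gt0.
have e0 : 0 <= e by rewrite subr_ge0 mulrC -ler_pdivlMr// mul1r.
have e1 : e <= 1 by rewrite gerBl mulr_ge0// ltW.
have DE : D = d%:R / 2 by [].
(* For [d >= 3] the first inequality of the hypothesis is exactly this one; for [d <= 2] it follows
   from [e <= 1]. *)
have De : D * e <= 1.
  case: hcond => [[d1 _ _]|[d2 _ _]|[d3 h _]].
  - by rewrite DE d1; move: e0 e1; clearbody e; lra.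
  - by rewrite DE d2; move: e0 e1; clearbody e; lra.
  have : (d%:R - 2) <= d%:R * (r0 * x).
    by rewrite mulrCA -ler_pdivrMl// mulrC.
  rewrite DE /e (_ : d%:R / 2 * (1 - r0 * x) = (d%:R - d%:R * (r0 * x)) / 2); last by field.
  by rewrite ler_pdivrMr// mul1r !lerBlDl addrC.
(* [e = 1] means [rt = oo], which is excluded for [d = 2] by assumption and for [d >= 3] by the
   first inequality, [r] being finite. *)
have eD : e = 1 -> D < 1.
  move=> eE; have /eqP : r0 * x = 0 by apply: oppr_inj; rewrite oppr0 -(addKr 1 (- _)) -/e eE addNr.
  rewrite mulf_eq0 gt_eqF//= => /eqP xz.
  case: hcond => [[d1 _ _]|[d2 _ /andP[_ rty]]|[d3 h _]].
  - by rewrite DE d1; lra.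
  - by move: rty; rewrite lt_neqAle -recip_eq0 ?(ltW rt1)// -/x xz eqxx.
  - exfalso; move: h; rewrite -/x xz mulr0 pmulr_lle0 ?invr_gt0//.
    have : 3 <= d%:R :> R by rewrite ler_nat.
    lra.
have PE : dual_exp e r0 = (1 - x)^-1.
  rewrite /dual_exp /e; field.
  by rewrite !gt_eqF//; nra.
have rDe : 0 < r0 - D * e by move: De hr; generalize (D * e) => u; lra.
(* The scaling relations identify [time_exp] with [qt'] and [decay_exp] with [qt' / q], which is
   below one because [1 / q < 1 / qt']. *)
have ipE : ip = (r0 - D * e) / r0.
  by rewrite hscal' -/x DE /e; field; rewrite gt_eqF.
have pE : @time_exp R d e r0 = ip^-1 by rewrite /time_exp ipE invf_div.
have kk : @decay_exp R d e r0 = recip q / ip.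
  rewrite /decay_exp -/D ipE invf_div mulrA; congr (_ / _).
  by rewrite -hscal DE; field; rewrite gt_eqF.
have [k0 k1] := kE _ kk.
have P1' : 1 <= dual_exp e r0 by rewrite PE.
have [C C0 HC] := space_norm_duhamel_le hd e0 e1 De eD hr P1'.
exists (C * (2 / (1 - @decay_exp R d e r0) + 1) `^ (@time_exp R d e r0)^-1); split.
  by rewrite mulr_gt0// powR_gt0// addr_gt0// divr_gt0// subr_gt0.
move=> F sF; rewrite -PE -pE.
apply: (weak_mixed_norm_le sF) => //.
- by rewrite pE.
- by rewrite pE kk invrK divfK// gt_eqF.
- by rewrite kk mulf_eq0 invr_eq0 (gt_eqF ip0) orbF recip_eq0.
- exact: HC.
Qed.
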